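(* Let $d\ge1$, $n\in\mathbb{N}^d$, and let $\Lambda\subset\mathbb{R}^{2d}$ be a lattice with adjoint lattice $\Lambda^0$. Then $\Gamma_\Lambda$ is a sampling sequence for $\mathbf{F}^n(\mathbb{C}^d)$ if and only if $\Gamma_{\Lambda^0}$ is a multiple interpolating sequence of multiplicity $K_n$ for the Fock space $\mathcal{F}(\mathbb{C}^d)$.
   Context: Notation: $|m|=\sum m_j$, $m!=\prod m_j!$, $z^m=\prod z_j^{m_j}$, $\bar z^m=\prod \bar z_j^{m_j}$, $|z|^2=\sum|z_j|^2$, $\bar z\cdot\zeta=\sum\bar z_j\zeta_j$. $K_n=\{k\in\mathbb{N}_0^d:0\le k_j\le n_j-1\ \forall j\}$. The Fock space $\mathcal{F}(\mathbb{C}^d)$ consists of entire functions $F$ on $\mathbb{C}^d$ with $\|F\|^2=\int_{\mathbb{C}^d}|F(z)|^2e^{-\pi|z|^2}dz<\infty$, inner product $\langle F,G\rangle=\int F\bar Ge^{-\pi|z|^2}dz$; $e_k(z)=(\pi^{|k|}/k!)^{1/2}z^k$. For $z\in\mathbb{C}^d$, $\beta_zF(\zeta)=e^{\pi\bar z\cdot\zeta-\frac{\pi}{2}|z|^2}F(\zeta-z)$. The polyanalytic Fock space $\mathbf{F}^n(\mathbb{C}^d)$ is the space of $F(z)=\sum_{k\in K_n}\bar z^k\varphi_k(z)$, $\varphi_k$ entire, with $\int|F|^2e^{-\pi|z|^2}dz<\infty$. A lattice is $\Lambda=A\mathbb{Z}^{2d}$ with $A$ an invertible real $2d\times2d$ matrix;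 for $\lambda=(x,\omega)\in\mathbb{R}^{2d}$ let $\pi_\lambda=M_\omega T_x$, where $T_xf(t)=f(t-x)$, $M_\omega f(t)=e^{2\pi i\omega\cdot t}f(t)$; the adjoint lattice is $\Lambda^0=\{\mu\in\mathbb{R}^{2d}:\pi_\lambda\pi_\mu=\pi_\mu\pi_\lambda\ \forall\lambda\in\Lambda\}$. For a set $\Lambda\subset\mathbb{R}^{2d}$, $\Gamma_\Lambda=\{x+i\omega\in\mathbb{C}^d:(x,\omega)\in\Lambda\}$. $\Gamma$ is a sampling sequence for $\mathbf{F}^n(\mathbb{C}^d)$ if there are $A,B>0$ with $A\|F\|^2\le\sum_{z\in\Gamma}|F(z)|^2e^{-\pi|z|^2}\le B\|F\|^2$ for all $F\in\mathbf{F}^n(\mathbb{C}^d)$. $\Gamma$ is a multiple interpolating sequence of multiplicity $K_n$ for $\mathcal{F}(\mathbb{C}^d)$ if for every family $(\alpha_z^{(k)})_{z\in\Gamma,k\in K_n}\in\ell^2$ there is $F\in\mathcal{F}(\mathbb{C}^d)$ with $\langle F,\beta_ze_k\rangle=\alpha_z^{(k)}$ for all $z\in\Gamma$, $k\in K_n$. *)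

(* Defs.v *)
From HB Require Import structures.
From mathcomp Require Import all_boot all_order all_algebra.
From mathcomp Require Import all_classical all_reals all_analysis.
From mathcomp Require Import complex.
Set Implicit Arguments.
Unset Strict Implicit.
Unset Printing Implicit Defensive.
Import Order.TTheory GRing.Theory Num.Theory.
Import numFieldNormedType.Exports.
Local Open Scope ring_scope.
Local Open Scope complex_scope.
Local Open Scope classical_set_scope.

Section PolyFock.
Variable R : realType.

(* The complex numbers, as a numFieldType (so that it carries its own
   normed/topological structure and [derivable] is complex differentiability). *)
Definition CC : numFieldType := (R[i] : numFieldType).

Definition cvec (d : nat) := 'rV[CC]_d.

Definition upd d (z : cvec d) (j : 'I_d) (w : CC) : cvec d :=
  \row_i (if i == j then w else z ord0 i).

Definition cabs2 (x : CC) : R := complex.Re x ^+ 2 + complex.Im x ^+ 2.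

Definition vnorm2 d (z : cvec d) : R := \sum_(j < d) cabs2 (z ord0 j).

Definition cexp (w : CC) : CC :=
  (expR (complex.Re w) * cos (complex.Im w)) +i* (expR (complex.Re w) * sin (complex.Im w)).

Definition cdot d (z zeta : cvec d) : CC :=
  \sum_(j < d) (z ord0 j)^* * zeta ord0 j.

Definition gweight d (z : cvec d) : R := expR (- pi * vnorm2 z).

(* Entire functions on C^d: holomorphic in each variable separately at every
   point (by Hartogs' theorem this is holomorphy on C^d). *)
Definition entire d (F : cvec d -> CC) : Prop :=
  forall (z : cvec d) (j : 'I_d), derivable (fun w : CC => F (upd z j w)) (z ord0 j) 1.

Definition setc (v : nat -> R) (m : nat) (x : R) : nat -> R :=
  fun i => if i == m then x else v i.

(* iterated Lebesgue integral of a nonnegative function over the first m real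
   coordinates (by Tonelli, equal to the integral w.r.t. Lebesgue measure on
   R^m for nonnegative measurable functions). *)
Fixpoint iint (m : nat) (g : (nat -> R) -> \bar R) : \bar R :=
  match m with
  | 0 => g (fun _ => 0)
  | m'.+1 => (\int[@lebesgue_measure R]_x iint m' (fun v => g (setc v m' x)))%E
  end.

Definition embC d (v : nat -> R) : cvec d :=
  \row_j (v (2 * j)%N +i* v (2 * j).+1).

Definition intCp d (f : cvec d -> \bar R) : \bar R := iint (2 * d) (fun v => f (embC d v)).

Definition intCr d (f : cvec d -> R) : R :=
  fine (intCp (fun z => (Num.max (f z) 0)%:E)) - fine (intCp (fun z => (Num.max (- f z) 0)%:E)).

Definition intC d (f : cvec d -> CC) : CC :=
  intCr (fun z => complex.Re (f z)) +i* intCr (fun z => complex.Im (f z)).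

Definition fnorm2 d (F : cvec d -> CC) : \bar R :=
  intCp (fun z => (cabs2 (F z) * gweight z)%:E).

Definition finner d (F G : cvec d -> CC) : CC :=
  intC (fun z => F z * (G z)^* * (gweight z)%:C).

Definition Fock d (F : cvec d -> CC) : Prop := entire F /\ (fnorm2 F < +oo)%E.

Definition Kn d (n : 'I_d -> nat) := {dffun forall j : 'I_d, 'I_(n j)}.

Definition cpow d (z : cvec d) (k : 'I_d -> nat) : CC := \prod_(j < d) z ord0 j ^+ k j.
Definition cpowbar d (z : cvec d) (k : 'I_d -> nat) : CC := \prod_(j < d) (z ord0 j)^* ^+ k j.

Definition polyFock d (n : 'I_d -> nat) (F : cvec d -> CC) : Prop :=
  (exists phi : Kn n -> cvec d -> CC,
      (forall k, entire (phi k)) /\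
      (forall z, F z = \sum_(k : Kn n) cpowbar z (fun j => k j) * phi k z))
  /\ (fnorm2 F < +oo)%E.

Definition ek d (k : 'I_d -> nat) (z : cvec d) : CC :=
  (Num.sqrt (pi ^+ (\sum_(j < d) k j) / (\prod_(j < d) (k j)`!)%:R))%:C * cpow z k.

Definition beta d (z : cvec d) (F : cvec d -> CC) (zeta : cvec d) : CC :=
  cexp ((pi%:C) * cdot z zeta - (pi / 2 * vnorm2 z)%:C) * F (zeta - z).

Definition rvec d := 'cV[R]_(d + d).
Definition xpart d (l : rvec d) : 'I_d -> R := fun j => l (lshift d j) ord0.
Definition wpart d (l : rvec d) : 'I_d -> R := fun j => l (rshift d j) ord0.

Definition lattice d (A : 'M[R]_(d + d)) : set (rvec d) :=
  [set l | exists m : 'cV[int]_(d + d), l = A *m map_mx (fun a : int => a%:~R) m].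

Definition tfshift d (l : rvec d) (f : ('I_d -> R) -> CC) : ('I_d -> R) -> CC :=
  fun t => cexp (0 +i* (2 * pi * \sum_(j < d) wpart l j * t j))
           * f (fun j => t j - xpart l j).

Definition adjoint d (L : set (rvec d)) : set (rvec d) :=
  [set mu | forall l, L l -> tfshift l \o tfshift mu = tfshift mu \o tfshift l].

Definition GammaOf d (L : set (rvec d)) : set (cvec d) :=
  [set \row_j (xpart l j +i* wpart l j) | l in L].

Definition sampling d (n : 'I_d -> nat) (G : set (cvec d)) : Prop :=
  exists A B : R, 0 < A /\ 0 < B /\
    forall F, polyFock n F ->
      (A%:E * fnorm2 F <= \esum_(z in G) (cabs2 (F z) * gweight z)%:E)%E /\
      (\esum_(z in G) (cabs2 (F z) * gweight z)%:E <= B%:E * fnorm2 F)%E.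

Definition mult_interpolating d (n : 'I_d -> nat) (G : set (cvec d)) : Prop :=
  forall alpha : cvec d -> Kn n -> CC,
    (\esum_(z in G) (\sum_(k : Kn n) cabs2 (alpha z k))%:E < +oo)%E ->
    exists F, Fock F /\
      forall (z : cvec d) (k : Kn n), G z -> finner F (beta z (ek (fun j => k j))) = alpha z k.

End PolyFock.

(* Main.v *)
(** Both sides are equivalent to the Riesz lower bound
    [A * sum |c v k|^2 <= || sum c v k * beta v (ek k) ||^2] over finite subsets of the adjoint
    lattice Gamma0, which consists of the [v] whose character [chi v] is trivial on Gamma.
    From sampling to Riesz: replacing the polynomials by their conjugates and twisting by the
    characters turns [h = sum c v k * beta v (ek k)] into polyanalytic functions with the same
    moduli as the translates of [h] on Gamma; averaging their norms over translates decouples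
    the summands.
    From Riesz to sampling: by the Moyal identity for complex Hermite functions the Riesz bound
    gives [A * |b|^2 * ||F||^2 <= || (sum b v * chi v) F ||^2] for every polyanalytic [F].  A
    trigonometric polynomial concentrated near Gamma (a product of Fejer-type kernels), together
    with local estimates for polyanalytic functions, yields the lower sampling inequality.
    From Riesz to interpolation: minimise [||h||^2 - 2 Re <h, alpha>] over finite combinations;
    minimising sequences are Cauchy.  The converse is a gliding-hump argument. *)

Require Import Defs.
From HB Require Import structures.
From mathcomp Require Import all_boot all_order all_algebra.
From mathcomp Require Import all_classical all_reals all_analysis.
From mathcomp Require Import measurable_realfun.
From mathcomp Require Import complex.
From mathcomp Require Import ring lra.
Import Order.TTheory GRing.Theory Num.Theory.
Local Open Scope ring_scope.

(** The characters link the two sides. Time-frequency shifts commute exactly when their symplectic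
    pairing is an integer, so [chi v] with [v] in Gamma0 is Gamma-periodic. The multi-order [n] and
    the index set K_n meet in the Moyal identity: the Gram matrix of the functions [chi v * HH m k]
    is the entrywise product of the Gram matrix of the translated monomials [bm v m] and the
    conjugate of that of [beta v (ek k)]. A Riesz bound on the second factor can therefore be
    applied for each fixed value of the variable of the first, and then integrated. The obstacle in
    the lower sampling inequality is that a concentrated multiplier has small norm. The argument
    survives because its L2 norm is controlled by the l2 norm of its coefficients with a constant
    independent of the degree, because these coefficients decay only polynomially, and because away
    from Gamma the multiplier decays exponentially. The iterated integral of the statement is
    replaced by the Gaussian probability [gm], on which translations and rotations act coordinate by
    coordinate. *)

Module Proofs.
Set Implicit Arguments.
Unset Strict Implicit.
Unset Printing Implicit Defensive.
Import numFieldNormedType.Exports.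
Local Open Scope classical_set_scope.

(** * Complex numbers *)
Section Complex.
Variable R : realType.
Local Notation C := (CC R).
Local Notation Re := (@complex.Re R).
Local Notation Im := (@complex.Im R).
Local Open Scope complex_scope.

(** The norm of the field [C] takes complex values ([cnE]). Real integrals and real inequalities
    call for a real-valued modulus. *)
Definition cn (z : C) : R := @Normc.normc R z.

Lemma cnE (z : C) : `|z| = (cn z)%:C. Proof. by []. Qed.

Lemma cn_sqr (z : C) : cn z ^+ 2 = cabs2 z.
Proof. by case: z => a b; rewrite /cn /cabs2 /= sqr_sqrtr // addr_ge0 // sqr_ge0. Qed.

Lemma cn_ge0 (z : C) : 0 <= cn z.
Proof. by case: z => a b; rewrite /cn /= sqrtr_ge0. Qed.

Lemma cabs2_ge0 (z : C) : 0 <= cabs2 z.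
Proof. by rewrite -cn_sqr sqr_ge0. Qed.

Lemma cn0 : cn 0 = 0. Proof. exact: Normc.normc0. Qed.
Lemma cn1 : cn 1 = 1. Proof. exact: Normc.normc1. Qed.
Lemma cn0_eq0 z : cn z = 0 -> z = 0. Proof. exact: Normc.eq0_normc. Qed.
Lemma cnM (x y : C) : cn (x * y) = cn x * cn y.
Proof. exact: Normc.normcM. Qed.
Lemma cnD (x y : C) : cn (x + y) <= cn x + cn y.
Proof. exact: le_normcD. Qed.
Lemma cnN (x : C) : cn (- x) = cn x. Proof. exact: normcN. Qed.
Lemma cnV (x : C) : cn x^-1 = (cn x)^-1. Proof. exact: Normc.normcV. Qed.
Definition cj (z : C) : C := conjc z.
Lemma cnJ (x : C) : cn (cj x) = cn x.
Proof. by case: x => a b; rewrite /cn /= sqrrN. Qed.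
Lemma cnX (x : C) k : cn (x ^+ k) = cn x ^+ k.
Proof. by elim: k => [|k ih]; rewrite ?cn1 // !exprS cnM ih. Qed.
Lemma cnR (x : R) : cn x%:C = `|x|.
Proof. by rewrite /cn /= expr0n /= addr0 sqrtr_sqr. Qed.
Lemma cn_prod (I : Type) (s : seq I) (f : I -> C) :
  cn (\prod_(i <- s) f i) = \prod_(i <- s) cn (f i).
Proof. by elim/big_rec2 : _ => [|i y1 y2 _ h]; rewrite ?cn1 // cnM h. Qed.
Lemma cn_sum (I : Type) (s : seq I) (f : I -> C) :
  cn (\sum_(i <- s) f i) <= \sum_(i <- s) cn (f i).
Proof.
elim/big_rec2 : _ => [|i y1 y2 _ h]; rewrite ?cn0 //.
by apply: (le_trans (cnD _ _)); rewrite lerD2l.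
Qed.
Lemma cnB (x y : C) : cn (x - y) = cn (y - x).
Proof. by rewrite -cnN opprB. Qed.
Lemma cn_dist (x y : C) : cn x <= cn y + cn (x - y).
Proof. by rewrite {1}(_ : x = y + (x - y)) ?cnD //; ring. Qed.
Lemma Re_cn (z : C) : `|Re z| <= cn z.
Proof.
by case: z => a b; rewrite /cn /= -sqrtr_sqr ler_wsqrtr // lerDl sqr_ge0.
Qed.
Lemma Im_cn (z : C) : `|Im z| <= cn z.
Proof.
by case: z => a b; rewrite /cn /= -sqrtr_sqr ler_wsqrtr // lerDr sqr_ge0.
Qed.
Lemma cn_ReIm (z : C) : cn z <= `|Re z| + `|Im z|.
Proof.
rewrite -(@ler_pXn2r _ 2) ?nnegrE ?cn_ge0 ?addr_ge0 // cn_sqr /cabs2.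
rewrite sqrrD !real_normK ?num_real // lerD2r lerDl.
by rewrite mulrn_wge0 // mulr_ge0.
Qed.

Lemma ReD (x y : C) : Re (x + y) = Re x + Re y. Proof. by case: x y => a b []. Qed.
Lemma ImD (x y : C) : Im (x + y) = Im x + Im y. Proof. by case: x y => a b []. Qed.
Lemma ReN (x : C) : Re (- x) = - Re x. Proof. by case: x. Qed.
Lemma ImN (x : C) : Im (- x) = - Im x. Proof. by case: x. Qed.
Lemma ReB (x y : C) : Re (x - y) = Re x - Re y. Proof. by case: x y => a b []. Qed.
Lemma ImB (x y : C) : Im (x - y) = Im x - Im y. Proof. by case: x y => a b []. Qed.
Lemma ReM (x y : C) : Re (x * y) = Re x * Re y - Im x * Im y.
Proof. by case: x y => a b []. Qed.
Lemma ImM (x y : C) : Im (x * y) = Re x * Im y + Im x * Re y.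
Proof. by case: x y => a b []. Qed.
Lemma ReJ (x : C) : Re (cj x) = Re x. Proof. by case: x. Qed.
Lemma ImJ (x : C) : Im (cj x) = - Im x. Proof. by case: x. Qed.
Lemma Re0 : Re 0 = 0. Proof. by []. Qed.
Lemma Im0 : Im 0 = 0. Proof. by []. Qed.
Lemma Re1 : Re 1 = 1. Proof. by []. Qed.
Lemma ReR (x : R) : Re x%:C = x. Proof. by []. Qed.
Lemma ImR (x : R) : Im x%:C = 0. Proof. by []. Qed.
Lemma Re_sum (I : Type) (s : seq I) (f : I -> C) :
  Re (\sum_(i <- s) f i) = \sum_(i <- s) Re (f i).
Proof. by elim/big_rec2 : _ => [|i y1 y2 _ h] //; rewrite ReD h. Qed.
Lemma Ceq (x y : C) : Re x = Re y -> Im x = Im y -> x = y.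
Proof. by case: x y => a b [c d] /= -> ->. Qed.
Lemma CE (x : C) : x = (Re x) +i* (Im x). Proof. by case: x. Qed.

Lemma JD (x y : C) : cj (x + y) = cj x + cj y. Proof. exact: (raddfD (@conjc R)). Qed.
Lemma JB (x y : C) : cj (x - y) = cj x - cj y. Proof. exact: (raddfB (@conjc R)). Qed.
Lemma JN (x : C) : cj (- x) = - cj x. Proof. exact: (raddfN (@conjc R)). Qed.
Lemma JM (x y : C) : cj (x * y) = cj x * cj y. Proof. exact: (rmorphM (@conjc R)). Qed.
Lemma JX (x : C) k : cj (x ^+ k) = cj x ^+ k. Proof. exact: (rmorphXn (@conjc R)). Qed.
Lemma JJ (x : C) : cj (cj x) = x. Proof. exact: conjcK. Qed.
Lemma JR (x : R) : cj (x%:C : C) = x%:C. Proof. exact: conjc_real. Qed.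
Lemma J0 : cj 0 = 0. Proof. exact: conjc0. Qed.
Lemma J1 : cj 1 = 1. Proof. exact: conjc1. Qed.
Lemma Jnat (k : nat) : cj k%:R = k%:R. Proof. exact: conjc_nat. Qed.
Lemma J_sum (I : Type) (s : seq I) (f : I -> C) :
  cj (\sum_(i <- s) f i) = \sum_(i <- s) cj (f i).
Proof. exact: (raddf_sum (@conjc R)). Qed.
Lemma J_prod (I : Type) (s : seq I) (f : I -> C) :
  cj (\prod_(i <- s) f i) = \prod_(i <- s) cj (f i).
Proof. exact: (rmorph_prod (@conjc R)). Qed.
Lemma mulJ (x : C) : x * cj x = (cabs2 x)%:C.
Proof. by apply: Ceq; rewrite ?ReM ?ImM ReJ ImJ ?ReR ?ImR /cabs2; ring. Qed.
Lemma cabs2M (x y : C) : cabs2 (x * y) = cabs2 x * cabs2 y.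
Proof. by rewrite -!cn_sqr cnM exprMn. Qed.
Lemma cabs2J (x : C) : cabs2 (cj x) = cabs2 x.
Proof. by rewrite -!cn_sqr cnJ. Qed.
Lemma cabs2R (x : R) : cabs2 (x%:C : C) = x ^+ 2.
Proof. by rewrite /cabs2 ReR ImR expr0n addr0. Qed.
Lemma cabs20 : cabs2 (0 : C) = 0. Proof. by rewrite (cabs2R 0) expr0n. Qed.
Lemma cabs2N (x : C) : cabs2 (- x) = cabs2 x.
Proof. by rewrite -!cn_sqr cnN. Qed.
Lemma cabs2D (x y : C) : cabs2 (x + y) = cabs2 x + cabs2 y + 2 * Re (x * cj y).
Proof. by rewrite /cabs2 ReD ImD ReM ReJ ImJ; ring. Qed.
Lemma cabs2_para (x y : C) :
  cabs2 (x + y) + cabs2 (x - y) = 2 * cabs2 x + 2 * cabs2 y.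
Proof. by rewrite /cabs2 ReD ImD ReB ImB; ring. Qed.
Lemma cabs2D_le (x y : C) : cabs2 (x + y) <= 2 * cabs2 x + 2 * cabs2 y.
Proof. by rewrite -cabs2_para lerDl cabs2_ge0. Qed.
Lemma realCM (x y : R) : (x * y)%:C = x%:C * y%:C :> C. Proof. exact: rmorphM. Qed.
Lemma realCD (x y : R) : (x + y)%:C = x%:C + y%:C :> C. Proof. exact: rmorphD. Qed.
Lemma realCN (x : R) : (- x)%:C = - x%:C :> C. Proof. exact: rmorphN. Qed.
Lemma realCB (x y : R) : (x - y)%:C = x%:C - y%:C :> C. Proof. exact: rmorphB. Qed.
Lemma realCX (x : R) k : (x ^+ k)%:C = x%:C ^+ k :> C. Proof. exact: rmorphXn. Qed.
Lemma realCV (x : R) : (x^-1)%:C = x%:C^-1 :> C. Proof. exact: fmorphV. Qed.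
Lemma realCnat (k : nat) : (k%:R : R)%:C = k%:R :> C. Proof. exact: rmorph_nat. Qed.
Lemma realC_sum (I : Type) (s : seq I) (f : I -> R) :
  (\sum_(i <- s) f i)%:C = \sum_(i <- s) (f i)%:C :> C.
Proof. exact: (raddf_sum (real_complex R)). Qed.
Lemma realC_prod (I : Type) (s : seq I) (f : I -> R) :
  (\prod_(i <- s) f i)%:C = \prod_(i <- s) (f i)%:C :> C.
Proof. exact: (rmorph_prod (real_complex R)). Qed.

Lemma cexpD (x y : C) : cexp (x + y) = cexp x * cexp y.
Proof.
by apply: Ceq; rewrite ?ReM ?ImM /cexp /= ReD ImD expRD ?cosD ?sinD; ring.
Qed.
Lemma cexp0 : cexp (0 : C) = 1.
Proof. by apply: Ceq; rewrite /cexp /= expR0 ?cos0 ?sin0; ring. Qed.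
Lemma cexpJ (x : C) : cj (cexp x) = cexp (cj x).
Proof. by apply: Ceq; rewrite ?ReJ ?ImJ /cexp /= ReJ ImJ ?cosN ?sinN; ring. Qed.
Lemma cexp_real (x : R) : cexp x%:C = (expR x)%:C.
Proof. by apply: Ceq; rewrite /cexp /= ?cos0 ?sin0; ring. Qed.
Lemma cabs2_cexp (x : C) : cabs2 (cexp x) = expR (2 * Re x).
Proof.
rewrite /cabs2 /cexp /= !exprMn -mulrDr cos2Dsin2 mulr1 -expRM_natl.
by congr expR; ring.
Qed.
Lemma cn_cexp (x : C) : cn (cexp x) = expR (Re x).
Proof.
apply/eqP; rewrite -(@eqrXn2 _ 2) ?cn_ge0 ?expR_ge0 // cn_sqr cabs2_cexp.
by rewrite -expRM_natl.
Qed.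
Lemma cexpN (x : C) : cexp (- x) * cexp x = 1.
Proof. by rewrite -cexpD addNr cexp0. Qed.
Lemma cexp_neq0 (x : C) : cexp x != 0.
Proof.
apply/eqP => h; have := cexpN x; rewrite h mulr0 => /eqP.
by rewrite eq_sym oner_eq0.
Qed.
Lemma cexp_nat (x : C) k : cexp (k%:R * x) = cexp x ^+ k.
Proof.
elim: k => [|k ih]; first by rewrite mul0r cexp0.
by rewrite exprS -ih -cexpD; congr cexp; rewrite -natr1; ring.
Qed.
Lemma cexp_sum (I : Type) (s : seq I) (f : I -> C) :
  cexp (\sum_(i <- s) f i) = \prod_(i <- s) cexp (f i).
Proof. by elim/big_rec2 : _ => [|i y1 y2 _ h]; rewrite ?cexp0 // cexpD h. Qed.

Section Meas.
Context d (T : measurableType d).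
Implicit Types f g : T -> C.

(** Measurability is carried by real and imaginary parts, so that each closure property reduces to
    the real case. *)
Definition mC f := measurable_fun setT (fun x => Re (f x)) /\
                   measurable_fun setT (fun x => Im (f x)).

Lemma mC_cst c : mC (fun=> c).
Proof. by split; exact: measurable_cst. Qed.
Lemma mCD f g : mC f -> mC g -> mC (fun x => f x + g x).
Proof.
move=> [a b] [c e]; split; [under eq_fun do rewrite ReD|under eq_fun do rewrite ImD];
  exact: measurable_funD.
Qed.
Lemma mCN f : mC f -> mC (fun x => - f x).
Proof.
move=> [a b]; split; [under eq_fun do rewrite ReN|under eq_fun do rewrite ImN];
  exact: measurableT_comp.
Qed.
Lemma mCB f g : mC f -> mC g -> mC (fun x => f x - g x).
Proof. by move=> mf mg; apply: mCD => //; exact: mCN. Qed.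
Lemma mCM f g : mC f -> mC g -> mC (fun x => f x * g x).
Proof.
move=> [a b] [c e]; split; [under eq_fun do rewrite ReM|under eq_fun do rewrite ImM].
  by apply: measurable_funB; exact: measurable_funM.
by apply: measurable_funD; exact: measurable_funM.
Qed.
Lemma mCJ f : mC f -> mC (fun x => cj (f x)).
Proof.
move=> [a b]; split; [under eq_fun do rewrite ReJ|under eq_fun do rewrite ImJ] => //.
exact: measurableT_comp.
Qed.
Lemma mC_sum (I : Type) (s : seq I) (h : I -> T -> C) :
  (forall i, mC (h i)) -> mC (fun x => \sum_(i <- s) h i x).
Proof.
move=> mh; elim: s => [|i s ih].
  by under eq_fun do rewrite big_nil; exact: mC_cst.
by under eq_fun do rewrite big_cons; exact: mCD.
Qed.
Lemma mC_prod (I : Type) (s : seq I) (h : I -> T -> C) :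
  (forall i, mC (h i)) -> mC (fun x => \prod_(i <- s) h i x).
Proof.
move=> mh; elim: s => [|i s ih].
  by under eq_fun do rewrite big_nil; exact: mC_cst.
by under eq_fun do rewrite big_cons; exact: mCM.
Qed.
Lemma mC_real (f : T -> R) : measurable_fun setT f -> mC (fun x => (f x)%:C).
Proof. by move=> mf; split => //=; exact: measurable_cst. Qed.
Lemma mC_exp f : mC f -> mC (fun x => cexp (f x)).
Proof.
move=> [a b]; split; apply: measurable_funM; apply: measurableT_comp => //;
  apply: continuous_measurable_fun;
  first [exact: continuous_expR|exact: continuous_cos|exact: continuous_sin].
Qed.
Lemma mabs2 f : mC f -> measurable_fun setT (fun x => cabs2 (f x)).
Proof. by move=> [a b]; apply: measurable_funD; exact: measurable_funX. Qed.
Lemma mcn f : mC f -> measurable_fun setT (fun x => cn (f x)).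
Proof.
move=> mf; rewrite (_ : (fun x => _) = fun x => Num.sqrt (cabs2 (f x))).
  apply: measurableT_comp; last exact: mabs2.
  by apply: continuous_measurable_fun; exact: sqrt_continuous.
by apply/funext => x; rewrite -cn_sqr sqrtr_sqr ger0_norm // cn_ge0.
Qed.
End Meas.

Lemma mC_comp d1 d2 (T1 : measurableType d1) (T2 : measurableType d2)
  (f : T2 -> C) (g : T1 -> T2) : mC f -> measurable_fun setT g -> mC (f \o g).
Proof. by move=> [a b] mg; split; [exact: (measurableT_comp a mg)|exact: (measurableT_comp b mg)]. Qed.

Lemma mC_lim d (T : measurableType d) (f_ : nat -> T -> C) (f : T -> C) :
  (forall k, mC (f_ k)) ->
  (forall x, cn (f_ k x - f x) @[k --> \oo] --> 0) -> mC f.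
Proof.
move=> mf cf; split.
- apply: (@measurable_fun_cvg _ _ _ _ (fun k x => Re (f_ k x))) => [k|x _].
    by have [] := mf k.
  apply/cvgrPdist_lt => /= e e0; have /cvgrPdist_lt /(_ e e0) := cf x.
  apply: filterS => k; rewrite sub0r normrN ger0_norm ?cn_ge0 //.
  by apply: le_lt_trans; rewrite -ReB cnB; exact: Re_cn.
- apply: (@measurable_fun_cvg _ _ _ _ (fun k x => Im (f_ k x))) => [k|x _].
    by have [] := mf k.
  apply/cvgrPdist_lt => /= e e0; have /cvgrPdist_lt /(_ e e0) := cf x.
  apply: filterS => k; rewrite sub0r normrN ger0_norm ?cn_ge0 //.
  by apply: le_lt_trans; rewrite -ImB cnB; exact: Im_cn.
Qed.

End Complex.

(** * Complex-valued integrals *)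
Section CInt.
Variable R : realType.
Local Notation C := (CC R).
Local Notation Re := (@complex.Re R).
Local Notation Im := (@complex.Im R).
Local Open Scope complex_scope.

Section One.
Context d (T : measurableType d) (mu : {measure set T -> \bar R}).
Implicit Types f g : T -> C.

Lemma ge0_le_int (f g : T -> \bar R) :
  measurable_fun setT f -> measurable_fun setT g ->
  (forall x, (0 <= f x)%E) -> (forall x, (f x <= g x)%E) ->
  (\int[mu]_x f x <= \int[mu]_x g x)%E.
Proof. by move=> mf mg f0 fg; apply: ge0_le_integral. Qed.

Definition cI f : C := (\int[mu]_x Re (f x)) +i* (\int[mu]_x Im (f x)).
Definition ci f := mC f /\ (\int[mu]_x (cn (f x))%:E < +oo)%E.

Lemma eq_cI f g : (forall x, f x = g x) -> cI f = cI g.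
Proof. by move=> /funext ->. Qed.

Lemma ci_mC f : ci f -> mC f. Proof. by case. Qed.

Lemma ciRe f : ci f -> mu.-integrable setT (EFin \o (fun x => Re (f x))).
Proof.
move=> [mf fi]; apply/integrableP; split.
  by apply/measurable_EFinP; case: mf.
apply: le_lt_trans fi; apply: ge0_le_int => //.
- by apply/measurable_EFinP/measurableT_comp => //; case: mf.
- by apply/measurable_EFinP/mcn.
- by move=> x /=; rewrite lee_fin Re_cn.
Qed.

Lemma ciIm f : ci f -> mu.-integrable setT (EFin \o (fun x => Im (f x))).
Proof.
move=> [mf fi]; apply/integrableP; split.
  by apply/measurable_EFinP; case: mf.
apply: le_lt_trans fi; apply: ge0_le_int => //.
- by apply/measurable_EFinP/measurableT_comp => //; case: mf.
- by apply/measurable_EFinP/mcn.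
- by move=> x /=; rewrite lee_fin Im_cn.
Qed.

Lemma ci_le f (g : T -> \bar R) : mC f -> measurable_fun setT g ->
  (forall x, ((cn (f x))%:E <= g x)%E) -> (\int[mu]_x g x < +oo)%E -> ci f.
Proof.
move=> mf mg fg gi; split => //; apply: le_lt_trans gi.
apply: ge0_le_int => // [|x]; first exact/measurable_EFinP/mcn.
by rewrite lee_fin cn_ge0.
Qed.

Lemma ciD f g : ci f -> ci g -> ci (fun x => f x + g x).
Proof.
move=> [mf fi] [mg gi].
apply: (@ci_le _ (fun x => ((cn (f x))%:E + (cn (g x))%:E)%E)); first exact: mCD.
- by apply: emeasurable_funD; apply/measurable_EFinP/mcn.
- by move=> x; rewrite -EFinD lee_fin cnD.
- rewrite ge0_integralD //; first exact: lte_add_pinfty.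
  + by move=> x _; rewrite lee_fin cn_ge0.
  + exact/measurable_EFinP/mcn.
  + by move=> x _; rewrite lee_fin cn_ge0.
  + exact/measurable_EFinP/mcn.
Qed.

Lemma ciZ c f : ci f -> ci (fun x => c * f x).
Proof.
move=> [mf fi].
apply: (@ci_le _ (fun x => ((cn c)%:E * (cn (f x))%:E)%E)).
- by apply: mCM => //; exact: mC_cst.
- by apply: emeasurable_funM => //; exact/measurable_EFinP/mcn.
- by move=> x; rewrite -EFinM lee_fin cnM.
- rewrite ge0_integralZl_EFin ?cn_ge0 //.
  + by rewrite lte_mul_pinfty // lee_fin cn_ge0.
  + by move=> x _; rewrite lee_fin cn_ge0.
  + exact/measurable_EFinP/mcn.
Qed.

Lemma ciN f : ci f -> ci (fun x => - f x).
Proof.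
move=> /(ciZ (-1)); congr ci; apply/funext => x; exact: mulN1r.
Qed.

Lemma ciJ f : ci f -> ci (fun x => cj (f x)).
Proof.
move=> [mf fi]; split; first exact: mCJ.
by under eq_integral do rewrite cnJ.
Qed.

Lemma ci0 : ci (fun=> 0).
Proof.
split; first exact: mC_cst.
by under eq_integral do rewrite cn0; rewrite integral0.
Qed.

Lemma ci_sum (I : Type) (s : seq I) (h : I -> T -> C) :
  (forall i, ci (h i)) -> ci (fun x => \sum_(i <- s) h i x).
Proof.
move=> mh; elim: s => [|i s ih].
  by under eq_fun do rewrite big_nil; exact: ci0.
by under eq_fun do rewrite big_cons; exact: ciD.
Qed.

Lemma cID f g : ci f -> ci g -> cI (fun x => f x + g x) = cI f + cI g.
Proof.
move=> cf cg; apply: Ceq; rewrite ?ReD ?ImD /cI /=.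
- by under eq_Rintegral do rewrite ReD; rewrite RintegralD //; exact: ciRe.
- by under eq_Rintegral do rewrite ImD; rewrite RintegralD //; exact: ciIm.
Qed.

Lemma intZ_int (c : R) (f : T -> R) : mu.-integrable setT (EFin \o f) ->
  mu.-integrable setT (EFin \o (fun x => c * f x)).
Proof. by move=> fi; exact: (integrableZl measurableT c fi). Qed.

Lemma cIZ c f : ci f -> cI (fun x => c * f x) = c * cI f.
Proof.
move=> cf; apply: Ceq; rewrite ?ReM ?ImM /cI /=.
- under eq_Rintegral do rewrite ReM.
  rewrite RintegralB //; try by apply: intZ_int; [exact: ciRe|exact: ciIm].
  + by rewrite !RintegralZl //; [exact: ciIm|exact: ciRe].
  + by apply: intZ_int; exact: ciRe.
  + by apply: intZ_int; exact: ciIm.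
- under eq_Rintegral do rewrite ImM.
  rewrite RintegralD //.
  + by rewrite !RintegralZl //; [exact: ciRe|exact: ciIm].
  + by apply: intZ_int; exact: ciIm.
  + by apply: intZ_int; exact: ciRe.
Qed.

Lemma cIN f : ci f -> cI (fun x => - f x) = - cI f.
Proof.
move=> cf; rewrite -mulN1r -cIZ //; apply: eq_cI => x; by rewrite mulN1r.
Qed.

Lemma cIB f g : ci f -> ci g -> cI (fun x => f x - g x) = cI f - cI g.
Proof. by move=> cf cg; rewrite cID ?cIN //; exact: ciN. Qed.

Lemma cIJ f : ci f -> cI (fun x => cj (f x)) = cj (cI f).
Proof.
move=> cf; apply: Ceq; rewrite ?ReJ ?ImJ /cI /=.
- by under eq_Rintegral do rewrite ReJ.
- under eq_Rintegral do rewrite ImJ -mulN1r.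
  by rewrite RintegralZl ?mulN1r //; exact: ciIm.
Qed.

Lemma cI_0 : cI (fun=> 0) = 0.
Proof. by apply: Ceq; rewrite /cI /= Rintegral_cst // mul0r. Qed.

Lemma cI_sum (I : Type) (s : seq I) (h : I -> T -> C) :
  (forall i, ci (h i)) -> cI (fun x => \sum_(i <- s) h i x) = \sum_(i <- s) cI (h i).
Proof.
move=> mh; elim: s => [|i s ih].
  by rewrite big_nil -[RHS]cI_0; apply: eq_cI => x; rewrite big_nil.
rewrite big_cons -ih -cID //; last exact: ci_sum.
by apply: eq_cI => x; rewrite big_cons.
Qed.

(** Multiplying by the unimodular constant [u] makes the integral real and nonnegative. It then
    equals the integral of a real part, which is at most the modulus. *)
Lemma cn_cI f : ci f -> ((cn (cI f))%:E <= \int[mu]_x (cn (f x))%:E)%E.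
Proof.
move=> cf; have [c0|c0] := eqVneq (cn (cI f)) 0.
  by rewrite c0; apply: integral_ge0 => x _; rewrite lee_fin cn_ge0.
pose u := cj (cI f) / (cn (cI f))%:C.
have nu : cn u = 1 by rewrite /u cnM cnV cnJ cnR ger0_norm ?cn_ge0 // divff.
have e : u * cI f = (cn (cI f))%:C.
  rewrite /u mulrAC [cj _ * _]mulrC mulJ -cn_sqr realCX expr2 mulfK //.
  by apply/eqP => /(congr1 Re) /= /eqP; exact/negP.
have {e} e : cn (cI f) = \int[mu]_x Re (u * f x).
  by rewrite -[LHS]/(Re (cn (cI f))%:C) -e -cIZ.
have cuf := ciZ u cf.
have fi := cf.2.
rewrite e /Rintegral fineK; last by apply: integrable_fin_num => //; exact: ciRe.
apply: le_trans; first exact: lee_abs.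
apply: le_trans; first by apply: le_abse_integral => //; exact: (measurable_int mu (ciRe cuf)).
apply: ge0_le_int => //.
- by apply: measurableT_comp => //; exact: (measurable_int mu (ciRe cuf)).
- exact/measurable_EFinP/mcn/ci_mC.
- by move=> x /=; rewrite lee_fin (le_trans (Re_cn _)) // cnM nu mul1r.
Qed.

Lemma cI_real (f : T -> R) : cI (fun x => (f x)%:C) = (\int[mu]_x f x)%:C.
Proof. by apply: Ceq; rewrite /cI /= ?Rintegral_cst ?mul0r. Qed.

End One.

Section Prob.
Context d (T : measurableType d) (P : probability T R).
Lemma cI_cst c : cI P (fun=> c) = c.
Proof. by apply: Ceq; rewrite /cI /= Rintegral_cst //= probability_setT mulr1. Qed.
Lemma ci_bnd (f : T -> C) M : mC f -> (forall x, cn (f x) <= M) -> ci P f.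
Proof.
move=> mf fM; apply: (@ci_le _ _ P _ (fun=> M%:E)) => //.
  by rewrite integral_cst //= probability_setT mule1 ltry.
Qed.
(* the variance of [f] is nonnegative *)
Lemma cI_jensen (f : T -> C) : ci P f ->
  ((cabs2 (cI P f))%:E <= \int[P]_x (cabs2 (f x))%:E)%E.
Proof.
move=> cf; have [mf _] := cf.
have [fi|] := ltP (\int[P]_x (cabs2 (f x))%:E)%E +oo%E; last first.
  by rewrite leye_eq => /eqP ->; rewrite leey.
pose c := cI P f.
have mb : measurable_fun setT (fun x => cabs2 (f x)) by exact: mabs2.
have h : (0 <= \int[P]_x (cabs2 (f x - c))%:E)%E.
  by apply: integral_ge0 => x _; rewrite lee_fin cabs2_ge0.
have i1 : P.-integrable setT (EFin \o (fun x => cabs2 (f x))).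
  apply/integrableP; split; first exact/measurable_EFinP.
  by under eq_integral do rewrite gee0_abs ?lee_fin ?cabs2_ge0 //.
have cg := ciZ (cj c) cf.
have i2 := ciRe cg.
have i3 := intZ_int (-2) i2.
have i4 : P.-integrable setT (EFin \o (fun=> cabs2 c)).
  by apply/finite_measure_integrable_cst.
have e : (\int[P]_x (cabs2 (f x - c)) = \int[P]_x (cabs2 (f x)) - cabs2 c)%R.
  transitivity (\int[P]_x (cabs2 (f x) + (-2 * Re (cj c * f x) + cabs2 c))).
    apply: eq_Rintegral => x _; rewrite cabs2D cabs2N.
    by rewrite JN mulrN ReN [f x * _]mulrC; ring.
  rewrite RintegralD //; last by exact: (integrableD _ i3 i4).
  rewrite (RintegralD measurableT i3 i4) (@RintegralZl _ _ _ P setT _ (-2) measurableT i2) Rintegral_cst //= probability_setT mulr1.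
  have -> : \int[P]_x Re (cj c * f x) = Re (cI P (fun x => cj c * f x)) by [].
  rewrite cIZ // -/c [cj c * c]mulrC mulJ ReR; ring.
have fin : (\int[P]_x (cabs2 (f x))%:E)%E \is a fin_num.
  rewrite ge0_fin_numE //; apply: integral_ge0 => x _; by rewrite lee_fin cabs2_ge0.
rewrite -[leRHS]fineK // lee_fin -subr_ge0.
have -> : fine (\int[P]_x (cabs2 (f x))%:E)%E = \int[P]_x cabs2 (f x) by [].
rewrite -e; apply: Rintegral_ge0 => x _; exact: cabs2_ge0.
Qed.
End Prob.

Section Fub.
Context d1 d2 (T1 : measurableType d1) (T2 : measurableType d2).
Variables (m1 : {sigma_finite_measure set T1 -> \bar R})
          (m2 : {sigma_finite_measure set T2 -> \bar R}).

Lemma ci_prod (f : T1 * T2 -> C) : mC f ->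
  (\int[m1]_x \int[m2]_y (cn (f (x, y)))%:E < +oo)%E -> ci (m1 \x m2)%E f.
Proof.
move=> mf fi; split => //; rewrite fubini_tonelli1 //.
- exact/measurable_EFinP/mcn.
- by move=> x; rewrite lee_fin cn_ge0.
Qed.

Lemma cI_fub (f : T1 * T2 -> C) : mC f ->
  (forall x, ci m2 (fun y => f (x, y))) -> (forall y, ci m1 (fun x => f (x, y))) ->
  (\int[m1]_x \int[m2]_y (cn (f (x, y)))%:E < +oo)%E ->
  cI m1 (fun x => cI m2 (fun y => f (x, y))) = cI m2 (fun y => cI m1 (fun x => f (x, y))).
Proof.
move=> mf f1 f2 fi; have cf := ci_prod mf fi.
have key (g : T1 * T2 -> R) :
    (m1 \x m2)%E.-integrable setT (EFin \o g) ->
    (forall x, m2.-integrable setT (EFin \o (fun y => g (x, y)))) ->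
    (forall y, m1.-integrable setT (EFin \o (fun x => g (x, y)))) ->
    \int[m1]_x (\int[m2]_y g (x, y)) = \int[m2]_y (\int[m1]_x g (x, y)).
  move=> gi g1 g2; rewrite /Rintegral; congr fine.
  (* Every section is integrable, not just almost every one, so [fine] can be removed pointwise
     under the outer integral. *)
  transitivity (\int[m1]_x fubini_F m2 (EFin \o g) x)%E.
    apply: eq_integral => x _; rewrite fineK //; apply: integrable_fin_num => //; exact: g1.
  rewrite integral12_prod_meas1 // -integral21_prod_meas1 //.
  by apply: eq_integral => y _; rewrite fineK //; apply: integrable_fin_num => //; exact: g2.
by apply: Ceq; apply: (key (fun z => _ (f z))) => [|x|y];
  [exact: ciRe|exact: ciRe (f1 x)|exact: ciRe (f2 y)|exact: ciIm|exact: ciIm (f1 x)|exact: ciIm (f2 y)].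
Qed.
End Fub.
End CInt.

(** * The Gaussian probability measure on C^d *)
Section Dens.
Context d (T : measurableType d) (R : realType).
Variables (nu mu : {measure set T -> \bar R}) (g : T -> R).
Hypotheses (g0 : forall x, 0 <= g x) (mg : measurable_fun setT g).
Hypothesis nuE : forall E, measurable E -> nu E = (\int[mu]_(x in E) (g x)%:E)%E.
Local Open Scope ereal_scope.
Import HBNNSimple.

Let int_indic E : measurable E ->
  \int[nu]_x (\1_E x)%:E = \int[mu]_x ((\1_E x)%:E * (g x)%:E).
Proof.
move=> mE; rewrite integral_indic // setIT nuE // integral_mkcond.
apply: eq_integral => x _; rewrite patchE indicE.
by case: ifP => _; rewrite ?mul1e ?mul0e.
Qed.

Let int_nnsfun (f : {nnsfun T >-> R}) :
  \int[nu]_x (f x)%:E = \int[mu]_x ((f x)%:E * (g x)%:E).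
Proof.
under [LHS]eq_integral do rewrite fimfunE -fsumEFin//.
rewrite [LHS]ge0_integral_fsum//; last 2 first.
  - by move=> r; exact/measurable_EFinP/measurableT_comp.
  - by move=> n x _; rewrite EFinM nnfun_muleindic_ge0.
under [RHS]eq_integral.
  move=> x xD; rewrite fimfunE -fsumEFin// ge0_mule_fsuml; last first.
    by move=> r; rewrite EFinM nnfun_muleindic_ge0.
  over.
rewrite [RHS]ge0_integral_fsum//; last 2 first.
  - move=> r; apply: emeasurable_funM; last exact/measurable_EFinP.
    by apply/measurable_EFinP; do 2 apply/measurableT_comp => //.
  - move=> n x _; rewrite EFinM mule_ge0//; first by rewrite nnfun_muleindic_ge0.
    by rewrite lee_fin.
apply: eq_fsbigr => r; rewrite inE /= => -[y _ <-].
under [RHS]eq_integral do rewrite EFinM -muleA.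
rewrite [RHS]ge0_integralZl_EFin //.
- under eq_integral do rewrite EFinM.
  rewrite [LHS]ge0_integralZl_EFin //.
  + by rewrite int_indic.
  + exact/measurable_EFinP/measurable_indic.
- by move=> x _; rewrite mule_ge0 // lee_fin.
- by apply: emeasurable_funM; apply/measurable_EFinP.
Qed.

(** The usual passage from indicators to simple functions ([int_nnsfun]) and then to monotone
    limits. *)
Lemma int_density (f : T -> \bar R) : measurable_fun setT f -> (forall x, 0 <= f x) ->
  \int[nu]_x f x = \int[mu]_x (f x * (g x)%:E).
Proof.
move=> mf f0; pose f_ := nnsfun_approx measurableT mf.
have c x : (f_ n x)%:E @[n --> \oo] --> f x by exact: cvg_nnsfun_approx.
transitivity (limn (fun n => \int[nu]_x (f_ n x)%:E)).
  rewrite -monotone_convergence//=.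
  - by apply: eq_integral => x _; apply/esym/cvg_lim.
  - by move=> n; exact/measurable_EFinP.
  - by move=> n x _; rewrite lee_fin.
  - by move=> x _ m n mn; rewrite lee_fin; exact/lefP/nd_nnsfun_approx.
rewrite (_ : (fun n => _) = fun n => \int[mu]_x ((f_ n x)%:E * (g x)%:E)).
  rewrite -monotone_convergence//=.
  - apply: eq_integral => x _; apply/cvg_lim => //; apply: cvgeZr => //.
  - by move=> n; apply: emeasurable_funM; exact/measurable_EFinP.
  - by move=> n x _; rewrite mule_ge0 // lee_fin.
  - move=> x _ m n mn; apply: lee_wpmul2r; rewrite lee_fin //.
    exact/lefP/nd_nnsfun_approx.
by apply/funext => n; exact: int_nnsfun.
Qed.
End Dens.

Section Tonelli.
Context d1 d2 (T1 : measurableType d1) (T2 : measurableType d2) (R : realType).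
Local Open Scope ereal_scope.
Lemma m_pair d0 (T0 : measurableType d0) (f : T0 -> T1) (g : T0 -> T2) :
  measurable_fun setT f -> measurable_fun setT g -> measurable_fun setT (fun x => (f x, g x)).
Proof. by move=> mf mg; exact/measurable_fun_pairP. Qed.
Lemma mI2 (m2 : {sigma_finite_measure set T2 -> \bar R}) (f : T1 * T2 -> \bar R) :
  measurable_fun setT f -> (forall x, 0 <= f x) ->
  measurable_fun setT (fun x => \int[m2]_y f (x, y)).
Proof. by move=> mf f0; exact: measurable_fun_fubini_tonelli_F. Qed.
Lemma tonelli (m1 : {sigma_finite_measure set T1 -> \bar R})
  (m2 : {sigma_finite_measure set T2 -> \bar R}) (f : T1 -> T2 -> \bar R) :
  measurable_fun setT (fun p : T1 * T2 => f p.1 p.2) -> (forall x y, 0 <= f x y) ->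
  \int[m1]_x \int[m2]_y f x y = \int[m2]_y \int[m1]_x f x y.
Proof.
by move=> mf f0; exact: (@fubini_tonelli _ _ _ _ _ m1 m2 (fun p => f p.1 p.2)).
Qed.
End Tonelli.

(** * Affine maps and rotations of Lebesgue integrals; the Gaussian on the plane *)

Section Leb.
Variable R : realType.
Local Notation leb := (@lebesgue_measure R).
Local Open Scope ereal_scope.

Lemma m_aff (s a : R) : measurable_fun setT (fun t : R => s * t + a)%R.
Proof. by apply: measurable_funD => //; apply: measurable_funM. Qed.

(** The push-forward of Lebesgue measure under the affine map, multiplied by [s], gives half-open
    intervals their length. Uniqueness of Lebesgue measure identifies the two. *)
Lemma leb_aff (s a : R) (f : R -> \bar R) : (0 < s)%R ->
  measurable_fun setT f -> (forall x, 0 <= f x) ->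
  s%:E * \int[leb]_t f (s * t + a)%R = \int[leb]_t f t.
Proof.
move=> s0 mf f0; pose phi := (fun t : measurableTypeR R => s * t + a : measurableTypeR R)%R.
have mphi : measurable_fun setT phi by exact: m_aff.
pose m1 := measure_function_pushforward__canonical__measure_function_Measure leb mphi.
pose m2 := [the measure _ _ of mscale (NngNum (ltW s0)) m1].
have e : forall A, measurable A -> leb A = m2 A.
  apply: lebesgue_measure_unique => X [[x y] _ <-].
  rewrite /m2 /= /mscale /= /m1 /= /pushforward /=.
  have -> : phi @^-1` [set` `]x, y]%R] = [set` `]((x - a) / s)%R, ((y - a) / s)%R]%R].
    apply/seteqP; split => t /=; rewrite /phi /= !in_itv /= ltr_pdivrMr // ler_pdivlMr //
      ltrBlDr lerBrDr mulrC //.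
  rewrite !lebesgue_measure_itv /= !lte_fin ltr_pM2r ?invr_gt0 // ltrD2r.
  case: ifP => _; last by rewrite mule0.
  by rewrite -!EFinD -EFinM; congr EFin; field; rewrite gt_eqF.
transitivity (\int[m2]_t f t); last by apply: eq_measure_integral => A mA _; first [exact: e|exact/esym/e].
rewrite ge0_integral_mscale //= ge0_integral_pushforward //.
Qed.

Lemma leb_shift (a : R) (f : R -> \bar R) :
  measurable_fun setT f -> (forall x, 0 <= f x) ->
  \int[leb]_t f (t + a)%R = \int[leb]_t f t.
Proof.
move=> mf f0; rewrite -(leb_aff a (ltr01 : 0 < 1 :> R)%R mf f0) mul1e.
by under [RHS]eq_integral do rewrite mul1r.
Qed.

Definition I2 (f : R -> R -> \bar R) := \int[leb]_x \int[leb]_y f x y.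
Definition m2f (f : R -> R -> \bar R) := measurable_fun setT (fun p : R * R => f p.1 p.2).

Lemma m2f_lin f (a b c e : R) : m2f f ->
  m2f (fun x y => f (a * x + b * y) (c * x + e * y))%R.
Proof.
move=> mf; apply: (measurableT_comp mf
  (_ : measurable_fun setT (fun p : R * R => (a * p.1 + b * p.2, c * p.1 + e * p.2)%R))).
by apply/measurable_fun_pairP; split; apply: measurable_funD; apply: measurable_funM => //.
Qed.

Lemma m2f_y f x : m2f f -> measurable_fun setT (f x).
Proof. by move=> mf; apply: (measurableT_comp mf (_ : measurable_fun setT (fun y => (x, y)))); exact: measurable_pair1. Qed.
Lemma m2f_x f y : m2f f -> measurable_fun setT (fun x => f x y).
Proof. by move=> mf; apply: (measurableT_comp mf (_ : measurable_fun setT (fun x => (x, y)))); exact: measurable_pair2. Qed.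

Lemma I2_swap f : m2f f -> (forall x y, 0 <= f x y) ->
  I2 f = \int[leb]_y \int[leb]_x f x y.
Proof. by move=> mf f0; exact: tonelli. Qed.

Lemma I2_shear_x f (t : R) : m2f f -> (forall x y, 0 <= f x y) ->
  I2 (fun x y => f (x + t * y)%R y) = I2 f.
Proof.
move=> mf f0.
have m1 : m2f (fun x y => f (x + t * y)%R y).
  have := m2f_lin 1 t 0 1 mf; congr m2f; apply/funext => x; apply/funext => y.
  by rewrite !mul1r mul0r add0r.
apply: (etrans (I2_swap m1 (fun x y => f0 _ _))); apply: (etrans _ (esym (I2_swap mf f0))).
by apply: eq_integral => y _; exact: (leb_shift (t * y)%R (m2f_x y mf)).
Qed.

Lemma I2_shear_y f (t : R) : m2f f -> (forall x y, 0 <= f x y) ->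
  I2 (fun x y => f x (t * x + y))%R = I2 f.
Proof.
move=> mf f0; apply: eq_integral => x _; apply: (etrans _ (leb_shift (t * x)%R (m2f_y x mf) (f0 x))).
by apply: eq_integral => y _; rewrite addrC.
Qed.

(** A rotation by an angle other than pi is a product of three shears, and a shear is a translation
    in one variable for each value of the other. The number [t] is the tangent of half the angle,
    whence the exclusion of [c = -1]. *)
Let I2_rot0 f (c s : R) : m2f f -> (forall x y, 0 <= f x y) ->
  (c ^+ 2 + s ^+ 2 = 1)%R -> (c != -1)%R ->
  I2 (fun x y => f (c * x - s * y) (s * x + c * y))%R = I2 f.
Proof.
move=> mf f0 cs c1; have c10 : (1 + c != 0)%R by rewrite addrC addr_eq0.
pose t := (s / (1 + c))%R.
have e1 := I2_shear_x (- t)%R mf f0.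
have m1 : m2f (fun x y => f (x + - t * y)%R y).
  have := m2f_lin 1 (- t)%R 0 1 mf; congr m2f; apply/funext => x; apply/funext => y.
  by rewrite !mul1r mul0r add0r.
have e2 := I2_shear_y s m1 (fun x y => f0 _ _).
have m2 : m2f (fun x y => f (x + - t * (s * x + y))%R (s * x + y)%R).
  have := m2f_lin 1 0 s 1 m1; congr m2f; apply/funext => x; apply/funext => y.
  by rewrite !mul1r mul0r addr0.
have e3 := I2_shear_x (- t)%R m2 (fun x y => f0 _ _).
apply: (etrans _ e1); apply: (etrans _ e2); apply: (etrans _ e3).
apply: eq_integral => x _; apply: eq_integral => y _.
have e : (s ^+ 2 = (1 - c) * (1 + c))%R.
  have -> : (s ^+ 2 = 1 - c ^+ 2)%R by rewrite -cs; ring.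
  by ring.
have ts : (t * s = 1 - c)%R by rewrite /t mulrAC -expr2 e mulfK.
congr (f _ _).
- transitivity ((1 - t * s) * x - t * (1 + (1 - t * s)) * y)%R; last by ring.
  rewrite ts; have -> : (1 - (1 - c) = c)%R by ring.
  by rewrite /t [(_ / _ * _)%R]mulrAC mulfK //; congr (_ - _ * _)%R; rewrite mulfK.
- transitivity (s * x + (1 - t * s) * y)%R; last by ring.
  by rewrite ts; congr (_ + _ * _)%R; ring.
Qed.

Lemma I2_rot f (c s : R) : m2f f -> (forall x y, 0 <= f x y) ->
  (c ^+ 2 + s ^+ 2 = 1)%R ->
  I2 (fun x y => f (c * x - s * y) (s * x + c * y))%R = I2 f.
Proof.
move=> mf f0 cs; have [c1|] := eqVneq c (-1)%R; last exact: I2_rot0.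
have s0 : s = 0%R.
  by apply/eqP; rewrite -sqrf_eq0; apply/eqP; move: cs; rewrite c1; lra.
have cs1 : (0 ^+ 2 + 1 ^+ 2 = 1 :> R)%R by ring.
have n1 : (0 != -1 :> R)%R by rewrite eq_sym oppr_eq0 oner_eq0.
have mr : m2f (fun x y => f (0 * x - 1 * y) (1 * x + 0 * y))%R.
  have := m2f_lin 0 (-1)%R 1 0 mf; congr m2f; apply/funext => x; apply/funext => y.
  by rewrite mulN1r !mul1r.
(* The rotation by pi has no half-angle tangent; it is a quarter turn applied twice. *)
apply: (etrans _ (I2_rot0 mf f0 cs1 n1)).
apply: (etrans _ (I2_rot0 mr (fun x y => f0 _ _) cs1 n1)).
apply: eq_integral => x _; apply: eq_integral => y _.
by rewrite c1 s0; congr (f _ _); rewrite !mul0r !mul1r ?mulN1r ?sub0r ?subr0 ?addr0 ?oppr0.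
Qed.

Definition gfun (x : R) : R := expR (- pi * x ^+ 2).
Lemma gfun_gt0 x : (0 < gfun x)%R. Proof. exact: expR_gt0. Qed.
Lemma mgfun : measurable_fun setT gfun.
Proof.
by apply: measurableT_comp => //; apply: measurable_funM => //; exact: measurable_funX.
Qed.

(** The standard deviation is the one for which the normal density is exactly [gfun], with peak
    value 1. *)
Definition Nv : probability (measurableTypeR R) R :=
  [the probability _ _ of normal_prob 0%R (Num.sqrt (2 * pi))^-1%R].

Lemma int_N (f : R -> \bar R) : measurable_fun setT f -> (forall x, 0 <= f x) ->
  \int[Nv]_x f x = \int[leb]_x (f x * (gfun x)%:E).
Proof.
have p0 : (0 < 2 * pi :> R)%R by rewrite mulr_gt0 // pi_gt0.
have sg : ((Num.sqrt (2 * pi))^-1 != 0 :> R)%R by rewrite invr_eq0 gt_eqF // sqrtr_gt0.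
have s2 : ((Num.sqrt (2 * pi))^-1 ^+ 2 = (2 * pi)^-1 :> R)%R.
  by rewrite exprVn sqr_sqrtr // ltW.
move=> mf f0; apply: (@int_density _ (measurableTypeR R) R Nv leb gfun) => //; [by move=> x; exact: ltW (gfun_gt0 x)|exact: mgfun|move=> E mE].
rewrite /Nv /= /normal_prob; apply: eq_integral => x _; congr EFin.
rewrite /normal_pdf (negbTE sg) /normal_peak /normal_fun /gfun s2 subr0.
have pi0 : (pi != 0 :> R)%R by rewrite gt_eqF // pi_gt0.
have -> : ((2 * pi)^-1 * pi *+ 2 = 1 :> R)%R
  by move: pi0; move: (pi : R) => q q0; field.
rewrite sqrtr1 invr1 mul1r; congr expR; clear -pi0; move: pi0; move: (pi : R) => q q0.
by field.
Qed.

Lemma g1_sig : {g : probability (measurableTypeR R * measurableTypeR R)%type R |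
  forall f : R * R -> \bar R, measurable_fun setT f -> (forall x, 0 <= f x) ->
  \int[g]_p f p = I2 (fun x y => f (x, y) * (expR (- pi * (x ^+ 2 + y ^+ 2)))%:E)}.
Proof.
exists [the probability _ _ of (Nv \x Nv)%E] => f mf f0.
rewrite /= fubini_tonelli1 // /fubini_F.
rewrite int_N; last 2 first.
- exact: (@mI2 _ _ _ _ _ Nv f mf f0).
- by move=> x; apply: integral_ge0.
apply: eq_integral => x _.
have mfx : measurable_fun setT (fun y => f (x, y)).
  by apply: (measurableT_comp mf); exact: measurable_pair1.
rewrite int_N // muleC -ge0_integralZl_EFin //.
- by apply: eq_integral => y _; rewrite muleCA -EFinM -expRD -mulrDr.
- by move=> y _; rewrite mule_ge0 // lee_fin ltW // gfun_gt0.
- have mg : measurable_fun setT (fun y : measurableTypeR R => (gfun y)%:E).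
    by apply/measurable_EFinP; exact: mgfun.
  exact: (emeasurable_funM mfx mg).
- exact: ltW (gfun_gt0 x).
Qed.

Definition g1 := sval g1_sig.
Lemma int_g1 (f : R * R -> \bar R) : measurable_fun setT f -> (forall x, 0 <= f x) ->
  \int[g1]_p f p = I2 (fun x y => f (x, y) * (expR (- pi * (x ^+ 2 + y ^+ 2)))%:E).
Proof. exact: (svalP g1_sig). Qed.
End Leb.

(** * The sigma-algebra on C^d *)

Definition vdisp : measure_display := measure_tuple_display default_measure_display.

Section VecMeas.
Variables (R : realType) (d : nat).
Local Notation C := (CC R).
Local Notation Re := (@complex.Re R).
Local Notation Im := (@complex.Im R).

HB.instance Definition _ := Choice.on (cvec R d).
HB.instance Definition _ := isPointed.Build (cvec R d) (0 : 'rV[C]_d).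

(** The sigma-algebra on C^d is generated by these maps, so a map into C^d is measurable as soon as
    its coordinates are ([mv_into]). *)
Definition coors : 'I_d -> cvec R d -> (R * R)%type :=
  fun j z => (Re (z ord0 j), Im (z ord0 j)).

Let v_set0 : g_sigma_preimage coors set0.
Proof. exact: sigma_algebra0. Qed.
Let v_setC A : g_sigma_preimage coors A -> g_sigma_preimage coors (~` A).
Proof. exact: sigma_algebraC. Qed.
Let v_bigcup (F : _^nat) : (forall i, g_sigma_preimage coors (F i)) ->
  g_sigma_preimage coors (\bigcup_i (F i)).
Proof. exact: sigma_algebra_bigcup. Qed.
HB.instance Definition _ := @isMeasurable.Build vdisp
  (cvec R d) (g_sigma_preimage coors) v_set0 v_setC v_bigcup.

Lemma mv_coors j : measurable_fun setT (coors j).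
Proof.
move=> _ Y mY; rewrite setTI; apply: sub_sigma_algebra => /=.
rewrite -bigcup_seq/=; exists j => /=; first by rewrite mem_index_enum.
by exists Y => //; rewrite setTI.
Qed.

Lemma mv_coord j : mC (fun z : cvec R d => z ord0 j).
Proof.
split.
- exact: (measurableT_comp measurable_fst (mv_coors j)).
- exact: (measurableT_comp measurable_snd (mv_coors j)).
Qed.

Lemma mv_into d1 (T : measurableType d1) (f : T -> cvec R d) :
  (forall j, mC (fun x => f x ord0 j)) -> measurable_fun setT f.
Proof.
move=> mf.
have mf' j : measurable_fun setT (coors j \o f).
  have [a b] := mf j; exact/measurable_fun_pairP.
have prefS : g_sigma_preimage (fun i => coors i \o f) `<=` measurable.
  apply: smallest_sub; first exact: sigma_algebra_measurable.
  rewrite -bigcup_seq; apply: bigcup_sub => i _ A [B mB <-].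
  exact: mf'.
move: prefS; rewrite g_sigma_preimage_comp => prefS.
by move=> _ A mA; apply: prefS; exists A.
Qed.
End VecMeas.

(** * Construction of the Gaussian measure on C^d, one complex coordinate at a time *)

Section Gam.
Variables (R : realType) (d : nat).
Local Notation C := (CC R).
Local Notation V := (cvec R d).
Local Notation R2 := (measurableTypeR R * measurableTypeR R)%type.
Local Notation leb := (@lebesgue_measure R).
Local Open Scope complex_scope.

Definition emb2 (p : R * R) : C := p.1 +i* p.2.
(** The index is a bare natural number so that [gam] can recurse on it; nothing changes when [s] is
    not below [d]. *)
Definition updn (z : V) (s : nat) (w : C) : V := \row_i (if i == s :> nat then w else z ord0 i).

Lemma updnE (z : V) (j : 'I_d) w : updn z j w = upd z j w.
Proof. by apply/rowP => i; rewrite !mxE. Qed.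

Lemma m_emb2 : mC (fun p : R2 => emb2 p).
Proof. by split; [exact: measurable_fst|exact: measurable_snd]. Qed.

Lemma m_updn d1 (T : measurableType d1) (f : T -> V) (w : T -> C) s :
  measurable_fun setT f -> mC w -> measurable_fun setT (fun x => updn (f x) s (w x)).
Proof.
move=> mf mw; apply: mv_into => j; under eq_fun do rewrite mxE.
case: (nat_of_ord j == s) => //.
have [a b] := @mv_coord R d j.
by split; [exact: (measurableT_comp a mf)|exact: (measurableT_comp b mf)].
Qed.
Lemma m_upd d1 (T : measurableType d1) (f : T -> V) (w : T -> C) (j : 'I_d) :
  measurable_fun setT f -> mC w -> measurable_fun setT (fun x => upd (f x) j (w x)).
Proof. by move=> mf mw; under eq_fun do rewrite -updnE; exact: m_updn. Qed.

Definition phis s (p : V * R2) : V := updn p.1 s (emb2 p.2).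
Lemma m_phis s : measurable_fun setT (phis s).
Proof. by apply: m_updn; [exact: measurable_fst|exact: mC_comp m_emb2 measurable_snd]. Qed.
HB.instance Definition _ s := isMeasurableFun.Build _ _ _ _ (phis s) (m_phis s).

(* [gam s] is the Gaussian in the first [s] coordinates and the Dirac mass at 0 in the others. *)
Lemma gam_sig : {gam : nat -> probability V R |
  (forall f : V -> \bar R, measurable_fun setT f -> (\int[gam 0%N]_z f z)%E = f (0 : V)) /\
  forall s (f : V -> \bar R), measurable_fun setT f -> (forall z, (0 <= f z)%E) ->
  (\int[gam s.+1]_z f z = \int[gam s]_z \int[@g1 R]_p f (updn z s (emb2 p)))%E}.
Proof.
exists (fix gam (s : nat) : probability V R :=
  match s with
  | 0 => [the probability V R of \d_(0 : V)]
  | s'.+1 => [the probability V R of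
      distribution [the probability (V * R2)%type R of (gam s' \x @g1 R)%E] (phis s')]
  end); split => [f mf|s f mf f0]; first by rewrite integral_dirac // diracT mul1e.
have mfp := measurableT_comp mf (m_phis s).
rewrite ge0_integral_pushforward // preimage_setT.
exact: (@fubini_tonelli1 _ _ _ _ _ _ (@g1 R) _ mfp (fun p => f0 (phis s p))).
Qed.
Definition gam := sval gam_sig.

Lemma int_gam0 (f : V -> \bar R) : measurable_fun setT f -> (\int[gam 0%N]_z f z)%E = f (0 : V).
Proof. exact: (svalP gam_sig).1. Qed.

Lemma int_gamS s (f : V -> \bar R) : measurable_fun setT f -> (forall z, (0 <= f z)%E) ->
  (\int[gam s.+1]_z f z = \int[gam s]_z \int[@g1 R]_p f (updn z s (emb2 p)))%E.
Proof. exact: (svalP gam_sig).2. Qed.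

(* [g1] is invariant, so that one may resample any coordinate already drawn *)
Lemma gam_resample s (j : 'I_d) (f : V -> \bar R) : (j < s)%N ->
  measurable_fun setT f -> (forall z, (0 <= f z)%E) ->
  (\int[gam s]_z f z = \int[gam s]_z \int[@g1 R]_p f (upd z j (emb2 p)))%E.
Proof.
elim: s f => // s ih f js mf f0.
have mg : measurable_fun setT (fun z => \int[@g1 R]_p f (upd z j (emb2 p)))%E.
  apply: (@mI2 _ _ _ _ R (@g1 R) (fun q : V * R2 => f (upd q.1 j (emb2 q.2)))) => //.
  apply: (measurableT_comp mf); apply: m_upd; first exact: measurable_fst.
  exact: mC_comp m_emb2 measurable_snd.
have g0 z : (0 <= \int[@g1 R]_p f (upd z j (emb2 p)))%E by exact: integral_ge0.
apply: (etrans (int_gamS s mf f0)); apply: (etrans _ (esym (int_gamS s mg g0))).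
move: js; rewrite ltnS leq_eqVlt => /orP [/eqP js|js].
  apply: eq_integral => z _.
  transitivity (\int[@g1 R]_q (\int[@g1 R]_p f (updn z s (emb2 p))))%E.
    by rewrite integral_cst //= probability_setT mule1.
  apply: eq_integral => q _; apply: eq_integral => p _; congr f.
  by rewrite -updnE js; apply/rowP => i; rewrite !mxE; case: ifP.
have mi : measurable_fun setT (fun z => \int[@g1 R]_p f (updn z s (emb2 p)))%E.
  apply: (@mI2 _ _ _ _ R (@g1 R) (fun q : V * R2 => f (updn q.1 s (emb2 q.2)))) => //.
  exact: (measurableT_comp mf (m_phis s)).
apply: (etrans (ih _ js mi (fun z => integral_ge0 _ (fun p _ => f0 _)))).
apply: eq_integral => z _.
have mt : measurable_fun setT (fun q : R2 * R2 => f (updn (upd z j (emb2 q.1)) s (emb2 q.2))).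
  apply: (measurableT_comp mf); apply: m_updn; last exact: mC_comp m_emb2 measurable_snd.
  apply: m_upd; [exact: measurable_cst|exact: mC_comp m_emb2 measurable_fst].
have e := tonelli (@g1 R) (@g1 R) (f := fun p q => f (updn (upd z j (emb2 p)) s (emb2 q)))
  mt (fun p q => f0 _).
apply: (etrans e); apply: eq_integral => p _; apply: eq_integral => q _; congr (f _).
apply/rowP => i; rewrite !mxE -val_eqE /=.
by have [->|//] := eqVneq (i : nat) s; rewrite (gtn_eqF js).
Qed.

Definition wv (s : nat) (v : nat -> R) : R := expR (- pi * \sum_(i < 2 * s) v i ^+ 2).

(** Here the iterated integral of the statement becomes integration against a measure. One step of
    [gam] accounts for two real variables of [iint]. *)
Lemma iint_gam s (g : V -> \bar R) : measurable_fun setT g -> (forall z, (0 <= g z)%E) ->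
  iint (2 * s) (fun v => ((wv s v)%:E * g (embC d v))%E) = (\int[gam s]_z g z)%E.
Proof.
elim: s g => [|s ih] g mg g0.
  rewrite muln0 /= int_gam0 // /wv big_ord0 mulr0 expR0 mul1e; congr g.
  by apply/rowP => i; rewrite !mxE.
rewrite mulnS add2n /=.
have mS (p : R * R) : measurable_fun setT (fun z : V => g (updn z s (emb2 p))).
  by apply: (measurableT_comp mg); apply: m_updn => //; exact: mC_cst.
(* The outermost variable of [iint] has the highest index, hence is the imaginary part: the new
   coordinate is [emb2 (y, x)], and the order of integration has to be exchanged below. *)
transitivity (\int[leb]_x \int[leb]_y \int[gam s]_z
   ((expR (- pi * (y ^+ 2 + x ^+ 2)))%:E * g (updn z s (emb2 (y, x)))))%E.
  apply: eq_integral => x _; apply: eq_integral => y _.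
  rewrite -ih; last 2 first.
  - by apply: emeasurable_funM => //.
  - by move=> z; rewrite mule_ge0 // lee_fin expR_ge0.
  (* [iint m] only evaluates its argument at assignments that vanish from index [m] on, since
     [iint 0] starts from the zero assignment. *)
  have h (G1 G2 : (nat -> R) -> \bar R) m : (forall v, (forall i, (i >= m)%N -> v i = 0) -> G1 v = G2 v) ->
      iint m G1 = iint m G2.
    elim: m G1 G2 => [|m IH] G1 G2 e; first by apply: e.
    apply: eq_integral => t _; apply: IH => v v0; apply: e => i im.
    by rewrite /setc gtn_eqF ?v0 // ltnW.
  apply: h => v v0; rewrite muleA -EFinM; congr (_%:E * g _)%E.
  - rewrite /wv -expRD -mulrDr mulnS add2n !big_ord_recr /= /setc.
    rewrite !eqxx (_ : (2 * s == (2 * s).+1)%N = false); last by rewrite ltn_eqF.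
    have -> : \sum_(i < 2 * s) (if i == (2 * s).+1 :> nat then x else
        if i == (2 * s)%N :> nat then y else v i) ^+ 2 = \sum_(i < 2 * s) v i ^+ 2.
      by apply: eq_bigr => i _; rewrite !ltn_eqF // (leq_trans (ltn_ord i)) ?leqnSn.
    by rewrite addrA.
  - apply/rowP => i; rewrite !mxE /setc.
    have e1 : (2 * i == (2 * s).+1 = false)%N.
      by apply/eqP => /(congr1 odd); rewrite /= !oddM.
    have e2 : ((2 * i).+1 == 2 * s = false)%N.
      by apply/eqP => /(congr1 odd); rewrite /= !oddM.
    have e3 : (2 * i == 2 * s)%N = (i == s :> nat) by rewrite eqn_mul2l.
    by rewrite e1 e2 e3 eqSS e3; case: ifP.
rewrite int_gamS //.
transitivity (\int[gam s]_z \int[leb]_y \int[leb]_x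
   (g (updn z s (emb2 (y, x))) * (expR (- pi * (y ^+ 2 + x ^+ 2)))%:E))%E; last first.
  apply: eq_integral => z _; rewrite int_g1 //.
  apply: (measurableT_comp mg); apply: m_updn; [exact: measurable_cst|exact: m_emb2].
pose F (q : V * R2) := (g (updn q.1 s (emb2 q.2)) * (expR (- pi * (q.2.1 ^+ 2 + q.2.2 ^+ 2)))%:E)%E.
have F0 q : (0 <= F q)%E by rewrite mule_ge0 // lee_fin expR_ge0.
have mF : measurable_fun setT F.
  apply: emeasurable_funM; first exact: measurableT_comp mg (m_phis s).
  apply/measurable_EFinP; apply: measurableT_comp => //; apply: measurable_funM => //.
  apply: measurable_funD; apply: measurable_funX; apply: measurableT_comp => //.
transitivity (\int[leb]_x \int[leb]_y \int[gam s]_z F (z, (y, x)))%E.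
  by apply: eq_integral => x _; apply: eq_integral => y _; apply: eq_integral => z _; rewrite muleC.
transitivity (\int[leb]_y \int[leb]_x \int[gam s]_z F (z, (y, x)))%E.
  apply: (tonelli leb leb (f := fun x y => (\int[gam s]_z F (z, (y, x)))%E)).
  - apply: (@mI2 _ _ _ _ R (gam s) (fun q : R2 * V => F (q.2, (q.1.2, q.1.1)))) => //.
    apply: (measurableT_comp mF); apply: m_pair; first exact: measurable_snd.
    by apply: m_pair; [exact: (measurableT_comp measurable_snd measurable_fst)
      |exact: (measurableT_comp measurable_fst measurable_fst)].
  - by move=> x y; exact: integral_ge0.
transitivity (\int[leb]_y \int[gam s]_z \int[leb]_x F (z, (y, x)))%E.
  apply: eq_integral => y _; apply: (tonelli leb (gam s) (f := fun x z => F (z, (y, x)))) => //.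
  apply: (measurableT_comp mF); apply: m_pair; first exact: measurable_snd.
  by apply: m_pair; [exact: measurable_cst|exact: measurable_fst].
apply: (etrans (tonelli leb (gam s) (f := fun y z => (\int[leb]_x F (z, (y, x)))%E) _ _)) => //.
- apply: (@mI2 _ _ _ _ R leb (fun q : (measurableTypeR R * V) * measurableTypeR R => F (q.1.2, (q.1.1, q.2)))) => //.
  apply: (measurableT_comp mF); apply: m_pair.
    exact: (measurableT_comp measurable_snd measurable_fst).
  by apply: m_pair; [exact: (measurableT_comp measurable_fst measurable_fst)|exact: measurable_snd].
- by move=> y z; exact: integral_ge0.
Qed.

End Gam.

(** * Square-integrable functions *)
Section L2.
Context (R : realType) d (T : measurableType d) (P : probability T R).
Local Notation C := (CC R).
Local Notation Re := (@complex.Re R).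
Local Open Scope complex_scope.
Implicit Types f g h : T -> C.

Definition n2 f : \bar R := (\int[P]_x (cabs2 (f x))%:E)%E.
Definition sq f := mC f /\ (n2 f < +oo)%E.
Definition ip f g : C := cI P (fun x => f x * cj (g x)).

Lemma n2_ge0 f : (0 <= n2 f)%E.
Proof. by apply: integral_ge0 => x _; rewrite lee_fin cabs2_ge0. Qed.
Lemma eq_n2 f g : (forall x, cabs2 (f x) = cabs2 (g x)) -> n2 f = n2 g.
Proof. by move=> fg; apply: eq_integral => x _; rewrite fg. Qed.
Lemma n2_fin f : sq f -> n2 f \is a fin_num.
Proof. by case=> _ h; rewrite ge0_fin_numE // n2_ge0. Qed.
Lemma n2_fine f : sq f -> (fine (n2 f))%:E = n2 f.
Proof. by move=> h; rewrite fineK // n2_fin. Qed.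
Lemma mn2 f : mC f -> measurable_fun setT (fun x => (cabs2 (f x))%:E).
Proof. by move=> mf; exact/measurable_EFinP/mabs2. Qed.
Lemma n2Z c f : mC f -> n2 (fun x => c * f x) = ((cabs2 c)%:E * n2 f)%E.
Proof.
move=> mf; rewrite /n2 -ge0_integralZl_EFin ?cabs2_ge0 //.
- by apply: eq_integral => x _; rewrite cabs2M.
- by move=> x _; rewrite lee_fin cabs2_ge0.
- exact: mn2.
Qed.
Lemma n2D_le f g : mC f -> mC g ->
  (n2 (fun x => f x + g x)%R <= 2%:E * n2 f + 2%:E * n2 g)%E.
Proof.
move=> mf mg.
apply: (@le_trans _ _ (\int[P]_x (2%:E * (cabs2 (f x))%:E + 2%:E * (cabs2 (g x))%:E))%E).
  apply: ge0_le_int.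
  - by apply: mn2; exact: mCD.
  - by apply: emeasurable_funD; apply: emeasurable_funM => //; exact: mn2.
  - by move=> x; rewrite lee_fin cabs2_ge0.
  - by move=> x; rewrite -!EFinM -EFinD lee_fin cabs2D_le.
rewrite ge0_integralD //.
- rewrite !ge0_integralZl_EFin //;
    first [exact: mn2|by move=> x _; rewrite lee_fin cabs2_ge0].
- by move=> x _; rewrite mule_ge0 // lee_fin cabs2_ge0.
- by apply: emeasurable_funM => //; exact: mn2.
- by move=> x _; rewrite mule_ge0 // lee_fin cabs2_ge0.
- by apply: emeasurable_funM => //; exact: mn2.
Qed.
Lemma n2_para f g : mC f -> mC g ->
  (n2 (fun x => f x + g x)%R + n2 (fun x => f x - g x)%R = 2%:E * n2 f + 2%:E * n2 g)%E.
Proof.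
move=> mf mg.
have z k x : (0 <= (cabs2 (k x : C))%:E)%E by rewrite lee_fin cabs2_ge0.
rewrite /n2 -ge0_integralD //; last 2 first.
- by apply: mn2; exact: mCD.
- by apply: mn2; exact: mCB.
rewrite -!ge0_integralZl_EFin //; try exact: mn2.
rewrite -ge0_integralD //.
- by apply: eq_integral => x _; rewrite -!EFinM -!EFinD cabs2_para.
- by move=> x _; rewrite mule_ge0.
- by apply: emeasurable_funM => //; exact: mn2.
- by move=> x _; rewrite mule_ge0.
- by apply: emeasurable_funM => //; exact: mn2.
Qed.

Lemma sqD f g : sq f -> sq g -> sq (fun x => f x + g x).
Proof.
move=> [mf f1] [mg g1]; split; first exact: mCD.
apply: (le_lt_trans (n2D_le mf mg)).
by apply: lte_add_pinfty; apply: lte_mul_pinfty.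
Qed.
Lemma sqZ c f : sq f -> sq (fun x => c * f x).
Proof.
move=> [mf f1]; split; first by apply: mCM => //; exact: mC_cst.
by rewrite n2Z // lte_mul_pinfty // lee_fin cabs2_ge0.
Qed.
Lemma sqN f : sq f -> sq (fun x => - f x).
Proof. by move=> /(sqZ (-1)); congr sq; apply/funext => x; rewrite mulN1r. Qed.
Lemma sqB f g : sq f -> sq g -> sq (fun x => f x - g x).
Proof. by move=> sf sg; apply: sqD => //; exact: sqN. Qed.
Lemma sq_cst c : sq (fun=> c).
Proof.
split; first exact: mC_cst.
by rewrite /n2 integral_cst //= probability_setT mule1 ltry.
Qed.
Lemma sq_sum (I : Type) (s : seq I) (h : I -> T -> C) :
  (forall i, sq (h i)) -> sq (fun x => \sum_(i <- s) h i x).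
Proof.
move=> mh; elim: s => [|i s ih].
  by under eq_fun do rewrite big_nil; exact: sq_cst.
by under eq_fun do rewrite big_cons; exact: sqD.
Qed.
Lemma sqM_bnd f g M : sq f -> mC g -> (forall x, cn (g x) <= M) -> sq (fun x => g x * f x).
Proof.
move=> [mf f1] mg gM; split; first exact: mCM.
have M0 : 0 <= M by exact: le_trans (cn_ge0 _) (gM point).
apply: (@le_lt_trans _ _ ((M ^+ 2)%:E * n2 f)%E); last first.
  by rewrite lte_mul_pinfty // lee_fin sqr_ge0.
rewrite /n2 -ge0_integralZl_EFin ?sqr_ge0 //.
- apply: ge0_le_int.
  + by apply: mn2; exact: mCM.
  + by apply: emeasurable_funM => //; exact: mn2.
  + by move=> x; rewrite lee_fin cabs2_ge0.
  + move=> x; rewrite lee_fin cabs2M ler_wpM2r ?cabs2_ge0 // -cn_sqr.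
    by rewrite lerXn2r // nnegrE ?cn_ge0.
- by move=> x _; rewrite lee_fin cabs2_ge0.
- exact: mn2.
Qed.

Lemma cnM_le (t : R) (x y : C) : 0 < t ->
  2 * (cn x * cn y) <= t * cabs2 x + t^-1 * cabs2 y.
Proof.
move=> t0; rewrite -!cn_sqr -subr_ge0.
have -> : t * cn x ^+ 2 + t^-1 * cn y ^+ 2 - 2 * (cn x * cn y) =
  t^-1 * (t * cn x - cn y) ^+ 2 by field; rewrite gt_eqF.
by rewrite mulr_ge0 ?sqr_ge0 // invr_ge0 ltW.
Qed.

Lemma ip_young t f g : 0 < t -> mC f -> mC g ->
  (2%:E * \int[P]_x (cn (f x * cj (g x)))%:E <= t%:E * n2 f + t^-1%:E * n2 g)%E.
Proof.
move=> t0 mf mg.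
have ti : 0 <= t^-1 by rewrite invr_ge0 ltW.
rewrite -ge0_integralZl_EFin //; last 2 first.
- by move=> x _; rewrite lee_fin cn_ge0.
- by apply/measurable_EFinP/mcn; apply: mCM => //; exact: mCJ.
rewrite /n2 -!ge0_integralZl_EFin ?(ltW t0) //; try exact: mn2.
all: try by move=> x _; rewrite lee_fin cabs2_ge0.
rewrite -ge0_integralD //.
- apply: ge0_le_int.
  + apply: emeasurable_funM => //.
    by apply/measurable_EFinP/mcn; apply: mCM => //; exact: mCJ.
  + by apply: emeasurable_funD; apply: emeasurable_funM => //; exact: mn2.
  + by move=> x; rewrite mule_ge0 // lee_fin cn_ge0.
  + by move=> x; rewrite -!EFinM -EFinD lee_fin cnM cnJ cnM_le.
- by move=> x _; rewrite mule_ge0 // lee_fin ?cabs2_ge0 // ltW.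
- by apply: emeasurable_funM => //; exact: mn2.
- by move=> x _; rewrite mule_ge0 // lee_fin cabs2_ge0.
- by apply: emeasurable_funM => //; exact: mn2.
Qed.

Lemma sq_ci f g : sq f -> sq g -> ci P (fun x => f x * cj (g x)).
Proof.
move=> [mf f1] [mg g1]; split; first by apply: mCM => //; exact: mCJ.
have h := ip_young ltr01 mf mg.
have l : (1%:E * n2 f + 1^-1%:E * n2 g < +oo)%E.
  by apply: lte_add_pinfty; apply: lte_mul_pinfty => //; rewrite lee_fin invr1.
move: (le_lt_trans h l); rewrite ltNge => /negP n; rewrite ltNge; apply/negP.
by rewrite leye_eq => /eqP e; apply: n; rewrite e gt0_muley.
Qed.

(** Cauchy-Schwarz, obtained by optimising the parameter of [ip_young]: [t = c / a] when [a] is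
    positive. *)
Lemma ip_cs f g : sq f -> sq g -> cabs2 (ip f g) <= fine (n2 f) * fine (n2 g).
Proof.
move=> sf sg; have [mf _] := sf; have [mg _] := sg.
set a := fine (n2 f); set b := fine (n2 g); set c := cn (ip f g).
have a0 : 0 <= a by rewrite fine_ge0 // n2_ge0.
have b0 : 0 <= b by rewrite fine_ge0 // n2_ge0.
have key t : 0 < t -> 2 * c <= t * a + t^-1 * b.
  move=> t0; rewrite -lee_fin EFinD !EFinM !n2_fine //.
  apply: le_trans (ip_young t0 mf mg).
  by apply: lee_wpmul2l => //; apply: cn_cI; exact: sq_ci.
rewrite -cn_sqr -/c.
have : 0 <= c by exact: cn_ge0.
rewrite le_eqVlt => /orP [/eqP <-|c0]; first by rewrite expr0n mulr_ge0.
move: a0; rewrite le_eqVlt => /orP [/eqP za|a0].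
  (* With [a = 0] a large parameter would give [2 * c <= c * (b / (b + 1))], which is impossible for
     positive [c]. *)
  have t0 : 0 < (b + 1) / c by rewrite divr_gt0 // ltr_wpDl.
  have := key _ t0; rewrite -za mulr0 add0r invf_div.
  have -> : c / (b + 1) * b = c * (b / (b + 1)) by ring.
  rewrite [2 * c]mulrC ler_pM2l // ler_pdivlMr ?ltr_wpDl // => h; exfalso; lra.
have t0 : 0 < c / a by rewrite divr_gt0.
have := key _ t0; rewrite mulfVK ?gt_eqF // invf_div => h.
have {}h : c <= a / c * b by lra.
by rewrite expr2 -ler_pdivlMr // mulrAC.
Qed.

Lemma ipDl f g h : sq f -> sq g -> sq h ->
  ip (fun x => f x + g x) h = ip f h + ip g h.
Proof.
move=> sf sg sh; rewrite /ip -cID; [|exact: sq_ci|exact: sq_ci].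
by apply: eq_cI => x; rewrite mulrDl.
Qed.
Lemma ipZl c f h : sq f -> sq h -> ip (fun x => c * f x) h = c * ip f h.
Proof.
move=> sf sh; rewrite /ip -cIZ; last exact: sq_ci.
by apply: eq_cI => x; rewrite mulrA.
Qed.
Lemma ipC f g : sq f -> sq g -> ip g f = cj (ip f g).
Proof.
move=> sf sg; rewrite /ip -cIJ; last exact: sq_ci.
by apply: eq_cI => x; rewrite JM JJ mulrC.
Qed.
Lemma ip_suml (I : Type) (s : seq I) (k : I -> T -> C) h :
  (forall i, sq (k i)) -> sq h ->
  ip (fun x => \sum_(i <- s) k i x) h = \sum_(i <- s) ip (k i) h.
Proof.
move=> sk sh; rewrite /ip -cI_sum => [|i]; last exact: sq_ci.
by apply: eq_cI => x; rewrite mulr_suml.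
Qed.
Lemma ip_sumr (I : Type) (s : seq I) (k : I -> T -> C) h :
  (forall i, sq (k i)) -> sq h ->
  ip h (fun x => \sum_(i <- s) k i x) = \sum_(i <- s) ip h (k i).
Proof.
move=> sk sh; rewrite ipC; [|exact: sq_sum|by []].
by rewrite ip_suml // J_sum; apply: eq_bigr => i _; rewrite -ipC.
Qed.
Lemma ipZr c f h : sq f -> sq h -> ip h (fun x => c * f x) = cj c * ip h f.
Proof. by move=> sf sh; rewrite ipC // ?ipZl // ?JM -?ipC //; exact: sqZ. Qed.
Lemma ipBl f g h : sq f -> sq g -> sq h ->
  ip (fun x => f x - g x) h = ip f h - ip g h.
Proof.
move=> sf sg sh; rewrite /ip -cIB; [|exact: sq_ci|exact: sq_ci].
by apply: eq_cI => x; rewrite mulrBl.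
Qed.
Lemma ip_n2 f : sq f -> n2 f = (Re (ip f f))%:E.
Proof.
move=> sf; rewrite -n2_fine // /ip /cI /=; congr EFin.
by apply: eq_Rintegral => x _; rewrite mulJ.
Qed.
Lemma ip_n2C f : sq f -> ip f f = (fine (n2 f))%:C.
Proof.
move=> sf; rewrite /ip -cI_real; apply: eq_cI => x; exact: mulJ.
Qed.
Lemma gram (I : Type) (s : seq I) (c : I -> C) (k : I -> T -> C) :
  (forall i, sq (k i)) ->
  n2 (fun x => \sum_(i <- s) c i * k i x) =
  (Re (\sum_(i <- s) \sum_(j <- s) c i * cj (c j) * ip (k i) (k j)))%:E.
Proof.
move=> sk; have sk' i := sqZ (c i) (sk i).
rewrite ip_n2; last exact: sq_sum.
rewrite ip_suml //; last exact: sq_sum.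
congr (Re _)%:E; apply: eq_bigr => i _.
rewrite ip_sumr //; apply: eq_bigr => j _; rewrite ipZl // ipZr //.
by rewrite mulrA.
Qed.

(** Fatou's lemma: pointwise limits do not increase the norm, which is how estimates for
    approximants pass to their limits. *)
Lemma n2_lim (f_ : nat -> T -> C) f (l : R) :
  (forall k, mC (f_ k)) -> mC f ->
  (forall x, cn (f_ k x - f x) @[k --> \oo] --> 0) ->
  (forall k, (n2 (f_ k) <= l%:E)%E) -> (n2 f <= l%:E)%E.
Proof.
move=> mf_ mf cf fl.
have e : n2 f = (\int[P]_x limn_einf (fun k => (cabs2 (f_ k x))%:E))%E.
  apply: eq_integral => x _; apply/esym.
  have c : (cabs2 (f_ k x))%:E @[k --> \oo] --> (cabs2 (f x))%:E.
    apply: cvg_EFin; first by near=> k.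
    have c1 : cn (f_ k x) @[k --> \oo] --> cn (f x).
      apply/cvgrPdist_lt => e e0; have /cvgrPdist_lt /(_ e e0) := cf x.
      apply: filterS => k; rewrite sub0r normrN ger0_norm ?cn_ge0 //.
      apply: le_lt_trans; rewrite ler_norml; apply/andP; split.
        by rewrite lerNl opprB lerBlDl cn_dist.
      by rewrite lerBlDl cnB cn_dist.
    under eq_fun do rewrite -cn_sqr expr2.
    by rewrite -cn_sqr expr2; exact: cvgM.
  by rewrite is_cvg_limn_einfE; [exact/cvg_lim|apply/cvg_ex; eexists; exact: c].
rewrite e; apply: le_trans.
  apply: fatou => //; first by move=> k; exact: mn2.
  by move=> k x _; rewrite lee_fin cabs2_ge0.
rewrite limn_einf_lim; apply: lime_le; first exact: is_cvg_einfs.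
near=> k; apply: (le_trans _ (fl k)); apply: ereal_inf_lbound.
by exists k => /=.
Unshelve. all: by end_near.
Qed.
End L2.

(** * Invariance of the Gaussian measure *)
Section Gauss1.
Variable R : realType.
Local Notation C := (CC R).
Local Notation Re := (@complex.Re R).
Local Notation Im := (@complex.Im R).
Local Notation R2 := (measurableTypeR R * measurableTypeR R)%type.
Local Notation leb := (@lebesgue_measure R).
Local Open Scope complex_scope.

Definition mE (f : C -> \bar R) := measurable_fun setT (fun p : R2 => f (emb2 p)).

Lemma mE_comp (f : C -> \bar R) d1 (T : measurableType d1) (w : T -> C) :
  mE f -> mC w -> measurable_fun setT (fun x => f (w x)).
Proof.
move=> mf [a b].
have e : (fun x => f (w x)) = (fun x => f (emb2 (Re (w x), Im (w x)))).
  by apply/funext => x; rewrite [in LHS](CE (w x)).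
rewrite e; apply: (measurableT_comp mf (m_pair a b)).
Qed.

Lemma g1_rot (u : C) (f : C -> \bar R) : cabs2 u = 1 -> mE f -> (forall w, (0 <= f w)%E) ->
  (\int[@g1 R]_p f (u * emb2 p)%R = \int[@g1 R]_p f (emb2 p))%E.
Proof.
move=> u1 mf f0.
have mfu : measurable_fun setT (fun p : R2 => f (u * emb2 p)).
  by apply: mE_comp => //; apply: mCM; [exact: mC_cst|exact: m_emb2].
apply: (etrans (int_g1 mfu (fun p => f0 _))).
apply: (etrans _ (esym (int_g1 mf (fun p => f0 _)))).
pose F x y := (f (emb2 (x, y)) * (expR (- pi * (x ^+ 2 + y ^+ 2)))%:E)%E.
have mF : m2f F.
  apply: emeasurable_funM; first exact: mf.
  apply/measurable_EFinP; apply: measurableT_comp => //; apply: measurable_funM => //.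
  by apply: measurable_funD; apply: measurable_funX.
have F0 x y : (0 <= F x y)%E by rewrite mule_ge0 // lee_fin expR_ge0.
apply: (etrans _ (I2_rot mF F0 u1)).
apply: eq_integral => x _; apply: eq_integral => y _; rewrite /F.
congr (f _ * (expR (_ * _))%:E)%E.
  by apply: Ceq; rewrite ?ReM ?ImM /emb2 /=; ring.
rewrite -[LHS]mul1r -u1 /cabs2; ring.
Qed.

(** The density of the Gaussian translated by [a] with respect to the Gaussian. It is also the
    squared modulus of the exponential in [beta], so that [beta] acts isometrically. *)
Definition wt1 (a w : C) : R := expR (2 * pi * Re (cj a * w) - pi * cabs2 a).

Lemma mwt1 a : measurable_fun setT (fun p : R2 => wt1 a (emb2 p)).
Proof.
apply: measurableT_comp => //; apply: measurable_funB => //; apply: measurable_funM => //.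
have [+ _] : mC (fun p : R2 => cj a * emb2 p) by apply: mCM; [exact: mC_cst|exact: m_emb2].
by [].
Qed.

Lemma g1_shift (a : C) (f : C -> \bar R) : mE f -> (forall w, (0 <= f w)%E) ->
  (\int[@g1 R]_p (f (emb2 p - a)%R * (wt1 a (emb2 p))%:E) = \int[@g1 R]_p f (emb2 p))%E.
Proof.
move=> mf f0.
pose F x y := (f (emb2 (x, y)) * (expR (- pi * (x ^+ 2 + y ^+ 2)))%:E)%E.
have mF : m2f F.
  apply: emeasurable_funM; first exact: mf.
  apply/measurable_EFinP; apply: measurableT_comp => //; apply: measurable_funM => //.
  by apply: measurable_funD; apply: measurable_funX.
have F0 x y : (0 <= F x y)%E by rewrite mule_ge0 // lee_fin expR_ge0.
have m1 : measurable_fun setT (fun p : R2 => (f (emb2 p - a)%R * (wt1 a (emb2 p))%:E)%E).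
  apply: emeasurable_funM; last by apply/measurable_EFinP; exact: mwt1.
  by apply: mE_comp => //; apply: mCB; [exact: m_emb2|exact: mC_cst].
have p1 p : (0 <= f (emb2 p - a)%R * (wt1 a (emb2 p))%:E)%E.
  by rewrite mule_ge0 // lee_fin expR_ge0.
apply: (etrans (int_g1 m1 p1)); apply: (etrans _ (esym (int_g1 mf (fun p => f0 _)))).
transitivity (I2 (fun x y => F (x - Re a) (y - Im a))%R).
  apply: eq_integral => x _; apply: eq_integral => y _.
  rewrite /F -muleA -EFinM /wt1 -expRD; congr (f _ * (expR _)%:E)%E.
    by apply: Ceq; rewrite ?ReB ?ImB.
  by rewrite ReM ReJ ImJ /cabs2 /emb2 /=; ring.
have mFs : measurable_fun setT (fun x => \int[leb]_y F x y)%E.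
  by apply: (@mI2 _ _ _ _ R leb (fun p => F p.1 p.2)).
have nn x : (0 <= \int[leb]_y F x y)%E by exact: integral_ge0.
have e := leb_shift (- Re a) mFs nn.
transitivity (\int[leb]_x (fun x => \int[leb]_y F x y) (x - Re a)%R)%E; last exact: e.
apply: eq_integral => x _.
exact: (leb_shift (- Im a) (m2f_y _ mF) (F0 _)).
Qed.
End Gauss1.

Section GaussD.
Variables (R : realType) (d : nat).
Local Notation C := (CC R).
Local Notation V := (cvec R d).
Local Notation Re := (@complex.Re R).
Local Notation Im := (@complex.Im R).
Local Notation R2 := (measurableTypeR R * measurableTypeR R)%type.
Local Notation gam := (@gam R d).
Local Open Scope complex_scope.

Lemma mE_upd (f : V -> \bar R) z (j : 'I_d) : measurable_fun setT f ->
  mE (fun w => f (upd z j w)).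
Proof.
move=> mf; apply: (measurableT_comp mf); apply: m_upd; [exact: measurable_cst|exact: m_emb2].
Qed.

Lemma upd_upd (z : V) j (w w' : C) : upd (upd z j w) j w' = upd z j w'.
Proof. by apply/rowP => i; rewrite !mxE; case: eqVneq. Qed.
Lemma upd_id (z : V) j : upd z j (z ord0 j) = z.
Proof. by apply/rowP => i; rewrite !mxE; case: eqVneq => [->|]. Qed.
Lemma upd_at (z : V) j (w : C) : upd z j w ord0 j = w.
Proof. by rewrite !mxE eqxx. Qed.
Lemma upd_ne (z : V) j (w : C) i : i != j -> upd z j w ord0 i = z ord0 i.
Proof. by rewrite !mxE => /negbTE ->. Qed.
Lemma upd_comm (z : V) i j (v w : C) : i != j -> upd (upd z i v) j w = upd (upd z j w) i v.
Proof.
move=> ij; apply/rowP => k; rewrite !mxE.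
by have [->|//] := eqVneq k j; rewrite eq_sym (negbTE ij).
Qed.

Lemma gam_rot s (j : 'I_d) (u : C) (f : V -> \bar R) : (j < s)%N -> cabs2 u = 1 ->
  measurable_fun setT f -> (forall z, (0 <= f z)%E) ->
  (\int[gam s]_z f (upd z j (u * z ord0 j)%R) = \int[gam s]_z f z)%E.
Proof.
move=> js u1 mf f0.
have mg : measurable_fun setT (fun z : V => f (upd z j (u * z ord0 j))).
  apply: (measurableT_comp mf); apply: m_upd => //.
  by apply: mCM; [exact: mC_cst|exact: mv_coord].
apply: (etrans (gam_resample js mg (fun z => f0 _))).
apply: (etrans _ (esym (gam_resample js mf f0))).
apply: eq_integral => z _; rewrite -(g1_rot u1 (mE_upd z j mf)) //.
by apply: eq_integral => p _; rewrite upd_upd upd_at.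
Qed.

Definition wt (a z : V) : R := expR (2 * pi * Re (cdot a z) - pi * vnorm2 a).

Lemma mcdot d1 (T : measurableType d1) (f g : T -> V) :
  measurable_fun setT f -> measurable_fun setT g -> mC (fun x => cdot (f x) (g x)).
Proof.
move=> mf mg; apply: mC_sum => j; apply: mCM.
- apply: mCJ; have [a b] := @mv_coord R d j.
  by split; [exact: (measurableT_comp a mf)|exact: (measurableT_comp b mf)].
- have [a b] := @mv_coord R d j.
  by split; [exact: (measurableT_comp a mg)|exact: (measurableT_comp b mg)].
Qed.

Lemma mwt a : measurable_fun setT (wt a).
Proof.
apply: measurableT_comp => //; apply: measurable_funB => //; apply: measurable_funM => //.
by have [+ _] := mcdot (measurable_cst (a : V)) (@measurable_id _ V setT).
Qed.

Lemma m_vshift a d1 (T : measurableType d1) (f : T -> V) :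
  measurable_fun setT f -> measurable_fun setT (fun x => (f x - a : V)).
Proof.
move=> mf; apply: mv_into => j; under eq_fun do rewrite mxE [(- a) _ _]mxE.
apply: mCB; last exact: mC_cst.
have [b c] := @mv_coord R d j.
by split; [exact: (measurableT_comp b mf)|exact: (measurableT_comp c mf)].
Qed.

Lemma cdotE (a z : V) : cdot a z = \sum_j cj (a ord0 j) * z ord0 j.
Proof. by []. Qed.

(** Coordinates are peeled off one at a time, the weight [wt] being a product over coordinates.
    Beyond the first [s] coordinates [gam s] is a Dirac mass at 0, so the translation has to vanish
    there. *)
Lemma gam_shift_s s (a : V) (f : V -> \bar R) : (s <= d)%N ->
  (forall i : 'I_d, (s <= i)%N -> a ord0 i = 0) ->
  measurable_fun setT f -> (forall z, (0 <= f z)%E) ->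
  (\int[gam s]_z (f (z - a)%R * (wt a z)%:E) = \int[gam s]_z f z)%E.
Proof.
elim: s a f => [|s ih] a f sd a0 mf f0.
  have -> : a = 0 by apply/rowP => i; rewrite mxE a0.
  apply: eq_integral => z _; rewrite subr0 /wt.
  have -> : cdot (0 : V) z = 0 by rewrite cdotE big1 // => i _; rewrite mxE J0 mul0r.
  have -> : vnorm2 (0 : V) = 0 by rewrite /vnorm2 big1 // => i _; rewrite mxE cabs20.
  by rewrite !mulr0 subr0 expR0 mule1.
pose j := Ordinal sd; pose a' : V := upd a j 0.
have mg b : measurable_fun setT (fun z : V => (f (z - b)%R * (wt b z)%:E)%E).
  apply: emeasurable_funM; last by apply/measurable_EFinP; exact: mwt.
  by apply: (measurableT_comp mf); apply: m_vshift.
have g0 b z : (0 <= f (z - b)%R * (wt b z)%:E)%E by rewrite mule_ge0 // lee_fin expR_ge0.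
pose G z := (\int[@g1 R]_p f (upd z j (emb2 p)))%E.
have mG : measurable_fun setT G.
  apply: (@mI2 _ _ _ _ R (@g1 R) (fun q : V * R2 => f (upd q.1 j (emb2 q.2)))) => //.
  apply: (measurableT_comp mf); apply: m_upd; first exact: measurable_fst.
  exact: mC_comp (@m_emb2 R) measurable_snd.
have G0 z : (0 <= G z)%E by exact: integral_ge0.
apply: (etrans (int_gamS s (mg a) (g0 a))); apply: (etrans _ (esym (int_gamS s mf f0))).
have a'0 (i : 'I_d) : (s <= i)%N -> a' ord0 i = 0.
  move=> si; rewrite mxE; case: eqVneq => // ij; apply: a0.
  by rewrite ltn_neqAle si andbT; apply: contra ij => /eqP e; apply/eqP/val_inj.
transitivity (\int[gam s]_z (G (z - a')%R * (wt a' z)%:E))%E; last first.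
  apply: (etrans (ih a' G (ltnW sd) a'0 mG G0)); apply: eq_integral => z _.
  by apply: eq_integral => p _; rewrite -updnE.
apply: eq_integral => z _.
rewrite /G -(g1_shift (a ord0 j) (mE_upd (z - a') j mf)) // muleC.
rewrite -ge0_integralZl_EFin ?expR_ge0 //.
- apply: eq_integral => p _; rewrite (updnE _ j) muleCA -EFinM.
  congr (f _ * _%:E)%E.
    apply/rowP => i; rewrite !mxE; case: eqVneq => [->|//]; by rewrite ?mxE.
  rewrite /wt /wt1 -expRD; congr expR.
  have e1 : cdot a (upd z j (emb2 p)) = cdot a' z + cj (a ord0 j) * emb2 p.
    rewrite !cdotE (bigD1 j) //= [in RHS](bigD1 j) //= upd_at /a' upd_at J0 mul0r add0r addrC.
    by congr (_ + _); apply: eq_bigr => i ij; rewrite !upd_ne.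
  have e2 : vnorm2 a = vnorm2 a' + cabs2 (a ord0 j).
    rewrite /vnorm2 (bigD1 j) //= [in RHS](bigD1 j) //= /a' upd_at cabs20 add0r addrC.
    by congr (_ + _); apply: eq_bigr => i ij; rewrite !upd_ne.
  by rewrite e1 e2 ReD; ring.
- by move=> p _; rewrite mule_ge0 // lee_fin expR_ge0.
- apply: emeasurable_funM; last by apply/measurable_EFinP; exact: mwt1.
  by apply: mE_comp (mE_upd _ j mf) _; apply: mCB; [exact: m_emb2|exact: mC_cst].
Qed.

Definition gm : probability V R := gam d.

Lemma gm_shift (a : V) (f : V -> \bar R) :
  measurable_fun setT f -> (forall z, (0 <= f z)%E) ->
  (\int[gm]_z (f (z - a)%R * (wt a z)%:E) = \int[gm]_z f z)%E.
Proof. by apply: gam_shift_s => // i; rewrite leqNgt ltn_ord. Qed.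

Lemma gm_rot (j : 'I_d) (u : C) (f : V -> \bar R) : cabs2 u = 1 ->
  measurable_fun setT f -> (forall z, (0 <= f z)%E) ->
  (\int[gm]_z f (upd z j (u * z ord0 j)%R) = \int[gm]_z f z)%E.
Proof. exact: gam_rot. Qed.

Lemma gm_resample (j : 'I_d) (f : V -> \bar R) :
  measurable_fun setT f -> (forall z, (0 <= f z)%E) ->
  (\int[gm]_z f z = \int[gm]_z \int[@g1 R]_p f (upd z j (emb2 p)))%E.
Proof. exact: gam_resample. Qed.

Lemma gweightE v : gweight (embC d v) = wv d v :> R.
Proof.
rewrite /gweight /wv /vnorm2; congr (expR (_ * _)).
rewrite (eq_bigr (fun j : 'I_d => v (2 * j)%N ^+ 2 + v (2 * j).+1 ^+ 2)); last first.
  by move=> j _; rewrite mxE.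
elim: d => [|m ih]; first by rewrite !big_ord0.
by rewrite mulnS add2n !big_ord_recr /= ih addrA.
Qed.

Lemma intCp_gm (f : V -> R) : measurable_fun setT f -> (forall z, 0 <= f z) ->
  intCp (fun z => (f z * gweight z)%:E) = (\int[gm]_z (f z)%:E)%E.
Proof.
move=> mf f0; rewrite /intCp -iint_gam //; last exact/measurable_EFinP.
by congr iint; apply/funext => v; rewrite gweightE mulrC EFinM.
Qed.

Lemma fnorm2_gm (F : V -> C) : mC F -> fnorm2 F = n2 gm F.
Proof. by move=> mF; apply: intCp_gm => [|z]; [exact: mabs2|exact: cabs2_ge0]. Qed.

Lemma intCr_gm (f : V -> R) : gm.-integrable setT (EFin \o f) ->
  intCr (fun z => f z * gweight z) = \int[gm]_z f z.
Proof.
move=> fi; have mf := measurable_int gm fi; move/measurable_EFinP : mf => mf.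
rewrite /intCr.
have e1 : (fun z => (Num.max (f z * gweight z) 0)%:E) =
   (fun z : V => (Num.max (f z) 0 * gweight z)%:E).
  by apply/funext => z; rewrite maxr_pMl ?mul0r // expR_ge0.
have e2 : (fun z => (Num.max (- (f z * gweight z)) 0)%:E) =
   (fun z : V => (Num.max (- f z) 0 * gweight z)%:E).
  by apply/funext => z; rewrite maxr_pMl ?mul0r ?mulNr // expR_ge0.
rewrite e1 e2 !intCp_gm; last 4 first.
- by apply: measurable_maxr => //; exact: measurable_funN.
- by move=> z; rewrite le_max lexx orbT.
- exact: measurable_maxr.
- by move=> z; rewrite le_max lexx orbT.
have -> : \int[gm]_z f z = fine (\int[gm]_z (EFin \o f)^\+ z)%E - fine (\int[gm]_z (EFin \o f)^\- z)%E.
  rewrite /Rintegral -fineB; [congr fine; exact: integralE|exact: integrable_pos_fin_num|].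
  exact: integrable_neg_fin_num.
congr (fine _ - fine _); apply: eq_integral => z _.
- by rewrite funeposE /= EFin_max.
- by rewrite funenegE /= EFin_max EFinN.
Qed.

Lemma finner_gm (F G : V -> C) : sq gm F -> sq gm G -> finner F G = ip gm F G.
Proof.
move=> sF sG; have c := sq_ci sF sG.
have e z : F z * cj (G z) * (gweight z)%:C =
  (Re (F z * cj (G z)) * gweight z) +i* (Im (F z * cj (G z)) * gweight z).
  by apply: Ceq; rewrite ?ReM ?ImM /=; ring.
rewrite /finner /intC.
rewrite (_ : (fun z => Re (F z * _ * _)) = fun z => Re (F z * cj (G z)) * gweight z); last first.
  by apply/funext => z; exact: (congr1 Re (e z)).
rewrite (_ : (fun z => Im (F z * _ * _)) = fun z => Im (F z * cj (G z)) * gweight z); last first.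
  by apply/funext => z; exact: (congr1 Im (e z)).
by rewrite (intCr_gm (ciRe c)) (intCr_gm (ciIm c)).
Qed.
End GaussD.

(** * Holomorphic functions of one variable *)
Section Hol.
Variable R : realType.
Local Notation C := (CC R).
Local Notation Re := (@complex.Re R).
Local Notation Im := (@complex.Im R).
Local Open Scope complex_scope.

(** Differentiability with real tolerances, the form in which Goursat's bisection consumes it;
    [derivable_cdiff] ties it to the notion of the statement. *)
Definition cdiff (f : C -> C) z c := forall e : R, 0 < e -> exists2 r : R, 0 < r &
  forall h : C, cn h < r -> cn (f (z + h) - f z - c * h) <= e * cn h.
Definition hol (f : C -> C) := forall z, exists c, cdiff f z c.
Definition ccont (f : C -> C) := forall z (e : R), 0 < e -> exists2 r : R, 0 < r &
  forall h : C, cn h < r -> cn (f (z + h) - f z) < e.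

Lemma derivable_cdiff (f : C -> C) z : derivable f z 1 <-> exists c, cdiff f z c.
Proof.
split.
- move=> /cvg_ex [l hl]; exists l => e e0.
  have H : forall eps : C, 0 < eps -> \forall t \near 0^', `|l - t^-1 *: (f (t *: 1 + z) - f z)| <= eps.
    by apply/cvgrPdist_le; exact: hl.
  have e0' : (0 : C) < e%:C by rewrite ltcR.
  have := H _ e0'; rewrite /dnbhs /within /= => /nbhs_ballP [r /= r0 hr].
  (* The order on [C] compares only numbers with equal imaginary parts, so a positive radius is a
     positive real. *)
  have [rE rp] : r = (Re r)%:C /\ 0 < Re r.
    by move: r0; rewrite ltcE => /andP [/eqP i0 r0]; split => //; apply: Ceq.
  exists (Re r) => // h hlt.
  have [->|h0] := eqVneq h 0; first by rewrite addr0 subrr mulr0 subrr cn0 mulr0.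
  have /hr /(_ h0) : ball (0 : C) r h.
    by rewrite -ball_normE /ball_ /= sub0r normrN cnE rE ltcR.
  rewrite scaler1 [h + z]addrC cnE lecR => le.
  have -> : f (z + h) - f z - l * h = - h * (l - h^-1 *: (f (z + h) - f z)).
    rewrite -[h^-1 *: _]/(h^-1 * _).
    transitivity ((h * h^-1) * (f (z + h) - f z) - l * h); last by ring.
    by rewrite divff // mul1r.
  by rewrite cnM cnN mulrC ler_wpM2r ?cn_ge0.
- move=> [c cd]; apply/cvg_ex; exists c; apply/cvgrPdist_le => e e0.
  have [eE ep] : e = (Re e)%:C /\ 0 < Re e.
    by move: e0; rewrite ltcE => /andP [/eqP i0 e0]; split => //; apply: Ceq.
  have [r r0 hr] := cd _ ep.
  apply/nbhs_ballP; exists (r%:C) => /=; first by rewrite ltcR.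
  move=> h; rewrite -ball_normE /ball_ /= sub0r normrN cnE ltcR => hlt h0.
  rewrite scaler1 [h + z]addrC cnE eE lecR.
  have -> : c - h^-1 *: (f (z + h) - f z) = - h^-1 * (f (z + h) - f z - c * h).
    rewrite -[h^-1 *: _]/(h^-1 * _) [RHS]mulrBr -[c in LHS]mul1r -(mulVf h0); ring.
  rewrite cnM cnN cnV mulrC ler_pdivrMr ?hr //.
  by rewrite lt_neqAle cn_ge0 andbT eq_sym; apply: contra h0 => /eqP /cn0_eq0 ->.
Qed.

Lemma hol_derivable f : hol f <-> forall z, derivable f z 1.
Proof. by split => h z; apply/derivable_cdiff; exact: h. Qed.

Lemma hol_ccont f : hol f -> ccont f.
Proof.
move=> hf z e e0; have [c cd] := hf z; have [r r0 hr] := cd _ ltr01.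
have c1 : 0 < cn c + 1 by rewrite ltr_wpDl ?cn_ge0.
exists (Num.min r (e / (cn c + 1))) => [|h].
  by rewrite lt_min r0 divr_gt0.
rewrite lt_min => /andP [h1 h2].
rewrite (_ : f (z + h) - f z = f (z + h) - f z - c * h + c * h); last by ring.
apply: (le_lt_trans (cnD _ _)).
apply: (@le_lt_trans _ _ ((cn c + 1) * cn h)).
  by rewrite cnM mulrDl addrC lerD2l hr.
by rewrite mulrC -ltr_pdivlMr.
Qed.

Lemma hol_cst c : hol (fun=> c).
Proof. by apply/hol_derivable => z; exact: derivable_cst. Qed.
Lemma hol_id : hol (fun z => z).
Proof. by apply/hol_derivable => z; exact: derivable_id. Qed.
Lemma holD f g : hol f -> hol g -> hol (fun z => f z + g z).
Proof. by move=> /hol_derivable a /hol_derivable b; apply/hol_derivable => z; exact: derivableD. Qed.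
Lemma holM f g : hol f -> hol g -> hol (fun z => f z * g z).
Proof. by move=> /hol_derivable a /hol_derivable b; apply/hol_derivable => z; exact: derivableM. Qed.
Lemma holX f k : hol f -> hol (fun z => f z ^+ k).
Proof.
move=> hf; elim: k => [|k ih]; first exact: hol_cst.
by under eq_fun do rewrite exprS; exact: holM.
Qed.
Lemma hol_sum (I : Type) (s : seq I) (h : I -> C -> C) :
  (forall i, hol (h i)) -> hol (fun x => \sum_(i <- s) h i x).
Proof.
move=> mh; elim: s => [|i s ih].
  by under eq_fun do rewrite big_nil; exact: hol_cst.
by under eq_fun do rewrite big_cons; exact: holD.
Qed.
Lemma hol_prod (I : Type) (s : seq I) (h : I -> C -> C) :
  (forall i, hol (h i)) -> hol (fun x => \prod_(i <- s) h i x).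
Proof.
move=> mh; elim: s => [|i s ih].
  by under eq_fun do rewrite big_nil; exact: hol_cst.
by under eq_fun do rewrite big_cons; exact: holM.
Qed.
Lemma hol_comp f g : hol f -> hol g -> hol (fun z => f (g z)).
Proof.
move=> /hol_derivable a /hol_derivable b; apply/hol_derivable => z.
apply/derivable1_diffP; apply: differentiable_comp; apply/derivable1_diffP; [exact: b|exact: a].
Qed.

Lemma real_diff (f : R -> R) (x l : R) : is_derive x 1 f l -> forall e : R, 0 < e ->
  exists2 r : R, 0 < r & forall h, `|h| < r -> `|f (x + h) - f x - l * h| <= e * `|h|.
Proof.
move=> [df dl] e e0; move: df; rewrite /derivable => /cvg_ex [l' /= hl].
have l'E : l' = l by rewrite -dl; apply/esym/cvg_lim.
move: hl; rewrite l'E => /cvgrPdist_le /(_ _ e0).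
rewrite /dnbhs /within /= => /nbhs_ballP [r /= r0 hr]; exists r => // h hlt.
have [->|h0] := eqVneq h 0; first by rewrite addr0 subrr mulr0 subrr normr0 mulr0.
have /hr /(_ h0) : ball 0 r h by rewrite -ball_normE /ball_ /= sub0r normrN.
rewrite scaler1 [h + x]addrC => le.
have -> : f (x + h) - f x - l * h = - h * (l - h^-1 *: (f (x + h) - f x)).
  rewrite -[h^-1 *: _]/(h^-1 * _).
  transitivity ((h * h^-1) * (f (x + h) - f x) - l * h); last by ring.
  by rewrite divff // mul1r.
by rewrite normrM normrN mulrC ler_wpM2r.
Qed.

Lemma cexp_cdiff0 : cdiff (@cexp R) 0 1.
Proof.
(* The constant 9 collects the error terms below: 2 and 4 from the two products [P1] and [P2], and 1
   from each of the three first-order remainders. *)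
move=> e e0; have [e' [e'0 e'1 e'8]] : exists e', [/\ 0 < e', e' <= 1 & 9 * e' <= e].
  exists (Num.min 1 (e / 9)); rewrite lt_min ltr01 divr_gt0 // ge_min lexx; split => //.
  by rewrite mulrC -ler_pdivlMr // ge_min lexx orbT.
have d1 : is_derive (0 : R) 1 expR 1 by rewrite -[X in is_derive _ _ _ X]expR0; exact: is_derive_expR.
have d2 : is_derive (0 : R) 1 cos 0.
  by have := @is_derive_cos R 0; rewrite sin0 oppr0.
have d3 : is_derive (0 : R) 1 sin 1.
  by have := @is_derive_sin R 0; rewrite cos0.
have [r1 r10 h1] := real_diff d1 e'0.
have [r2 r20 h2] := real_diff d2 e'0.
have [r3 r30 h3] := real_diff d3 e'0.
exists (Num.min e' (Num.min r1 (Num.min r2 r3))) => [|h].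
  by rewrite !lt_min e'0 r10 r20 r30.
rewrite !lt_min => /and4P [le lr1 lr2 lr3].
have lx := Re_cn h; have ly := Im_cn h.
set x := Re h in lx *; set y := Im h in ly *.
have := h1 x (le_lt_trans lx lr1); rewrite !add0r expR0 mul1r => E1.
have := h2 y (le_lt_trans ly lr2); rewrite !add0r cos0 mul0r subr0 => E2.
have := h3 y (le_lt_trans ly lr3); rewrite !add0r sin0 mul1r subr0 => E3.
rewrite cexp0 [1 * h]mul1r.
set m := cn h in le lx ly *.
have m0 : 0 <= m by exact: cn_ge0.
have {}E1 : `|expR x - 1 - x| <= e' * m by apply: (le_trans E1); rewrite ler_pM2l.
have {}E2 : `|cos y - 1| <= e' * m by apply: (le_trans E2); rewrite ler_pM2l.
have {}E3 : `|sin y - y| <= e' * m by apply: (le_trans E3); rewrite ler_pM2l.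
have em : e' * m <= m by rewrite ler_piMl.
have E4 : `|expR x - 1| <= 2 * m.
  rewrite (_ : expR x - 1 = (expR x - 1 - x) + x); last by ring.
  apply: (le_trans (ler_normD _ _)); lra.
have E5 : `|sin y| <= 2 * m.
  rewrite (_ : sin y = (sin y - y) + y); last by ring.
  apply: (le_trans (ler_normD _ _)); lra.
have mm : m * m <= e' * m by rewrite ler_wpM2r // ltW.
apply: (le_trans (cn_ReIm _)).
have -> : Re (cexp h - 1 - h) = (expR x - 1) * (cos y - 1) + (cos y - 1) + (expR x - 1 - x).
  by rewrite !ReB /cexp /= -/x -/y; ring.
have -> : Im (cexp h - 1 - h) = (expR x - 1) * sin y + (sin y - y).
  by rewrite !ImB /cexp /= -/x -/y; ring.
have mle1 : m * m <= e' * m by [].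
have P1 : `|(expR x - 1) * (cos y - 1)| <= 2 * (e' * m).
  rewrite normrM; apply: (@le_trans _ _ (2 * m * (e' * m))); first by rewrite ler_pM.
  rewrite -mulrA ler_pM2l // ler_piMl ?mulr_ge0 ?(ltW e'0) //.
  by apply: ltW; exact: lt_le_trans le e'1.
have P2 : `|(expR x - 1) * sin y| <= 4 * (e' * m).
  rewrite normrM; apply: (@le_trans _ _ (2 * m * (2 * m))); first by rewrite ler_pM.
  by rewrite (_ : 2 * m * (2 * m) = 4 * (m * m)); [rewrite ler_pM2l|ring].
have T1 := ler_normD ((expR x - 1) * (cos y - 1) + (cos y - 1)) (expR x - 1 - x).
have T2 := ler_normD ((expR x - 1) * (cos y - 1)) (cos y - 1).
have T3 := ler_normD ((expR x - 1) * sin y) (sin y - y).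
have T4 : 9 * (e' * m) <= e * m by rewrite mulrA ler_wpM2r.
have T5 : 0 <= e' * m by rewrite mulr_ge0 // ltW.
lra.
Qed.

Lemma hol_exp : hol (@cexp R).
Proof.
move=> z; exists (cexp z) => e e0.
have ez : 0 < expR (Re z) by exact: expR_gt0.
have [r r0 hr] := cexp_cdiff0 (divr_gt0 e0 ez); exists r => // h /hr.
rewrite add0r cexp0 mul1r cexpD => le.
have -> : cexp z * cexp h - cexp z - cexp z * h = cexp z * (cexp h - 1 - h) by ring.
by rewrite cnM cn_cexp mulrC -ler_pdivlMr // mulrAC.
Qed.

(** Writing a nonzero point as an exponential turns circles around 0 into segments of direction
    [tau], to which Goursat's theorem applies. *)
Lemma cexp_onto (z : C) : z != 0 -> exists w, cexp w = z.
Proof.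
move=> z0; have r0 : 0 < cn z.
  by rewrite lt_neqAle cn_ge0 andbT eq_sym; apply: contra z0 => /eqP /cn0_eq0 ->.
pose x := Re z / cn z; pose y := Im z / cn z.
have xy : x ^+ 2 + y ^+ 2 = 1.
  rewrite /x /y !exprMn -mulrDl -[X in X * _]/(cabs2 z) -cn_sqr -exprMn divff ?expr1n //.
  by rewrite gt_eqF.
have x1 : -1 <= x <= 1.
  rewrite -ler_norml -sqrtr_sqr -[leRHS]sqrtr1 ler_wsqrtr // -xy lerDl sqr_ge0 //.
have [s sE] : exists s : R, (cos s = x) /\ (sin s = y).
  have ca := acosK x1; have sa : sin (acos x) = `|y|.
    by rewrite sin_acos // -sqrtr_sqr; congr Num.sqrt; rewrite -xy; ring.
  have [y0|y0] := leP 0 y; first by exists (acos x); rewrite ca sa ger0_norm.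
  by exists (- acos x); rewrite cosN sinN ca sa ltr0_norm // opprK.
exists ((ln (cn z)) +i* s); rewrite /cexp /= lnK ?posrE // sE.1 sE.2 /x /y.
by apply: Ceq; rewrite /= mulrC divfK // gt_eqF.
Qed.
End Hol.

(** * The uniform measure on the unit interval and averages of continuous functions *)

Section Unif.
Variable R : realType.
Local Notation C := (CC R).
Local Notation Re := (@complex.Re R).
Local Notation Im := (@complex.Im R).
Local Notation leb := (@lebesgue_measure R).
Local Open Scope complex_scope.

Definition ind01 (x : R) : R := (0 <= x < 1)%R%:R.
Lemma mind01 : measurable_fun setT ind01.
Proof.
have -> : ind01 = \1_(`[0, 1[%classic : set R).
  by apply/funext => x; rewrite indicE /ind01 mem_setE in_itv.
exact: measurable_indic.
Qed.
Lemma ind01_ge0 x : 0 <= ind01 x. Proof. exact: ler0n. Qed.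

Lemma U_sig : {U : probability (measurableTypeR R) R |
  forall f : R -> \bar R, measurable_fun setT f -> (forall x, (0 <= f x)%E) ->
  (\int[U]_x f x = \int[leb]_x (f x * (ind01 x)%:E))%E}.
Proof.
exists [the probability _ _ of uniform_prob (@ltr01 R)] => f mf f0.
rewrite integral_uniform // subr0 invr1 mul1e -integral_itv_bndo_bndc; last exact: measurable_funTS.
rewrite integral_mkcond; apply: eq_integral => x _; rewrite patchE /ind01 mem_setE in_itv /=.
by case: ifP => _; rewrite ?mule1 ?mule0.
Qed.
Definition U := sval U_sig.
Lemma int_U (f : R -> \bar R) : measurable_fun setT f -> (forall x, (0 <= f x)%E) ->
  (\int[U]_x f x = \int[leb]_x (f x * (ind01 x)%:E))%E.
Proof. exact: (svalP U_sig). Qed.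

Lemma U_mono (f g : R -> \bar R) : measurable_fun setT f -> measurable_fun setT g ->
  (forall x, (0 <= f x)%E) -> (forall x, (0 <= g x)%E) ->
  (forall x, 0 <= x <= 1 -> (f x <= g x)%E) -> (\int[U]_x f x <= \int[U]_x g x)%E.
Proof.
move=> mf mg f0 g0 fg; rewrite !int_U //.
have mi : measurable_fun setT (fun x => (ind01 x)%:E) by apply/measurable_EFinP; exact: mind01.
apply: ge0_le_int.
- exact: (emeasurable_funM mf mi).
- exact: (emeasurable_funM mg mi).
- by move=> x; rewrite mule_ge0 // lee_fin ind01_ge0.
- move=> x; rewrite /ind01; case: (boolP (0 <= x < 1)%R) => h /=; last by rewrite !mule0.
  by rewrite !mule1; apply: fg; move: h => /andP [-> /ltW ->].
Qed.

(** Self-similarity of the uniform measure, the source of the additivity of segment integrals under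
    bisection. The half-open convention of [ind01] makes the two halves disjoint. *)
Lemma U_half (f : R -> \bar R) : measurable_fun setT f -> (forall x, (0 <= f x)%E) ->
  (\int[U]_x f x = 2^-1%:E * \int[U]_x f (2^-1 * x)%R + 2^-1%:E * \int[U]_x f (2^-1 * x + 2^-1)%R)%E.
Proof.
move=> mf f0.
have h0 : 0 < 2^-1 :> R by rewrite invr_gt0.
have mi : measurable_fun setT (fun x => (ind01 x)%:E) by apply/measurable_EFinP; exact: mind01.
have maff (b : R) : measurable_fun setT (fun x : R => f (2^-1 * x + b)%R).
  by apply: (measurableT_comp mf); exact: m_aff.
have mhalf : measurable_fun setT (fun x : R => f (2^-1 * x)%R).
  by have := maff 0; congr (measurable_fun _ _); apply/funext => x; rewrite addr0.
rewrite (int_U mf f0) (int_U mhalf (fun x => f0 _)) (int_U (maff _) (fun x => f0 _)).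
pose i1 (x : R) : R := (0 <= x < 2^-1)%R%:R.
pose i2 (x : R) : R := (2^-1 <= x < 1)%R%:R.
have m1 : measurable_fun setT i1.
  have -> : i1 = \1_(`[0, 2^-1[%classic : set R).
    by apply/funext => x; rewrite indicE /i1 mem_setE in_itv.
  exact: measurable_indic.
have m2 : measurable_fun setT i2.
  have -> : i2 = \1_(`[2^-1, 1[%classic : set R).
    by apply/funext => x; rewrite indicE /i2 mem_setE in_itv.
  exact: measurable_indic.
have mf1 : measurable_fun setT (fun x => f x * (i1 x)%:E)%E.
  by apply: (emeasurable_funM mf); exact/measurable_EFinP.
have mf2 : measurable_fun setT (fun x => f x * (i2 x)%:E)%E.
  by apply: (emeasurable_funM mf); exact/measurable_EFinP.
have p1 x : (0 <= f x * (i1 x)%:E)%E by rewrite mule_ge0 // lee_fin ler0n.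
have p2 x : (0 <= f x * (i2 x)%:E)%E by rewrite mule_ge0 // lee_fin ler0n.
have e1 := leb_aff 0 h0 mf1 p1.
have e2 := leb_aff 2^-1 h0 mf2 p2.
have E1 : (2^-1%:E * \int[leb]_x (f (2^-1 * x)%R * (ind01 x)%:E) = \int[leb]_x (f x * (i1 x)%:E))%E.
  rewrite -e1; congr (_ * _)%E; apply: eq_integral => x _; rewrite addr0.
  congr (_ * (_%:R)%:E)%E; congr nat_of_bool.
  by apply/idP/idP => /andP [a b]; apply/andP; split; lra.
have E2 : (2^-1%:E * \int[leb]_x (f (2^-1 * x + 2^-1)%R * (ind01 x)%:E) = \int[leb]_x (f x * (i2 x)%:E))%E.
  rewrite -e2; congr (_ * _)%E; apply: eq_integral => x _.
  congr (_ * (_%:R)%:E)%E; congr nat_of_bool; congr andb.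
    by rewrite lerDr pmulr_rge0.
  by apply/idP/idP => h; lra.
rewrite E1 E2 -ge0_integralD //; apply: eq_integral => x _.
rewrite /i1 /i2 /ind01 -ge0_muleDr ?lee_fin ?ler0n // -EFinD -natrD; congr (_ * (_%:R)%:E)%E.
have [h|h] := ltP x 2^-1.
  have -> : (x < 1)%R by lra.
  by rewrite andbT addn0.
have -> : (0 <= x)%R by lra.
by rewrite andbF add0n.
Qed.

Definition contC (p : R -> C) := continuous (fun t => Re (p t)) /\ continuous (fun t => Im (p t)).

Lemma contC_mC p : contC p -> mC (T := measurableTypeR R) p.
Proof. by move=> [a b]; split; exact: continuous_measurable_fun. Qed.

Lemma contC_bnd p : contC p -> exists M, forall t, 0 <= t <= 1 -> cn (p t) <= M.
Proof.
move=> [a b].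
have h (q : R -> R) : continuous q -> exists M, forall t, 0 <= t <= 1 -> `|q t| <= M.
  move=> cq; have cq' : {within `[0, 1], continuous (fun t => `|q t|)}.
    apply: continuous_subspaceT => t; apply: continuous_comp; first exact: cq.
    exact: norm_continuous.
  by have [c _ hc] := EVT_max ler01 cq'; exists `|q c| => t t01; apply: hc; rewrite in_itv.
have [M1 h1] := h _ a; have [M2 h2] := h _ b; exists (M1 + M2) => t t01.
by apply: (le_trans (cn_ReIm _)); apply: lerD; [exact: h1|exact: h2].
Qed.

Lemma contC_int_bnd p M : contC p -> (forall t, 0 <= t <= 1 -> cn (p t) <= M) ->
  (\int[U]_t (cn (p t))%:E <= M%:E)%E.
Proof.
move=> cp hM; have M0 : 0 <= M by apply: le_trans (cn_ge0 _) (hM 0 _); rewrite lexx ler01.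
apply: (@le_trans _ _ (\int[U]_t (cst M%:E t))%E); last first.
  by rewrite integral_cst //= probability_setT mule1.
apply: U_mono => //.
- by apply/measurable_EFinP/mcn; exact: contC_mC.
- by move=> x; rewrite lee_fin cn_ge0.
Qed.

Lemma contC_ci p : contC p -> ci U p.
Proof.
move=> cp; split; first exact: contC_mC.
have [M hM] := contC_bnd cp; apply: le_lt_trans (contC_int_bnd cp hM) _; exact: ltry.
Qed.

Lemma cI_U_bnd p M : contC p -> (forall t, 0 <= t <= 1 -> cn (p t) <= M) -> cn (cI U p) <= M.
Proof.
move=> cp hM; rewrite -lee_fin; apply: (le_trans (cn_cI (contC_ci cp))).
exact: contC_int_bnd.
Qed.

Lemma Rintegral_pn d (T : measurableType d) (mu : {measure set T -> \bar R}) (f : T -> R) :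
  mu.-integrable setT (EFin \o f) ->
  [/\ \int[mu]_z f z = fine (\int[mu]_z maxe (f z)%:E 0)%E - fine (\int[mu]_z maxe (- (f z)%:E) 0)%E,
      (\int[mu]_z maxe (f z)%:E 0)%E \is a fin_num &
      (\int[mu]_z maxe (- (f z)%:E) 0)%E \is a fin_num].
Proof.
move=> fi.
have e1 : (\int[mu]_z maxe (f z)%:E 0 = \int[mu]_z (EFin \o f)^\+ z)%E.
  by apply: eq_integral => z _; rewrite funeposE.
have e2 : (\int[mu]_z maxe (- (f z)%:E) 0 = \int[mu]_z (EFin \o f)^\- z)%E.
  by apply: eq_integral => z _; rewrite funenegE.
have f1 := integrable_pos_fin_num measurableT fi.
have f2 := integrable_neg_fin_num measurableT fi.
rewrite e1 e2; split => //.
by rewrite /Rintegral -fineB //; congr fine; exact: integralE.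
Qed.

Lemma cI_half p : contC p ->
  cI U p = 2^-1 * (cI U (fun t => p (2^-1 * t)) + cI U (fun t => p (2^-1 * t + 2^-1))).
Proof.
move=> cp.
have ca (b : R) : contC (fun t => p (2^-1 * t + b)).
  have cc : continuous (fun t : R => 2^-1 * t + b).
    by move=> t; apply: cvgD; [apply: cvgM; [exact: cvg_cst|exact: cvg_id]|exact: cvg_cst].
  case: cp => a e; split => t.
  - exact: (@continuous_comp _ _ _ _ (fun t => Re (p t)) t (cc t) (a _)).
  - exact: (@continuous_comp _ _ _ _ (fun t => Im (p t)) t (cc t) (e _)).
have c0 : contC (fun t => p (2^-1 * t)).
  by have := ca 0; congr contC; apply/funext => t; rewrite addr0.
have key (q : R -> R) : U.-integrable setT (EFin \o q) ->
    U.-integrable setT (EFin \o (fun t => q (2^-1 * t))) ->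
    U.-integrable setT (EFin \o (fun t => q (2^-1 * t + 2^-1))) ->
    \int[U]_t q t = 2^-1 * (\int[U]_t q (2^-1 * t) + \int[U]_t q (2^-1 * t + 2^-1)).
  move=> i0 i1 i2.
  have mq : measurable_fun setT (EFin \o q) by exact: measurable_int i0.
  have h (Q : R -> \bar R) : measurable_fun setT Q -> (forall x, (0 <= Q x)%E) ->
    (\int[U]_t Q (2^-1 * t)%R)%E \is a fin_num -> (\int[U]_t Q (2^-1 * t + 2^-1)%R)%E \is a fin_num ->
    fine (\int[U]_t Q t)%E = 2^-1 * (fine (\int[U]_t Q (2^-1 * t)%R)%E + fine (\int[U]_t Q (2^-1 * t + 2^-1)%R)%E).
    move=> mQ Q0 f1 f2; rewrite U_half // -ge0_muleDr; last 2 first.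
    - exact: integral_ge0.
    - exact: integral_ge0.
    by rewrite fineM; [rewrite fineD|by []|by rewrite fin_numD f1 f2].
  have [E0 _ _] := Rintegral_pn i0; have [E1 a1 b1] := Rintegral_pn i1.
  have [E2 a2 b2] := Rintegral_pn i2.
  have mm1 : measurable_fun setT (fun t => maxe (q t)%:E 0%E).
    by apply: measurable_maxe; [exact: mq|exact: measurable_cst].
  have mm2 : measurable_fun setT (fun t : R => maxe (- (q t)%:E) 0)%E.
    by apply: measurable_maxe; [exact: (measurableT_comp (@oppe_measurable R setT) mq)|exact: measurable_cst].
  have pp1 x : (0 <= maxe (q x)%:E 0)%E by rewrite le_max lexx orbT.
  have pp2 x : (0 <= maxe (- (q x)%:E) 0)%E by rewrite le_max lexx orbT.
  have H1 := h _ mm1 pp1 a1 a2; have H2 := h _ mm2 pp2 b1 b2.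
  have arith (x y z A B D E D' E' : R) : x = A - B -> y = D - E -> z = D' - E' ->
    A = 2^-1 * (D + D') -> B = 2^-1 * (E + E') -> x = 2^-1 * (y + z).
    by move=> -> -> -> -> ->; ring.
  exact: (arith _ _ _ _ _ _ _ _ _ E0 E1 E2 H1 H2).
have e : 2^-1 = (2^-1 : R)%:C :> C by rewrite realCV realCnat.
have I0 := contC_ci cp; have I1 := contC_ci c0; have I2 := contC_ci (ca 2^-1).
apply: Ceq; rewrite e ?ReM ?ImM ?ReD ?ImD ReR ImR mul0r ?subr0 ?addr0.
- by apply: key; exact: ciRe.
- by apply: key; exact: ciIm.
Qed.

Lemma contC_ccont f a h : ccont f -> contC (fun t => f (a + t%:C * h)).
Proof.
move=> cf.
have key (t e : R) : 0 < e -> \forall s \near t, cn (f (a + t%:C * h) - f (a + s%:C * h)) < e.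
  move=> e0; have [r r0 hr] := cf (a + t%:C * h) _ e0.
  have h1 : 0 < cn h + 1 by rewrite ltr_wpDl ?cn_ge0.
  near=> s; rewrite cnB.
  rewrite (_ : a + s%:C * h = a + t%:C * h + (s - t)%:C * h); last by rewrite realCB; ring.
  apply: hr; rewrite cnM cnR.
  apply: (@le_lt_trans _ _ (`|s - t| * (cn h + 1))).
    by rewrite ler_wpM2l // lerDl.
  rewrite -ltr_pdivlMr // distrC; near: s; apply/nbhs_ballP.
  by exists (r / (cn h + 1)) => //=; rewrite divr_gt0.
split => t; apply/cvgrPdist_lt => e e0; apply: filterS (key t e e0) => s.
- by apply: le_lt_trans; rewrite -ReB; exact: Re_cn.
- by apply: le_lt_trans; rewrite -ImB; exact: Im_cn.
Unshelve. all: by end_near.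
Qed.
End Unif.

(** * Goursat's theorem for parallelograms *)

Section Goursat.
Variable R : realType.
Local Notation C := (CC R).
Local Notation U := (@U R).
Local Open Scope complex_scope.

Lemma ccontD f g : @ccont R f -> ccont g -> ccont (fun z => f z + g z).
Proof.
move=> cf cg z e e0; have e2 : 0 < e / 2 by rewrite divr_gt0.
have [r r0 hr] := cf z _ e2; have [s s0 hs] := cg z _ e2.
exists (Num.min r s) => [|h]; first by rewrite lt_min r0.
rewrite lt_min => /andP [h1 h2].
rewrite (_ : _ - _ = (f (z + h) - f z) + (g (z + h) - g z)); last by ring.
apply: (le_lt_trans (cnD _ _)); rewrite [e]splitr ltrD //; [exact: hr|exact: hs].
Qed.

Definition seg (f : C -> C) (a h : C) : C := h * cI U (fun t => f (a + t%:C * h)).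
(** The integral around the parallelogram with corners [a], [a + h], [a + h + k], [a + k]; it may be
    degenerate. *)
Definition par f (a h k : C) : C := seg f a h + seg f (a + h) k - seg f (a + k) h - seg f a k.

Lemma seg_half f (a h : C) : ccont f -> seg f a h = seg f a (h / 2) + seg f (a + h / 2) (h / 2).
Proof.
move=> cf; have H := cI_half (contC_ccont a h cf).
have e2 : (2^-1 : R)%:C = 2^-1 :> C by rewrite realCV realCnat.
have arith (x y z y' z' : C) : x = 2^-1 * (y + z) -> y = y' -> z = z' ->
  h * x = h / 2 * y' + h / 2 * z' by move=> -> -> ->; ring.
apply: (arith _ _ _ _ _ H); apply: eq_cI => t; congr f.
  by rewrite realCM e2; ring.
by rewrite realCD realCM e2; ring.
Qed.

Lemma seg_bnd f (a h : C) M : ccont f -> (forall t, 0 <= t <= 1 -> cn (f (a + t%:C * h)) <= M) ->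
  cn (seg f a h) <= cn h * M.
Proof.
move=> cf hM; rewrite cnM ler_wpM2l ?cn_ge0 //.
by apply: cI_U_bnd => //; exact: contC_ccont.
Qed.

Lemma segD f g (a h : C) : ccont f -> ccont g -> seg (fun z => f z + g z) a h = seg f a h + seg g a h.
Proof.
move=> cf cg; rewrite /seg -mulrDr -cID //; apply: contC_ci; exact: contC_ccont.
Qed.
Lemma parD f g (a h k : C) : ccont f -> ccont g -> par (fun z => f z + g z) a h k = par f a h k + par g a h k.
Proof. by move=> cf cg; rewrite /par !segD //; ring. Qed.

(** The mean [B] of an affine function over a segment changes by [c * b] when the segment is moved
    by [b]. The contributions [c * h * k] of the two pairs of opposite sides cancel. *)
Lemma par_affine (c0 c a h k : C) : par (fun z => c0 + c * z) a h k = 0.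
Proof.
have ca : ccont (fun z => c0 + c * z).
  by apply: hol_ccont; apply: holD; [exact: hol_cst|apply: holM; [exact: hol_cst|exact: hol_id]].
pose B (a h : C) := cI U (fun t => c0 + c * (a + t%:C * h)).
have sB (a' h' : C) : seg (fun z => c0 + c * z) a' h' = h' * B a' h' by [].
have Bs (a' b h' : C) : B (a' + b) h' = B a' h' + c * b.
  rewrite /B -[c * b](cI_cst U) -cID //.
  - by apply: eq_cI => t; ring.
  - by apply: contC_ci; exact: (contC_ccont _ _ ca).
  - by apply: (@ci_bnd _ _ _ U _ (cn (c * b))); [exact: mC_cst|].
rewrite /par !sB !Bs; move: (B a h) (B a k) => X Y; ring.
Qed.

Opaque seg.
(** Each inner side occurs twice, with opposite orientations. *)
Lemma par_quarter f (a h k : C) : ccont f -> par f a h k =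
  par f a (h / 2) (k / 2) + par f (a + h / 2) (h / 2) (k / 2) +
  par f (a + k / 2) (h / 2) (k / 2) + par f (a + h / 2 + k / 2) (h / 2) (k / 2).
Proof.
move=> cf; rewrite /par (seg_half a h cf) (seg_half (a + h) k cf) (seg_half (a + k) h cf)
  (seg_half a k cf).
have -> : a + h / 2 + k / 2 + h / 2 = a + h + k / 2 by field.
have -> : a + h / 2 + k / 2 + k / 2 = a + k + h / 2 by field.
have -> : a + k / 2 + h / 2 = a + h / 2 + k / 2 by ring.
have -> : a + h / 2 + h / 2 = a + h by field.
have -> : a + k / 2 + k / 2 = a + k by field.
ring.
Qed.

Lemma dyadic_lim (u : nat -> R) : (forall n, u n <= u n.+1 <= u n + 2 ^- n.+1) ->
  exists l, forall n, u n <= l <= u n + 2 ^- n.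
Proof.
move=> hu.
have up n m : u n <= u (n + m)%N.
  elim: m => [|m ih]; first by rewrite addn0.
  by rewrite addnS; apply: (le_trans ih); have /andP [] := hu (n + m)%N.
have dn n m : u (n + m)%N <= u n + 2 ^- n - 2 ^- (n + m).
  elim: m => [|m ih]; first by rewrite addn0 addrK.
  have /andP [_ h] := hu (n + m)%N.
  rewrite addnS; apply: (le_trans h).
  have e : 2 ^- (n + m) = 2 ^- (n + m).+1 + 2 ^- (n + m).+1 :> R.
    by rewrite exprS invfM; field; rewrite expf_neq0.
  rewrite -lerBrDr; apply: (le_trans ih); rewrite e; lra.
have bd n m : u m <= u n + 2 ^- n.
  have p : 0 <= 2 ^- n :> R by rewrite invr_ge0 exprn_ge0.
  have [nm|/ltnW mn] := leqP n m.
    rewrite -(subnKC nm); apply: (le_trans (dn _ _)).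
    by rewrite gerBl invr_ge0 exprn_ge0.
  by rewrite -(subnKC mn) (le_trans (up m (n - m)%N)) // lerDl subnKC.
exists (sup (range u)) => n; apply/andP; split.
  apply: sup_upper_bound; last by exists n.
  split; first by exists (u 0%N); exists 0%N.
  by exists (u 0%N + 2 ^- 0) => _ [m _ <-].
by apply: ge_sup; [exists (u 0%N); exists 0%N|move=> _ [m _ <-]].
Qed.

Lemma four_lt (c x y1 y2 y3 y4 : R) : x <= y1 + y2 + y3 + y4 ->
  y1 < c -> y2 < c -> y3 < c -> y4 < c -> x < c * 4.
Proof. by move=> *; lra. Qed.

Lemma goursat f (a h k : C) : hol f -> par f a h k = 0.
Proof.
move=> hf; have cf := hol_ccont hf.
pose c := cn (par f a h k).
pose hn n : C := h / 2 ^+ n; pose kn n : C := k / 2 ^+ n.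
pose pt (p : R * R) : C := a + p.1%:C * h + p.2%:C * k.
pose v n p := 4 ^+ n * cn (par f (pt p) (hn n) (kn n)).
pose q n (p : R * R) (x y : bool) := (p.1 + x%:R * 2 ^- n.+1, p.2 + y%:R * 2 ^- n.+1).
(* The bisection keeps a quarter whose integral, rescaled by the power of 4, is still at least [c].
   The fourth quarter is the default; [four_lt] shows that all four cannot fail. *)
pose step n p := if c <= v n.+1 (q n p false false) then q n p false false
  else if c <= v n.+1 (q n p true false) then q n p true false
  else if c <= v n.+1 (q n p false true) then q n p false true
  else q n p true true.
pose s := fix s n := if n is m.+1 then step m (s m) else (0, 0) : R * R.
have h2 n : hn n.+1 = hn n / 2 by rewrite /hn exprSr invfM mulrA.
have k2 n : kn n.+1 = kn n / 2 by rewrite /kn exprSr invfM mulrA.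
have ptq n p (x y : bool) : pt (q n p x y) = pt p + x%:R * hn n.+1 + y%:R * kn n.+1.
  rewrite /pt /q /= !realCD !realCM !realCV !realCX !realCnat /hn /kn; ring.
have inv n : c <= v n (s n).
  elim: n => [|n ih].
    by rewrite /v /hn /kn /pt /= !expr0 !divr1 mul1r !mul0r !addr0.
  have -> : s n.+1 = step n (s n) by [].
  move: (s n) ih => p ih; rewrite /step.
  case: (boolP (c <= v n.+1 (q n p false false))) => [h1|]; first exact: h1.
  rewrite -ltNge => n1.
  case: (boolP (c <= v n.+1 (q n p true false))) => [h1|]; first exact: h1.
  rewrite -ltNge => n2.
  case: (boolP (c <= v n.+1 (q n p false true))) => [h1|]; first exact: h1.
  rewrite -ltNge => n3.
  rewrite leNgt; apply/negP => n4.
  move: ih; rewrite leNgt => /negP; apply.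
  have e4 : 4 ^+ n = 4 ^+ n.+1 / 4 :> R by rewrite exprSr mulfK.
  have E (x y : bool) : par f (pt p + x%:R * hn n.+1 + y%:R * kn n.+1) (hn n.+1) (kn n.+1) =
     par f (pt (q n p x y)) (hn n.+1) (kn n.+1) by rewrite ptq.
  have E0 := E false false; have E1 := E true false; have E2 := E false true; have E3 := E true true.
  rewrite /= !mul0r !mul1r !addr0 in E0 E1 E2 E3.
  rewrite {1}/v (par_quarter _ _ _ cf) -h2 -k2 E0 E1 E2 E3.
  rewrite e4 mulrAC ltr_pdivrMr //.
  apply: (@four_lt c _ (v n.+1 (q n p false false)) (v n.+1 (q n p true false))
    (v n.+1 (q n p false true)) (v n.+1 (q n p true true)) _ n1 n2 n3 n4).
  rewrite /v -!mulrDr; apply: ler_wpM2l; first by rewrite exprn_ge0.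
  apply: (le_trans (cnD _ _)); rewrite lerD2r.
  by apply: (le_trans (cnD _ _)); rewrite lerD2r cnD.
have sb n : ((s n).1 <= (s n.+1).1 <= (s n).1 + 2 ^- n.+1) /\
            ((s n).2 <= (s n.+1).2 <= (s n).2 + 2 ^- n.+1).
  have p : 0 <= 2 ^- n.+1 :> R by rewrite invr_ge0 exprn_ge0.
  by rewrite /= /step; do 3? case: ifP => _; rewrite /q /= ?mul0r ?mul1r ?addr0 !lexx ?lerDl ?p.
have [al hal] := dyadic_lim (fun n => (sb n).1).
have [be hbe] := dyadic_lim (fun n => (sb n).2).
pose z := pt (al, be); have [d cd] := hf z.
pose L := cn h + cn k; have L0 : 0 <= L by rewrite addr_ge0 // cn_ge0.
apply: cn0_eq0; apply/eqP; rewrite eq_le cn_ge0 andbT.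
rewrite -/c; apply/ler_addgt0Pr => e e0; rewrite add0r.
(* The summand 1 keeps the denominator positive when both sides are zero. *)
have L1 : 0 < 2 * L ^+ 2 + 1 by rewrite ltr_wpDl // mulr_ge0 // sqr_ge0.
have [r r0 hr] := cd _ (divr_gt0 e0 L1).
have [n nr] : exists n, 2 ^- n * L < r.
  have : (fun n => geometric L (2^-1 : R) n) @ \oo --> 0.
    by apply: cvg_geometric; rewrite ger0_norm ?invr_ge0 // invf_lt1 // ltr1n.
  move/cvgrPdist_lt => /(_ _ r0) [n _ hn0]; exists n.
  have := hn0 n (leqnn n); rewrite sub0r normrN /geometric /= exprVn => le.
  by rewrite mulrC; apply: le_lt_trans le; exact: ler_norm.
(* [E] is [f] minus its first-order expansion at the limit point [z]; by [par_affine] it has the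
   same integrals around parallelograms. *)
pose E (w : C) := f w + (- (f z - d * z) + - d * w).
have cE : ccont E.
  apply: ccontD => //; apply: hol_ccont; apply: holD; first exact: hol_cst.
  by apply: holM; [exact: hol_cst|exact: hol_id].
have pE (p x y : C) : par f p x y = par E p x y.
  rewrite parD ?par_affine ?addr0 //; apply: hol_ccont; apply: holD; first exact: hol_cst.
  by apply: holM; [exact: hol_cst|exact: hol_id].
pose D := 2 ^- n * L; have D0 : 0 <= D by rewrite mulr_ge0 // invr_ge0 exprn_ge0.
pose e' := e / (2 * L ^+ 2 + 1).
have e'0 : 0 <= e' by rewrite divr_ge0 // ltW.
have Eb (x y : R) : 0 <= x <= 1 -> 0 <= y <= 1 ->
    cn (E (pt (s n) + x%:C * hn n + y%:C * kn n)) <= e' * D.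
  move=> x01 y01; set w := _ + _.
  have wz : w - z = ((s n).1 - al + x * 2 ^- n)%:C * h + ((s n).2 - be + y * 2 ^- n)%:C * k.
    rewrite /w /z /pt /= /hn /kn !realCD !realCN !realCM !realCV !realCX !realCnat; ring.
  have lwz : cn (w - z) <= D.
    have p : 0 <= 2 ^- n :> R by rewrite invr_ge0 exprn_ge0.
    have b1 (u l t : R) : u <= l <= u + 2 ^- n -> 0 <= t <= 1 -> `|u - l + t * 2 ^- n| <= 2 ^- n.
      move=> /andP [u1 u2] /andP [t0 t1].
      have q1 : t * 2 ^- n <= 2 ^- n by rewrite ler_piMl.
      have q2 : 0 <= t * 2 ^- n by rewrite mulr_ge0.
      rewrite ler_norml; apply/andP; split; lra.
    rewrite wz /D mulrDr; apply: (le_trans (cnD _ _)); rewrite !cnM !cnR.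
    by apply: lerD; rewrite ler_wpM2r ?cn_ge0 //; apply: b1.
  have -> : E w = f (z + (w - z)) - f z - d * (w - z).
    by rewrite [z + _]addrC subrK /E; ring.
  apply: (le_trans (hr _ (le_lt_trans lwz nr))).
  by rewrite -/e' ler_wpM2l.
have nh : cn (hn n) = 2 ^- n * cn h.
  by rewrite /hn cnM cnV cnX -realCnat cnR ger0_norm // mulrC.
have nk : cn (kn n) = 2 ^- n * cn k.
  by rewrite /kn cnM cnV cnX -realCnat cnR ger0_norm // mulrC.
(* The perimeter is at most [2 * D] and [E] is at most [e' * D] on it. Since [D = 2 ^- n * L], this
   product is of order [4 ^- n], which the rescaling by [4 ^+ n] exactly offsets. *)
have jb : cn (par f (pt (s n)) (hn n) (kn n)) <= 2 * D * (e' * D).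
  rewrite pE /par.
  have I0 : 0 <= (0 : R) <= 1 by rewrite lexx ler01.
  have I1 : 0 <= (1 : R) <= 1 by rewrite lexx ler01.
  have S1 : cn (seg E (pt (s n)) (hn n)) <= cn (hn n) * (e' * D).
    apply: seg_bnd => // t t01; have := Eb t 0 t01 I0; by rewrite mul0r addr0.
  have S2 : cn (seg E (pt (s n) + hn n) (kn n)) <= cn (kn n) * (e' * D).
    apply: seg_bnd => // t t01; have := Eb 1 t I1 t01; by rewrite mul1r.
  have S3 : cn (seg E (pt (s n) + kn n) (hn n)) <= cn (hn n) * (e' * D).
    apply: seg_bnd => // t t01; have := Eb t 1 t01 I1; by rewrite mul1r addrAC.
  have S4 : cn (seg E (pt (s n)) (kn n)) <= cn (kn n) * (e' * D).
    apply: seg_bnd => // t t01; have := Eb 0 t I0 t01; by rewrite mul0r addr0.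
  have T1 := cnD (seg E (pt (s n)) (hn n)) (seg E (pt (s n) + hn n) (kn n)).
  have T2 := cnD (seg E (pt (s n)) (hn n) + seg E (pt (s n) + hn n) (kn n)) (- seg E (pt (s n) + kn n) (hn n)).
  have T3 := cnD (seg E (pt (s n)) (hn n) + seg E (pt (s n) + hn n) (kn n) - seg E (pt (s n) + kn n) (hn n)) (- seg E (pt (s n)) (kn n)).
  rewrite !cnN in T2 T3.
  rewrite (_ : 2 * D * (e' * D) = 2 * (cn (hn n) * (e' * D)) + 2 * (cn (kn n) * (e' * D))); last first.
    by rewrite nh nk {1}/D /L; ring.
  lra.
apply: (le_trans (inv n)); rewrite /v.
apply: (@le_trans _ _ (4 ^+ n * (2 * D * (e' * D)))); first by rewrite ler_wpM2l ?exprn_ge0.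
have -> : 4 ^+ n * (2 * D * (e' * D)) = (4 ^+ n * (2 ^- n * 2 ^- n)) * (2 * L ^+ 2 * e').
  by rewrite /D; ring.
have -> : 4 ^+ n * (2 ^- n * 2 ^- n) = 1 :> R.
  by rewrite -invfM -exprMn (_ : 2 * 2 = 4 :> R) ?divff ?expf_neq0 //; ring.
rewrite mul1r /e' mulrA ler_pdivrMr // mulrC ler_wpM2l ?(ltW e0) // lerDl //.
Qed.
End Goursat.

(** * Taylor coefficients as averages over circles *)

Section Coef.
Variable R : realType.
Local Notation C := (CC R).
Local Notation Re := (@complex.Re R).
Local Notation Im := (@complex.Im R).
Local Notation U := (@U R).
Local Open Scope complex_scope.

Definition tau : C := 0 +i* (2 * pi).
Definition ei (t : R) : C := cexp (t%:C * tau).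

Lemma cexp_tau : cexp tau = 1.
Proof.
by apply: Ceq; rewrite /cexp /tau /= expR0 mul1r mulr_natl ?cos2pi ?sin2pi.
Qed.
Lemma tau_neq0 : tau != 0.
Proof.
apply/eqP => /(congr1 Im) /= /eqP; apply/negP.
by rewrite mulf_neq0 // gt_eqF // pi_gt0.
Qed.
Lemma cj_tau : cj tau = - tau.
Proof. by apply: Ceq; rewrite ?ReJ ?ImJ ?ReN ?ImN /tau /= ?oppr0. Qed.
Lemma cabs2_ei t : cabs2 (ei t) = 1.
Proof.
by rewrite cabs2_cexp ReM ReR ImR /tau /= !mulr0 !mul0r subrr mulr0 expR0.
Qed.
Lemma cn_ei t : cn (ei t) = 1.
Proof.
by apply/eqP; rewrite -(@eqrXn2 _ 2) ?cn_ge0 // cn_sqr cabs2_ei expr1n.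
Qed.
Lemma eiJ t : ei t * cj (ei t) = 1. Proof. by rewrite mulJ cabs2_ei. Qed.
Lemma cj_ei t : cj (ei t) = cexp (- (t%:C * tau)).
Proof.
have := cexpN (t%:C * tau); rewrite -/(ei t) => h.
by rewrite -[LHS]mul1r -h -mulrA eiJ mulr1.
Qed.

Lemma contC_hol_exp (f : C -> C) c z : hol f ->
  contC (fun t => f (z * ei t) * cexp (c * (t%:C * tau))).
Proof.
move=> hf; pose g w := f (z * cexp w) * cexp (c * w).
have hg : hol g.
  apply: holM.
    apply: (hol_comp hf); apply: holM; [exact: hol_cst|exact: hol_exp].
  apply: (hol_comp (@hol_exp R)); apply: holM; [exact: hol_cst|exact: hol_id].
have := contC_ccont 0 tau (hol_ccont hg).
by congr contC; apply/funext => t; rewrite add0r.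
Qed.

(** A Fourier coefficient of [f] on the circle through [z] around 0; the frequency [c] is an
    arbitrary complex number so that negative and positive integers are treated alike. *)
Definition Ic (f : C -> C) (c z : C) := cI U (fun t => f (z * ei t) * cexp (c * (t%:C * tau))).

(** The function [g w = f (cexp w) * cexp (c * w)] has period [tau] by the condition on [c]. In
    Goursat's theorem for the parallelogram with sides [w] and [tau] the two sides parallel to [w]
    cancel, so the mean over a period does not depend on its starting point. *)
Lemma Ic_shift f c w : hol f -> cexp (c * tau) = 1 ->
  cexp (c * w) * Ic f c (cexp w) = Ic f c 1.
Proof.
move=> hf c1; pose g w := f (cexp w) * cexp (c * w).
have hg : hol g.
  apply: holM; first exact: (hol_comp hf (@hol_exp R)).
  apply: (hol_comp (@hol_exp R)); apply: holM; [exact: hol_cst|exact: hol_id].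
have per a : g (a + tau) = g a.
  by rewrite /g mulrDr !cexpD cexp_tau c1 !mulr1.
have e1 : seg g (0 + tau) w = seg g 0 w.
  rewrite /seg; congr (_ * _); apply: eq_cI => t; rewrite -(per (0 + _)).
  by congr g; ring.
have := goursat 0 w tau hg; rewrite /par e1 add0r [seg g 0 w + _]addrC addrK => /eqP.
rewrite subr_eq0 => /eqP; rewrite /seg => /(mulfI tau_neq0) h.
rewrite /Ic -cIZ; last by apply: contC_ci; exact: contC_hol_exp.
transitivity (cI U (fun t => g (w + t%:C * tau))).
  by apply: eq_cI => t; rewrite /g /ei mulrDr !cexpD; ring.
rewrite h; apply: eq_cI => t.
by rewrite /g add0r mul1r.
Qed.

Lemma Ic0 f c : Ic f c 0 = f 0 * Ic (fun=> 1) c 1.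
Proof.
rewrite /Ic -cIZ; last exact: contC_ci (@contC_hol_exp (fun=> 1) c 1 (hol_cst 1)).
by apply: eq_cI => t; rewrite mul0r mul1r.
Qed.

Lemma cexp_nat_tau k : cexp (k%:R * tau) = 1.
Proof. by rewrite cexp_nat cexp_tau expr1n. Qed.
Lemma cexp_Nnat_tau k : cexp (- k%:R * tau) = 1.
Proof. by have := cexpN (k%:R * tau); rewrite cexp_nat_tau mulr1 mulNr. Qed.

Lemma Ic_bnd f c z M : hol f -> Re (c * tau) = 0 ->
  (forall w, cn w = cn z -> cn (f w) <= M) -> cn (Ic f c z) <= M.
Proof.
move=> hf rc hM; apply: cI_U_bnd; first exact: contC_hol_exp.
move=> t _; rewrite cnM cn_cexp mulrCA ReM ReR ImR rc !mul0r mulr0 subr0 expR0 mulr1.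
by apply: hM; rewrite cnM cn_ei mulr1.
Qed.

Lemma Re_nat_tau k : Re (k%:R * tau) = 0.
Proof. by rewrite -realCnat ReM ReR ImR /tau /= mulr0 mul0r subrr. Qed.
Lemma Re_Nnat_tau k : Re (- k%:R * tau) = 0.
Proof. by rewrite mulNr ReN Re_nat_tau oppr0. Qed.

(** For the constant function [Ic] does not depend on [z], yet by [Ic_shift] at the point 2 it is
    equal to itself divided by [2 ^+ k.+1]. *)
Lemma Ic_one k : Ic (fun=> 1) (- k.+1%:R) 1 = 0.
Proof.
have n2 : (2 : C) != 0 by rewrite pnatr_eq0.
have [w w2] := cexp_onto n2.
have := Ic_shift w (@hol_cst R 1) (cexp_Nnat_tau k.+1).
have -> : Ic (fun=> 1) (- k.+1%:R) (cexp w) = Ic (fun=> 1) (- k.+1%:R) 1 by [].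
move=> h; have e : cexp (k.+1%:R * w) = 2 ^+ k.+1 by rewrite cexp_nat w2.
have := cexpN (k.+1%:R * w); rewrite -mulNr e => h2.
have : (1 - 2 ^+ k.+1) * Ic (fun=> 1) (- k.+1%:R) 1 = 0.
  by rewrite mulrBl mul1r -{2}h mulrA [_ * cexp _]mulrC h2 mul1r subrr.
move/eqP; rewrite mulf_eq0 => /orP [|/eqP //].
rewrite subr_eq0 => /eqP /(congr1 Re).
have -> : (2 : C) ^+ k.+1 = (2 ^+ k.+1 : R)%:C by rewrite realCX realCnat.
rewrite ReR /= => e2; have : (1 : R) < 2 ^+ k.+1 by rewrite exprn_egt1 // ltr1n.
by rewrite -e2 ltxx.
Qed.

Lemma Ic_one' k : Ic (fun=> 1) (k.+1%:R) 1 = 0.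
Proof.
rewrite -[LHS]JJ -[RHS]J0; congr cj; rewrite -(Ic_one k) /Ic -cIJ.
  by apply: eq_cI => t; rewrite !mul1r cexpJ !JM Jnat JR cj_tau; congr cexp; ring.
exact: contC_ci (@contC_hol_exp (fun=> 1) _ 1 (hol_cst 1)).
Qed.

Lemma ccont_near0 f e : hol f -> 0 < e -> exists2 r : R, 0 < r &
  forall w : C, cn w < r -> cn (f w - f 0) < e.
Proof.
move=> hf e0; have [r r0 hr] := hol_ccont hf 0 e0; exists r => // w /hr.
by rewrite add0r.
Qed.

Lemma cn_real (x : R) : 0 <= x -> cn (x%:C : C) = x.
Proof. by move=> x0; rewrite cnR ger0_norm. Qed.

(** The mean does not depend on the radius, and over a small circle it is close to [f 0] by
    continuity. *)
Lemma Ic_mean f : hol f -> Ic f 0 1 = f 0.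
Proof.
move=> hf; apply/eqP; rewrite -subr_eq0; apply/eqP; apply: cn0_eq0; apply/eqP.
rewrite eq_le cn_ge0 andbT; apply/ler_addgt0Pr => e e0; rewrite add0r.
have [r r0 hr] := ccont_near0 hf e0.
pose x := (r / 2)%:C : C; have r2 : 0 < r / 2 by rewrite divr_gt0.
have x0 : x != 0.
  by apply/eqP => /(congr1 Re) /= /eqP; apply/negP; rewrite gt_eqF.
have [w wx] := cexp_onto x0.
have h0 : cexp (0 * tau) = 1 by rewrite mul0r cexp0.
have := Ic_shift w hf h0; rewrite mul0r cexp0 mul1r => <-.
rewrite wx.
have -> : Ic f 0 x - f 0 = Ic (fun w => f w - f 0) 0 x.
  rewrite /Ic -[X in _ - X](cI_cst U) -cIB.
  - by apply: eq_cI => t; rewrite mul0r cexp0 !mulr1.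
  - by apply: contC_ci; exact: contC_hol_exp.
  - by apply: (@ci_bnd _ _ _ U _ (cn (f 0))); [exact: mC_cst|].
apply: Ic_bnd.
- by apply: holD => //; exact: hol_cst.
- by rewrite mul0r.
- move=> v; rewrite cn_real ?(ltW r2) // => ve; apply: ltW; apply: hr; rewrite ve.
  by rewrite ltr_pdivrMr // ltr_pMr // ltr1n.
Qed.

(* The k-th Taylor coefficient at 0, as an average over the unit circle. *)
Definition coefk f k := Ic f (- k%:R) 1.

Lemma coefk0 f : hol f -> coefk f 0 = f 0.
Proof. by move=> hf; rewrite /coefk oppr0 Ic_mean. Qed.

Lemma Ic_pos f k z : hol f -> Ic f (- k%:R) z = coefk f k * z ^+ k.
Proof.
move=> hf; have [->|z0] := eqVneq z 0.
  rewrite Ic0; case: k => [|k]; last by rewrite Ic_one mulr0 expr0n mulr0.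
  by rewrite expr0 mulr1 (coefk0 hf) oppr0 Ic_mean ?mulr1 //; exact: hol_cst.
have [w wz] := cexp_onto z0.
rewrite /coefk -(Ic_shift w hf (cexp_Nnat_tau k)) wz.
have := cexpN (k%:R * w); rewrite -mulNr cexp_nat wz => h.
by rewrite mulrAC h mul1r.
Qed.

(** The value at radius 1 is [s ^+ k.+1] times the value at radius [s], which stays bounded as [s]
    tends to 0. *)
Lemma Ic_neg f k z : hol f -> Ic f k.+1%:R z = 0.
Proof.
move=> hf.
have I1 : Ic f k.+1%:R 1 = 0.
  apply: cn0_eq0; apply/eqP.
  rewrite eq_le cn_ge0 andbT; apply/ler_addgt0Pr => e e0; rewrite add0r.
  have [r r0 hr] := ccont_near0 hf ltr01.
  pose M := cn (f 0) + 1; have M0 : 0 < M by rewrite ltr_wpDl ?cn_ge0.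
  pose s := Num.min 1 (Num.min (r / 2) (e / M)).
  have s0 : 0 < s by rewrite !lt_min ltr01 !divr_gt0.
  have s1 : s <= 1 by rewrite ge_min lexx.
  have sr : s < r.
    apply: (@le_lt_trans _ _ (r / 2)); first by rewrite !ge_min lexx orbT.
    by rewrite ltr_pdivrMr // ltr_pMr // ltr1n.
  have se : s * M <= e by rewrite -ler_pdivlMr // !ge_min lexx !orbT.
  have x0 : (s%:C : C) != 0.
    by apply/eqP => /(congr1 Re) /= /eqP; apply/negP; rewrite gt_eqF.
  have [w wx] := cexp_onto x0.
  rewrite -(Ic_shift w hf (cexp_nat_tau k.+1)) wx cnM cexp_nat wx cnX cn_real ?(ltW s0) //.
  apply: (le_trans _ se); apply: ler_pM; rewrite ?exprn_ge0 ?cn_ge0 ?(ltW s0) //.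
    by rewrite exprS ler_piMr ?exprn_ile1 // ltW.
  apply: Ic_bnd => //; first exact: Re_nat_tau.
  move=> v; rewrite cn_real ?(ltW s0) // => ve.
  by rewrite (le_trans (cn_dist _ (f 0))) // lerD2l ltW // hr // ve.
have [->|z0] := eqVneq z 0; first by rewrite Ic0 Ic_one' mulr0.
have [w wz] := cexp_onto z0.
have := Ic_shift w hf (cexp_nat_tau k.+1); rewrite I1 wz => /eqP.
by rewrite mulf_eq0 (negbTE (cexp_neq0 _)) /= => /eqP.
Qed.

(** Since [ei t] is unimodular, the trigonometric monomial has the single frequency [a - b]: it
    picks a Taylor coefficient if this is at most 0, and meets no term of [f] otherwise. *)
Lemma circ_coef f a b z : hol f ->
  cI U (fun t => f (z * ei t) * (ei t ^+ a * cj (ei t) ^+ b)) =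
  if (a <= b)%N then coefk f (b - a) * z ^+ (b - a) else 0.
Proof.
move=> hf; case: leqP => [ab|ba].
  rewrite -Ic_pos //; apply: eq_cI => t; congr (_ * _).
  rewrite -{1}(subnK ab) exprD mulrCA -exprMn eiJ expr1n mulr1 cj_ei -cexp_nat.
  by congr cexp; ring.
have h : (a - b = (a - b.+1).+1)%N by rewrite subnSK.
rewrite -(Ic_neg (a - b.+1) z hf); apply: eq_cI => t; congr (_ * _).
rewrite -{1}(subnK (ltnW ba)) exprD -mulrA -exprMn eiJ expr1n mulr1 -h.
by rewrite /ei -cexp_nat.
Qed.

Lemma circ_ci f a b z : hol f -> ci U (fun t => f (z * ei t) * (ei t ^+ a * cj (ei t) ^+ b)).
Proof.
move=> hf; have := contC_ci (contC_hol_exp (a%:R - b%:R) z hf).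
congr ci; apply/funext => t; congr (_ * _).
rewrite mulrBl cexpD cexp_nat; congr (_ * _).
by rewrite cj_ei -cexp_nat mulrN.
Qed.

Lemma coefk_bnd f k M : hol f -> (forall w, cn w = 1 -> cn (f w) <= M) -> cn (coefk f k) <= M.
Proof.
move=> hf hM; apply: Ic_bnd => //; first exact: Re_Nnat_tau.
by move=> w; rewrite cn1; exact: hM.
Qed.
End Coef.

Lemma binom_prod (K : comNzRingType) N (x y b : K) : (1 + x) ^+ N * (1 + y) ^+ N * b =
  \sum_(p : 'I_N.+1 * 'I_N.+1) ('C(N, p.1)%:R * 'C(N, p.2)%:R * b) * (x ^+ p.1 * y ^+ p.2).
Proof.
rewrite !exprDn big_distrlr /= pair_bigA /= mulr_suml; apply: eq_bigr => p _.
rewrite !expr1n !mul1r -[_ *+ 'C(N, p.1)]mulr_natr -[_ *+ 'C(N, p.2)]mulr_natr.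
by set u := _%:R; set v := _%:R; ring.
Qed.

(** * Fejer-type means *)
Section Fejer.
Variable R : realType.
Local Notation C := (CC R).
Local Notation Re := (@complex.Re R).
Local Notation U := (@U R).
Local Notation ei := (@ei R).
Local Open Scope complex_scope.

(** The central binomial coefficient, written as the sum of squares in which it arises as the mean
    of [cabs2 (1 + ei t) ^+ N]. *)
Definition cbin N : R := \sum_(a < N.+1) 'C(N, a)%:R ^+ 2.
(* A power of [cos^2], normalised to mean 1: a positive trigonometric kernel of degree [N], easier
   to estimate than the classical Fejer kernel. *)
Definition fk N t : R := cabs2 (1 + ei t) ^+ N / cbin N.

(** Cauchy-Schwarz for the [N + 1] binomial coefficients, whose sum is [2 ^+ N], in the form of a
    nonnegative sum of squares. *)
Lemma cbin_ge N : 4 ^+ N / N.+1%:R <= cbin N.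
Proof.
rewrite ler_pdivrMr ?ltr0n //.
have e : (\sum_(a < N.+1) ('C(N, a)%:R : R)) = 2 ^+ N.
  rewrite -natr_sum -natrX; congr _%:R.
  by have := expnDn 1 1 N; rewrite addn1 => ->; apply: eq_bigr => i _; rewrite !exp1n !muln1.
have -> : 4 ^+ N = (2 ^+ N) ^+ 2 :> R by rewrite -exprM mulnC exprM; congr (_ ^+ _); ring.
rewrite -e.
have : 0 <= \sum_(a < N.+1) (N.+1%:R * 'C(N, a)%:R - 2 ^+ N : R) ^+ 2.
  by apply: sumr_ge0 => i _; rewrite sqr_ge0.
have -> : \sum_(a < N.+1) (N.+1%:R * 'C(N, a)%:R - 2 ^+ N : R) ^+ 2 =
  N.+1%:R * (N.+1%:R * cbin N - (2 ^+ N) ^+ 2).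
  transitivity (\sum_(a < N.+1) (N.+1%:R ^+ 2 * ('C(N, a)%:R ^+ 2) +
     ((- 2 * N.+1%:R * 2 ^+ N) * 'C(N, a)%:R + (2 ^+ N) ^+ 2)) : R).
    by apply: eq_bigr => i _; ring.
  transitivity (N.+1%:R ^+ 2 * cbin N + ((- 2 * N.+1%:R * 2 ^+ N) * (2 ^+ N) + N.+1%:R * (2 ^+ N) ^+ 2)); last by ring.
  rewrite big_split big_split /= -!mulr_sumr e -/(cbin N); congr (_ + (_ + _)).
  by rewrite sumr_const card_ord -[_ *+ N.+1]mulr_natl; ring.
by rewrite pmulr_rge0 ?ltr0n // subr_ge0 e mulrC.
Qed.
Lemma cbin_gt0 N : 0 < cbin N.
Proof. by apply: lt_le_trans (cbin_ge N); rewrite divr_gt0 ?exprn_gt0 ?ltr0n. Qed.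

Lemma fkE N t : (fk N t)%:C = \sum_(p : 'I_N.+1 * 'I_N.+1)
  ('C(N, p.1)%:R * 'C(N, p.2)%:R / cbin N)%:C * (ei t ^+ p.1 * cj (ei t) ^+ p.2).
Proof.
rewrite /fk realCM realCX -mulJ JD J1 exprMn binom_prod.
by apply: eq_bigr => p _; rewrite !realCM !realCnat.
Qed.

Lemma fk_ge0 N t : 0 <= fk N t.
Proof. by rewrite divr_ge0 ?exprn_ge0 ?cabs2_ge0 // ltW // cbin_gt0. Qed.

Lemma contC_ei : contC (fun t => ei t).
Proof.
have := contC_hol_exp 0 1 (@hol_id R); congr contC; apply/funext => t.
by rewrite mul0r cexp0 mulr1 mul1r.
Qed.
Lemma mC_ei : mC (T := measurableTypeR R) (fun t => ei t).
Proof. exact: contC_mC contC_ei. Qed.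
Lemma mfk N : measurable_fun setT (fun t : measurableTypeR R => fk N t).
Proof.
apply: measurable_funM => //; apply: measurable_funX; apply: mabs2.
by apply: mCD; [exact: mC_cst|exact: mC_ei].
Qed.

Definition fejer N (f : C -> C) z := cI U (fun t => (fk N t)%:C * f (z * ei t)).
Definition fco N (a b : nat) : R := 'C(N, a)%:R * 'C(N, b)%:R / cbin N.

(** The kernel is a finite sum of trigonometric monomials, each handled by [circ_coef]. The factor
    [cj z ^+ c] only raises the admissible frequencies by [c], so the mean is a polynomial even for
    polyanalytic functions. *)
Lemma fejer_hol N f c z : hol f ->
  cI U (fun t => (fk N t)%:C * (cj (z * ei t) ^+ c * f (z * ei t))) =
  \sum_(p : 'I_N.+1 * 'I_N.+1) (fco N p.1 p.2)%:C *
    (if (p.1 <= p.2 + c)%N then coefk f (p.2 + c - p.1) * (cj z ^+ c * z ^+ (p.2 + c - p.1)) else 0).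
Proof.
move=> hf.
transitivity (cI U (fun t => \sum_(p : 'I_N.+1 * 'I_N.+1) (cj z ^+ c * (fco N p.1 p.2)%:C) *
   (f (z * ei t) * (ei t ^+ p.1 * cj (ei t) ^+ (p.2 + c))))).
  apply: eq_cI => t; rewrite fkE mulr_suml; apply: eq_bigr => p _.
  rewrite /fco JM exprMn exprD; ring.
rewrite cI_sum => [|p]; last by apply: ciZ; exact: circ_ci.
apply: eq_bigr => p _; rewrite cIZ; last exact: circ_ci.
rewrite circ_coef //; case: ifP => _; last by rewrite !mulr0.
ring.
Qed.

Lemma fk_ci N f z : hol f -> ci U (fun t => (fk N t)%:C * f (z * ei t)).
Proof.
move=> hf; have : ci U (fun t => \sum_(p : 'I_N.+1 * 'I_N.+1) ((fco N p.1 p.2)%:C) *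
   (f (z * ei t) * (ei t ^+ p.1 * cj (ei t) ^+ p.2))).
  by apply: ci_sum => p; apply: ciZ; exact: circ_ci.
congr ci; apply/funext => t; rewrite fkE mulr_suml; apply: eq_bigr => p _; rewrite /fco; ring.
Qed.

Lemma coefk_1 k : coefk (fun=> 1 : C) k = (k == 0)%:R.
Proof.
case: k => [|k]; first by rewrite coefk0 //; exact: hol_cst.
by rewrite /coefk Ic_one.
Qed.

Lemma cI_fk N : cI U (fun t => (fk N t)%:C) = 1.
Proof.
  have := fejer_hol N 0 1 (hol_cst 1); rewrite (_ : cI U _ = cI U (fun t => (fk N t)%:C)); last first.
    by apply: eq_cI => t; rewrite expr0 !mulr1.
  move=> ->; rewrite (bigID (fun p : 'I_N.+1 * 'I_N.+1 => p.1 == p.2)) /= [X in _ + X]big1 ?addr0.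
    transitivity (\sum_(p : 'I_N.+1 * 'I_N.+1 | p.1 == p.2) (fco N p.1 p.1)%:C).
      by apply: eq_bigr => p /eqP e; rewrite e addn0 leqnn subnn coefk_1 eqxx !expr0 !mulr1.
    rewrite -(pair_big_dep predT (fun i j : 'I_N.+1 => i == j) (fun i j : 'I_N.+1 => (fco N i i)%:C)) /=.
    transitivity ((\sum_(i < N.+1) fco N i i)%:C).
      by rewrite realC_sum; apply: eq_bigr => i _; rewrite (eq_bigl (pred1 i)) ?big_pred1_eq // => j; rewrite /= eq_sym.
    have -> : \sum_(i < N.+1) fco N i i = cbin N / cbin N.
      by rewrite {1}/cbin mulr_suml; apply: eq_bigr => i _; rewrite /fco expr2.
    by rewrite divff ?realC1 // gt_eqF // cbin_gt0.
  move=> p ne; case: ifP => [le|_]; last by rewrite mulr0.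
  rewrite addn0 in le *; rewrite coefk_1 (_ : (p.2 - p.1 == 0)%N = false) ?mul0r ?mulr0 //.
  apply/eqP => /eqP; rewrite subn_eq0 => le2; case/eqP: ne; apply/val_inj/eqP.
  by rewrite eqn_leq le.
Qed.

Lemma ci_fk N : ci U (fun t => (fk N t)%:C).
Proof. by have := fk_ci N 0 (hol_cst 1); congr ci; apply/funext => t; rewrite mulr1. Qed.

Lemma fk_int N : (\int[U]_t (fk N t)%:E = 1)%E.
Proof.
have := congr1 Re (cI_fk N); rewrite cI_real /= /Rintegral => e1.
have hi := ciRe (ci_fk N); rewrite -[LHS]fineK ?e1 //; exact: integrable_fin_num hi.
Qed.
End Fejer.

(** * Convergence of the Fejer-type means *)

Section FejerConv.
Variable R : realType.
Local Notation C := (CC R).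
Local Notation U := (@U R).
Local Notation ei := (@ei R).
Local Open Scope complex_scope.

Lemma contC_near (p : R -> C) : contC p <->
  forall t (e : R), 0 < e -> \forall s \near t, cn (p t - p s) < e.
Proof.
split=> [[c1 c2] t e e0|key].
  have e2 : 0 < e / 2 by rewrite divr_gt0.
  have /cvgrPdist_lt/(_ _ e2) h1 := c1 t; have /cvgrPdist_lt/(_ _ e2) h2 := c2 t.
  near=> s; apply: (le_lt_trans (cn_ReIm _)); rewrite ReB ImB [e]splitr; apply: ltrD.
    by near: s.
  by near: s.
split => t; apply/cvgrPdist_lt => e e0; apply: filterS (key t e e0) => s.
- by apply: le_lt_trans; rewrite -ReB; exact: Re_cn.
- by apply: le_lt_trans; rewrite -ImB; exact: Im_cn.
Unshelve. all: by end_near.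
Qed.

Lemma contC_comp (f : C -> C) p : ccont f -> contC p -> contC (fun t => f (p t)).
Proof.
move=> cf /contC_near cp; apply/contC_near => t e e0.
have [r r0 hr] := cf (p t) _ e0.
apply: filterS (cp t r r0) => s hs; rewrite cnB.
by rewrite -[p s](subrKC (p t)); apply: hr; rewrite cnB.
Qed.

Lemma contCM (p q : R -> C) : contC p -> contC q -> contC (fun t => p t * q t).
Proof.
move=> [p1 p2] [q1 q2]; split => t.
  under eq_fun do rewrite ReM.
  by apply: cvgB; apply: cvgM; [exact: p1|exact: q1|exact: p2|exact: q2].
under eq_fun do rewrite ImM.
by apply: cvgD; apply: cvgM; [exact: p1|exact: q2|exact: p2|exact: q1].
Qed.
Lemma contCD (p q : R -> C) : contC p -> contC q -> contC (fun t => p t + q t).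
Proof.
move=> [p1 p2] [q1 q2]; split => t.
  by under eq_fun do rewrite ReD; apply: cvgD; [exact: p1|exact: q1].
by under eq_fun do rewrite ImD; apply: cvgD; [exact: p2|exact: q2].
Qed.
Lemma contC_cst (c : C) : contC (fun _ : R => c).
Proof. by split => t; exact: cvg_cst. Qed.
Lemma contCB (p q : R -> C) : contC p -> contC q -> contC (fun t => p t - q t).
Proof.
move=> cp cq; have := contCD cp (contCM (contC_cst (-1)) cq); congr contC.
by apply/funext => t; rewrite mulN1r.
Qed.
Lemma contCJ (p : R -> C) : contC p -> contC (fun t => cj (p t)).
Proof.
move=> [p1 p2]; split => t; first by under eq_fun do rewrite ReJ; exact: p1.
by under eq_fun do rewrite ImJ; apply: cvgN; exact: p2.
Qed.
Lemma contCX (p : R -> C) k : contC p -> contC (fun t => p t ^+ k).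
Proof.
move=> cp; elim: k => [|k IH]; first exact: contC_cst.
by under eq_fun do rewrite exprS; exact: contCM.
Qed.
Lemma contC_fk N : contC (fun t : R => (fk N t)%:C).
Proof.
have c1 : contC (fun t : R => (1 + ei t) * cj (1 + ei t)).
  have h : contC (fun t : R => 1 + ei t) by apply: contCD; [exact: contC_cst|exact: contC_ei].
  exact: (contCM h (contCJ h)).
have := contCM (contCX N c1) (contC_cst ((cbin R N)^-1)%:C); congr contC; apply/funext => t.
by rewrite mulJ -realCX -realCM.
Qed.
Lemma contC_circ (f : C -> C) z : ccont f -> contC (fun t => f (z * ei t)).
Proof.
move=> cf; apply: (contC_comp (p := fun t => z * ei t)) cf _.
by apply: contCM; [exact: contC_cst|exact: contC_ei].
Qed.

(** With [s] the square root of [p >= q], Bernoulli's inequality bounds [N.+1 * x * s ^+ N] by 1,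
    and squaring leaves a factor [1 / N.+1] to spare. The lower bound 1/4 on [p] gives [x <= 1],
    which turns [1 + N * x] into [N.+1 * x]. *)
Lemma geo_small (q : R) (e : R) : 0 <= q < 1 -> 0 < e ->
  exists N0, forall N, (N0 <= N)%N -> N.+1%:R * q ^+ N <= e.
Proof.
move=> /andP[q0 q1] e0.
have [p [p0 p1 qp]] : exists p : R, [/\ 4^-1 <= p, p < 1 & q <= p].
  by exists (Num.max q 4^-1); rewrite !le_max lexx orbT gt_max q1 /= lexx; split => //; lra.
set s := Num.sqrt p.
have pp : 0 < p by lra.
have s0 : 0 < s by rewrite sqrtr_gt0.
have s2 : s ^+ 2 = p by rewrite sqr_sqrtr // ltW.
have s1 : s < 1 by nra.
have sh : 2^-1 <= s by nra.
pose x := s^-1 - 1.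
have x0 : 0 < x by rewrite subr_gt0 invf_gt1.
have x1 : x <= 1 by rewrite lerBlDr -[1 + 1]invrK lef_pV2 ?posrE // ; lra.
have bern (N : nat) : 1 + N%:R * x <= s^-1 ^+ N.
  rewrite (_ : s^-1 = 1 + x); last by rewrite /x; ring.
  elim: N => [|N IH]; first by rewrite mul0r addr0 expr0.
  rewrite exprS; apply: (@le_trans _ _ ((1 + x) * (1 + N%:R * x))).
    rewrite -natr1; have := ler0n R N; nra.
  by rewrite ler_wpM2l //; lra.
exists (Num.truncn (1 / (x ^+ 2 * e))).+1 => N hN.
have hN2 : 1 / (x ^+ 2 * e) <= N%:R.
  apply: (le_trans (ltW (truncnS_gt _))); by rewrite ler_nat.
have hb : N.+1%:R * x <= s^-1 ^+ N.
  by apply: le_trans (bern N); rewrite -natr1; lra.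
have sN0 : 0 < s ^+ N by rewrite exprn_gt0.
have hs : N.+1%:R * x * s ^+ N <= 1.
  by rewrite -ler_pdivlMr // mul1r -exprVn.
have : q ^+ N <= (s ^+ N) ^+ 2 by rewrite -exprM mulnC exprM s2 lerXn2r ?nnegrE // ltW.
move/(ler_wpM2l (ler0n R N.+1)) => h; apply: le_trans h _.
have n1 : 1 <= x ^+ 2 * e * N.+1%:R.
  move: hN2; rewrite ler_pdivrMr ?mulr_gt0 ?exprn_gt0 // => h; apply: le_trans h _.
  by rewrite mulrC ler_wpM2l ?ler_nat // mulr_ge0 ?sqr_ge0 // ltW.
move: hs n1 sN0; move: (s ^+ N) (N.+1%:R) (ltr0Sn R N) => y m m0 h1 h2 y0.
have : (m * x * y) ^+ 2 <= 1 by rewrite expr_le1 // !mulr_ge0 // ltW.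
move=> h3.
have h4 : m * y ^+ 2 * (m * x ^+ 2) <= e * (m * x ^+ 2).
  rewrite (_ : _ * _ = (m * x * y) ^+ 2); last by ring.
  by apply: le_trans h3 _; apply: le_trans h2 _; rewrite le_eqVlt; apply/orP; left; apply/eqP; ring.
by rewrite -(ler_pM2r (_ : 0 < m * x ^+ 2)) // mulr_gt0 ?exprn_gt0.
Qed.

(** By the parallelogram law, being far from 1 makes [cabs2 (1 + ei t)] at most [4 * q]; [cbin_ge]
    loses only the factor [N + 1] against [4 ^+ N]. *)
Lemma fk_far N t (q : R) : 0 <= q -> 4 * (1 - q) <= cabs2 (1 - ei t) -> fk N t <= N.+1%:R * q ^+ N.
Proof.
move=> q0 h.
have e4 : cabs2 (1 + ei t) + cabs2 (1 - ei t) = 4.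
  by rewrite cabs2_para cabs2_ei (cabs2R 1); ring.
have h4 : cabs2 (1 + ei t) <= 4 * q by lra.
rewrite /fk ler_pdivrMr ?cbin_gt0 //.
apply: (@le_trans _ _ ((4 * q) ^+ N)); first by rewrite lerXn2r ?nnegrE ?cabs2_ge0 // mulr_ge0.
rewrite exprMn; have := cbin_ge R N; rewrite ler_pdivrMr ?ltr0n // => /(ler_wpM2r (exprn_ge0 N q0)) h5.
by apply: le_trans h5 _; rewrite le_eqVlt; apply/orP; left; apply/eqP; ring.
Qed.

Lemma fejer_sub N f z : ccont f ->
  fejer N f z - f z = cI U (fun t => (fk N t)%:C * (f (z * ei t) - f z)).
Proof.
move=> cf; rewrite -[X in _ - X]mulr1 -(cI_fk R N) -cIZ ?ci_fk //; last exact: ci_fk.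
rewrite /fejer -cIB; first by apply: eq_cI => t; ring.
  by apply: contC_ci; apply: contCM; [exact: contC_fk|exact: contC_circ].
by apply: ciZ; exact: ci_fk.
Qed.

Lemma fejer_cvg f z (e : R) : ccont f -> 0 < e ->
  exists N0, forall N, (N0 <= N)%N -> cn (fejer N f z - f z) <= e.
Proof.
move=> cf e0.
pose g t := f (z * ei t) - f z.
have cg : contC g by apply: contCB; [exact: contC_circ|exact: contC_cst].
have [M hM] := contC_bnd cg.
have M0 : 0 <= M by apply: le_trans (hM 0 _); rewrite ?cn_ge0 ?lexx ?ler01.
have [|r r0 hr] := cf z (e / 2); first by rewrite divr_gt0.
have z1 : 0 < cn z + 1 by rewrite ltr_wpDl ?cn_ge0.
pose dl := Num.min 1 (r / (cn z + 1)).
have d0 : 0 < dl by rewrite lt_min ltr01 divr_gt0.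
have d1 : dl <= 1 by rewrite ge_min lexx.
have dr : dl * (cn z + 1) <= r by rewrite -ler_pdivlMr // ge_min lexx orbT.
(* The threshold [4 * (1 - q)] is [dl ^+ 2]: beyond chordal distance [dl] from 1 the kernel is small
   by [fk_far], and within it [f] varies by at most [e / 2]. *)
pose q := 1 - dl ^+ 2 / 4.
have q0 : 0 <= q by rewrite /q; nra.
have q1 : q < 1 by rewrite /q; have := exprn_gt0 2 d0; lra.
have M1 : 0 < M + 1 by lra.
have [||N0 hN] := @geo_small q (e / 2 / (M + 1)); first by rewrite q0.
  by rewrite !divr_gt0.
exists N0 => N /hN {}hN; rewrite fejer_sub // -/g.
pose K := N.+1%:R * q ^+ N * M.
have K0 : 0 <= K by rewrite !mulr_ge0 // exprn_ge0.
have Ke : K <= e / 2.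
  apply: (@le_trans _ _ (N.+1%:R * q ^+ N * (M + 1))).
    by rewrite ler_wpM2l ?mulr_ge0 ?exprn_ge0 //; lra.
  by rewrite -ler_pdivlMr.
have cc : contC (fun t => (fk N t)%:C * g t) by apply: contCM cg; exact: contC_fk.
have pt t : 0 <= t <= 1 -> cn ((fk N t)%:C * g t) <= e / 2 * fk N t + K.
  move=> t01; rewrite cnM cnR ger0_norm ?fk_ge0 //.
  have [h|h] := leP (4 * (1 - q)) (cabs2 (1 - ei t)).
    have fl := fk_far N q0 h; have f0 : 0 <= fk N t by exact: fk_ge0.
    apply: (@le_trans _ _ K); last by rewrite lerDr mulr_ge0 // ltW // divr_gt0.
    by apply: ler_pM; rewrite ?cn_ge0 // hM.
  have gl : cn (g t) <= e / 2.
    rewrite /g (_ : z * ei t = z + z * (ei t - 1)); last by ring.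
    apply/ltW/hr; rewrite cnM cnB.
    have : cn (1 - ei t) < dl.
      rewrite -(@ltr_pXn2r _ 2) ?nnegrE ?cn_ge0 ?(ltW d0) // cn_sqr.
      by move: h; rewrite /q; lra.
    move=> h2; apply: (@le_lt_trans _ _ (cn z * dl)); first by rewrite ler_wpM2l ?cn_ge0 // ltW.
    by apply: lt_le_trans dr; rewrite mulrC ltr_pM2l // ltrDl.
  by apply: (@le_trans _ _ (fk N t * (e / 2))); [rewrite ler_wpM2l // fk_ge0|rewrite mulrC lerDl].
have ci1 := contC_ci cc.
rewrite -lee_fin; apply: le_trans (cn_cI ci1) _.
apply: (@le_trans _ _ (\int[U]_t ((e / 2)%:E * (fk N t)%:E + K%:E))%E).
  apply: U_mono.
  - by apply: measurableT_comp => //; apply: mcn; case: ci1.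
  - apply: emeasurable_funD; last exact: measurable_cst.
    by apply: emeasurable_funM; [exact: measurable_cst|apply: measurableT_comp => //; exact: mfk].
  - by move=> x; rewrite lee_fin cn_ge0.
  - by move=> x; rewrite -EFinM -EFinD lee_fin addr_ge0 // mulr_ge0 ?fk_ge0 // ltW // divr_gt0.
  - by move=> t t01; rewrite -EFinM -EFinD lee_fin; exact: pt.
have mf : measurable_fun setT (fun t : measurableTypeR R => (fk N t)%:E).
  by apply: measurableT_comp => //; exact: mfk.
have e20 : (0 <= e / 2)%R by rewrite ltW // divr_gt0.
have -> : (\int[U]_t ((e / 2)%:E * (fk N t)%:E + K%:E) = (e / 2 + K)%:E)%E.
  apply: (etrans (ge0_integralD _ _ _ _ _ _)) => //.
  - by move=> x _; rewrite -EFinM lee_fin mulr_ge0 ?fk_ge0.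
  - by apply: emeasurable_funM; [exact: measurable_cst|exact: mf].
  rewrite EFinD; congr (_ + _)%E.
    apply: (etrans (ge0_integralZl_EFin _ _ _ _ _)) => //.
    - by move=> x _; rewrite lee_fin fk_ge0.
    - by rewrite (fk_int) mule1.
  by rewrite -[RHS]mule1 -(probability_setT U); exact: integral_cst.
by rewrite lee_fin; move: Ke; lra.
Qed.
End FejerConv.

(** * Holomorphy of pointwise limits of locally bounded holomorphic functions *)

Section HolLim.
Variable R : realType.
Local Notation C := (CC R).
Local Notation Re := (@complex.Re R).
Local Notation Im := (@complex.Im R).
Local Notation U := (@U R).
Local Open Scope complex_scope.

Lemma real_cauchy (u : nat -> R) :
  (forall e, 0 < e -> exists N, forall m, (N <= m)%N -> `|u m - u N| <= e) ->
  exists l, forall e, 0 < e -> exists N, forall m, (N <= m)%N -> `|u m - l| <= e.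
Proof.
move=> h; have cu : cvg (u @ \oo).
  apply: cauchy_cvg; apply: cauchy_exP => e e0.
  have [|N hN] := h (e / 2); first by rewrite divr_gt0.
  exists (u N); exists N => // m /= /hN; rewrite /ball /= distrC => le.
  by apply: le_lt_trans le _; rewrite ltr_pdivrMr // ltr_pMr // ltr1n.
exists (lim (u @ \oo)) => e e0; move/cvgrPdist_le: cu => /(_ e e0) [N _ hN].
by exists N => m /hN; rewrite distrC.
Qed.

Lemma C_cauchy (u : nat -> C) :
  (forall e, 0 < e -> exists N, forall m, (N <= m)%N -> cn (u m - u N) <= e) ->
  exists l, forall e, 0 < e -> exists N, forall m, (N <= m)%N -> cn (u m - l) <= e.
Proof.
move=> h.
have [|a ha] := @real_cauchy (fun m => Re (u m)).
  by move=> e /h [N hN]; exists N => m /hN; apply: le_trans; rewrite -ReB; exact: Re_cn.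
have [|b hb] := @real_cauchy (fun m => Im (u m)).
  by move=> e /h [N hN]; exists N => m /hN; apply: le_trans; rewrite -ImB; exact: Im_cn.
exists (a +i* b) => e e0.
have e2 : 0 < e / 2 by rewrite divr_gt0.
have [N1 h1] := ha _ e2; have [N2 h2] := hb _ e2.
exists (maxn N1 N2) => m; rewrite geq_max => /andP[m1 m2].
apply: (le_trans (cn_ReIm _)); rewrite ReB ImB /= [e]splitr.
by apply: lerD; [exact: h1|exact: h2].
Qed.

(** The factor by which [fejer N] damps the Taylor coefficient of degree [k] (see [fejer_kh]); terms
    with [a + k] above [N] vanish with the binomial coefficient. *)
Definition kh N k : R := \sum_(0 <= a < N.+1) fco R N a (a + k).

Lemma sum_shift (K : nmodType) N a (g : nat -> K) : (forall b, (N < b)%N -> g b = 0) ->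
  \sum_(0 <= k < N.+1) g (a + k)%N = \sum_(0 <= b < N.+1 | (a <= b)%N) g b.
Proof.
move=> g0; transitivity (\sum_(a <= b < N.+1 + a) g b).
  have -> : \sum_(a <= b < N.+1 + a) g b = \sum_(0 <= i < N.+1 + a - a) g (i + a)%N.
    exact: (big_addn 0 (N.+1 + a) a xpredT g).
  by rewrite addnK; apply: eq_bigr => i _; rewrite addnC.
have [le|lt] := leqP a N.+1; last first.
  rewrite big_nat big1 => [|i /andP[i1 _]]; last by rewrite g0 //; apply: leq_trans i1; apply: ltnW.
  rewrite big_nat_cond big1 // => i /andP[/andP[_ i1] i2].
  by move: (leq_trans lt (leq_trans i2 (ltnW i1))); rewrite ltnn.
rewrite (@big_cat_nat _ _ _ N.+1) ?leq_addr //= [X in _ + X]big_nat [X in _ + X]big1 ?addr0 => [|i /andP[i1 _]]; last exact: g0.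
rewrite [RHS](@big_cat_nat _ _ _ a) //= [X in _ = X + _]big_nat_cond [X in _ = X + _]big1 ?add0r.
  by rewrite big_nat [RHS]big_nat_cond; apply: eq_bigl => i; case: (a <= i)%N; rewrite //= andbT.
by move=> i /andP[/andP[_ i1] i2]; move: i1; rewrite ltnNge i2.
Qed.

(** The product of two binomial coefficients is at most half the sum of their squares, and shifting
    the index can only lose terms of [cbin]. *)
Lemma kh_le1 N k : kh N k <= 1.
Proof.
have c0 := cbin_gt0 R N.
rewrite /kh /fco -mulr_suml ler_pdivrMr // mul1r.
pose g (b : nat) : R := 'C(N, b)%:R ^+ 2.
have s1 : \sum_(0 <= a < N.+1) g (k + a)%N <= cbin R N.
  rewrite (@sum_shift R N k g) => [|b Nb]; last by rewrite /g bin_small // expr2 mulr0.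
  by rewrite /cbin big_mkord big_mkcond /=; apply: ler_sum => i _; case: ifP; rewrite /g ?sqr_ge0.
have s0 : \sum_(0 <= a < N.+1) g a = cbin R N by rewrite big_mkord.
apply: (@le_trans _ _ (\sum_(0 <= a < N.+1) (2^-1 * g a + 2^-1 * g (k + a)%N))).
  apply: ler_sum => a _; rewrite /g addnC; move: ('C(N, a)%:R) ('C(N, k + a)%:R) => x y.
  by have := sqr_ge0 (x - y : R); rewrite !expr2; lra.
rewrite big_split /= -!mulr_sumr s0.
by rewrite -mulrDr ler_pdivrMl // mulr_natl mulr2n lerD2l.
Qed.

Lemma fco_ge0 N a b : 0 <= fco R N a b.
Proof. by rewrite /fco divr_ge0 ?mulr_ge0 // ltW // cbin_gt0. Qed.
Lemma kh_ge0 N k : 0 <= kh N k.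
Proof. by apply: sumr_ge0 => i _; exact: fco_ge0. Qed.

Lemma kh0 N : kh N 0 = 1.
Proof.
rewrite /kh big_mkord -(divff (lt0r_neq0 (cbin_gt0 R N))) {2}/cbin mulr_suml.
by apply: eq_bigr => i _; rewrite /fco addn0 expr2.
Qed.

Lemma fejer_kh N f z : hol f ->
  fejer N f z = \sum_(k < N.+1) (kh N k)%:C * (coefk f k * z ^+ k).
Proof.
move=> hf; have := fejer_hol N 0 z hf.
rewrite (_ : cI U _ = fejer N f z); last by apply: eq_cI => t; rewrite expr0 mul1r.
move=> ->; rewrite -(pair_bigA _ (fun p1 p2 : 'I_N.+1 => (fco R N p1 p2)%:C *
  (if (p1 <= p2 + 0)%N then coefk f (p2 + 0 - p1) * (cj z ^+ 0 * z ^+ (p2 + 0 - p1)) else 0))) /=.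
transitivity (\sum_(a < N.+1) \sum_(k < N.+1) (fco R N a (a + k))%:C * (coefk f k * z ^+ k)).
  apply: eq_bigr => a _.
  rewrite -(big_mkord predT (fun k => (fco R N a (a + k))%:C * (coefk f k * z ^+ k))).
  pose g b := (fco R N a b)%:C * (coefk f (b - a) * z ^+ (b - a)).
  transitivity (\sum_(0 <= k < N.+1) g (a + k)%N); last first.
    by apply: eq_bigr => k _; rewrite /g addKn.
  rewrite sum_shift => [|b Nb]; last by rewrite /g /fco (bin_small Nb) mulr0 mul0r mul0r.
  rewrite big_mkord [RHS]big_mkcond /=; apply: eq_bigr => b _; rewrite addn0.
  by case: (a <= b)%N; rewrite /g ?mulr0 // expr0 mul1r.
rewrite exchange_big /=; apply: eq_bigr => k _.
by rewrite -mulr_suml /kh big_mkord -realC_sum.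
Qed.

Lemma coefk_id k : coefk (fun z : C => z) k = (k == 1)%:R.
Proof.
case: k => [|k]; first by rewrite coefk0 //; exact: hol_id.
have -> : coefk (fun z : C => z) k.+1 = Ic (fun=> 1) (- k%:R) 1.
  apply: eq_cI => t; rewrite !mul1r -cexpD; congr cexp; rewrite -natr1; ring.
case: k => [|k]; last by rewrite Ic_one.
rewrite /Ic -[RHS](cI_cst U); apply: eq_cI => t; rewrite mul1r oppr0 mul0r cexp0 //.
Qed.

(** The convergence theorem for the means, tested on the identity function at the point 1. *)
Lemma kh1_cvg (e : R) : 0 < e -> exists N0, forall N, (N0 <= N)%N -> `|kh N 1 - 1| <= e.
Proof.
move=> e0; have hi := @hol_id R.
have [N0 h] := @fejer_cvg R (fun z => z) 1 e (hol_ccont hi) e0.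
exists (maxn N0 1) => -[|N]; first by rewrite geq_max andbF.
rewrite geq_max => /andP[/h {}h _]; move: h; rewrite fejer_kh // (bigD1 (inord 1)) //= big1 => [|i ni].
  rewrite addr0 inordK // coefk_id expr1n !mulr1 -[X in _ - X]/(1%:C) -realCB cnR //.
rewrite coefk_id (_ : (_ == _) = false) ?mul0r ?mulr0 //.
by apply: contraNF ni => /eqP i1; apply/eqP/val_inj; rewrite /= inordK.
Qed.

Lemma geo_le (x : R) n : 0 <= x <= 2^-1 -> \sum_(k < n) x ^+ k <= 2.
Proof.
move=> /andP[x0 x1]; suff : (1 - x) * \sum_(k < n) x ^+ k <= 1.
  have : 0 <= \sum_(k < n) x ^+ k by apply: sumr_ge0 => k _; rewrite exprn_ge0.
  by move: (\sum_(k < n) _) => s; nra.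
rewrite -opprB mulNr -subrX1 opprB gerBl exprn_ge0 //.
Qed.

(** In the polynomial [fejer N f h] the damping factors lie between 0 and 1 and the coefficients are
    at most [M], so the terms of degree at least 2 are dominated by a geometric series. Then [N] is
    taken large, where the mean approaches [f h] and [kh N 1] approaches 1. *)
Lemma taylor1 f M (h : C) : hol f -> (forall w, cn w = 1 -> cn (f w) <= M) -> cn h <= 2^-1 ->
  cn (f h - f 0 - coefk f 1 * h) <= 2 * M * cn h ^+ 2.
Proof.
move=> hf hM hh.
have M0 : 0 <= M by apply: le_trans (hM 1 (cn1 R)); exact: cn_ge0.
apply/ler_addgt0Pr => e e0.
have e2 : 0 < e / 2 by rewrite divr_gt0.
have [N1 h1] := @fejer_cvg R f h _ (hol_ccont hf) e2.
have c1 : 0 < cn (coefk f 1 * h) + 1 by rewrite ltr_wpDl ?cn_ge0.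
have [|N2 h2] := @kh1_cvg (e / 2 / (cn (coefk f 1 * h) + 1)); first by rewrite divr_gt0.
pose N := (maxn N1 N2).+1.
have {}h1 : cn (fejer N f h - f h) <= e / 2 by apply: h1; rewrite leqW // leq_maxl.
have {}h2 : `|kh N 1 - 1| <= e / 2 / (cn (coefk f 1 * h) + 1) by apply: h2; rewrite leqW // leq_maxr.
pose S := \sum_(k < (maxn N1 N2)) (kh N k.+2)%:C * (coefk f k.+2 * h ^+ k.+2).
have eF : fejer N f h = f 0 + (kh N 1)%:C * (coefk f 1 * h) + S.
  by rewrite fejer_kh // big_ord_recl big_ord_recl /= kh0 mul1r coefk0 // expr0 mulr1 addrA.
have Sb : cn S <= 2 * M * cn h ^+ 2.
  apply: le_trans (cn_sum _ _) _.
  apply: (@le_trans _ _ (\sum_(k < maxn N1 N2) (M * cn h ^+ 2) * cn h ^+ k)).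
    apply: ler_sum => k _; rewrite cnM cnR [cn (_ * h ^+ _)]cnM cnX ger0_norm ?kh_ge0 //.
    have := coefk_bnd k.+2 hf hM; have := cn_ge0 (coefk f k.+2); have := kh_ge0 N k.+2; have := kh_le1 N k.+2.
    have hk : 0 <= cn h ^+ k.+2 by rewrite exprn_ge0 ?cn_ge0.
    rewrite -mulrA -exprD addSn addSn add0n; move: hk; move: (cn h ^+ _) (kh _ _) (cn (coefk _ _)) => x y z x0 y1 y0 z0 zM.
    apply: (@le_trans _ _ (z * x)); last by rewrite ler_wpM2r.
    by rewrite ler_piMl // mulr_ge0.
  rewrite -mulr_sumr; have := @geo_le (cn h) (maxn N1 N2); rewrite cn_ge0 hh => /(_ isT) g.
  apply: le_trans (ler_wpM2l _ g) _; first by rewrite mulr_ge0 ?exprn_ge0 ?cn_ge0.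
  by rewrite le_eqVlt; apply/orP; left; apply/eqP; ring.
have -> : f h - f 0 - coefk f 1 * h = - (fejer N f h - f h) + S + ((kh N 1)%:C - 1) * (coefk f 1 * h).
  by rewrite eF; ring.
apply: le_trans (cnD _ _) _; apply: le_trans (lerD (cnD _ _) (lexx _)) _.
rewrite cnN -[X in (_ - X) * _]/(1%:C) -realCB [cn (_ * (_ * _))]cnM cnR.
have : `|kh N 1 - 1| * cn (coefk f 1 * h) <= e / 2.
  apply: (@le_trans _ _ (e / 2 / (cn (coefk f 1 * h) + 1) * (cn (coefk f 1 * h) + 1))).
    by apply: ler_pM; rewrite ?cn_ge0 // lerDl.
  by rewrite divfK // gt_eqF.
move: h1 Sb; move: (cn (_ - _)) (cn S) (`|_| * _) => x y z; lra.
Qed.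

Lemma hol_shift f (a : C) : hol f -> hol (fun w => f (a + w)).
Proof. by move=> hf; apply: (hol_comp hf); apply: holD; [exact: hol_cst|exact: hol_id]. Qed.

Lemma lim_arith (M c r e : R) : 0 <= M -> 0 <= c -> c <= r -> r * (2 * (M + 1)) <= e ->
  2 * M * c ^+ 2 <= e * c.
Proof.
move=> M0 c0 cr h; rewrite expr2 mulrA ler_wpM2r //.
have : c * M <= r * M by rewrite ler_wpM2r.
have : 0 <= r by exact: le_trans c0 cr.
lra.
Qed.

(** The local bound makes the quadratic remainder of [taylor1] uniform in [k]. The derivatives [c k]
    then converge, and the remainder estimate passes to the limit. *)
Lemma hol_lim (f_ : nat -> C -> C) f :
  (forall k, hol (f_ k)) ->
  (forall z (e : R), 0 < e -> exists N, forall k, (N <= k)%N -> cn (f_ k z - f z) <= e) ->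
  (forall z, exists M, forall k w, cn w <= 1 -> cn (f_ k (z + w)) <= M) -> hol f.
Proof.
move=> hf fl bd z.
have [M hM] := bd z.
have M0 : 0 <= M by apply: le_trans (hM 0%N 0 _); rewrite ?cn_ge0 ?cn0.
pose c k := coefk (fun w => f_ k (z + w)) 1.
have ty k (h : C) : cn h <= 2^-1 -> cn (f_ k (z + h) - f_ k z - c k * h) <= 2 * M * cn h ^+ 2.
  move=> hh; have := @taylor1 (fun w => f_ k (z + w)) M h (hol_shift z (hf k)); rewrite addr0; apply => //.
  by move=> w w1; apply: hM; rewrite w1.
have [|l hl] := @C_cauchy c.
  move=> e e0.
  (* Difference quotients with a fixed step [t] converge along with the functions. This step makes
     the quadratic remainder at most [t * e / 4], so the derivatives agree up to [e]. *)
  pose t := Num.min 2^-1 (e / (8 * (M + 1))).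
  have M1 : 0 < M + 1 by lra.
  have t0 : 0 < t by rewrite lt_min invr_gt0 ltr0n divr_gt0 // mulr_gt0.
  have t1 : t <= 2^-1 by rewrite ge_min lexx.
  have tM : t * (8 * (M + 1)) <= e by rewrite -ler_pdivlMr ?mulr_gt0 // ge_min lexx orbT.
  have te : 0 < t * e / 8 by rewrite divr_gt0 // mulr_gt0.
  have [N1 h1] := fl (z + t%:C) _ te; have [N2 h2] := fl z _ te.
  have ct : cn (t%:C : C) = t by rewrite cn_real // ltW.
  have key m : (maxn N1 N2 <= m)%N -> cn (c m * t%:C - (f (z + t%:C) - f z)) <= t * e / 2.
    rewrite geq_max => /andP[/h1 k1 /h2 k2].
    have := ty m t%:C; rewrite ct => /(_ t1) k3.
    rewrite (_ : c m * t%:C - _ = - (f_ m (z + t%:C) - f_ m z - c m * t%:C) +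
      (f_ m (z + t%:C) - f (z + t%:C)) - (f_ m z - f z)); last by ring.
    apply: le_trans (cnD _ _) _; apply: le_trans (lerD (cnD _ _) (lexx _)) _; rewrite !cnN.
    have : 2 * M * t ^+ 2 <= t * e / 4 by rewrite expr2; nra.
    by lra.
  exists (maxn N1 N2) => m /key k1; have k2 := key _ (leqnn _).
  rewrite -(ler_pM2r t0) -{1}ct -cnM.
  rewrite (_ : _ * t%:C = (c m * t%:C - (f (z + t%:C) - f z)) - (c (maxn N1 N2) * t%:C - (f (z + t%:C) - f z))); last by ring.
  apply: le_trans (cnD _ _) _; rewrite cnN; lra.
exists l => e e0.
pose r := Num.min 2^-1 (e / (2 * (M + 1))).
have M1 : 0 < M + 1 by lra.
have r0 : 0 < r by rewrite lt_min invr_gt0 ltr0n divr_gt0 // mulr_gt0.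
have r1 : r <= 2^-1 by rewrite ge_min lexx.
have rM : r * (2 * (M + 1)) <= e by rewrite -ler_pdivlMr ?mulr_gt0 // ge_min lexx orbT.
exists r => // h hr.
have hh : cn h <= 2^-1 by apply: le_trans (ltW hr) r1.
have c0 := cn_ge0 h.
apply: (@le_trans _ _ (2 * M * cn h ^+ 2)); last exact: lim_arith M0 c0 (ltW hr) rM.
apply/ler_addgt0Pr => g g0.
have g3 : 0 < g / 3 by rewrite divr_gt0.
have [N1 h1] := fl (z + h) _ g3; have [N2 h2] := fl z _ g3; have [N3 h3] := hl _ g3.
pose m := maxn N1 (maxn N2 N3).
have {}h1 : cn (f_ m (z + h) - f (z + h)) <= g / 3 by apply: h1; rewrite leq_maxl.
have {}h2 : cn (f_ m z - f z) <= g / 3 by apply: h2; rewrite leq_max leq_maxl orbT.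
have {}h3 : cn (c m - l) <= g / 3 by apply: h3; rewrite !leq_max leqnn !orbT.
have k := ty m h hh.
rewrite (_ : f (z + h) - f z - l * h = (f_ m (z + h) - f_ m z - c m * h) -
  (f_ m (z + h) - f (z + h)) + (f_ m z - f z) + (c m - l) * h); last by ring.
apply: le_trans (cnD _ _) _; apply: le_trans (lerD (cnD _ _) (lexx _)) _.
apply: le_trans (lerD (lerD (cnD _ _) (lexx _)) (lexx _)) _; rewrite cnN [cn ((_ - l) * h)]cnM.
have : cn (c m - l) * cn h <= g / 3 by have := cn_ge0 (c m - l); nra.
by lra.
Qed.
End HolLim.

(** * Measurability of functions measurable in one variable and continuous in the other *)

Section Carath.
Variable R : realType.
Local Notation C := (CC R).
Local Notation Re := (@complex.Re R).
Local Notation Im := (@complex.Im R).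
Local Open Scope complex_scope.

(** Cells of side [1 / (M + 1)] starting at [- M]: range and fineness grow together, so every point
    is eventually caught and ever better approximated. *)
Definition grid (M i : nat) : R := i%:R / M.+1%:R - M%:R.
Definition gcell (M i : nat) (x : R) : R := ind01 (M.+1%:R * (x + M%:R) - i%:R).

Lemma gcell_sum M x : `|x| < M%:R -> exists2 i : nat, (i < (M.+1) * M.*2)%N &
  `|grid M i - x| <= M.+1%:R^-1 /\ forall (K : nmodType) (G : nat -> K),
  \sum_(j < M.+1 * M.*2) (G j *+ (gcell M j x == 1)) = G i.
Proof.
move=> xM; pose y := M.+1%:R * (x + M%:R).
have M0 : 0 < M.+1%:R :> R by rewrite ltr0n.
have y0 : 0 <= y by move: xM; rewrite ltr_norml => /andP[]; rewrite /y => h1 h2; rewrite mulr_ge0 //; lra.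
have /andP[t1 t2] := truncn_itv y0; pose i := Num.truncn y.
have yM : y < (M.+1 * M.*2)%:R.
  rewrite natrM ltr_pM2l // -addnn natrD; move: xM; rewrite ltr_norml => /andP[]; lra.
have iM : (i < M.+1 * M.*2)%N by rewrite -(ltr_nat R) (le_lt_trans t1).
exists i => //; split.
  have -> : grid M i - x = (i%:R - y) / M.+1%:R.
    by rewrite /grid /y; field; rewrite gt_eqF.
  rewrite normrM [X in _ * X]gtr0_norm ?invr_gt0 // ler_piMl ?invr_ge0 ?(ltW M0) //.
  move: t1 t2; rewrite -/i -natr1 ler_norml => t1 t2; apply/andP; split; lra.
move=> K G; rewrite (bigD1 (Ordinal iM)) //= big1 ?addr0.
  rewrite /gcell /ind01 -/y subr_ge0 t1 /= ltrBlDr addrC natr1 t2 eqxx //.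
move=> j ji; rewrite /gcell /ind01 -/y subr_ge0 ltrBlDr addrC natr1.
case: andP => [[j1 j2]|_]; last by rewrite eq_sym oner_eq0.
case/eqP: ji; apply/val_inj => /=.
by apply/esym/eqP; rewrite truncn_eq // j1 j2.
Qed.

(* Measurability of a Caratheodory function, by approximating [c] with grid values. *)
Lemma m_carath d (T : measurableType d) (G : T -> C -> C) (c : T -> C) :
  (forall w, mC (fun x => G x w)) -> (forall x, ccont (G x)) -> mC c -> mC (fun x => G x (c x)).
Proof.
move=> mG cG mc.
pose S M x := \sum_(i < M.+1 * M.*2) \sum_(j < M.+1 * M.*2)
  ((gcell M i (Re (c x)))%:C * (gcell M j (Im (c x)))%:C) * G x (grid M i +i* grid M j).
have mcell M i (h : T -> R) : measurable_fun setT h -> measurable_fun setT (fun x => gcell M i (h x)).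
  move=> mh; apply: (measurableT_comp (@mind01 R)).
  by apply: measurable_funB => //; apply: measurable_funM => //; apply: measurable_funD.
apply: (@mC_lim _ _ _ S) => [M|x].
  apply: mC_sum => i; apply: mC_sum => j; apply: mCM; last exact: mG.
  by case: mc => m1 m2; apply: mCM; apply: mC_real; apply: mcell.
apply/cvgrPdist_le => e e0; have [r r0 hr] := cG x (c x) e e0.
have r2 : 0 < r / 2 by rewrite divr_gt0.
near=> M.
have M1 : `|Re (c x)| < M%:R.
  by near: M; exists (Num.truncn `|Re (c x)|).+1 => // m /= h; apply: lt_le_trans (truncnS_gt _) _; rewrite ler_nat.
have M2 : `|Im (c x)| < M%:R.
  by near: M; exists (Num.truncn `|Im (c x)|).+1 => // m /= h; apply: lt_le_trans (truncnS_gt _) _; rewrite ler_nat.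
have M3 : M.+1%:R^-1 < r / 2.
  near: M; exists (Num.truncn (r / 2)^-1).+1 => // m /= h.
  rewrite -[r / 2]invrK ltf_pV2 ?posrE ?ltr0n ?invr_gt0 //.
  by apply: lt_le_trans (truncnS_gt _) _; rewrite ler_nat ltnW.
have [i _ [i1 i2]] := gcell_sum M1; have [j _ [j1 j2]] := gcell_sum M2.
have -> : S M x = G x (grid M i +i* grid M j).
  have gE k (y : R) : (gcell M k y)%:C = ((gcell M k y == 1)%:R : C).
    by rewrite /gcell /ind01; case: (_ <= _ < _); rewrite ?eqxx // eq_sym oner_eq0.
  rewrite -(i2 C (fun i => G x (grid M i +i* grid M j))); apply: eq_bigr => i' _.
  rewrite -(j2 C (fun j => G x (grid M i' +i* grid M j))).
  rewrite -sumrMnl; apply: eq_bigr => j' _; rewrite !gE.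
  by do 2 case: (_ == 1); rewrite ?mul1r ?mul0r ?mulr0n ?mulr1n ?mul0rn.
rewrite sub0r normrN ger0_norm ?cn_ge0 //.
rewrite -[grid M i +i* grid M j](subrKC (c x)); apply/ltW/hr.
apply: le_lt_trans (cn_ReIm _) _; rewrite ReB ImB /= [r]splitr.
by apply: ltrD; [exact: le_lt_trans i1 _|exact: le_lt_trans j1 _].
Unshelve. all: by end_near.
Qed.

Lemma ccont_mC d (T : measurableType d) (f : C -> C) (c : T -> C) : ccont f -> mC c -> mC (fun x => f (c x)).
Proof. by move=> cf mc; apply: (@m_carath _ _ (fun _ => f)) => // w; exact: mC_cst. Qed.
End Carath.

(** * Polyanalytic functions of one variable *)
Section PolyAn.
Variable R : realType.
Local Notation C := (CC R).
Local Notation U := (@U R).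
Local Notation ei := (@ei R).
Local Open Scope complex_scope.

Definition PA n (f : C -> C) := exists phi : nat -> C -> C,
  (forall k, hol (phi k)) /\ forall z, f z = \sum_(k < n) cj z ^+ k * phi k z.

Lemma ccontM (f g : C -> C) : ccont f -> ccont g -> ccont (fun z => f z * g z).
Proof.
move=> cf cg z e e0.
have a0 : 0 < cn (f z) + 1 by rewrite ltr_wpDl ?cn_ge0.
have b0 : 0 < cn (g z) + 1 by rewrite ltr_wpDl ?cn_ge0.
have [|r1 r10 h1] := cf z (Num.min 1 (e / 2 / (cn (g z) + 1))); first by rewrite lt_min ltr01 !divr_gt0.
have [|r2 r20 h2] := cg z (Num.min 1 (e / 2 / (cn (f z) + 1))); first by rewrite lt_min ltr01 !divr_gt0.
exists (Num.min r1 r2) => [|h]; first by rewrite lt_min r10.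
rewrite lt_min => /andP[/h1 k1 /h2 k2].
move: k1 k2; rewrite !lt_min => /andP[p1 p2] /andP[q1 q2].
rewrite (_ : _ - _ = f (z + h) * (g (z + h) - g z) + (f (z + h) - f z) * g z); last by ring.
apply: le_lt_trans (cnD _ _) _; rewrite !cnM [e]splitr; apply: ler_ltD.
  move: q2; rewrite ltr_pdivlMr // => q2; apply: le_trans (ltW q2); rewrite mulrC ler_wpM2l ?cn_ge0 //.
  by apply: le_trans (cn_dist _ (f z)) _; rewrite lerD2l ltW.
move: p2; rewrite ltr_pdivlMr //; apply: le_lt_trans; rewrite ler_wpM2l ?cn_ge0 // lerDl //.
Qed.
Lemma ccont_cst (c : C) : ccont (fun _ : C => c).
Proof. exact/hol_ccont/hol_cst. Qed.
Lemma ccontJ (f : C -> C) : ccont f -> ccont (fun z => cj (f z)).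
Proof. by move=> cf z e /(cf z)[r r0 hr]; exists r => // h /hr; rewrite -JB cnJ. Qed.
Lemma ccontX (f : C -> C) k : ccont f -> ccont (fun z => f z ^+ k).
Proof.
move=> cf; elim: k => [|k IH]; first exact: ccont_cst.
rewrite (_ : (fun z => _) = (fun z => f z * f z ^+ k)); last by apply/funext => z; rewrite exprS.
exact: ccontM.
Qed.
Lemma ccont_sum (I : Type) (s : seq I) (h : I -> C -> C) :
  (forall i, ccont (h i)) -> ccont (fun x => \sum_(i <- s) h i x).
Proof.
move=> ch; elim: s => [|i s IH].
  rewrite (_ : (fun _ => _) = (fun _ : C => 0)); last by apply/funext => x; rewrite big_nil.
  exact: ccont_cst.
rewrite (_ : (fun _ => _) = (fun x => h i x + \sum_(i <- s) h i x)); last by apply/funext => x; rewrite big_cons.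
exact: ccontD.
Qed.

Lemma ccont_id : ccont (fun z : C => z).
Proof. exact/hol_ccont/hol_id. Qed.

Lemma PA_ccont n f : PA n f -> ccont f.
Proof.
move=> [phi [hp fE]]; rewrite (_ : f = fun z => \sum_(k < n) cj z ^+ k * phi k z); last exact/funext.
apply: ccont_sum => k; apply: ccontM; last exact: hol_ccont.
by apply: ccontX; apply: ccontJ; exact: ccont_id.
Qed.

Lemma PA_shift n f a : PA n f -> PA n (fun w => f (a + w)).
Proof.
move=> [phi [hp fE]].
exists (fun i w => \sum_(k < n) ('C(k, i)%:R * cj a ^+ (k - i)) * phi k (a + w)); split.
  by move=> i; apply: hol_sum => k; apply: holM; [exact: hol_cst|exact: hol_shift].
move=> z; rewrite fE.
under [RHS]eq_bigr do rewrite mulr_sumr.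
rewrite exchange_big /=; apply: eq_bigr => k _; rewrite JD exprDn mulr_suml.
pose g (i : nat) : C := cj z ^+ i * ('C(k, i)%:R * cj a ^+ (k - i) * phi k (a + z)).
rewrite -(big_mkord predT g) (@big_cat_nat _ _ _ k.+1) //= [X in _ = _ + X]big_nat [X in _ = _ + X]big1 ?addr0.
  rewrite big_mkord; apply: eq_bigr => i _; rewrite /g -[_ *+ 'C(k, i)]mulr_natr.
  by move: (cj a ^+ _) (cj z ^+ _) (_%:R) (phi _ _) => u v w x; ring.
by move=> i /andP[ki _]; rewrite /g bin_small // !mul0r mulr0.
Qed.

Lemma PA_M n f g : PA n f -> hol g -> PA n (fun w => f w * g w).
Proof.
move=> [phi [hp fE]] hg; exists (fun i w => phi i w * g w); split; first by move=> i; exact: holM.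
by move=> z; rewrite fE mulr_suml; apply: eq_bigr => k _; rewrite mulrA.
Qed.

(** Against the factor [cj (ei t) ^+ k] only the Taylor term of degree [k] has a nonzero mean. *)
Lemma circ_coefJ (phi : C -> C) k w : hol phi ->
  cI U (fun t => cj (w * ei t) ^+ k * phi (w * ei t)) = (cabs2 w ^+ k)%:C * coefk phi k.
Proof.
move=> hp.
transitivity (cI U (fun t => cj w ^+ k * (phi (w * ei t) * (ei t ^+ 0 * cj (ei t) ^+ k)))).
  apply: eq_cI => t; rewrite JM exprMn expr0 mul1r.
  by move: (cj w ^+ _) (cj (ei t) ^+ _) (phi _) => u v x; ring.
rewrite cIZ; last exact: circ_ci.
rewrite circ_coef // leq0n subn0 realCX -mulJ exprMn.
by move: (cj w ^+ _) (w ^+ _) (coefk _ _) => u v x; ring.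
Qed.

(** The circle mean is thus a polynomial in [cabs2 w] of degree less than [n]. Its constant term is
    [f 0], which a radial kernel can isolate by its moments. *)
Lemma PA_mean n f w phi : (forall k, hol (phi k)) -> (forall z, f z = \sum_(k < n) cj z ^+ k * phi k z) ->
  cI U (fun t => f (w * ei t)) = \sum_(k < n) (cabs2 w ^+ k)%:C * coefk (phi k) k.
Proof.
move=> hp fE; transitivity (cI U (fun t => \sum_(k < n) cj (w * ei t) ^+ k * phi k (w * ei t))).
  by apply: eq_cI => t; rewrite fE.
rewrite cI_sum => [|k]; first by apply: eq_bigr => k _; exact: circ_coefJ.
apply: contC_ci; apply: (@contC_circ R (fun z => cj z ^+ k * phi k z)).
apply: ccontM; last exact: hol_ccont.
by apply: ccontX; apply: ccontJ; exact: ccont_id.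
Qed.

(** The bidegree bound depends on [N] and [n] alone, so all these means lie in one
    finite-dimensional space; this is what makes interpolation at finitely many nodes possible
    later. *)
Lemma fejer_PA N n f : PA n f -> exists a : nat -> nat -> C, forall z,
  fejer N f z = \sum_(k < n) \sum_(m < N + n) a k m * (cj z ^+ k * z ^+ m).
Proof.
move=> [phi [hp fE]].
exists (fun k m => \sum_(p : 'I_N.+1 * 'I_N.+1 | (p.1 <= p.2 + k)%N && (p.2 + k - p.1 == m)%N)
  (fco R N p.1 p.2)%:C * coefk (phi k) (p.2 + k - p.1)) => z.
transitivity (cI U (fun t => \sum_(k < n) (fk N t)%:C * (cj (z * ei t) ^+ k * phi k (z * ei t)))).
  by apply: eq_cI => t; rewrite fE mulr_sumr.
rewrite cI_sum => [|k]; last first.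
  apply: contC_ci; apply: contCM; first exact: contC_fk.
  apply: (@contC_circ R (fun z => cj z ^+ k * phi k z)); apply: ccontM; last exact: hol_ccont.
  by apply: ccontX; apply: ccontJ; exact: ccont_id.
apply: eq_bigr => k _; rewrite fejer_hol //.
under [RHS]eq_bigr do rewrite mulr_suml big_mkcond /=.
rewrite exchange_big /=; apply: eq_bigr => p _.
case: leqP => le /=; last by rewrite mulr0 big1.
have lt : (p.2 + k - p.1 < N + n)%N.
  by apply: leq_ltn_trans (leq_subr _ _) _; rewrite -addnS leq_add // -ltnS.
rewrite (bigD1 (Ordinal lt)) //= eqxx big1 ?addr0 ?mulrA // => i ni.
by case: eqP => // e; case/eqP: ni; apply/val_inj.
Qed.
End PolyAn.

(** * From changes of variables for nonnegative functions to complex integrals *)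

Section Transfer.
Variable R : realType.
Local Notation C := (CC R).
Local Notation Re := (@complex.Re R).
Local Notation Im := (@complex.Im R).
Local Open Scope complex_scope.
Context d1 d2 d3 (T : measurableType d1) (X : measurableType d2) (T' : measurableType d3).
Variables (mu : {measure set T -> \bar R}) (nu : {measure set T' -> \bar R}).
Variables (w : T -> R) (phi : T -> X) (psi : T' -> X).
Hypothesis mw : measurable_fun setT w.
Hypothesis w0 : forall x, 0 <= w x.
Hypothesis mphi : measurable_fun setT phi.
Hypothesis mpsi : measurable_fun setT psi.
Hypothesis tr : forall f : X -> \bar R, measurable_fun setT f -> (forall x, (0 <= f x)%E) ->
  (\int[mu]_x (f (phi x) * (w x)%:E) = \int[nu]_y f (psi y))%E.

Let maxM (a b : R) : 0 <= b -> (maxe (b * a)%:E 0 = maxe a%:E 0 * b%:E)%E.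
Proof. by move=> b0; rewrite -!EFin_max -EFinM maxr_pMl // mul0r [a * b]mulrC. Qed.

Let tr_real (h : X -> R) : measurable_fun setT h ->
  mu.-integrable setT (EFin \o (fun x => w x * h (phi x))) ->
  nu.-integrable setT (EFin \o (fun y => h (psi y))) ->
  \int[mu]_x (w x * h (phi x)) = \int[nu]_y h (psi y).
Proof.
move=> mh i1 i2; have [-> _ _] := Rintegral_pn i1; have [-> _ _] := Rintegral_pn i2.
have mp (g : X -> R) : measurable_fun setT g -> measurable_fun setT (fun x => maxe (g x)%:E 0%E).
  by move=> mg; apply: measurable_maxe; [exact/measurable_EFinP|exact: measurable_cst].
congr (fine _ - fine _).
  rewrite -(tr (mp _ mh)); last by move=> x; rewrite le_max lexx orbT.
  by apply: eq_integral => x _; exact: maxM.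
rewrite -(tr (mp _ (measurable_funN mh))); last by move=> x; rewrite le_max lexx orbT.
by apply: eq_integral => x _; rewrite -EFinN -mulrN maxM.
Qed.

Lemma cI_transfer (F : X -> C) : mC F -> ci nu (fun y => F (psi y)) ->
  ci mu (fun x => (w x)%:C * F (phi x)) /\
  cI mu (fun x => (w x)%:C * F (phi x)) = cI nu (fun y => F (psi y)).
Proof.
move=> mF cF.
have c1 : ci mu (fun x => (w x)%:C * F (phi x)).
  split; first by apply: mCM; [exact: mC_real|exact: (mC_comp mF mphi)].
  case: cF => _; rewrite -(tr (f := fun z => (cn (F z))%:E)); last 2 first.
  - by apply/measurable_EFinP; exact: mcn.
  - by move=> x; rewrite lee_fin cn_ge0.
  by congr (_ < _)%E; apply: eq_integral => x _; rewrite cnM cnR ger0_norm // -EFinM mulrC.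
split => //; case: mF => m1 m2; rewrite /cI; congr (_ +i* _).
  have i1 := ciRe c1; have i2 := ciRe cF; rewrite -(tr_real (h := fun z => Re (F z))) //.
    by apply: eq_Rintegral => x _; rewrite ReM ReR ImR mul0r subr0.
  by move: i1; congr (_.-integrable _ _); apply/funext => x /=; rewrite ReM ReR ImR mul0r subr0.
have i1 := ciIm c1; have i2 := ciIm cF; rewrite -(tr_real (h := fun z => Im (F z))) //.
  by apply: eq_Rintegral => x _; rewrite ImM ReR ImR mul0r addr0.
by move: i1; congr (_.-integrable _ _); apply/funext => x /=; rewrite ImM ReR ImR mul0r addr0.
Qed.
End Transfer.

(** * Radial kernels with prescribed moments *)

Section Kernel.
Variable R : realType.
Local Notation C := (CC R).
Local Notation Re := (@complex.Re R).
Local Notation Im := (@complex.Im R).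
Local Notation g1 := (@g1 R).
Local Notation R2 := (measurableTypeR R * measurableTypeR R)%type.
Local Notation emb2 := (@emb2 R).
Local Notation leb := (@lebesgue_measure R).
Local Open Scope complex_scope.

Lemma emb2K (w : C) : emb2 (Re w, Im w) = w. Proof. by rewrite [RHS]CE. Qed.

Lemma cI_g1_rot (u : C) (F : C -> C) : cabs2 u = 1 -> mC (fun p : R2 => F (emb2 p)) ->
  ci g1 (fun p => F (emb2 p)) -> cI g1 (fun p => F (u * emb2 p)) = cI g1 (fun p => F (emb2 p)).
Proof.
move=> u1 mF cF; pose phi (p : R2) : R2 := (Re (u * emb2 p), Im (u * emb2 p)).
have mu : mC (fun p : R2 => u * emb2 p) by apply: mCM; [exact: mC_cst|exact: (@m_emb2 R)].
have := @cI_transfer R _ _ _ R2 R2 R2 g1 g1 (fun=> 1) phi id (measurable_cst _) _ _ _ (fun p => F (emb2 p)) mF cF.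
case.
- by move=> _; exact: ler01.
- by case: mu => a b; exact: m_pair.
- move=> f mf f0; pose f' (w : C) := f (Re w, Im w).
  have fE p : f' (emb2 p) = f p by case: p.
  have mf' : mE f' by apply: (eq_measurable_fun f) => // x _; rewrite fE.
  transitivity (\int[g1]_y f' (emb2 y))%E; last by apply: eq_integral => y _; rewrite fE.
  apply: (etrans _ (g1_rot u1 mf' (fun w => f0 _))).
  by apply: eq_integral => x _; rewrite mule1.
move=> _ <-; apply: eq_cI => p; by rewrite mul1r /phi emb2K.
Qed.

Lemma cI_g1_shift (a : C) (F : C -> C) : mC (fun p : R2 => F (emb2 p)) ->
  ci g1 (fun p => F (emb2 p)) ->
  ci g1 (fun p => (wt1 a (emb2 p))%:C * F (emb2 p - a)) /\
  cI g1 (fun p => (wt1 a (emb2 p))%:C * F (emb2 p - a)) = cI g1 (fun p => F (emb2 p)).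
Proof.
move=> mF cF; pose phi (p : R2) : R2 := (Re (emb2 p - a), Im (emb2 p - a)).
have mu : mC (fun p : R2 => emb2 p - a) by apply: mCB; [exact: (@m_emb2 R)|exact: mC_cst].
have := @cI_transfer R _ _ _ R2 R2 R2 g1 g1 (fun p => wt1 a (emb2 p)) phi id (mwt1 a) _ _ _ (fun p => F (emb2 p)) mF cF.
rewrite (_ : (fun x => (wt1 a (emb2 x))%:C * F (emb2 (phi x))) = (fun p => (wt1 a (emb2 p))%:C * F (emb2 p - a))); last first.
  by apply/funext => p; rewrite /phi emb2K.
apply.
- by move=> p; exact: expR_ge0.
- by case: mu => x y; exact: m_pair.
- move=> f mf f0; pose f' (w : C) := f (Re w, Im w).
  have fE p : f' (emb2 p) = f p by case: p.
  have mf' : mE f' by apply: (eq_measurable_fun f) => // x _; rewrite fE.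
  transitivity (\int[g1]_y f' (emb2 y))%E; last by apply: eq_integral => y _; rewrite fE.
  exact: (g1_shift a mf' (fun w => f0 _)).
Qed.

Lemma ccont_bnd (f : C -> C) r : ccont f -> exists2 M, 0 <= M & forall w, cn w <= r -> cn (f w) <= M.
Proof.
move=> cf; pose g (p : R * R) := cn (f (emb2 p)).
have cg : continuous g.
  move=> p; apply/cvgrPdist_lt => e e0.
  have [s s0 hs] := cf (emb2 p) e e0.
  have s2 : 0 < s / 2 by rewrite divr_gt0.
  have k1 : (fun q : R * R => q.1) @ p --> p.1 by exact: cvg_fst.
  have k2 : (fun q : R * R => q.2) @ p --> p.2 by exact: cvg_snd.
  near=> q; have : cn (f (emb2 q) - f (emb2 p)) < e.
    rewrite -[emb2 q](subrKC (emb2 p)); apply: hs.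
    apply: le_lt_trans (cn_ReIm _) _; rewrite ReB ImB /= [s]splitr.
    by apply: ltrD; rewrite distrC; near: q; [move/cvgrPdist_lt: k1; apply|move/cvgrPdist_lt: k2; apply].
  apply: le_lt_trans; rewrite ler_norml; apply/andP; split.
    by rewrite lerNl opprB lerBlDr addrC cn_dist.
  by rewrite lerBlDr addrC cnB cn_dist.
have ck := compact_setX (@segment_compact R (- r) r) (@segment_compact R (- r) r).
have /compact_bounded := continuous_compact (continuous_subspaceT cg) ck.
case=> M [_ hM]; exists (`|M| + 1) => [|w wr]; first by rewrite addr_ge0.
have h1 : M < `|M| + 1 by apply: le_lt_trans (ler_norm M) _; rewrite ltrDl.
have := hM _ h1 (cn (f w)); rewrite /= ger0_norm ?cn_ge0 // => h2; apply: h2.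
exists (Re w, Im w); last by rewrite /g emb2K.
by split; rewrite /= ?in_itv /= -ler_norml; apply: le_trans wr; [exact: Re_cn|exact: Im_cn].
Unshelve. all: by end_near.
Qed.

(* The radial kernel [kap] is a combination of dilates of the bump [rho], chosen by [lagrange] so that
   its moments of orders 1 to n - 1 vanish: it then reproduces the value at 0 of a polyanalytic function. *)
Definition rho (x : R) : R := Num.max 0 (1 - x).
Lemma rho_ge0 x : 0 <= rho x. Proof. by rewrite /rho le_max lexx. Qed.
Lemma rho_le1 x : 0 <= x -> rho x <= 1. Proof. by move=> x0; rewrite /rho ge_max ler01 /=; lra. Qed.
Lemma rho_out x : 1 <= x -> rho x = 0.
Proof. by move=> x1; rewrite /rho; apply/max_idPl; lra. Qed.
Lemma rho_lip x y : `|rho x - rho y| <= `|x - y|.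
Proof.
rewrite /rho; have [h1|h1] := leP 1 x; have [h2|h2] := leP 1 y.
- by rewrite !max_l ?subrr ?normr0 //; lra.
- rewrite max_l ?max_r; [|lra|lra]; rewrite sub0r normrN !ger0_norm; lra.
- rewrite max_r ?max_l; [|lra|lra]; rewrite subr0 [`|x - y|]distrC !ger0_norm; lra.
- rewrite !max_r; [|lra|lra]; rewrite [X in `|X|](_ : _ = - (x - y)) ?normrN //; lra.
Qed.
Lemma mrho d (T : measurableType d) (f : T -> R) : measurable_fun setT f -> measurable_fun setT (fun x => rho (f x)).
Proof. by move=> mf; apply: measurable_maxr; [exact: measurable_cst|apply: measurable_funB]. Qed.

Definition kap (l : seq (R * nat)) x := \sum_(q <- l) q.1 * (4 ^+ q.2 * rho (4 ^+ q.2 * x)).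
Definition kapB (l : seq (R * nat)) := \sum_(q <- l) `|q.1| * 4 ^+ q.2.
Definition kapL (l : seq (R * nat)) := \sum_(q <- l) `|q.1| * (4 ^+ q.2 * 4 ^+ q.2).
Lemma kapB_ge0 l : 0 <= kapB l. Proof. by apply: sumr_ge0 => i _; rewrite mulr_ge0 ?exprn_ge0. Qed.
Lemma kapL_ge0 l : 0 <= kapL l. Proof. by apply: sumr_ge0 => i _; rewrite !mulr_ge0 ?exprn_ge0. Qed.
Lemma kap_bnd l x : 0 <= x -> `|kap l x| <= kapB l.
Proof.
move=> x0; apply: le_trans (ler_norm_sum _ _ _) _; apply: ler_sum => q _.
rewrite !normrM ler_wpM2l // ger0_norm ?exprn_ge0 // ler_piMr ?exprn_ge0 //.
by rewrite ger0_norm ?rho_ge0 ?rho_le1 // mulr_ge0 ?exprn_ge0.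
Qed.
Lemma pow4_ge1 s : 1 <= 4 ^+ s :> R. Proof. by apply: exprn_ege1; rewrite ler1n. Qed.
Lemma kap_out l x : 1 <= x -> kap l x = 0.
Proof.
move=> x1; rewrite /kap big1 // => q _; rewrite rho_out ?mulr0 //.
by apply: (le_trans x1); rewrite ler_peMl ?pow4_ge1 //; lra.
Qed.
Lemma kap_lip l x y : `|kap l x - kap l y| <= kapL l * `|x - y|.
Proof.
rewrite /kap -sumrB mulr_suml; apply: le_trans (ler_norm_sum _ _ _) _; apply: ler_sum => q _.
rewrite -mulrBr -mulrBr !normrM -!mulrA ler_wpM2l // ger0_norm ?exprn_ge0 // ler_wpM2l ?exprn_ge0 //.
apply: le_trans (rho_lip _ _) _; by rewrite -mulrBr normrM ger0_norm ?exprn_ge0.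
Qed.
Lemma mkap l d (T : measurableType d) (f : T -> R) : measurable_fun setT f -> measurable_fun setT (fun x => kap l (f x)).
Proof.
move=> mf; apply: measurable_sum => q; apply: measurable_funM => //; apply: measurable_funM => //.
by apply: mrho; apply: measurable_funM.
Qed.

(** Induction on the number of moments: a combination is mixed with its dilate by one more factor 4,
    with weights [1 - y] and [y]. Their sum 1 keeps the moment of order 0 and the vanishing ones. *)
Lemma lagrange n : (0 < n)%N -> exists l : seq (R * nat), forall k, (k < n)%N ->
  \sum_(q <- l) q.1 * (4 ^+ q.2) ^- k = (k == 0)%:R.
Proof.
case: n => // n _; elim: n => [|n [l hl]].
  by exists [:: (1, 0%N)] => k; rewrite ltnS leqn0 => /eqP ->; rewrite big_seq1 /= expr0 invr1 mulr1.
have n0 : 1 - 4 ^- n.+1 != 0 :> R.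
  rewrite subr_eq0 eq_sym lt_eqF // invf_lt1 ?exprn_gt0 //; apply: exprn_egt1 => //; rewrite ltr1n //.
(* This [y] solves [1 - y + y * 4 ^- n.+1 = 0], which cancels the next moment. *)
have [y yy] : exists y, y * (1 - 4 ^- n.+1) = 1 :> R by exists (1 - 4 ^- n.+1)^-1; rewrite mulVf.
exists ([seq ((1 - y) * q.1, q.2) | q <- l] ++ [seq (y * q.1, q.2.+1) | q <- l]) => k kn.
rewrite big_cat !big_map /=.
pose S := \sum_(q <- l) q.1 * (4 ^+ q.2) ^- k.
transitivity ((1 - y) * S + y * 4 ^- k * S).
  rewrite /S !mulr_sumr; congr (_ + _); apply: eq_bigr => q _; first by rewrite mulrA.
  by rewrite exprS exprMn invfM; ring.
rewrite -mulrDl; move: kn; rewrite ltnS leq_eqVlt => /orP[/eqP ->|kn].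
    have -> : 1 - y + y * 4 ^- n.+1 = 1 - y * (1 - 4 ^- n.+1) by move: (4 ^- n.+1) => v; ring.
  by rewrite yy subrr mul0r.
rewrite /S hl //; case: (k =P 0%N) => [->|_]; rewrite ?mulr0 //.
by rewrite expr0 invr1 !mulr1 subrK.
Qed.

(** The exponential undoes the Gaussian density, so that integrals of [rk] against [g1] are Lebesgue
    integrals and behave simply under dilations. *)
Definition rk (k : nat) (s : nat) (w : C) : R := 4 ^+ s * rho (4 ^+ s * cabs2 w) * expR (pi * cabs2 w) * cabs2 w ^+ k.
Lemma mrk k s : measurable_fun setT (fun p : R2 => rk k s (emb2 p)).
Proof.
have m2 : measurable_fun setT (fun p : R2 => cabs2 (emb2 p)) by apply: mabs2; exact: (@m_emb2 R).
apply: measurable_funM; last exact: measurable_funX.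
apply: measurable_funM; first by apply: measurable_funM => //; apply: mrho; apply: measurable_funM.
by apply: measurableT_comp => //; apply: measurable_funM.
Qed.
Lemma rk_ge0 k s w : 0 <= rk k s w.
Proof. by rewrite /rk !mulr_ge0 ?exprn_ge0 ?rho_ge0 ?expR_ge0 ?cabs2_ge0. Qed.

Definition mom k := (\int[g1]_p (rk k 0 (emb2 p))%:E)%E.

(** Dilating the plane by [c = 2 ^+ s] multiplies [cabs2] by [4 ^+ s]. The prefactor [4 ^+ s] in
    [rk] is the Jacobian, which leaves only the effect on the power [k]. *)
Lemma mom_scale k s : (\int[g1]_p (rk k s (emb2 p))%:E = ((4 ^+ s) ^- k)%:E * mom k)%E.
Proof.
have m0 s' : measurable_fun setT (fun p : R2 => (rk k s' (emb2 p))%:E) by apply/measurable_EFinP; exact: mrk.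
have g0 s' (p : R2) : (0 <= (rk k s' (emb2 p))%:E)%E by rewrite lee_fin rk_ge0.
pose G (x y : R) : \bar R := (rho (x ^+ 2 + y ^+ 2) * (x ^+ 2 + y ^+ 2) ^+ k)%:E.
have mG : m2f G.
  apply/measurable_EFinP; have ms : measurable_fun setT (fun p : R * R => p.1 ^+ 2 + p.2 ^+ 2).
    by apply: measurable_funD; apply: measurable_funX.
  by apply: measurable_funM; [exact: mrho|exact: measurable_funX].
have G0 x y : (0 <= G x y)%E by rewrite lee_fin mulr_ge0 ?rho_ge0 // exprn_ge0 // addr_ge0 ?sqr_ge0.
have key s' : (\int[g1]_p (rk k s' (emb2 p))%:E = ((4 ^+ s') ^- k)%:E * I2 G)%E.
  apply: (etrans (int_g1 (m0 s') (g0 s'))).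
  pose c : R := 2 ^+ s'.
  have c0 : 0 < c by rewrite exprn_gt0.
  have c4 : 4 ^+ s' = c * c by rewrite -exprMn; congr (_ ^+ _); ring.
  pose q := c * c.
  transitivity (I2 (fun x y : R => (q * q ^- k)%R%:E * G (c * x)%R (c * y)%R)%E).
    apply: eq_integral => x _; apply: eq_integral => y _.
    rewrite /rk /G -!EFinM /cabs2 /= c4; congr EFin; rewrite -/q.
    have -> : (c * x) ^+ 2 + (c * y) ^+ 2 = q * (x ^+ 2 + y ^+ 2) by rewrite /q; ring.
    rewrite [(q * _) ^+ k]exprMn mulNr expRN; move: (x ^+ 2 + y ^+ 2) => u.
    have : expR (pi * u) != 0 :> R by rewrite gt_eqF // expR_gt0.
    have : q ^+ k != 0 by rewrite gt_eqF // exprn_gt0 // mulr_gt0.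
    move: (expR _) (q ^+ k) => e v v0 e0; by field; rewrite v0 e0.
  pose cc : R := (c * c) ^- k.
  have cc0 : 0 <= cc by rewrite invr_ge0 exprn_ge0 // mulr_ge0 // ltW.
  have mGx x : measurable_fun setT (fun y : R => G x y) by exact: m2f_y.
  have step1 (x : R) : (\int[leb]_y ((c * c * cc)%:E * G (c * x)%R (c * y)%R) = (c * cc)%:E * \int[leb]_y G (c * x)%R y)%E.
    have := leb_aff 0 c0 (mGx (c * x)) (G0 (c * x)).
    move=> <-; rewrite muleA -EFinM.
    rewrite (_ : c * cc * c = c * c * cc); last by ring.
    transitivity ((c * c * cc)%:E * \int[leb]_y G (c * x)%R (c * y)%R)%E.
      apply: (ge0_integralZl_EFin _ measurableT) => //.
      - by have := measurableT_comp (mGx (c * x)) (@m_aff R c 0); apply: eq_measurable_fun => y _ /=; rewrite addr0.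
      - by rewrite !mulr_ge0 // ltW.
    by congr (_ * _)%E; apply: eq_integral => y _; rewrite addr0.
  transitivity (\int[leb]_x ((c * cc)%:E * \int[leb]_y G (c * x)%R y))%E.
    by apply: eq_integral => x _; exact: step1.
  have mI : measurable_fun setT (fun x : R => \int[leb]_y G x y)%E.
    by have := @mI2 _ _ _ _ R leb (fun p : R * R => G p.1 p.2) mG (fun p => G0 p.1 p.2).
  have I0 x : (0 <= \int[leb]_y G x y)%E by apply: integral_ge0 => y _; exact: G0.
  rewrite /I2 c4 -/cc -(leb_aff 0 c0 mI I0) muleA -EFinM [cc * c]mulrC.
  transitivity ((c * cc)%:E * \int[leb]_x \int[leb]_y G (c * x)%R y)%E.
    apply: (ge0_integralZl_EFin _ measurableT) => //.
    - by have := measurableT_comp mI (@m_aff R c 0); apply: eq_measurable_fun => x _ /=; rewrite addr0.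
    - by rewrite mulr_ge0 // ltW.
  apply: (congr1 (fun u => (c * cc)%:E * u)%E); apply: eq_integral => x _; by rewrite addr0.
by rewrite /mom !key expr0 expr1n invr1 mul1e.
Qed.
End Kernel.

(** * The reproducing kernel of compact support *)

Section KernelRep.
Variable R : realType.
Local Notation C := (CC R).
Local Notation U := (@U R).
Local Notation ei := (@ei R).
Local Notation g1 := (@g1 R).
Local Notation R2 := (measurableTypeR R * measurableTypeR R)%type.
Local Notation emb2 := (@emb2 R).
Local Notation leb := (@lebesgue_measure R).
Local Open Scope complex_scope.

Definition disc (r : R) (w : C) : R := ind01 (cabs2 w / r).
Lemma disc_ge0 r w : 0 <= disc r w. Proof. exact: ind01_ge0. Qed.
Lemma mdisc r : measurable_fun setT (fun p : R2 => disc r (emb2 p)).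
Proof.
apply: (measurableT_comp (@mind01 R)); apply: measurable_funM => //.
by apply: mabs2; exact: (@m_emb2 R).
Qed.
Lemma discP r w : 0 < r -> disc r w = (cabs2 w < r)%R%:R.
Proof. by move=> r0; rewrite /disc /ind01 divr_ge0 ?cabs2_ge0 ?ltW //= ltr_pdivrMr // mul1r. Qed.

Lemma rk_bnd k (w : C) : rk k 0 w <= expR pi.
Proof.
rewrite /rk expr0 !mul1r.
have [h|h] := leP 1 (cabs2 w); first by rewrite rho_out // !mul0r expR_ge0.
have p1 : expR (pi * cabs2 w) <= expR pi :> R by rewrite ler_expR ler_piMr ?pi_ge0 // ltW.
rewrite -[leRHS]mulr1; apply: ler_pM.
- by rewrite mulr_ge0 ?rho_ge0 ?expR_ge0.
- by rewrite exprn_ge0 ?cabs2_ge0.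
- by rewrite -[leRHS]mul1r; apply: ler_pM; rewrite ?rho_ge0 ?expR_ge0 ?rho_le1 ?cabs2_ge0.
- by rewrite exprn_ile1 ?cabs2_ge0 // ltW.
Qed.

Lemma int_bnd d (T : measurableType d) (P : probability T R) (f : T -> R) B :
  measurable_fun setT f -> (forall x, 0 <= f x <= B) -> (\int[P]_x (f x)%:E <= B%:E)%E.
Proof.
move=> mf fB; have B0 : (0 <= B)%R.
  have [x|e] := pselect (exists x : T, True); first by case: x => x _; have /andP[a b] := fB x; exact: le_trans a b.
  have := @probability_setT _ _ _ P; rewrite (_ : [set: T] = set0) ?measure0.
    by move=> /eqP; rewrite eq_sym onee_eq0.
  by apply/seteqP; split => x // _; apply: e; exists x.
have -> : B%:E = (\int[P]_x B%:E)%E.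
  by rewrite -[LHS]mule1 -(@probability_setT _ _ _ P); apply/esym; exact: integral_cst.
apply: ge0_le_int; [exact/measurable_EFinP|exact: measurable_cst| |] => x; rewrite lee_fin; by have /andP[] := fB x.
Qed.

Lemma mom_fin k : mom R k \is a fin_num.
Proof.
rewrite ge0_fin_numE; last by apply: integral_ge0 => p _; rewrite lee_fin rk_ge0.
apply: le_lt_trans (int_bnd g1 (mrk k 0) _) (ltry (expR pi)) => p.
by rewrite rk_ge0 rk_bnd.
Qed.

Lemma leb_ind01 : (\int[leb]_x (@ind01 R x)%:E = 1)%E.
Proof.
have := @int_U R (fun=> 1%E) (measurable_cst _) (fun _ => lee01).
rewrite (_ : \int[U]_x 1 = 1)%E; last first.
  by rewrite -[RHS]mule1 -(@probability_setT _ _ _ U); exact: integral_cst.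
by move=> ->; apply: eq_integral => x _; rewrite mul1e.
Qed.

Lemma mom0_gt0 : (0 < mom R 0)%E.
Proof.
have mrk0 : measurable_fun setT (fun p : R2 => (rk 0 0 (emb2 p))%:E) by apply/measurable_EFinP; exact: mrk.
have rk0 (p : R2) : (0 <= (rk 0 0 (emb2 p))%:E)%E by rewrite lee_fin rk_ge0.
rewrite /mom (int_g1 mrk0 rk0).
have mi : measurable_fun setT (fun x : R => (ind01 (2 * x + 0))%:E).
  by apply/measurable_EFinP; apply: (measurableT_comp (@mind01 R)); exact: m_aff.
have hI : (\int[leb]_x (ind01 (2 * x + 0))%:E = 2^-1%:E)%E.
  have := @leb_aff R 2 0 (fun x => (ind01 x)%:E) ltac:(done) _ _; rewrite leb_ind01 => h.
  rewrite -[LHS]mul1e (_ : 1%E = (2^-1)%:E * 2%:E)%E; last by rewrite -EFinM mulVf.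
  by rewrite -muleA h ?mule1 //; [apply/measurable_EFinP; exact: mind01|move=> x; rewrite lee_fin ind01_ge0].
(* On the square of side 1/2 one has [x ^+ 2 + y ^+ 2 <= 1/2], hence [rho] is at least 1/2; the area
   1/4 of the square then gives the lower bound 1/8. *)
have low (x y : R) : ((2^-1)%:E * ((ind01 (2 * x + 0))%:E * (ind01 (2 * y + 0))%:E) <=
  (rk 0 0 (emb2 (x, y)))%:E * (expR (- pi * (x ^+ 2 + y ^+ 2)))%:E)%E.
  rewrite -!EFinM lee_fin /rk /cabs2 /= !expr0 !mul1r mulr1 mulNr expRN mulfK ?gt_eqF ?expR_gt0 //.
  rewrite /ind01 !addr0; case: andP => [[x0 x1]|_]; last by rewrite mul0r mulr0 rho_ge0.
  case: andP => [[y0 y1]|_]; last by rewrite !mulr0 rho_ge0.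
  by rewrite /rho le_max; apply/orP; right; rewrite !mulr1 !expr2; nra.
apply: (@lt_le_trans _ _ (8^-1)%:E); first by rewrite lte_fin invr_gt0.
have <- : (I2 (fun x y : R => (2^-1)%:E * ((ind01 (2 * x + 0))%:E * (ind01 (2 * y + 0))%:E)) = (8^-1)%:E)%E.
  transitivity (\int[leb]_x ((4^-1)%:E * (ind01 (2 * x + 0))%:E))%E.
    apply: eq_integral => x _.
    transitivity ((2^-1 * ind01 (2 * x + 0))%:E * \int[leb]_y (ind01 (2 * y + 0))%:E)%E.
      rewrite -(ge0_integralZl_EFin leb measurableT) //.
      - by apply: eq_integral => y _; rewrite EFinM muleA.
      - by move=> y _; rewrite lee_fin ind01_ge0.
      - by rewrite mulr_ge0 ?ind01_ge0.
    by rewrite hI -!EFinM; congr EFin; field.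
  rewrite (ge0_integralZl_EFin leb measurableT) //; last by move=> y _; rewrite lee_fin ind01_ge0.
  by rewrite hI -EFinM; congr EFin; field.
have ml : m2f (fun x y : R => (2^-1)%:E * ((ind01 (2 * x + 0))%:E * (ind01 (2 * y + 0))%:E))%E.
  apply: emeasurable_funM; first exact: measurable_cst.
  by apply: emeasurable_funM; [exact: (measurableT_comp mi measurable_fst)|exact: (measurableT_comp mi measurable_snd)].
have mr : m2f (fun x y : R => (rk 0 0 (emb2 (x, y)))%:E * (expR (- pi * (x ^+ 2 + y ^+ 2)))%:E)%E.
  apply: emeasurable_funM; first by apply: (eq_measurable_fun (fun p : R2 => (rk 0 0 (emb2 p))%:E)) => // -[].
  apply/measurable_EFinP; apply: measurableT_comp => //; apply: measurable_funM => //.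
  by apply: measurable_funD; apply: measurable_funX.
have l0 (x y : R) : (0 <= (2^-1)%:E * ((ind01 (2 * x + 0))%:E * (ind01 (2 * y + 0))%:E))%E.
  by rewrite !mule_ge0 // lee_fin ind01_ge0.
have r0 (x y : R) : (0 <= (rk 0 0 (emb2 (x, y)))%:E * (expR (- pi * (x ^+ 2 + y ^+ 2)))%:E)%E.
  by rewrite mule_ge0 // lee_fin ?rk_ge0 ?expR_ge0.
apply: ge0_le_int.
- exact: (@mI2 _ _ _ _ R leb (fun p : R * R => _ p.1 p.2) ml (fun p => l0 p.1 p.2)).
- exact: (@mI2 _ _ _ _ R leb (fun p : R * R => _ p.1 p.2) mr (fun p => r0 p.1 p.2)).
- by move=> x; apply: integral_ge0 => y _; exact: l0.
move=> x; apply: ge0_le_int; [exact: (m2f_y x ml)|exact: (m2f_y x mr)|exact: l0|exact: low].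
Qed.

Definition Kf l (w : C) : R := kap l (cabs2 w) * expR (pi * cabs2 w).
Definition KB l : R := kapB l * expR pi.
Lemma KB_ge0 l : 0 <= KB l. Proof. by rewrite mulr_ge0 ?kapB_ge0 ?expR_ge0. Qed.
Lemma Kf_bnd l w : `|Kf l w| <= KB l * disc 1 w.
Proof.
rewrite discP // /Kf; have [h|h] := ltP (cabs2 w) 1; last by rewrite kap_out // mul0r normr0 mulr0.
rewrite mulr1 normrM; apply: ler_pM => //; first by rewrite kap_bnd ?cabs2_ge0.
by rewrite ger0_norm ?expR_ge0 // ler_expR ler_piMr ?pi_ge0 // ltW.
Qed.
Lemma mKf l : measurable_fun setT (fun p : R2 => Kf l (emb2 p)).
Proof.
have m2 : measurable_fun setT (fun p : R2 => cabs2 (emb2 p)) by apply: mabs2; exact: (@m_emb2 R).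
by apply: measurable_funM; [exact: mkap|apply: measurableT_comp => //; apply: measurable_funM].
Qed.

Lemma mC_emb (f : C -> C) : ccont f -> mC (fun p : R2 => f (emb2 p)).
Proof. by move=> cf; exact: ccont_mC cf (@m_emb2 R). Qed.

Lemma Kf_loc l (f : C -> C) : ccont f -> exists2 M, 0 <= M & forall w z : C, cabs2 z <= 1 ->
  cn ((Kf l w)%:C * f (w * z)) <= M.
Proof.
move=> cf; have [M M0 hM] := ccont_bnd 1 cf; exists (KB l * M) => [|w z z1]; first by rewrite mulr_ge0 ?KB_ge0.
rewrite cnM cnR; apply: (le_trans (ler_wpM2r (cn_ge0 _) (Kf_bnd l w))).
rewrite discP // -mulrA ler_wpM2l ?KB_ge0 //.
have [h|h] := ltP (cabs2 w) 1; last by rewrite mul0r.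
rewrite mul1r; apply: hM; rewrite -(@ler_pXn2r _ 2) ?nnegrE ?cn_ge0 // cn_sqr cabs2M expr1n.
by rewrite -[leRHS]mulr1; apply: ler_pM; rewrite ?cabs2_ge0 // ltW.
Qed.

Lemma Kf_ci l f : ccont f -> ci g1 (fun p => (Kf l (emb2 p))%:C * f (emb2 p)).
Proof.
move=> cf; have [M M0 hM] := Kf_loc l cf.
apply: (@ci_bnd _ _ _ _ _ M); first by apply: mCM; [apply: mC_real; exact: mKf|exact: mC_emb].
by move=> p; have := hM (emb2 p) 1; rewrite mulr1 (cabs2R 1) expr1n; apply.
Qed.

(** [Kf] is radial and [g1] is rotation invariant, so averaging over the angle leaves the integral
    unchanged; Fubini moves the average onto [f]. *)
Lemma Kf_rot l f : ccont f -> cI g1 (fun p => (Kf l (emb2 p))%:C * f (emb2 p)) =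
  cI g1 (fun p => (Kf l (emb2 p))%:C * cI U (fun t => f (emb2 p * ei t))).
Proof.
move=> cf; have [M M0 hM] := Kf_loc l cf.
pose c := cI g1 (fun p => (Kf l (emb2 p))%:C * f (emb2 p)).
have h t : cI g1 (fun p => (Kf l (emb2 p))%:C * f (emb2 p * ei t)) = c.
  pose G w := (Kf l w)%:C * f w.
  have mG : mC (fun p : R2 => G (emb2 p)) by apply: mCM; [apply: mC_real; exact: mKf|exact: mC_emb].
  apply: (etrans _ (@cI_g1_rot _ (ei t) G (cabs2_ei t) mG (Kf_ci l cf))).
  by apply: eq_cI => p; rewrite /G /Kf cabs2M cabs2_ei mul1r [emb2 p * _]mulrC.
transitivity (cI U (fun t => cI g1 (fun p => (Kf l (emb2 p))%:C * f (emb2 p * ei t)))).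
  by rewrite -[LHS](cI_cst U); apply: eq_cI => t; rewrite h.
have mj d (T : measurableType d) (a : T -> R2) (b : T -> measurableTypeR R) : measurable_fun setT a -> measurable_fun setT b ->
  mC (fun x => (Kf l (emb2 (a x)))%:C * f (emb2 (a x) * ei (b x))).
  move=> ma mb; apply: mCM; first by apply: mC_real; exact: (measurableT_comp (mKf l) ma).
  apply: ccont_mC cf _; apply: mCM; first exact: (mC_comp (@m_emb2 R) ma).
  exact: (mC_comp (@mC_ei R) mb).
have hM' p t : cn ((Kf l (emb2 p))%:C * f (emb2 p * ei t)) <= M by apply: hM; rewrite cabs2_ei.
rewrite (@cI_fub _ _ _ _ _ U g1 (fun q => (Kf l (emb2 q.2))%:C * f (emb2 q.2 * ei q.1))).
- apply: eq_cI => p /=; rewrite cIZ //; apply: contC_ci; exact: contC_circ.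
- exact: mj measurable_snd measurable_fst.
- move=> t /=; apply: (@ci_bnd _ _ _ _ _ M); last by move=> p; exact: hM'.
  exact: (mj _ _ id (fun=> t) (@measurable_id _ R2 setT) (measurable_cst _)).
- move=> p /=; apply: (@ci_bnd _ _ _ _ _ M); last by move=> t; exact: hM'.
  exact: (mj _ _ (fun=> p) id (measurable_cst _) (@measurable_id _ (measurableTypeR R) setT)).
apply: (@le_lt_trans _ _ M%:E); last exact: ltry.
have mn : measurable_fun setT (fun q : measurableTypeR R * R2 => (cn ((Kf l (emb2 q.2))%:C * f (emb2 q.2 * ei q.1)))%:E).
  by apply/measurable_EFinP; apply: mcn; exact: mj measurable_snd measurable_fst.
have b1 (t : R) : (\int[g1]_y (cn ((Kf l (emb2 y))%:C * f (emb2 y * ei t)))%:E <= M%:E)%E.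
  apply: int_bnd; last by move=> p; rewrite cn_ge0 hM'.
  by apply: mcn; exact: (mj _ _ id (fun=> t) (@measurable_id _ R2 setT) (measurable_cst _)).
apply: (@le_trans _ _ (\int[U]_t M%:E)%E); last first.
  by rewrite (_ : \int[U]_t M%:E = M%:E)%E // -[RHS]mule1 -(@probability_setT _ _ _ U); exact: integral_cst.
apply: ge0_le_int; [| exact: measurable_cst | | exact: b1].
  by have := @mI2 _ _ _ _ R g1 _ mn; apply => q; rewrite lee_fin cn_ge0.
by move=> t; apply: integral_ge0 => p _; rewrite lee_fin cn_ge0.
Qed.

Lemma ciRk k s : ci g1 (fun p => (rk k s (emb2 p))%:C).
Proof.
split; first by apply: mC_real; exact: mrk.
rewrite (_ : (\int[g1]_x _ = \int[g1]_x (rk k s (emb2 x))%:E)%E).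
  by rewrite mom_scale -(fineK (mom_fin k)) -EFinM ltry.
by apply: eq_integral => p _; rewrite cnR ger0_norm ?rk_ge0.
Qed.
Lemma cIRk k s : cI g1 (fun p => (rk k s (emb2 p))%:C) = ((4 ^+ s) ^- k * fine (mom R k))%:C.
Proof. by rewrite cI_real /Rintegral mom_scale -[in LHS](fineK (mom_fin k)) -EFinM. Qed.

(** By [Kf_rot] and [PA_mean] the integral is a combination of moments of [kap] of orders below [n],
    and [lagrange] kills all of them except the one of order 0. *)
Lemma kernel_rep n : (0 < n)%N -> exists (l : seq (R * nat)) (m0 : R), 0 < m0 /\
  forall f : C -> C, PA n f -> cI g1 (fun p => (Kf l (emb2 p))%:C * f (emb2 p)) = m0%:C * f 0.
Proof.
move=> n0; have [l hl] := lagrange R n0; exists l, (fine (mom R 0)).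
split; first by rewrite fine_gt0 // mom0_gt0 /= -ge0_fin_numE ?mom_fin // ltW // mom0_gt0.
move=> f Pf; rewrite Kf_rot; last exact: PA_ccont Pf.
case: Pf => phi [hp fE].
transitivity (cI g1 (fun p => \sum_(k < n) \sum_(q <- l)
   (coefk (phi k) k * q.1%:C) * (rk k q.2 (emb2 p))%:C)).
  apply: eq_cI => p; rewrite (PA_mean _ hp fE) mulr_sumr; apply: eq_bigr => k _.
  have kE : Kf l (emb2 p) * cabs2 (emb2 p) ^+ k = \sum_(q <- l) q.1 * rk k q.2 (emb2 p).
    by rewrite /Kf /kap !mulr_suml; apply: eq_bigr => q _; rewrite /rk !mulrA.
  rewrite mulrA -realCM kE realC_sum mulr_suml; apply: eq_bigr => q _.
  by rewrite realCM mulrC mulrA.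
rewrite cI_sum => [|k]; last by apply: ci_sum => q; apply: ciZ; exact: ciRk.
transitivity (\sum_(k < n) coefk (phi k) k * ((k == 0 :> nat)%:R * fine (mom R k))%:C).
  apply: eq_bigr => k _; rewrite cI_sum => [|q]; last by apply: ciZ; exact: ciRk.
  rewrite -(hl k) // mulr_suml realC_sum mulr_sumr; apply: eq_bigr => q _.
  by rewrite cIZ ?cIRk; [rewrite !realCM !mulrA|exact: ciRk].
case: n n0 hl fE => // n _ _ fE.
rewrite big_ord_recl big1 => [|i _]; last by rewrite mul0r mulr0.
rewrite addr0 mul1r coefk0 // mulrC fE big_ord_recl big1 ?addr0 ?expr0 ?mul1r // => i _.
by rewrite J0 exprS !mul0r.
Qed.
End KernelRep.

(** * Local estimates *)
Section Loc1.
Variable R : realType.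
Local Notation C := (CC R).
Local Notation Re := (@complex.Re R).
Local Notation g1 := (@g1 R).
Local Notation R2 := (measurableTypeR R * measurableTypeR R)%type.
Local Notation emb2 := (@emb2 R).
Local Open Scope complex_scope.

(** The disc has radius 2: it contains the support of the unit kernel moved by any [h] with
    [cn h <= 1]. *)
Definition l1 (f : C -> C) : \bar R := (\int[g1]_p (disc 4 (emb2 p) * cabs2 (f (emb2 p)))%:E)%E.

Lemma m_l1 f : ccont f -> measurable_fun setT (fun p : R2 => (disc 4 (emb2 p) * cabs2 (f (emb2 p)))%:E).
Proof.
move=> cf; apply/measurable_EFinP; apply: measurable_funM; first exact: mdisc.
by apply: mabs2; exact: mC_emb.
Qed.

(** Jensen's inequality for the probability [g1], followed by the pointwise bound on [G], which also
    localises the integral to the disc. *)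
Lemma kern_est (G : C -> C) A f : ccont f -> 0 <= A ->
  mC (fun p : R2 => G (emb2 p)) -> (forall w, cn (G w) <= A * disc 4 w) ->
  ci g1 (fun p => G (emb2 p) * f (emb2 p)) ->
  ((cabs2 (cI g1 (fun p => G (emb2 p) * f (emb2 p))))%:E <= (A ^+ 2)%:E * l1 f)%E.
Proof.
move=> cf A0 mG hG cG; apply: le_trans (cI_jensen cG) _.
have ml := m_l1 cf.
have l0 (p : R2) : (0 <= (disc 4 (emb2 p) * cabs2 (f (emb2 p)))%:E)%E.
  by rewrite lee_fin mulr_ge0 ?disc_ge0 ?cabs2_ge0.
apply: (@le_trans _ _ (\int[g1]_p ((A ^+ 2)%:E * (disc 4 (emb2 p) * cabs2 (f (emb2 p)))%:E))%E).
  apply: ge0_le_int.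
  - by apply: mn2; case: cG.
  - by apply: emeasurable_funM; [exact: measurable_cst|exact: ml].
  - by move=> p; rewrite lee_fin cabs2_ge0.
  - move=> p; rewrite -EFinM lee_fin cabs2M mulrA ler_wpM2r ?cabs2_ge0 // -cn_sqr.
    have := hG (emb2 p); rewrite discP //; case: (_ < _); rewrite ?mulr1 ?mulr0 => h.
      by rewrite lerXn2r ?nnegrE ?cn_ge0.
    by rewrite (_ : cn _ = 0) ?expr0n //; apply/eqP; rewrite eq_le h cn_ge0.
apply: (eq_ind_r (fun x => (x <= _)%E) (lexx _)).
by apply: (ge0_integralZl_EFin g1 measurableT) => //; rewrite sqr_ge0.
Qed.

Lemma PA_cst n (c : C) : (0 < n)%N -> PA n (fun _ : C => c).
Proof.
case: n => // n _; exists (fun k _ => if k == 0%N then c else 0); split; first by move=> k; exact: hol_cst.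
by move=> z; rewrite big_ord_recl big1 => [|i _]; rewrite ?expr0 ?mul1r ?addr0 //= mulr0.
Qed.
Lemma PA_B n (f g : C -> C) : PA n f -> PA n g -> PA n (fun w => f w - g w).
Proof.
move=> [p [hp fE]] [q [hq gE]]; exists (fun k w => p k w + (-1) * q k w); split.
  by move=> k; apply: holD => //; apply: holM => //; exact: hol_cst.
by move=> z; rewrite fE gE -sumrB; apply: eq_bigr => k _; ring.
Qed.

Lemma loc_pt0 n : (0 < n)%N -> exists2 B, 0 <= B & forall f : C -> C, PA n f ->
  ((cabs2 (f 0))%:E <= B%:E * l1 f)%E.
Proof.
move=> n0; have [l [m0 [m00 rep]]] := kernel_rep R n0.
exists ((KB l / m0) ^+ 2) => [|f Pf]; first exact: sqr_ge0.
have cf := PA_ccont Pf.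
have h := @kern_est (fun w => (Kf l w)%:C) (KB l) f cf (KB_ge0 l) _ _ (Kf_ci l cf).
have {}h : ((cabs2 (m0%:C * f 0))%:E <= (KB l ^+ 2)%:E * l1 f)%E.
  rewrite -(rep f Pf); apply: h; first by apply: mC_real; exact: mKf.
  move=> w; rewrite cnR; apply: (le_trans (Kf_bnd l w)); rewrite ler_wpM2l ?KB_ge0 //.
  rewrite !discP //; case: ltP => h1; last exact: ler0n.
  by rewrite (lt_trans h1) // ltr1n.
have i0 : (0 <= (m0 ^+ 2)^-1)%R by rewrite invr_ge0 sqr_ge0.
have := lee_wpmul2l (_ : (0 <= ((m0 ^+ 2)^-1)%:E)%E) h; rewrite lee_fin => /(_ i0).
rewrite muleA -!EFinM cabs2M cabs2R mulrA mulVf ?mul1r ?gt_eqF ?exprn_gt0 //.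
by rewrite expr_div_n mulrC.
Qed.

(** The translation weight recombines with the exponential of [Kf] into one that does not depend on
    [h]; only the compactly supported factor [kap] moves, and it is Lipschitz. *)
Lemma Kf_shift l (h w : C) : wt1 h w * Kf l (w - h) = kap l (cabs2 (w - h)) * expR (pi * cabs2 w).
Proof.
rewrite /Kf /wt1 mulrCA -expRD; congr (_ * expR _).
by rewrite /cabs2 !ReB !ImB ReM ReJ ImJ; ring.
Qed.

Lemma cabs2_shift_near (h w : C) : cn h <= 1 -> cn w <= 2 -> `|cabs2 (w - h) - cabs2 w| <= 5 * cn h.
Proof.
move=> h1 w2.
have -> : cabs2 (w - h) - cabs2 w = cabs2 h - 2 * Re (w * cj h).
  by rewrite /cabs2 !ReB !ImB ReM ReJ ImJ; ring.
apply: le_trans (ler_normB _ _) _; rewrite ger0_norm ?cabs2_ge0 // -cn_sqr normrM ger0_norm //.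
have : `|Re (w * cj h)| <= cn w * cn h by rewrite -(cnJ h) -cnM Re_cn.
have := cn_ge0 h; move: (cn h) (cn w) h1 w2 (`|_|) => a b a1 b2 x a0 hx.
have : b * a <= 2 * a by rewrite ler_wpM2r.
have : a ^+ 2 <= a by rewrite expr2 ler_piMl.
lra.
Qed.

(** Inside the disc this is the Lipschitz bound of [kap], the 5 coming from [cabs2_shift_near] and
    the exponential from its maximum there. Outside, [w] and [w - h] both have modulus at least 1,
    where [kap] vanishes. *)
Lemma Kf_diff l (h w : C) : cn h <= 1 ->
  `|wt1 h w * Kf l (w - h) - Kf l w| <= (kapL l * expR (pi * 4) * 5) * cn h * disc 4 w.
Proof.
move=> h1; rewrite Kf_shift /Kf -mulrBl normrM discP //.
have [w4|w4] := ltP (cabs2 w) 4.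
  have w2 : cn w <= 2.
    by rewrite -(@ler_pXn2r _ 2) ?nnegrE ?cn_ge0 // cn_sqr; apply/ltW; rewrite expr2; lra.
  rewrite mulr1; have k1 := kap_lip l (cabs2 (w - h)) (cabs2 w); have k2 := cabs2_shift_near h1 w2.
  have k3 : `|expR (pi * cabs2 w)| <= expR (pi * 4).
    by rewrite ger0_norm ?expR_ge0 // ler_expR ler_wpM2l ?pi_ge0 // ltW.
  have k4 : `|kap l (cabs2 (w - h)) - kap l (cabs2 w)| <= kapL l * (5 * cn h).
    by apply: le_trans k1 _; rewrite ler_wpM2l ?kapL_ge0.
  apply: (le_trans (ler_pM _ _ k4 k3)) => //.
  by rewrite le_eqVlt; apply/orP; left; apply/eqP; ring.
have w2 : 2 <= cn w by rewrite -(@ler_pXn2r _ 2) ?nnegrE ?cn_ge0 // cn_sqr; apply: le_trans w4; rewrite expr2; lra.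
rewrite !kap_out ?subrr ?normr0 ?mul0r ?mulr0 //; first by apply: le_trans w4; rewrite ler1n.
rewrite -cn_sqr -[1](expr1n _ 2) lerXn2r ?nnegrE ?cn_ge0 //.
have := cn_dist w h; lra.
Qed.

(** [f h] is reproduced by the translated kernel and [f 0] by the original one. The difference is an
    integral of [f] against a kernel of size proportional to [cn h]. *)
Lemma loc_diff0 n : (0 < n)%N -> exists2 D, 0 <= D & forall (f : C -> C) h, PA n f -> cn h <= 1 ->
  ((cabs2 (f h - f 0))%:E <= (D * cabs2 h)%:E * l1 f)%E.
Proof.
move=> n0; have [l [m0 [m00 rep]]] := kernel_rep R n0.
pose A := kapL l * expR (pi * 4) * 5 : R.
have A0 : 0 <= A by rewrite !mulr_ge0 ?kapL_ge0 ?expR_ge0.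
exists ((A / m0) ^+ 2) => [|f h Pf h1]; first exact: sqr_ge0.
have cf := PA_ccont Pf; have Ph := PA_shift h Pf; have cfh := PA_ccont Ph.
pose F w := (Kf l w)%:C * f (h + w).
have mF : mC (fun p : R2 => F (emb2 p)) by apply: mCM; [apply: mC_real; exact: mKf|exact: (mC_emb cfh)].
have [c1 e1] := cI_g1_shift h mF (Kf_ci l cfh).
have e2 : cI g1 (fun p => F (emb2 p)) = m0%:C * f h by rewrite (rep _ Ph) addr0.
pose G w := (wt1 h w * Kf l (w - h) - Kf l w)%:C.
have GE p : G (emb2 p) * f (emb2 p) = (wt1 h (emb2 p))%:C * F (emb2 p - h) - (Kf l (emb2 p))%:C * f (emb2 p).
  by rewrite /G /F subrKC realCB realCM; ring.
have cG : ci g1 (fun p => G (emb2 p) * f (emb2 p)).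
  rewrite (_ : (fun p => _) = (fun p => (wt1 h (emb2 p))%:C * F (emb2 p - h) + - ((Kf l (emb2 p))%:C * f (emb2 p)))); last exact/funext.
  by apply: ciD c1 _; apply: ciN; exact: Kf_ci.
have eG : cI g1 (fun p => G (emb2 p) * f (emb2 p)) = m0%:C * (f h - f 0).
  transitivity (cI g1 (fun p => (wt1 h (emb2 p))%:C * F (emb2 p - h) - (Kf l (emb2 p))%:C * f (emb2 p))).
    by apply: eq_cI => p; exact: GE.
  rewrite cIB //; last exact: Kf_ci.
  by rewrite e1 e2 (rep _ Pf) mulrBr.
have := @kern_est G (A * cn h) f cf; rewrite eG => k.
have {}k : ((cabs2 (m0%:C * (f h - f 0)))%:E <= ((A * cn h) ^+ 2)%:E * l1 f)%E.
  apply: k => //; first by rewrite mulr_ge0 ?cn_ge0.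
    apply: mC_real; apply: measurable_funB; last exact: mKf.
    rewrite (_ : (fun x => _) = (fun p : R2 => kap l (cabs2 (emb2 p - h)) * expR (pi * cabs2 (emb2 p)))); last first.
      by apply/funext => p; exact: Kf_shift.
    apply: measurable_funM.
      by apply: mkap; apply: mabs2; apply: mCB; [exact: (@m_emb2 R)|exact: mC_cst].
    apply: measurableT_comp => //; apply: measurable_funM => //.
    by apply: mabs2; exact: (@m_emb2 R).
  by move=> w; rewrite cnR; exact: Kf_diff.
have i0 : (0 <= (m0 ^+ 2)^-1)%R by rewrite invr_ge0 sqr_ge0.
have := lee_wpmul2l (_ : (0 <= ((m0 ^+ 2)^-1)%:E)%E) k; rewrite lee_fin => /(_ i0).
rewrite muleA -!EFinM cabs2M cabs2R mulrA mulVf ?mul1r ?gt_eqF ?exprn_gt0 //.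
by rewrite exprMn cn_sqr expr_div_n [_^-1 * _]mulrC mulrAC.
Qed.

Lemma l1_ge0 f : (0 <= l1 f)%E.
Proof. by apply: integral_ge0 => p _; rewrite lee_fin mulr_ge0 ?disc_ge0 ?cabs2_ge0. Qed.

Lemma loc_pt n : (0 < n)%N -> exists2 B, 0 <= B & forall (f : C -> C) h, PA n f -> cn h <= 1 ->
  ((cabs2 (f h))%:E <= B%:E * l1 f)%E.
Proof.
move=> n0; have [B B0 hB] := loc_pt0 n0; have [D D0 hD] := loc_diff0 n0.
exists (2 * D + 2 * B) => [|f h Pf h1]; first by rewrite addr_ge0 // mulr_ge0.
apply: (@le_trans _ _ (2 * cabs2 (f h - f 0) + 2 * cabs2 (f 0))%:E).
  by rewrite lee_fin -[X in cabs2 X <= _](subrK (f 0)) cabs2D_le.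
rewrite EFinD !EFinM [(2 * D + 2 * B)%:E]EFinD ge0_muleDl ?lee_fin ?mulr_ge0 // !EFinM -!muleA; apply: leeD.
  rewrite lee_wpmul2l //; apply: le_trans (hD f h Pf h1) _.
  rewrite lee_wpmul2r ?l1_ge0 // lee_fin ler_piMr // -cn_sqr expr_le1 ?cn_ge0 //.
by rewrite lee_wpmul2l //; exact: hB.
Qed.
End Loc1.

(** * Local estimates in several variables *)

Section LocD.
Variables (R : realType) (d : nat).
Local Notation C := (CC R).
Local Notation V := (cvec R d).
Local Notation g1 := (@g1 R).
Local Notation gm := (gm R d).
Local Notation R2 := (measurableTypeR R * measurableTypeR R)%type.
Local Notation emb2 := (@emb2 R).
Local Open Scope complex_scope.

Definition mixn s (z0 z : V) : V := \row_j (if (j < s)%N then z ord0 j else z0 ord0 j).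

(* Separate continuity suffices: one coordinate is freed at a time, each step being [m_carath]. *)
Lemma sep_mC (F : V -> C) : (forall z j, ccont (fun w => F (upd z j w))) -> mC F.
Proof.
move=> cF; suff h s : (s <= d)%N -> forall z0, mC (fun z => F (mixn s z0 z)).
  have := h d (leqnn d) 0; congr mC; apply/funext => z; congr F.
  by apply/rowP => j; rewrite mxE ltn_ord.
elim: s => [_ z0|s IH sd z0].
  have : mC (fun _ : V => F z0) by exact: mC_cst.
   congr mC; apply/funext => z; congr F.
  by apply/rowP => j; rewrite mxE.
pose j := Ordinal sd.
have := @m_carath R _ V (fun z w => F (mixn s (upd z0 j w) z)) (fun z => z ord0 j).
rewrite (_ : (fun x : V => F (mixn s (upd z0 j (x ord0 j)) x)) = (fun z : V => F (mixn s.+1 z0 z))); last first.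
  apply/funext => z; congr F; apply/rowP => i; rewrite !mxE -val_eqE /= ltnS.
  by case: (ltngtP i s) => [||e] //=; rewrite (_ : j = i) //; apply/val_inj; rewrite /= e.
apply; last exact: mv_coord.
  by move=> w; apply: IH; exact: ltnW.
move=> z; have := cF (mixn s z0 z) j; congr ccont; apply/funext => w; congr F.
apply/rowP => i; rewrite !mxE; case: eqP => [->|//]; by rewrite /= ltnn.
Qed.

Variable n : 'I_d -> nat.
Hypothesis n0 : forall j, (0 < n j)%N.

(* Separately polyanalytic: every one-variable slice has order at most [n j]. *)
Definition SP (F : V -> C) := forall z j, PA (n j) (fun w => F (upd z j w)).

Lemma SP_mC F : SP F -> mC F.
Proof. by move=> h; apply: sep_mC => z j; exact: PA_ccont (h z j). Qed.

Lemma SP_upd F j c : SP F -> SP (fun z => F (upd z j c)).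
Proof.
move=> h z i; have [->|ne] := eqVneq i j.
  have := PA_cst (F (upd z j c)) (n0 j); congr PA; apply/funext => w; by rewrite upd_upd.
have := h (upd z j c) i; congr PA; apply/funext => w; by rewrite upd_comm // eq_sym.
Qed.
Lemma SP_B F G : SP F -> SP G -> SP (fun z => F z - G z).
Proof. by move=> h k z j; exact: PA_B (h z j) (k z j). Qed.

Definition mixs (S : seq 'I_d) (y h : V) : V := \row_j (if j \in S then y ord0 j else h ord0 j).
Definition Ds (S : seq 'I_d) (y : V) : R := \prod_(j <- S) disc 4 (y ord0 j).
Lemma Ds_ge0 S y : 0 <= Ds S y. Proof. by apply: prodr_ge0 => j _; exact: disc_ge0. Qed.
Lemma mDs S : measurable_fun setT (Ds S).
Proof.
apply: measurable_prod => j _; apply: (measurableT_comp (@mind01 R)); apply: measurable_funM => //.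
by apply: mabs2; exact: mv_coord.
Qed.

Lemma Ds_upd S y j w : j \notin S -> Ds S (upd y j w) = Ds S y.
Proof.
move=> jS; rewrite /Ds !big_seq; apply: eq_bigr => i iS; rewrite upd_ne //.
by apply: contraNneq jS => <-.
Qed.

(** Resampling the coordinate [j] turns a one-variable estimate, valid for all values of the other
    coordinates, into an estimate of integrals. As [j] is not in [S], the cut-off [Ds S] is constant
    along that coordinate. *)
Lemma loc_step S j (F G : V -> C) (B : R) : j \notin S -> 0 <= B -> mC F -> mC G ->
  (forall y, ((cabs2 (G y))%:E <= B%:E * l1 (fun w => F (upd y j w)))%E) ->
  (\int[gm]_y (Ds S y * cabs2 (G y))%:E <= B%:E * \int[gm]_y (Ds (j :: S) y * cabs2 (F y))%:E)%E.
Proof.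
move=> jS B0 mF mG h.
have mD (S' : seq 'I_d) (H : V -> C) : mC H -> measurable_fun setT (fun y => (Ds S' y * cabs2 (H y))%:E).
  by move=> mH; apply/measurable_EFinP; apply: measurable_funM; [exact: mDs|exact: mabs2].
have D0 (S' : seq 'I_d) (H : V -> C) y : (0 <= (Ds S' y * cabs2 (H y))%:E)%E by rewrite lee_fin mulr_ge0 ?Ds_ge0 ?cabs2_ge0.
rewrite (gm_resample j (mD (j :: S) F mF) (D0 (j :: S) F)).
have mU : measurable_fun setT (fun q : V * R2 => upd q.1 j (emb2 q.2)).
  by apply: m_upd; [exact: measurable_fst|exact: (mC_comp (@m_emb2 R) measurable_snd)].
have mI : measurable_fun setT (fun y => \int[g1]_p (Ds (j :: S) (upd y j (emb2 p)) * cabs2 (F (upd y j (emb2 p))))%:E)%E.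
  apply: (@mI2 _ _ _ _ R g1 (fun q : V * R2 => (Ds (j :: S) (upd q.1 j (emb2 q.2)) * cabs2 (F (upd q.1 j (emb2 q.2))))%:E)).
    exact: (measurableT_comp (mD (j :: S) F mF) mU).
  by move=> q; exact: D0.
have I0 y : (0 <= \int[g1]_p (Ds (j :: S) (upd y j (emb2 p)) * cabs2 (F (upd y j (emb2 p))))%:E)%E.
  by apply: integral_ge0 => p _; exact: D0.
rewrite -(ge0_integralZl_EFin gm measurableT) //.
apply: ge0_le_int => //.
- exact: mD.
- by apply: emeasurable_funM; [exact: measurable_cst|exact: mI].
move=> y; rewrite EFinM.
apply: (@le_trans _ _ ((Ds S y)%:E * (B%:E * l1 (fun w => F (upd y j w))))%E).
  by rewrite lee_wpmul2l ?lee_fin ?Ds_ge0.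
rewrite muleCA lee_wpmul2l // /l1 -(ge0_integralZl_EFin g1 measurableT) ?Ds_ge0 //; last 2 first.
- by move=> p _; rewrite lee_fin mulr_ge0 ?disc_ge0 ?cabs2_ge0.
- apply/measurable_EFinP; apply: measurable_funM; first exact: mdisc.
  apply: mabs2; apply: (mC_comp (g := fun p : R2 => upd y j (emb2 p)) mF).
  by apply: m_upd; [exact: measurable_cst|exact: (@m_emb2 R)].
rewrite le_eqVlt; apply/orP; left; apply/eqP; apply: eq_integral => p _.
by rewrite -EFinM {2}/Ds big_cons -/(Ds S _) upd_at Ds_upd // mulrCA mulrA.
Qed.

(** Each coordinate added to [S] is released from its value at the point [h] and replaced by an
    average over a disc. *)
Lemma loc_multi (S : seq 'I_d) : uniq S -> exists2 B, 0 <= B & forall F (h : V), SP F -> (forall j, cn (h ord0 j) <= 1) ->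
  ((cabs2 (F h))%:E <= B%:E * \int[gm]_y (Ds S y * cabs2 (F (mixs S y h)))%:E)%E.
Proof.
elim: S => [_|j S IH /= /andP[jS uS]].
  exists 1 => // F h SF h1; rewrite mul1e (_ : \int[gm]_y _ = (cabs2 (F h))%:E)%E //.
  rewrite -[RHS]mule1 -(@probability_setT _ _ _ gm) -integral_cst //.
  apply: eq_integral => y _; rewrite /Ds big_nil mul1r; congr (cabs2 (F _))%:E.
  by apply/rowP => i; rewrite mxE.
have [B B0 hB] := IH uS; have [B1 B10 hB1] := loc_pt R (n0 j).
exists (B * B1) => [|F h SF h1]; first by rewrite mulr_ge0.
have := hB _ h (SP_upd j (h ord0 j) SF) h1; rewrite upd_id => k; apply: le_trans k _.
rewrite EFinM -muleA lee_wpmul2l //.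
pose F' y := F (mixs (j :: S) y h).
have updE y w : upd (mixs S y h) j w = mixs (j :: S) (upd y j w) h.
  by apply/rowP => i; rewrite !mxE in_cons; case: eqP => //= e; case: ifP.
have mF' : mC F'.
  apply: (mC_comp (g := fun y => mixs (j :: S) y h) (SP_mC SF)); apply: mv_into => i.
  have [iS|iS] := boolP (i \in j :: S).
    by have := mv_coord R i; congr mC; apply/funext => y; rewrite mxE iS.
  have : mC (fun _ : V => h ord0 i) by exact: mC_cst.
   congr mC; apply/funext => y; by rewrite mxE (negPf iS).
apply: (@loc_step S j F' (fun y => F (upd (mixs S y h) j (h ord0 j)))) => //.
  have : mC (fun y => F' (upd y j (h ord0 j))).
    apply: (mC_comp (g := fun y => upd y j (h ord0 j)) mF'); apply: m_upd; first exact: measurable_id.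
    exact: mC_cst.
  by congr mC; apply/funext => y; rewrite /F' updE.
move=> y; have := hB1 (fun w => F (upd (mixs S y h) j w)) (h ord0 j) (SF _ j) (h1 j).
by congr (_ <= _ * l1 _)%E; apply/funext => w; rewrite updE.
Qed.

Definition Dall : V -> R := Ds (enum 'I_d).
Definition lD F : \bar R := (\int[gm]_y (Dall y * cabs2 (F y))%:E)%E.

Lemma lD_ge0 F : (0 <= lD F)%E.
Proof. by apply: integral_ge0 => p _; rewrite lee_fin mulr_ge0 ?Ds_ge0 ?cabs2_ge0. Qed.

Lemma local_bound : exists2 B, 0 <= B & forall F (h : V), SP F -> (forall j, cn (h ord0 j) <= 1) ->
  ((cabs2 (F h))%:E <= B%:E * lD F)%E.
Proof.
have [B B0 hB] := loc_multi (enum_uniq 'I_d); exists B => // F h SF h1.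
have := hB F h SF h1; congr (_ <= _ * _)%E; apply: eq_integral => y _; congr (_ * cabs2 (F _))%:E.
by apply/rowP => j; rewrite mxE mem_enum.
Qed.

Lemma cabs2_sum_le (I : Type) (s : seq I) (x : I -> C) :
  cabs2 (\sum_(i <- s) x i) <= 2 ^+ size s * \sum_(i <- s) cabs2 (x i).
Proof.
elim: s => [|i s IH]; first by rewrite !big_nil cabs20 mulr0.
rewrite !big_cons /= exprS; apply: le_trans (cabs2D_le _ _) _.
have p1 : 1 <= 2 ^+ size s :> R by apply: exprn_ege1; rewrite ler1n.
rewrite -mulrA -mulrDr ler_wpM2l // mulrDr lerD //.
by rewrite ler_peMl ?cabs2_ge0.
Qed.

Lemma local_diff1 j : exists2 D, 0 <= D & forall F (h : V), SP F -> (forall j, cn (h ord0 j) <= 1) ->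
  ((cabs2 (F h - F (upd h j 0)))%:E <= (D * cabs2 (h ord0 j))%:E * lD F)%E.
Proof.
pose S := [seq i <- enum 'I_d | i != j].
have uS : uniq S by rewrite filter_uniq ?enum_uniq.
have jS : j \notin S by rewrite mem_filter eqxx.
have [B B0 hB] := loc_multi uS; have [D D0 hD] := loc_diff0 R (n0 j).
exists (B * D) => [|F h SF h1]; first by rewrite mulr_ge0.
(* The increment in the coordinate [j] alone is still separately polyanalytic: the other coordinates
   are released by [loc_multi], and [loc_diff0] supplies the small factor in this one. *)
pose H y := F (upd y j (h ord0 j)) - F (upd y j 0).
have SH : SP H by apply: SP_B; exact: SP_upd.
have := hB H h SH h1; rewrite /H upd_id -/H => k; apply: le_trans k _.
rewrite -mulrA EFinM -muleA lee_wpmul2l //.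
have lE : lD F = (\int[gm]_y (Ds (j :: S) y * cabs2 (F y))%:E)%E.
  apply: eq_integral => y _; congr (_ * _)%:E; apply: perm_big.
  apply: uniq_perm; rewrite /= ?enum_uniq ?jS //.
  by move=> i; rewrite mem_enum in_cons mem_filter mem_enum andbT inE orbN.
rewrite lE; apply: loc_step => //.
- by rewrite mulr_ge0 ?cabs2_ge0.
- exact: SP_mC.
- apply: (mC_comp (g := fun y => mixs S y h) (SP_mC SH)); apply: mv_into => i.
  have [iS|iS] := boolP (i \in S).
    by have := mv_coord R i; congr mC; apply/funext => y; rewrite mxE iS.
  have : mC (fun _ : V => h ord0 i) by exact: mC_cst.
   congr mC; apply/funext => y; by rewrite mxE (negPf iS).
move=> y; have := hD (fun w => F (upd y j w)) (h ord0 j) (SF _ j) (h1 j).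
congr (_ <= _)%E; rewrite /H; congr (cabs2 (F _ - F _))%:E; apply/rowP => i; rewrite !mxE mem_filter mem_enum andbT.
  by case: eqP.
by case: eqP.
Qed.

(** Telescoping along a path that changes one coordinate at a time; the factor [2 ^+ d] comes from
    the crude bound [cabs2_sum_le]. *)
Lemma local_diff : exists2 D, 0 <= D & forall F (h : V), SP F -> (forall j, cn (h ord0 j) <= 1) ->
  ((cabs2 (F h - F 0))%:E <= (D * vnorm2 h)%:E * lD F)%E.
Proof.
have /choice [D hD] : forall j, exists D, 0 <= D /\ forall F (h : V), SP F -> (forall j, cn (h ord0 j) <= 1) ->
  ((cabs2 (F h - F (upd h j 0)))%:E <= (D * cabs2 (h ord0 j))%:E * lD F)%E.
  by move=> j; have [D D0 h] := local_diff1 j; exists D.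
have D0 j : 0 <= D j by case: (hD j).
exists (2 ^+ d * \sum_j D j) => [|F h SF h1]; first by rewrite mulr_ge0 ?exprn_ge0 // sumr_ge0.
pose hs s : V := \row_j (if (j < s)%N then h ord0 j else 0).
have tel : F h - F 0 = \sum_(j < d) (F (hs j.+1) - F (hs j)).
  rewrite -(big_mkord predT (fun j => F (hs j.+1) - F (hs j))) telescope_sumr //.
  by congr (F _ - F _); apply/rowP => j; rewrite !mxE ?ltn_ord.
have hs1 s j : cn (hs s ord0 j) <= 1 by rewrite mxE; case: ifP; rewrite ?h1 ?cn0 ?ler01.
have st (j : 'I_d) : ((cabs2 (F (hs j.+1) - F (hs j)))%:E <= (D j * cabs2 (h ord0 j))%:E * lD F)%E.
  have [_ /(_ F (hs j.+1) SF (hs1 _))] := hD j.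
  rewrite [hs j.+1 ord0 j]mxE ltnSn (_ : upd (hs j.+1) j 0 = hs j) //.
  apply/rowP => i; rewrite !mxE ltnS -val_eqE /= leq_eqVlt; case: eqP => [->|]; by rewrite ?ltnn.
have l0 := lD_ge0 F.
rewrite tel; apply: (@le_trans _ _ (2 ^+ d * \sum_(j < d) cabs2 (F (hs j.+1) - F (hs j)))%:E).
  by rewrite lee_fin; have := cabs2_sum_le (enum 'I_d) (fun j : 'I_d => F (hs j.+1) - F (hs j)); rewrite size_enum_ord !big_enum.
rewrite EFinM -sumEFin -[2 ^+ d * _ * _]mulrA [(2 ^+ d * _)%:E]EFinM -muleA lee_wpmul2l ?lee_fin ?exprn_ge0 //.
apply: (@le_trans _ _ (\sum_(j < d) (D j * cabs2 (h ord0 j))%:E * lD F)%E).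
  by apply: lee_sum => j _; exact: st.
rewrite -ge0_sume_distrl => [|j _]; last by rewrite lee_fin mulr_ge0 ?cabs2_ge0.
rewrite lee_wpmul2r // sumEFin lee_fin mulr_suml; apply: ler_sum => j _; rewrite ler_wpM2l //.
by rewrite /vnorm2 (bigD1 j) //= lerDl sumr_ge0 // => i _; exact: cabs2_ge0.
Qed.
End LocD.

Section Esum.
Variables (R : realType) (T : choiceType).
Lemma esum_le_seq (G : set T) (f : T -> \bar R) B : (forall x, G x -> (0 <= f x)%E) ->
  (forall V : seq T, uniq V -> (forall v, v \in V -> G v) -> (\sum_(v <- V) f v <= B)%E) ->
  (\esum_(x in G) f x <= B)%E.
Proof.
move=> f0 h; rewrite /esum; apply: ge_ereal_sup => _ [A [finA AG] <-].
rewrite fsbig_finite //; apply: h; first exact: finmap.fset_uniq.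
by move=> v; rewrite in_fset_set // inE => /AG.
Qed.
Lemma seq_le_esum (G : set T) (f : T -> \bar R) (V : seq T) : (forall x, G x -> (0 <= f x)%E) ->
  uniq V -> (forall v, v \in V -> G v) -> (\sum_(v <- V) f v <= \esum_(x in G) f x)%E.
Proof.
move=> f0 uV VG; apply: ereal_sup_ubound; exists [set` V]; first by split; [exact: finite_seq|exact: VG].
by rewrite -fsbig_seq.
Qed.
End Esum.

(** * Bessel inequalities for lattices *)
Section PolyFockSP.
Variables (R : realType) (d : nat).
Local Notation C := (CC R).
Local Notation V := (cvec R d).
Local Notation gm := (gm R d).
Local Open Scope complex_scope.

Lemma PA_D m (f g : C -> C) : PA m f -> PA m g -> PA m (fun w => f w + g w).
Proof.
move=> [p [hp fE]] [q [hq gE]]; exists (fun k w => p k w + q k w); split.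
  by move=> k; apply: holD.
by move=> z; rewrite fE gE -big_split; apply: eq_bigr => k _; rewrite mulrDr.
Qed.
Lemma PA_0 m : PA m (fun _ : C => 0).
Proof. by exists (fun _ _ => 0); split=> [k|z]; [exact: hol_cst|rewrite big1 // => k _; rewrite mulr0]. Qed.
Lemma PA_sum m (I : Type) (s : seq I) (f : I -> C -> C) : (forall i, PA m (f i)) ->
  PA m (fun w => \sum_(i <- s) f i w).
Proof.
move=> h; elim: s => [|i s IH].
  by have := PA_0 m; congr PA; apply/funext => w; rewrite big_nil.
by have := PA_D (h i) IH; congr PA; apply/funext => w; rewrite big_cons.
Qed.
Lemma PA_mono m k (f : C -> C) : (k < m)%N -> hol f -> PA m (fun w => cj w ^+ k * f w).
Proof.
move=> km hf; exists (fun i w => if i == k then f w else 0); split.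
  by move=> i; case: (i == k); [exact: hf|exact: hol_cst].
move=> z; rewrite (bigD1 (Ordinal km)) //= eqxx big1 ?addr0 // => i ne.
by rewrite -val_eqE /= in ne; rewrite (negPf ne) mulr0.
Qed.

Lemma entire_hol (F : V -> C) : entire F <-> forall z j, hol (fun w => F (upd z j w)).
Proof.
split=> [eF z j|h z j]; last by have /hol_derivable := h z j; apply.
apply/hol_derivable => w; have := eF (upd z j w) j; rewrite upd_at.
rewrite (_ : (fun v => F (upd (upd z j w) j v)) = (fun v => F (upd z j v))) //.
by apply/funext => v; rewrite upd_upd.
Qed.

Variable n : 'I_d -> nat.
(** With the other variables frozen, the powers of their conjugates are constants and the exponent
    in the variable [j] stays below [n j]. *)
Lemma polyFock_SP (F : V -> C) : polyFock n F -> SP n F.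
Proof.
move=> [[phi [ephi FE]] _] z j.
have -> : (fun w => F (upd z j w)) = (fun w => \sum_(k : Kn n)
   cj w ^+ k j * ((\prod_(i < d | i != j) cj (z ord0 i) ^+ k i) * phi k (upd z j w))).
  apply/funext => w; rewrite FE; apply: eq_bigr => k _; rewrite /cpowbar (bigD1 j) //= upd_at -/(cj w) -mulrA.
  congr (_ * (_ * _)); apply: eq_bigr => i ij; by rewrite upd_ne.
apply: PA_sum => k; apply: PA_mono => //; apply: holM; first exact: hol_cst.
by have /entire_hol := ephi k; apply.
Qed.

Lemma vnorm2_ge0 (z : V) : 0 <= vnorm2 z. Proof. by apply: sumr_ge0 => i _; exact: cabs2_ge0. Qed.

Lemma cabs2_beta (a : V) (F : V -> C) z : cabs2 (beta a F z) = cabs2 (F (z - a)) * wt a z.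
Proof.
rewrite /beta cabs2M cabs2_cexp /wt mulrC; congr (_ * expR _).
rewrite ReB ReR ReM ReR ImR mul0r subr0; by field.
Qed.

Lemma SP_beta (a : V) (F : V -> C) : SP n F -> SP n (beta a F).
Proof.
move=> h z j; have := PA_M (PA_shift (- a ord0 j) (h (z - a) j)) (_ : hol (fun w => cexp (pi%:C * cdot a (upd z j w) - (pi / 2 * vnorm2 a)%:C))).
have hh : hol (fun w => cexp (pi%:C * cdot a (upd z j w) - (pi / 2 * vnorm2 a)%:C)).
  apply: (hol_comp (@hol_exp R)); apply: holD; last exact: hol_cst.
  apply: holM; first exact: hol_cst.
  have := @hol_sum R _ (index_enum 'I_d) (fun i w => cj (a ord0 i) * upd z j w ord0 i); rewrite (_ : (fun x => _) = (fun w => cdot a (upd z j w))); last first.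
    by apply/funext => w; rewrite cdotE.
  apply=> i; apply: holM; first exact: hol_cst.
  have [->|ne] := eqVneq i j.
    by have := @hol_id R; congr hol; apply/funext => w; rewrite upd_at.
  by have := @hol_cst R (z ord0 i); congr hol; apply/funext => w; rewrite upd_ne.
move=> /(_ hh); congr PA; apply/funext => w; rewrite /beta mulrC; congr (_ * F _).
by apply/rowP => i; rewrite !mxE; case: eqP => [->|//]; rewrite addrC.
Qed.

(** A weighted sample at [a] is the value at the origin of a translate with the same norm, so
    estimates at the origin suffice. *)
Lemma beta_at0 (a : V) (F : V -> C) : cabs2 (beta (- a) F 0) = cabs2 (F a) * gweight a.
Proof.
rewrite cabs2_beta sub0r opprK /wt /gweight; congr (_ * expR _).
rewrite cdotE big1 => [|i _]; last by rewrite !mxE mulr0.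
rewrite Re0 mulr0 sub0r mulNr; congr (- (_ * _)); apply: eq_bigr => i _; by rewrite mxE cabs2N.
Qed.

Lemma mDall : measurable_fun setT (@Dall R d).
Proof. exact: mDs. Qed.

Lemma lD_beta (a : V) (F : V -> C) : mC F -> lD (beta (- a) F) = (\int[gm]_y (Dall (y - a) * cabs2 (F y))%:E)%E.
Proof.
move=> mF; pose f (y : V) := (Dall (y - a) * cabs2 (F y))%:E : \bar R.
have mf : measurable_fun setT f.
  apply/measurable_EFinP; apply: measurable_funM; last exact: mabs2.
  exact: (measurableT_comp mDall (m_vshift _ (@measurable_id _ V setT))).
have f0 y : (0 <= f y)%E by rewrite lee_fin mulr_ge0 ?Ds_ge0 ?cabs2_ge0.
rewrite -(gm_shift (- a) mf f0); apply: eq_integral => z _.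
by rewrite /f cabs2_beta -EFinM mulrA opprK addrK.
Qed.
End PolyFockSP.

Section Count.
Variables (R : realType) (d : nat).
Local Notation C := (CC R).
Local Notation V := (cvec R d).
Local Notation gm := (gm R d).
Local Open Scope complex_scope.

Definition toC (l : rvec R d) : V := \row_j (xpart l j +i* wpart l j).
Definition Gam (A : 'M[R]_(d + d)) : set V := GammaOf (lattice A).
Definition mapZ (m : 'cV[int]_(d + d)) : 'cV[R]_(d + d) := map_mx (fun a : int => a%:~R) m.

Lemma GamP A v : Gam A v <-> exists m, v = toC (A *m mapZ m).
Proof.
split=> [[l [m ->] <-]|[m ->]]; first by exists m.
by exists (A *m mapZ m) => //; exists m.
Qed.

Lemma toC_bnd (l : rvec R d) M : (forall j, cn (toC l ord0 j) <= M) -> forall i, `|l i ord0| <= M.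
Proof.
move=> h i; case: (split_ordP i) => k ->.
  by apply: le_trans (h k); rewrite mxE; apply: le_trans (Re_cn _); rewrite /= /xpart.
by apply: le_trans (h k); rewrite mxE; apply: le_trans (Im_cn _); rewrite /= /wpart.
Qed.
Lemma toC_B (l m : rvec R d) : toC (l - m) = toC l - toC m.
Proof. by apply/rowP => j; rewrite !mxE /xpart /wpart !mxE; apply: Ceq; rewrite ?ReB ?ImB. Qed.

Lemma int_bnd_nat (a : int) (K : nat) : `|a%:~R| <= K%:R :> R -> (0 <= a + K%:Z)%R /\ (absz (a + K%:Z)%R < K.*2.+1)%N.
Proof.
rewrite -intr_norm -[K%:R](mulrz_nat) ler_int natz => h.
have h2 : - K%:Z <= a <= K%:Z by rewrite -ler_norml.
split; first by rewrite -lerBlDr sub0r; case/andP: h2.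
have : (0 <= a + K%:Z <= (K.*2)%:Z)%R.
  rewrite -addnn PoszD; case/andP: h2 => h3 h4; apply/andP; split; lra.
by case: (a + K%:Z) => // p /andP[_]; rewrite lez_nat ltnS.
Qed.

(** Two points within 2 of [z] in every coordinate differ by at most 4. Through [invmx A] their
    integer coordinates then differ by at most [K], and the differences with [v0] embed [S] into a
    fixed finite set. *)
Lemma lattice_count A : A \in unitmx -> exists N : nat, forall (S : seq V) (z : V), uniq S ->
  (forall v, v \in S -> Gam A v) -> (forall v j, v \in S -> cn (z ord0 j - v ord0 j) <= 2) -> (size S <= N)%N.
Proof.
move=> uA; pose Kr : R := 4 * \sum_i \sum_j `|invmx A i j|.
have Kr0 : 0 <= Kr by rewrite mulr_ge0 // sumr_ge0 // => i _; rewrite sumr_ge0.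
pose K := (Num.truncn Kr).+1.
have KrK : Kr <= K%:R by apply/ltW; exact: truncnS_gt.
exists #|{ffun 'I_(d + d) -> 'I_(K.*2.+1)}| => -[|v0 S] z uS GS zS; first by [].
have /choice[m hm] : forall v, exists m, v \in v0 :: S -> v = toC (A *m mapZ m).
  move=> v; case: (boolP (v \in v0 :: S)) => [/GS/GamP[m e]|_]; first by exists m.
  by exists 0.
pose f v : {ffun 'I_(d + d) -> 'I_(K.*2.+1)} := [ffun i => inord (absz (m v i ord0 - m v0 i ord0 + K%:Z)%R)].
have v0S : v0 \in v0 :: S by rewrite inE eqxx.
have bnd v i : v \in v0 :: S -> `|(m v i ord0 - m v0 i ord0)%:~R| <= K%:R :> R.
  move=> vS; apply: le_trans KrK.
  pose l := A *m mapZ (m v) - A *m mapZ (m v0).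
  have lb k : `|l k ord0| <= 4.
    apply: toC_bnd => j; rewrite toC_B -hm // -hm // !mxE.
    have -> : v ord0 j - v0 ord0 j = (z ord0 j - v0 ord0 j) - (z ord0 j - v ord0 j) by ring.
    apply: le_trans (cnD _ _) _; rewrite cnN; have := zS v j vS; have := zS v0 j v0S.
    move: (cn _) (cn _) => a b; lra.
  have -> : (m v i ord0 - m v0 i ord0)%:~R = (invmx A *m l) i ord0 :> R.
    by rewrite /l -mulmxBr mulKmx // !mxE rmorphB.
  rewrite mxE; apply: le_trans (ler_norm_sum _ _ _) _.
  apply: (@le_trans _ _ (4 * \sum_j `|invmx A i j|)).
    rewrite mulr_sumr; apply: ler_sum => k _; rewrite normrM mulrC.
    by apply: ler_pM.
  by rewrite /Kr ler_wpM2l // [leRHS](bigD1 i) //= lerDl sumr_ge0 // => k _; rewrite sumr_ge0.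
have fi : {in v0 :: S &, injective f}.
  move=> u v uS' vS' e; rewrite (hm u uS') (hm v vS'); congr (toC (A *m mapZ _)).
  apply/colP => i; have := congr1 (fun g : {ffun _ -> _} => val (g i)) e; rewrite !ffunE.
  have [u1 u2] := int_bnd_nat (bnd u i uS'); have [w1 w2] := int_bnd_nat (bnd v i vS').
  rewrite /= !inordK // => /(congr1 Posz); rewrite !gez0_abs // => /addIr /addIr //.
rewrite -(size_map f); have /card_uniqP <- : uniq (map f (v0 :: S)) by rewrite map_inj_in_uniq.
exact: max_card.
Qed.

Lemma DallE (z : V) : Dall z = [forall j, cabs2 (z ord0 j) < 4]%:R.
Proof.
rewrite /Dall /Ds big_enum /=; case: forallP => [h|h].
  by rewrite big1 // => j _; rewrite discP // h.
have [j hj] : exists j, ~~ (cabs2 (z ord0 j) < 4) by apply/existsP; rewrite -negb_forall; apply/forallP.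
by rewrite (bigD1 j) //= discP // (negPf hj) mul0r.
Qed.

Lemma Dall_count A : A \in unitmx -> exists N : nat, forall (S : seq V) (z : V), uniq S ->
  (forall v, v \in S -> Gam A v) -> \sum_(v <- S) Dall (z - v) <= N%:R.
Proof.
move=> uA; have [N hN] := lattice_count uA; exists N => S z uS GS.
pose p v := [forall j, cabs2 ((z - v) ord0 j) < 4].
rewrite (eq_bigr (fun v => (p v)%:R)) => [|v _]; last by rewrite DallE.
rewrite -natr_sum ler_nat.
have -> : (\sum_(v <- S) p v = size [seq v <- S | p v])%N by rewrite size_filter -sum1_count [RHS]big_mkcond; apply: eq_bigr => v _; case: (p v).
apply: (hN _ z); first by rewrite filter_uniq.
  by move=> v; rewrite mem_filter => /andP[_ /GS].
move=> v j; rewrite mem_filter => /andP[/forallP/(_ j) h _].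
rewrite -(@ler_pXn2r _ 2) ?nnegrE ?cn_ge0 // cn_sqr; move: h; rewrite !mxE => /ltW h.
by apply: le_trans h _; rewrite expr2; lra.
Qed.

Variable n : 'I_d -> nat.
Hypothesis n0 : forall j, (0 < n j)%N.

Lemma sum_lD A : A \in unitmx -> exists2 N : R, 0 <= N & forall (S : seq V) (F : V -> C), uniq S ->
  (forall v, v \in S -> Gam A v) -> mC F ->
  (\sum_(v <- S) lD (beta (- v)%R F) <= N%:E * n2 gm F)%E.
Proof.
move=> uA; have [N hN] := Dall_count uA; exists N%:R => // S F uS GS mF.
have mf v : measurable_fun setT (fun y : V => (Dall (y - v) * cabs2 (F y))%:E).
  apply/measurable_EFinP; apply: measurable_funM; last exact: mabs2.
  exact: (measurableT_comp (@mDall R d) (m_vshift _ (@measurable_id _ V setT))).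
have f0 v (y : V) : (0 <= (Dall (y - v) * cabs2 (F y))%:E)%E by rewrite lee_fin mulr_ge0 ?Ds_ge0 ?cabs2_ge0.
rewrite (eq_bigr (fun v => \int[gm]_y (Dall (y - v) * cabs2 (F y))%:E)%E) => [|v _]; last exact: lD_beta.
rewrite -ge0_integral_sum // /n2 -(ge0_integralZl_EFin gm measurableT) //; last 2 first.
- by move=> y _; rewrite lee_fin cabs2_ge0.
- exact: mn2.
apply: ge0_le_int.
- exact: emeasurable_sum.
- by apply: emeasurable_funM; [exact: measurable_cst|exact: mn2].
- by move=> y; apply: sume_ge0.
move=> y; rewrite sumEFin lee_fin -mulr_suml ler_wpM2r ?cabs2_ge0 //; exact: hN.
Qed.

(** Each sample is controlled by the local norm of a translate, and the corresponding regions around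
    lattice points overlap a bounded number of times ([Dall_count]). *)
Lemma bessel A : A \in unitmx -> exists2 B : R, 0 <= B & forall (S : seq V) (F : V -> C), uniq S ->
  (forall v, v \in S -> Gam A v) -> SP n F ->
  ((\sum_(v <- S) cabs2 (F v) * gweight v)%:E <= B%:E * n2 gm F)%E.
Proof.
move=> uA; have [N N0 hN] := sum_lD uA; have [B B0 hB] := local_bound R n0.
exists (B * N) => [|S F uS GS SF]; first exact: mulr_ge0.
rewrite EFinM -muleA; apply: (@le_trans _ _ (B%:E * \sum_(v <- S) lD (beta (- v)%R F))%E); last first.
  by rewrite lee_wpmul2l ?lee_fin // hN //; exact: SP_mC SF.
rewrite ge0_sume_distrr => [|v _]; last exact: lD_ge0.
rewrite -sumEFin; apply: lee_sum => v _; rewrite -beta_at0.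
by apply: hB; [exact: SP_beta|move=> j; rewrite mxE cn0].
Qed.

(** As in [bessel], with [local_diff] in place of [local_bound]. The factor [vnorm2 h] allows
    samples to be moved by a small [h] at a cost that can be absorbed. *)
Lemma bessel_diff A : A \in unitmx -> exists2 B : R, 0 <= B & forall (S : seq V) (F : V -> C) (h : V), uniq S ->
  (forall v, v \in S -> Gam A v) -> SP n F -> (forall j, cn (h ord0 j) <= 1) ->
  ((\sum_(v <- S) cabs2 (beta (- v) F h - beta (- v) F 0))%:E <= (B * vnorm2 h)%:E * n2 gm F)%E.
Proof.
move=> uA; have [N N0 hN] := sum_lD uA; have [D D0 hD] := local_diff R n0.
exists (D * N) => [|S F h uS GS SF h1]; first exact: mulr_ge0.
rewrite mulrAC EFinM -muleA; apply: (@le_trans _ _ ((D * vnorm2 h)%:E * \sum_(v <- S) lD (beta (- v)%R F))%E); last first.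
  by rewrite lee_wpmul2l ?lee_fin ?mulr_ge0 ?vnorm2_ge0 // hN //; exact: SP_mC SF.
rewrite ge0_sume_distrr => [|v _]; last exact: lD_ge0.
rewrite -sumEFin; apply: lee_sum => v _.
by apply: hD; [exact: SP_beta|].
Qed.
End Count.

Lemma cancel2 (K : comNzRingType) (x y u w s v : K) : x * y = 1 -> u * w = 1 ->
  s * v = x * (u * v * y * (s * w)).
Proof.
move=> h1 h2; have -> : x * (u * v * y * (s * w)) = (x * y) * (u * w) * (s * v) by ring.
by rewrite h1 h2 !mul1r.
Qed.

(** * The reproducing property *)
Section ExpCoef.
Variable R : realType.
Local Notation C := (CC R).
Local Notation U := (@U R).
Local Notation ei := (@ei R).
Local Open Scope complex_scope.

Lemma coefk_ci (f : C -> C) k : hol f -> ci U (fun t => f (1 * ei t) * cexp (- k%:R * (t%:C * tau R))).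
Proof. by move=> hf; apply: contC_ci; exact: contC_hol_exp. Qed.
Lemma coefkB (f g : C -> C) k : hol f -> hol g -> coefk (fun z => f z - g z) k = coefk f k - coefk g k.
Proof.
move=> hf hg; rewrite /coefk /Ic -cIB; [|exact: coefk_ci|exact: coefk_ci].
by apply: eq_cI => t; rewrite mulrBl.
Qed.
Lemma coefkZ (f : C -> C) c k : hol f -> coefk (fun z => c * f z) k = c * coefk f k.
Proof.
move=> hf; rewrite /coefk /Ic -cIZ; last exact: coefk_ci.
by apply: eq_cI => t; rewrite mulrA.
Qed.
Lemma ei_cexp (t : R) : ei t = cexp (t%:C * tau R). Proof. by []. Qed.
Lemma coefk_mulX (f : C -> C) k : coefk (fun z => z * f z) k.+1 = coefk f k.
Proof.
apply: eq_cI => t; rewrite mul1r mulrAC mulrC; congr (_ * _).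
rewrite ei_cexp -cexpD; congr cexp; rewrite -natr1; move: (k%:R) (t%:C * _) => a b; ring.
Qed.
Lemma coefk_scale (f : C -> C) c k : hol f -> coefk (fun z => f (c * z)) k = c ^+ k * coefk f k.
Proof.
move=> hf; rewrite mulrC -Ic_pos //; by apply: eq_cI => t; rewrite mul1r.
Qed.

Lemma pow1h (h : R) q : 0 <= h <= 1 -> `|(1 + h) ^+ q - 1 - q%:R * h| <= 4 ^+ q * h ^+ 2.
Proof.
move=> /andP[h0 h1]; elim: q => [|q IH]; first by rewrite expr0 subrr mul0r subr0 normr0 mul1r sqr_ge0.
rewrite exprS (_ : (1 + h) * _ - 1 - _ = (1 + h) * ((1 + h) ^+ q - 1 - q%:R * h) + q%:R * h ^+ 2); last first.
  by rewrite -natr1; move: ((1 + h) ^+ q) (q%:R) => a b; ring.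
apply: le_trans (ler_normD _ _) _; rewrite normrM (ger0_norm (_ : 0 <= 1 + h)); last by rewrite addr_ge0.
rewrite (ger0_norm (_ : 0 <= q%:R * h ^+ 2)); last by rewrite mulr_ge0 ?sqr_ge0.
have q4 : q%:R <= 4 ^+ q :> R by rewrite -natrX ler_nat; apply/ltnW/ltn_expl.
have s0 : 0 <= h ^+ 2 by exact: sqr_ge0.
have : (1 + h) * `|(1 + h) ^+ q - 1 - q%:R * h| <= 2 * (4 ^+ q * h ^+ 2).
  by apply: ler_pM => //; lra.
have : q%:R * h ^+ 2 <= 4 ^+ q * h ^+ 2 by rewrite ler_wpM2r.
have : 0 <= 4 ^+ q * h ^+ 2 by rewrite mulr_ge0 // exprn_ge0.
rewrite [4 ^+ q.+1]exprS -[4 * _ * _]mulrA; move: (4 ^+ q * _) (q%:R * _) (_ * `|_|) => a b c; lra.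
Qed.

(** The differential equation of the exponential, read on coefficients. On the unit circle
    [cexp ((1 + h) * z) - cexp z] is [h * z * cexp z] up to an error small compared with [h]. On the
    left the coefficient of degree [q.+1] is multiplied by [(1 + h) ^+ q.+1 - 1], and on the right
    it is that of degree [q]. *)
Lemma coefk_expS q : q.+1%:R * coefk (@cexp R) q.+1 = coefk (@cexp R) q.
Proof.
have hx := @hol_exp R.
have M1 w : cn w = 1 -> cn (@cexp R w) <= expR 1.
  by move=> w1; rewrite cn_cexp ler_expR -w1; apply: le_trans (ler_norm _) (Re_cn _).
set b := coefk _ _; set b' := coefk _ _.
apply/eqP; rewrite -subr_eq0; apply/eqP/cn0_eq0/eqP; rewrite eq_le cn_ge0 andbT.
apply/ler_addgt0Pr => e e0; rewrite add0r.
have e10 : 0 < e / 2 / expR 1 by rewrite !divr_gt0 ?expR_gt0.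
have [r r0 hr] := @cexp_cdiff0 R _ e10.
have p0 : 0 < 4 ^+ q.+1 * (cn b + 1) by rewrite mulr_gt0 ?exprn_gt0 // ltr_wpDl ?cn_ge0.
pose h := Num.min (Num.min 1 (r / 2)) (e / 2 / (4 ^+ q.+1 * (cn b + 1))).
have h0 : 0 < h by rewrite !lt_min ltr01 !divr_gt0.
have h1 : h <= 1 by rewrite !ge_min lexx.
have hlr : h < r.
  apply: le_lt_trans (_ : h <= r / 2) _; first by rewrite !ge_min lexx orbT.
  by rewrite ltr_pdivrMr // ltr_pMr // ltr1n.
have hb : h * (4 ^+ q.+1 * (cn b + 1)) <= e / 2 by rewrite -ler_pdivlMr // ge_min lexx orbT.
have hh : hol (fun z : C => h%:C * z) by apply: holM; [exact: hol_cst|exact: hol_id].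
pose g (z : C) := cexp ((1 + h)%:C * z) - cexp z - h%:C * (z * cexp z).
have g1h : hol (fun z : C => cexp ((1 + h)%:C * z)).
  by apply: (hol_comp hx); apply: holM; [exact: hol_cst|exact: hol_id].
have zx : hol (fun z : C => z * cexp z) by apply: holM => //; exact: hol_id.
have s1 : hol (fun z : C => cexp ((1 + h)%:C * z) - cexp z).
  rewrite (_ : (fun _ => _) = (fun z : C => cexp ((1 + h)%:C * z) + (-1) * cexp z)); last by apply/funext => z; rewrite mulN1r.
  by apply: holD => //; apply: holM => //; exact: hol_cst.
have s2 : hol (fun z : C => h%:C * (z * cexp z)) by apply: holM => //; exact: hol_cst.
have hg : hol g.
  rewrite (_ : g = (fun z : C => (cexp ((1 + h)%:C * z) - cexp z) + (-1) * (h%:C * (z * cexp z)))); last by apply/funext => z; rewrite mulN1r.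
  by apply: holD => //; apply: holM => //; exact: hol_cst.
have eg : coefk g q.+1 = (((1 + h) ^+ q.+1 - 1)%:C * b - h%:C * b').
  rewrite coefkB // coefkB // coefkZ // coefk_mulX coefk_scale // realCB realCX.
  by rewrite /b /b'; move: (coefk _ _) (coefk _ _) => x y; rewrite (_ : (1%:C : C) = 1) //; ring.
have gb w : cn w = 1 -> cn (g w) <= e / 2 * h.
  move=> w1; have -> : g w = cexp w * (cexp (0 + h%:C * w) - cexp 0 - 1 * (h%:C * w)).
    by rewrite /g realCD mulrDl cexpD cexp0 add0r mul1r (_ : (1%:C : C) * w = w) ?mul1r //; ring.
  have hw : cn (h%:C * w) = h by rewrite cnM w1 mulr1 cn_real // ltW.
  rewrite cnM; have := hr (h%:C * w); rewrite hw => /(_ hlr) k.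
  apply: le_trans (ler_pM (cn_ge0 _) (cn_ge0 _) (M1 w w1) k) _.
  rewrite le_eqVlt; apply/orP; left; apply/eqP.
  have : expR 1 != 0 :> R by rewrite gt_eqF // expR_gt0.
  by move: (expR 1) => x x0; field.
have := coefk_bnd q.+1 hg gb; rewrite eg => k1.
have k2 : cn ((q.+1%:R * h)%:C * b - h%:C * b') <= e * h.
  have -> : (q.+1%:R * h)%:C * b - h%:C * b' = (((1 + h) ^+ q.+1 - 1)%:C * b - h%:C * b') -
     ((1 + h) ^+ q.+1 - 1 - q.+1%:R * h)%:C * b.
    by rewrite [in X in _ = _ - X]realCB; ring.
  apply: le_trans (cnD _ _) _; rewrite cnN [X in _ + X]cnM cnR.
  have k3 := @pow1h h q.+1 _; rewrite (ltW h0) h1 in k3; move/(_ isT) in k3.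
  have : `|(1 + h) ^+ q.+1 - 1 - q.+1%:R * h| * cn b <= h * (h * (4 ^+ q.+1 * (cn b + 1))).
    apply: (@le_trans _ _ (4 ^+ q.+1 * h ^+ 2 * (cn b + 1))).
      by apply: ler_pM; rewrite ?cn_ge0 // lerDl.
    by rewrite le_eqVlt; apply/orP; left; apply/eqP; ring.
  have : h * (h * (4 ^+ q.+1 * (cn b + 1))) <= h * (e / 2) by rewrite ler_wpM2l // ltW.
  move: k1; move: (cn (_ - _)) (_ * cn b) (h * (h * _)) => x y z; lra.
have : h * cn (q.+1%:R * b - b') <= h * e.
  rewrite -[X in X * _](cn_real (ltW h0)) -cnM mulrC [h * e]mulrC.
  by apply: le_trans k2; rewrite le_eqVlt; apply/orP; left; apply/eqP; congr cn; rewrite realCM realCnat; ring.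
by rewrite ler_pM2l.
Qed.

Lemma coefk_exp q : coefk (@cexp R) q = (q`!%:R)^-1.
Proof.
elim: q => [|q IH]; first by rewrite coefk0 ?cexp0 ?fact0 ?invr1 //; exact: hol_exp.
have q0 : q.+1%:R != 0 :> C by rewrite pnatr_eq0.
apply: (mulfI q0); rewrite coefk_expS IH factS natrM invfM mulrA divff // mul1r //.
Qed.
End ExpCoef.

(** * Gaussian integrals of functions of exponential growth *)

Section Growth.
Variable R : realType.
Local Notation C := (CC R).
Local Notation U := (@U R).
Local Notation ei := (@ei R).
Local Notation g1 := (@g1 R).
Local Notation R2 := (measurableTypeR R * measurableTypeR R)%type.
Local Notation emb2 := (@emb2 R).
Local Open Scope complex_scope.

(** A class stable under sums, products, conjugation and translation whose members are integrable
    against the Gaussian; it contains every one-variable function integrated below. *)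
Definition E1 (f : C -> C) := mC (fun p : R2 => f (emb2 p)) /\
  exists A B, [/\ 0 <= A, 0 <= B & forall w, cn (f w) <= A * expR (B * cn w)].

Lemma E1_cst c : E1 (fun=> c).
Proof.
split; first exact: mC_cst.
by exists (cn c), 0; split => [||w]; rewrite ?cn_ge0 // mul0r expR0 mulr1.
Qed.
Lemma E1_id : E1 (fun z => z).
Proof.
split; first exact: (@m_emb2 R).
exists 1, 1; split => [||w] //; rewrite !mul1r.
by apply: le_trans (expR_ge1Dx (cn w)); rewrite lerDr.
Qed.
Lemma E1D f g : E1 f -> E1 g -> E1 (fun z => f z + g z).
Proof.
move=> [mf [A [B [A0 B0 hf]]]] [mg [A' [B' [A0' B0' hg]]]]; split; first exact: mCD.
exists (A + A'), (B + B'); split => [||w]; rewrite ?addr_ge0 //.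
apply: le_trans (cnD _ _) _; rewrite mulrDl; apply: lerD.
  apply: le_trans (hf w) _; rewrite ler_wpM2l // ler_expR ler_wpM2r ?cn_ge0 // lerDl //.
apply: le_trans (hg w) _; rewrite ler_wpM2l // ler_expR ler_wpM2r ?cn_ge0 // lerDr //.
Qed.
Lemma E1M f g : E1 f -> E1 g -> E1 (fun z => f z * g z).
Proof.
move=> [mf [A [B [A0 B0 hf]]]] [mg [A' [B' [A0' B0' hg]]]]; split; first exact: mCM.
exists (A * A'), (B + B'); split => [||w]; rewrite ?addr_ge0 ?mulr_ge0 //.
by rewrite cnM mulrDl expRD mulrACA; apply: ler_pM; rewrite ?cn_ge0.
Qed.
Lemma E1J f : E1 f -> E1 (fun z => cj (f z)).
Proof.
by move=> [mf [A [B [A0 B0 hf]]]]; split; [exact: mCJ|exists A, B; split => // w; rewrite cnJ].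
Qed.
Lemma E1X f k : E1 f -> E1 (fun z => f z ^+ k).
Proof.
move=> ef; elim: k => [|k IH]; first exact: E1_cst.
have := E1M ef IH; congr E1; apply/funext => z; by rewrite exprS.
Qed.
Lemma E1_sum (I : Type) (s : seq I) (h : I -> C -> C) : (forall i, E1 (h i)) ->
  E1 (fun z => \sum_(i <- s) h i z).
Proof.
move=> eh; elim: s => [|i s IH].
  by have := E1_cst 0; congr E1; apply/funext => z; rewrite big_nil.
by have := E1D (eh i) IH; congr E1; apply/funext => z; rewrite big_cons.
Qed.
Lemma E1_exp c : E1 (fun z => cexp (c * z)).
Proof.
split; first by apply: mC_exp; apply: mCM; [exact: mC_cst|exact: (@m_emb2 R)].
exists 1, (cn c); split => [||w]; rewrite ?cn_ge0 // mul1r cn_cexp ler_expR -cnM.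
exact: le_trans (ler_norm _) (Re_cn _).
Qed.
Lemma E1_shift f a : E1 f -> E1 (fun z => f (a + z)).
Proof.
move=> [mf [A [B [A0 B0 hf]]]]; split.
  have m1 : mC (fun p : R2 => a + emb2 p) by apply: mCD; [exact: mC_cst|exact: (@m_emb2 R)].
  case: m1 => x y; have := mC_comp mf (m_pair x y); congr mC; apply/funext => p /=; by rewrite emb2K.
exists (A * expR (B * cn a)), B; split => [||w] //; first by rewrite mulr_ge0 ?expR_ge0.
by apply: le_trans (hf _) _; rewrite -mulrA ler_wpM2l // -expRD ler_expR -mulrDr ler_wpM2l // cnD.
Qed.

Lemma int_wt1 a : (\int[g1]_p (wt1 a (emb2 p))%:E = 1)%E.
Proof.
have := @g1_shift R a (fun=> 1%E) (measurable_cst _) (fun _ => lee01).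
rewrite (_ : \int[g1]_p 1 = 1)%E; last first.
  by rewrite -[RHS]mule1 -(@probability_setT _ _ _ g1); exact: integral_cst.
by move=> <-; apply: eq_integral => p _; rewrite mul1e.
Qed.

(** The exponential of [B * cn w] is bounded by a product of two hyperbolic cosines, hence by a
    constant times four translation weights [wt1] at the corners of a square. Each weight has
    integral 1 by [int_wt1]. *)
Lemma expB_ci (B : R) : 0 <= B -> (\int[g1]_p (expR (B * cn (emb2 p)))%:E < +oo)%E.
Proof.
move=> B0; pose b := B / (2 * pi).
have pi0 : 0 < pi :> R by exact: pi_gt0.
pose a1 : C := b +i* b; pose a2 : C := b +i* (- b); pose a3 : C := (- b) +i* b; pose a4 : C := (- b) +i* (- b).
pose W (p : R2) : \bar R := ((wt1 a1 (emb2 p))%:E + (wt1 a2 (emb2 p))%:E + ((wt1 a3 (emb2 p))%:E + (wt1 a4 (emb2 p))%:E))%E.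
have [k kE] : {k | k = pi * (b ^+ 2 + b ^+ 2)} by eexists.
pose K := expR k.
have wE (x y u v : R) : wt1 (u +i* v) (emb2 (x, y)) = expR (2 * pi * (u * x + v * y)) * expR (- (pi * (u ^+ 2 + v ^+ 2))).
  by rewrite /wt1 -expRD ReM ReJ ImJ /cabs2 /=; congr expR; ring.
have m_ a : measurable_fun setT (fun p : R2 => (wt1 a (emb2 p))%:E) by apply/measurable_EFinP; exact: mwt1.
have n_ a (p : R2) : (0 <= (wt1 a (emb2 p))%:E)%E by rewrite lee_fin expR_ge0.
apply: (@le_lt_trans _ _ (\int[g1]_p (K%:E * W p))%E).
  apply: ge0_le_int.
  - by apply/measurable_EFinP; apply: measurableT_comp => //; apply: measurable_funM => //; apply: mcn; exact: (@m_emb2 R).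
  - by apply: emeasurable_funM; [exact: measurable_cst|do 2 apply: emeasurable_funD => //].
  - by move=> p; rewrite lee_fin expR_ge0.
  - move=> [x y]; rewrite /W -!EFinD -EFinM lee_fin !wE !sqrrN -!kE -!mulrDl mulrCA [expR (- k)]expRN -/K divff ?gt_eqF ?expR_gt0 // mulr1.
    have e2 u v : 2 * pi * (u * x + v * y) = 2 * pi * u * x + 2 * pi * v * y by ring.
    have bE : 2 * pi * b = B.
      by rewrite /b mulrC divfK // mulf_neq0 ?pnatr_eq0 // gt_eqF.
    rewrite !e2 !expRD mulrN bE.
    have ex (c : R) : expR (B * `|c|) <= expR (B * c) + expR (- B * c).
      have [h|h] := lerP 0 c; [rewrite ger0_norm // lerDl|rewrite ltr0_norm // mulrN -mulNr lerDr]; exact: expR_ge0.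
    apply: (@le_trans _ _ (expR (B * `|x|) * expR (B * `|y|))).
      by rewrite -expRD ler_expR -mulrDr ler_wpM2l // cn_ReIm.
    apply: (le_trans (ler_pM _ _ (ex x) (ex y))); rewrite ?expR_ge0 //.
    by rewrite le_eqVlt; apply/orP; left; apply/eqP; ring.
rewrite (ge0_integralZl_EFin g1 measurableT) ?expR_ge0 //; last 2 first.
- by move=> p _; rewrite !adde_ge0.
- by do 2 apply: emeasurable_funD => //.
rewrite ge0_integralD //; [|by move=> p _; rewrite adde_ge0|by apply: emeasurable_funD|by move=> p _; rewrite adde_ge0|by apply: emeasurable_funD].
by rewrite !ge0_integralD // !int_wt1 -!EFinD -EFinM ltry.
Qed.

Lemma E1_ci f : E1 f -> ci g1 (fun p => f (emb2 p)).
Proof.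
move=> [mf [A [B [A0 B0 hf]]]]; split => //.
have mB : measurable_fun setT (fun p : R2 => (expR (B * cn (emb2 p)))%:E).
  by apply/measurable_EFinP; apply: measurableT_comp => //; apply: measurable_funM => //; apply: mcn; exact: (@m_emb2 R).
apply: (@le_lt_trans _ _ (\int[g1]_p (A%:E * (expR (B * cn (emb2 p)))%:E))%E).
  apply: ge0_le_int; [by apply/measurable_EFinP; exact: mcn|by apply: emeasurable_funM; [exact: measurable_cst|]| |].
    by move=> p; rewrite lee_fin cn_ge0.
  by move=> p; rewrite -EFinM lee_fin.
have -> : (\int[g1]_p (A%:E * (expR (B * cn (emb2 p)))%:E) = A%:E * \int[g1]_p (expR (B * cn (emb2 p)))%:E)%E.
  by apply: ge0_integralZl_EFin => // p _; rewrite lee_fin expR_ge0.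
have := expB_ci B0; rewrite -ge0_fin_numE => [h|]; last by apply: integral_ge0 => p _; rewrite lee_fin expR_ge0.
by rewrite -(fineK h) -EFinM ltry.
Qed.

Lemma cI_circ (f : C -> C) : E1 f -> cI g1 (fun p => f (emb2 p)) =
  cI g1 (fun p => cI U (fun t => f (emb2 p * ei t))).
Proof.
move=> ef; have [mf [A [B [A0 B0 hf]]]] := ef.
pose c := cI g1 (fun p => f (emb2 p)).
have h t : cI g1 (fun p => f (emb2 p * ei t)) = c.
  rewrite /c; apply: (etrans _ (@cI_g1_rot R (ei t) f (cabs2_ei t) mf (E1_ci ef))).
  by apply: eq_cI => p; rewrite mulrC.
transitivity (cI U (fun t => cI g1 (fun p => f (emb2 p * ei t)))).
  by rewrite -[LHS](cI_cst U); apply: eq_cI => t; rewrite h.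
have mj d (T : measurableType d) (a : T -> R2) (b : T -> measurableTypeR R) : measurable_fun setT a -> measurable_fun setT b ->
  mC (fun x => f (emb2 (a x) * ei (b x))).
  move=> ma mb; have [x y] : mC (fun x => emb2 (a x) * ei (b x)).
    by apply: mCM; [exact: (mC_comp (@m_emb2 R) ma)|exact: (mC_comp (@mC_ei R) mb)].
  have := mC_comp mf (m_pair x y); congr mC; apply/funext => p /=; by rewrite emb2K.
have hM p t : cn (f (emb2 p * ei t)) <= A * expR (B * cn (emb2 p)).
  by have := hf (emb2 p * ei t); rewrite cnM cn_ei mulr1.
have cB : ci g1 (fun p => (A * expR (B * cn (emb2 p)))%:C).
  apply: (E1_ci (f := fun w => (A * expR (B * cn w))%:C)); split.
    by apply: mC_real; apply: measurable_funM => //; apply: measurableT_comp => //; apply: measurable_funM => //; apply: mcn; exact: (@m_emb2 R).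
  by exists A, B; split => // w; rewrite cn_real // mulr_ge0 ?expR_ge0.
have s1 t : (\int[g1]_p (cn (f (emb2 p * ei t)))%:E <= \int[g1]_p (A * expR (B * cn (emb2 p)))%:E)%E.
  apply: ge0_le_int.
  - apply/measurable_EFinP; apply: mcn; exact: (mj _ _ id (fun=> t) (@measurable_id _ R2 setT) (measurable_cst _)).
  - by case: cB => -[m _] _; apply/measurable_EFinP; exact: m.
  - by move=> p; rewrite lee_fin cn_ge0.
  - by move=> p; rewrite lee_fin.
have fin : (\int[g1]_p (A * expR (B * cn (emb2 p)))%:E < +oo)%E.
  case: cB => _; congr (_ < _)%E; apply: eq_integral => p _; by rewrite cn_real // mulr_ge0 ?expR_ge0.
rewrite (@cI_fub _ _ _ _ _ U g1 (fun q => f (emb2 q.2 * ei q.1))) //.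
- exact: mj measurable_snd measurable_fst.
- move=> t /=; split; last exact: le_lt_trans (s1 t) fin.
  exact: (mj _ _ id (fun=> t) (@measurable_id _ R2 setT) (measurable_cst _)).
- move=> p /=; apply: (@ci_bnd _ _ _ _ _ (A * expR (B * cn (emb2 p)))); last by move=> t; exact: hM.
  exact: (mj _ _ (fun=> p) id (measurable_cst _) (@measurable_id _ (measurableTypeR R) setT)).
apply: le_lt_trans fin; set I := (X in (_ <= X)%E).
apply: (@le_trans _ _ (\int[U]_t I)%E); last first.
  rewrite (_ : \int[U]_t I = I)%E //.
  have I0 : (0 <= I)%E by apply: integral_ge0 => p _; rewrite lee_fin mulr_ge0 ?expR_ge0.
  by rewrite -[RHS]mule1 -(@probability_setT _ _ _ U); exact: integral_cst.
apply: ge0_le_int; [| exact: measurable_cst | | exact: s1].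
  have mn : measurable_fun setT (fun q : measurableTypeR R * R2 => (cn (f (emb2 q.2 * ei q.1)))%:E).
    by apply/measurable_EFinP; apply: mcn; exact: mj measurable_snd measurable_fst.
  by have := @mI2 _ _ _ _ R g1 _ mn; apply => q; rewrite lee_fin cn_ge0.
by move=> t; apply: integral_ge0 => p _; rewrite lee_fin cn_ge0.
Qed.

Definition mq q : C := cI g1 (fun p => (cabs2 (emb2 p) ^+ q)%:C).

(** Averaging over circles first isolates one Taylor coefficient; the remaining radial integral is
    the moment [mq]. *)
Lemma int_hol_bar (f : C -> C) q : hol f -> E1 f ->
  cI g1 (fun p => f (emb2 p) * cj (emb2 p) ^+ q) = coefk f q * mq q.
Proof.
move=> hf ef; pose F w := f w * cj w ^+ q.
have eF : E1 F by apply: E1M ef _; apply: E1X; apply: E1J; exact: E1_id.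
rewrite (cI_circ eF) /mq -cIZ; last first.
  have : E1 (fun w => w ^+ q * cj w ^+ q).
    by apply: E1M; [exact: E1X E1_id|apply: E1X; apply: E1J; exact: E1_id].
  by move/E1_ci; congr ci; apply/funext => p; rewrite -exprMn mulJ realCX.
apply: eq_cI => p; rewrite [RHS]mulrC -circ_coefJ //; apply: eq_cI => t; by rewrite /F mulrC.
Qed.

Lemma mq0 : mq 0 = 1.
Proof. by rewrite -[RHS](cI_cst g1); apply: eq_cI => p; rewrite expr0. Qed.

Lemma mean0 (f : C -> C) : hol f -> E1 f -> cI g1 (fun p => f (emb2 p)) = f 0.
Proof.
move=> hf ef; have := int_hol_bar 0 hf ef; rewrite mq0 mulr1 coefk0 // => <-.
by apply: eq_cI => p; rewrite expr0 mulr1.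
Qed.

Lemma wt1E (a z : C) : (wt1 a z)%:C = cexp (pi%:C * (cj a * z)) * cexp (pi%:C * a * cj z) * cexp (- (pi * cabs2 a)%:C).
Proof.
rewrite -!cexpD /wt1 -cexp_real; congr cexp.
by apply: Ceq; rewrite !(ReD, ImD, ReN, ImN, ReM, ImM, ReJ, ImJ, ReR, ImR); ring.
Qed.

(** By [wt1E] the antiholomorphic exponential is, up to a constant and a holomorphic exponential,
    the translation weight. Translating by [a] therefore trades it for a holomorphic factor. *)
Lemma shift_int (a : C) (F : C -> C) : E1 F ->
  cI g1 (fun p => F (emb2 p) * cexp (pi%:C * a * cj (emb2 p))) =
  cexp ((pi * cabs2 a)%:C) * cI g1 (fun p => F (a + emb2 p) * cexp (- (pi%:C * cj a) * (a + emb2 p))).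
Proof.
move=> eF; pose G w := F (a + w) * cexp (- (pi%:C * cj a) * (a + w)).
have eG : E1 G.
  by apply: E1M; [exact: E1_shift|exact: (E1_shift (f := fun z => cexp (- (pi%:C * cj a) * z)) a (E1_exp _))].
have [c1 e1] := cI_g1_shift a (proj1 eG) (E1_ci eG).
rewrite -e1 -cIZ //; apply: eq_cI => p; rewrite /G subrKC wt1E.
have k1 : cexp ((pi * cabs2 a)%:C) * cexp (- (pi * cabs2 a)%:C) = 1 :> C by rewrite mulrC cexpN.
have k2 : cexp (pi%:C * (cj a * emb2 p)) * cexp (- (pi%:C * cj a) * emb2 p) = 1 :> C.
  by rewrite mulNr mulrA mulrC cexpN.
exact: (cancel2 _ _ k1 k2).
Qed.

(** After [shift_int] the integrand is holomorphic, so its mean is its value at 0, where the two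
    exponentials cancel. *)
Lemma reproducing (a : C) (f : C -> C) : hol f -> E1 f ->
  cI g1 (fun p => f (emb2 p) * cexp (pi%:C * a * cj (emb2 p))) = f a.
Proof.
move=> hf ef; rewrite shift_int //.
rewrite (mean0 (f := fun w => f (a + w) * cexp (- (pi%:C * cj a) * (a + w)))).
- rewrite addr0 (_ : - (pi%:C * cj a) * a = - (pi * cabs2 a)%:C); last first.
    by rewrite realCM -mulJ mulNr -mulrA [cj a * a]mulrC.
  by rewrite mulrCA [X in _ * X]mulrC cexpN mulr1.
- apply: holM; first exact: hol_shift.
  apply: (hol_shift (f := fun z => cexp (- (pi%:C * cj a) * z)) a).
  by apply: (hol_comp (@hol_exp R)); apply: holM; [exact: hol_cst|exact: hol_id].
- by apply: E1M; [exact: E1_shift|exact: (E1_shift (f := fun z => cexp (- (pi%:C * cj a) * z)) a (E1_exp _))].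
Qed.

(** The moment is read off by integrating [z ^+ q] against the conjugate exponential in two ways:
    the reproducing property at the point 1 gives 1, and the Taylor coefficients of the exponential
    give [pi ^+ q / q!] times the moment. *)
Lemma mqE q : mq q = (q`!%:R / pi ^+ q)%:C.
Proof.
have e1 := @reproducing 1 (fun z => z ^+ q) (holX q (@hol_id R)) (E1X q E1_id).
have hx : hol (fun z : C => cexp (pi%:C * z)).
  by apply: (hol_comp (@hol_exp R)); apply: holM; [exact: hol_cst|exact: hol_id].
have := int_hol_bar q hx (E1_exp _).
rewrite (coefk_scale pi%:C q (@hol_exp R)) coefk_exp => e2.
have e3 : cj (pi%:C ^+ q / q`!%:R * mq q) = 1.
  rewrite -e2 -cIJ; last first.
    by apply: (E1_ci (f := fun w => cexp (pi%:C * w) * cj w ^+ q)); apply: E1M; [exact: E1_exp|apply: E1X; apply: E1J; exact: E1_id].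
  rewrite -[RHS](expr1n _ q) -e1; apply: eq_cI => p; rewrite JM JX JJ cexpJ JM JR mulr1 mulrC //.
have e4 : pi%:C ^+ q / q`!%:R * mq q = 1 by rewrite -[LHS]JJ e3 J1.
have p0 : pi%:C ^+ q != 0 :> C.
  by rewrite expf_neq0 // -[X in _ != X]/(0%:C) (inj_eq (@complexI R)) gt_eqF // pi_gt0.
have q0 : q`!%:R != 0 :> C by rewrite pnatr_eq0 -lt0n fact_gt0.
apply: (mulfI (_ : pi%:C ^+ q / q`!%:R != 0)); first by rewrite mulf_neq0 // invr_eq0.
rewrite e4 realCM realCV realCX realCnat.
by rewrite mulrA divfK // divff.
Qed.
End Growth.

(** * Complex Hermite polynomials as polynomials in two variables *)

Section PolyHermite.
Variables (K : comNzRingType) (p : K).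

(* Outer variable: the conjugate of z; inner variable: z. *)
Fixpoint Hp m k : {poly {poly K}} := if m is m'.+1 then 'X%:P * Hp m' k + ((k%:R * p)%:P)%:P * Hp m' k.-1 else (- 'X) ^+ k.
Fixpoint Hcp m k : {poly {poly K}} := if m is m'.+1 then 'X * Hcp m' k + ((k%:R * p)%:P)%:P * Hcp m' k.-1 else (- 'X%:P) ^+ k.
Lemma HS m k : Hp m.+1 k = 'X%:P * Hp m k + ((k%:R * p)%:P)%:P * Hp m k.-1. Proof. by []. Qed.
Lemma HcS m k : Hcp m.+1 k = 'X * Hcp m k + ((k%:R * p)%:P)%:P * Hcp m k.-1. Proof. by []. Qed.
Lemma polyCn (k : nat) : k%:R%:P%:P = k%:R :> {poly {poly K}}.
Proof. by rewrite !polyC_natr. Qed.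
Lemma polyCnp (k : nat) : (k%:R * p)%:P%:P = k%:R * p%:P%:P :> {poly {poly K}}.
Proof. by rewrite !polyCM polyCn. Qed.

(** [deriv] differentiates in the conjugate variable and lowers [k]. The integration by parts
    therefore never leaves this family of polynomials. *)
Lemma deriv_H m k : deriv (Hp m k) = - (k%:R * Hp m k.-1).
Proof.
elim: m k => [|m IH] k.
  rewrite (_ : Hp 0 k = (- 'X) ^+ k) // (_ : Hp 0 k.-1 = (- 'X) ^+ k.-1) //.
  by rewrite deriv_exp derivN derivX mulN1r mulNrn mulr_natl.
rewrite HS derivD 2!derivM 2!derivC !mul0r !add0r !IH polyCnp.
case: k => [|k]; first by rewrite !mul0r oppr0 mulr0 addr0.
rewrite HS polyCnp /=; move: (Hp m k) (Hp m k.-1) ('X%:P) (_%:P%:P) (k.+1%:R) (k%:R) => a b x c u v; ring.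
Qed.

Lemma deriv_Hc m k : deriv (Hcp m k) = m%:R * Hcp m.-1 k.
Proof.
elim: m k => [|m IH] k.
  by rewrite [Hcp 0 k]/(_ ^+ k) deriv_exp derivN derivC oppr0 !mul0r mul0rn.
rewrite HcS derivD 2!derivM derivX derivC mul0r add0r mul1r !IH /=.
case: m {IH} => [|m]; first by rewrite !mul0r !mulr0 !addr0 mul1r.
rewrite HcS -[m.+2%:R]natr1 -[m.+1.-1]/m.
by move: (Hcp m k) (Hcp m k.-1) ('X) (_%:P%:P) (m.+1%:R) => a b x c u; ring.
Qed.

Lemma deriv_HHc m k m' k' : deriv (Hp m k * Hcp m' k') =
  (- k%:R)%:P%:P * (Hp m k.-1 * Hcp m' k') + m'%:R%:P%:P * (Hp m k * Hcp m'.-1 k').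
Proof. by rewrite derivM deriv_H deriv_Hc !polyCN !polyCn !mulNr !mulrA [m'%:R * _]mulrC. Qed.

(** The polynomial factor in the inner product of two translated monomials; [w] will be the
    conjugate of the second centre. *)
Definition Qpp (v w : K) m m' : {poly {poly K}} := (('X - v%:P)%:P) ^+ m * ('X - w%:P%:P) ^+ m'.
Lemma QppS v w m m' : Qpp v w m.+1 m' = 'X%:P * Qpp v w m m' + (- v)%:P%:P * Qpp v w m m'.
Proof. by rewrite /Qpp exprS -mulrA polyCB mulrDl !polyCN. Qed.
Lemma deriv_Qpp v w m m' : deriv (Qpp v w m m') = m'%:R%:P%:P * Qpp v w m m'.-1.
Proof.
rewrite /Qpp -rmorphXn /= deriv_mulC deriv_exp derivB derivX derivC subr0 mul1r polyCn.
by rewrite -mulr_natl mulrCA.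
Qed.
End PolyHermite.

(** * Complex Hermite functions and the Moyal identity *)
Lemma alg_J (K : comNzRingType) (f x y n : K) : f * (x * y * n) = n * x * (f * y).
Proof. by ring. Qed.

Lemma alg_L (K : comNzRingType) (a p k m x y z : K) :
  a * x + p * (- k * y + m * z) + k * p * y = a * x + m * (p * z).
Proof. by ring. Qed.

Lemma alg_swap (K : comNzRingType) (z w p m k a b c e : K) :
  m * a = m * (z * b + k * p * c) -> k * a = k * (w * e + m * p * c) ->
  z * (w * a + m * p * b) + (k + 1) * p * a = w * (z * a + k * p * e) + (m + 1) * p * a.
Proof.
move=> e1 e2; apply/eqP; rewrite -subr_eq0; apply/eqP.
transitivity (p * (m * (z * b + k * p * c) - m * a) - p * (k * (w * e + m * p * c) - k * a)); first by ring.
by rewrite -e1 -e2 !subrr.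
Qed.

Section Hermite.
Variable R : realType.
Local Notation C := (CC R).
Local Notation g1 := (@g1 R).
Local Notation emb2 := (@emb2 R).
Local Open Scope complex_scope.

Lemma E1_expJ (c : C) : E1 (fun z => cexp (c * cj z)).
Proof.
have := E1J (E1_exp (cj c)); congr E1; apply/funext => z.
by rewrite cexpJ JM JJ.
Qed.

Definition Jq (f : C -> C) q (a : C) := cI g1 (fun p => f (emb2 p) * cj (emb2 p) ^+ q * cexp (pi%:C * a * cj (emb2 p))).

Lemma mqS q : mq R q.+1 = q.+1%:R / pi%:C * mq R q.
Proof.
rewrite !mqE factS natrM exprS invfM !realCM !realCV !realCnat.
by move: (q.+1%:R) (pi%:C^-1) (q`!%:R) => x y z; rewrite -!mulrA; congr (_ * _); rewrite mulrCA.
Qed.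

(** The holomorphic integrand that remains after the translation by [a] in [shift_int]. *)
Let psi (f : C -> C) (a : C) w := f (a + w) * cexp (- (pi%:C * cj a) * (a + w)).
Let hol_psi f a : hol f -> hol (psi f a).
Proof.
move=> hf; apply: holM; first exact: hol_shift.
apply: (hol_shift (f := fun z => cexp (- (pi%:C * cj a) * z)) a).
by apply: (hol_comp (@hol_exp R)); apply: holM; [exact: hol_cst|exact: hol_id].
Qed.
Let E1_psi f a : E1 f -> E1 (psi f a).
Proof.
by move=> ef; apply: E1M; [exact: E1_shift|exact: (E1_shift (f := fun z => cexp (- (pi%:C * cj a) * z)) a (E1_exp _))].
Qed.

Lemma JqE f q a : hol f -> E1 f -> Jq f q a = cexp ((pi * cabs2 a)%:C) *
  \sum_(j < q.+1) ('C(q, j)%:R * cj a ^+ (q - j)) * (coefk (psi f a) j * mq R j).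
Proof.
move=> hf ef; have ez : E1 (fun w : C => w) by exact: E1_id.
have eF : E1 (fun w => f w * cj w ^+ q) by apply: E1M ef _; apply: E1X; exact: E1J.
rewrite /Jq (shift_int a eF); congr (_ * _).
transitivity (cI g1 (fun p => \sum_(j < q.+1) ('C(q, j)%:R * cj a ^+ (q - j)) * (psi f a (emb2 p) * cj (emb2 p) ^+ j))).
  apply: eq_cI => p; rewrite JD exprDn /psi mulrAC mulr_sumr; apply: eq_bigr => j _.
  rewrite -[_ *+ 'C(q, j)]mulr_natr; exact: alg_J.
have e1 (j : nat) : E1 (fun w => psi f a w * cj w ^+ j) by apply: E1M; [exact: E1_psi|apply: E1X; exact: E1J].
rewrite cI_sum => [|j]; last by apply: ciZ; exact: (E1_ci (e1 j)).
apply: eq_bigr => j _; rewrite cIZ; last exact: (E1_ci (e1 j)).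
by rewrite (int_hol_bar j (hol_psi a hf) (E1_psi a ef)).
Qed.

Lemma coefkD (f g : C -> C) k : hol f -> hol g -> coefk (fun z => f z + g z) k = coefk f k + coefk g k.
Proof.
move=> hf hg; rewrite /coefk /Ic -cID; [|exact: coefk_ci|exact: coefk_ci].
by apply: eq_cI => t; rewrite mulrDl.
Qed.

(** After the translation, multiplication by [z] is multiplication by [a + w]. The factor [w] shifts
    Taylor coefficients, and [mqS] with the absorption identity for binomials converts the shift
    into [q / pi] times the term of order [q - 1]. *)
Lemma Jq_rec f q a : hol f -> E1 f -> Jq (fun z => z * f z) q a =
  a * Jq f q a + q%:R / pi%:C * Jq f q.-1 a.
Proof.
move=> hf ef; rewrite !JqE //; last 2 first.
- by apply: holM => //; exact: hol_id.
- by apply: E1M => //; exact: E1_id.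
have hp := hol_psi a hf.
have eC j : coefk (psi (fun z => z * f z) a) j = a * coefk (psi f a) j + coefk (fun w => w * psi f a w) j.
  rewrite -coefkZ // -coefkD; last 2 first.
  - by apply: holM => //; exact: hol_cst.
  - by apply: holM => //; exact: hol_id.
  by congr (coefk _ j); apply/funext => w; rewrite /psi -mulrDl mulrA.
transitivity (cexp ((pi * cabs2 a)%:C) * (a * (\sum_(j < q.+1) ('C(q, j)%:R * cj a ^+ (q - j)) * (coefk (psi f a) j * mq R j)) +
   \sum_(j < q.+1) ('C(q, j)%:R * cj a ^+ (q - j)) * (coefk (fun w => w * psi f a w) j * mq R j))).
  congr (_ * _); rewrite mulr_sumr -big_split; apply: eq_bigr => j _ /=; rewrite eC.
  by move: (_ * cj a ^+ _) (coefk _ _) (coefk _ _) (mq _ _) => x y z u; ring.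
rewrite mulrDr mulrCA; congr (_ + _).
rewrite mulrCA; congr (_ * _).
case: q => [|q].
  rewrite mul0r mul0r big_ord_recl big_ord0 addr0 coefk0; last by apply: holM => //; exact: hol_id.
  by rewrite mul0r mul0r mulr0.
rewrite big_ord_recl /= coefk0 ?mul0r ?mulr0 ?add0r; last by apply: holM => //; exact: hol_id.
rewrite mulr_sumr; apply: eq_bigr => j _; rewrite /bump /= add1n subSS coefk_mulX mqS.
have e : 'C(q.+1, j.+1)%:R * j.+1%:R = q.+1%:R * 'C(q, j)%:R :> C by rewrite -!natrM mulnC mul_bin_diag.
move: e; move: ('C(q.+1, j.+1)%:R) (j.+1%:R) (q.+1%:R) ('C(q, j)%:R) (cj a ^+ _) (coefk _ _) (mq _ _) (pi%:C^-1) => x y z u v w s t e.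
transitivity ((x * y) * v * w * s * t); first by ring.
by rewrite e; ring.
Qed.

Definition ev (P : {poly {poly C}}) (z : C) : C := (P.[(cj z)%:P]).[z].
Lemma evM P Q z : ev (P * Q) z = ev P z * ev Q z. Proof. by rewrite /ev !hornerM. Qed.
Lemma evD P Q z : ev (P + Q) z = ev P z + ev Q z. Proof. by rewrite /ev !hornerD. Qed.
Lemma evN P z : ev (- P) z = - ev P z. Proof. by rewrite /ev !hornerN. Qed.
Lemma evC c z : ev c%:P%:P z = c. Proof. by rewrite /ev !hornerC. Qed.
Lemma evX z : ev 'X z = cj z. Proof. by rewrite /ev hornerX hornerC. Qed.
Lemma evXP z : ev 'X%:P z = z. Proof. by rewrite /ev hornerC hornerX. Qed.
Lemma evX_ P k z : ev (P ^+ k) z = ev P z ^+ k. Proof. by rewrite /ev !horner_exp. Qed.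

Lemma ev_wide N (P : {poly {poly C}}) z : (size P <= N)%N -> ev P z = \sum_(q < N) (P`_q).[z] * cj z ^+ q.
Proof.
move=> sP; rewrite /ev (horner_coef_wide _ sP) horner_sum; apply: eq_bigr => q _.
by rewrite hornerM horner_exp hornerC.
Qed.
Lemma hol_poly (p : {poly C}) : hol (fun z => p.[z]).
Proof.
rewrite (_ : (fun z => p.[z]) = (fun z => \sum_(i < size p) p`_i * z ^+ i)).
  by apply: hol_sum => i; apply: holM; [exact: hol_cst|apply: holX; exact: hol_id].
by apply/funext => z; rewrite horner_coef.
Qed.
Lemma E1_poly (p : {poly C}) : E1 (fun z => p.[z]).
Proof.
rewrite (_ : (fun z => p.[z]) = (fun z => \sum_(i < size p) p`_i * z ^+ i)).
  by apply: E1_sum => i; apply: E1M; [exact: E1_cst|apply: E1X; exact: E1_id].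
by apply/funext => z; rewrite horner_coef.
Qed.
Lemma E1_ev P : E1 (ev P).
Proof.
rewrite (_ : ev P = (fun z => \sum_(i < size P) (P`_i).[z] * cj z ^+ i)).
  by apply: E1_sum => i; apply: E1M; [exact: E1_poly|apply: E1X; apply: E1J; exact: E1_id].
by apply/funext => z; rewrite -ev_wide.
Qed.

(* Integrals of exponentials times polynomials in z and its conjugate against the Gaussian; [ibp] is
   the integration by parts that drives all the recursions below. *)
Definition Tev (A a : C) (P : {poly {poly C}}) := cI g1 (fun p => cexp (A * emb2 p) * ev P (emb2 p) * cexp (pi%:C * a * cj (emb2 p))).

Lemma E1_Tev A a P : E1 (fun z => cexp (A * z) * ev P z * cexp (pi%:C * a * cj z)).
Proof. by apply: E1M; [apply: E1M; [exact: E1_exp|exact: E1_ev]|exact: E1_expJ]. Qed.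

Lemma TevE A a N (P : {poly {poly C}}) : (size P <= N)%N -> Tev A a P = \sum_(q < N) Jq (fun z => cexp (A * z) * (P`_q).[z]) q a.
Proof.
move=> sP; transitivity (cI g1 (fun p => \sum_(q < N) (cexp (A * emb2 p) * (P`_q).[emb2 p]) * cj (emb2 p) ^+ q * cexp (pi%:C * a * cj (emb2 p)))).
  apply: eq_cI => p; rewrite (ev_wide _ sP) mulr_sumr mulr_suml; apply: eq_bigr => q _.
  by rewrite mulrA.
rewrite cI_sum // => q.
apply: (E1_ci (f := fun z => (cexp (A * z) * (P`_q).[z]) * cj z ^+ q * cexp (pi%:C * a * cj z))).
apply: E1M; last exact: E1_expJ.
by apply: E1M; [apply: E1M; [exact: E1_exp|exact: E1_poly]|apply: E1X; apply: E1J; exact: E1_id].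
Qed.

Lemma Jq_Z f q a c : E1 f -> Jq (fun z => c * f z) q a = c * Jq f q a.
Proof.
move=> ef; rewrite /Jq -cIZ.
  by apply: eq_cI => p; rewrite !mulrA.
apply: (E1_ci (f := fun z => f z * cj z ^+ q * cexp (pi%:C * a * cj z))).
by apply: E1M; [apply: E1M => //; apply: E1X; apply: E1J; exact: E1_id|exact: E1_expJ].
Qed.

Lemma ibp A a P : Tev A a ('X%:P * P) = a * Tev A a P + pi%:C^-1 * Tev A a (deriv P).
Proof.
pose N := size P; have hs : (size P <= N.+1)%N by exact: leqnSn.
have hs1 : (size ('X%:P * P)%R <= N.+1)%N.
  by rewrite mul_polyC; apply: leq_trans (size_scale_leq _ _) _.
have hs2 : (size (deriv P) <= N)%N by apply: leq_trans (size_poly _ _) _; exact: leq_pred.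
rewrite (TevE A a hs1) (TevE A a hs) (TevE A a hs2).
have hP q : hol (fun z => cexp (A * z) * (P`_q).[z]).
  apply: holM; last exact: hol_poly.
  by apply: (hol_comp (@hol_exp R)); apply: holM; [exact: hol_cst|exact: hol_id].
have eP q : E1 (fun z => cexp (A * z) * (P`_q).[z]) by apply: E1M; [exact: E1_exp|exact: E1_poly].
transitivity (\sum_(q < N.+1) (a * Jq (fun z => cexp (A * z) * (P`_q).[z]) q a + q%:R / pi%:C * Jq (fun z => cexp (A * z) * (P`_q).[z]) q.-1 a)).
  apply: eq_bigr => q _; rewrite -(Jq_rec q a (hP q) (eP q)); congr (Jq _ q a); apply/funext => z.
  by rewrite coefCM hornerM hornerX mulrCA.
rewrite big_split /= -mulr_sumr; congr (_ + _).
rewrite big_ord_recl mul0r mul0r add0r mulr_sumr; apply: eq_bigr => q _.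
rewrite lift0 mulrAC mulrC mulrA -mulrA; congr (_ * _).
rewrite -Jq_Z //; congr (Jq _ q a); apply/funext => z.
by rewrite coef_deriv hornerMn mulrnAr mulr_natl.
Qed.

Local Notation H := (Hp (pi%:C^-1)).
Local Notation Hc := (Hcp (pi%:C^-1)).
(* Complex Hermite polynomials: the Moyal dual of the pair of monomials of degrees [m] and [k]. *)
Definition hh m k z := ev (H m k) z.

Lemma hh0 k z : hh 0 k z = (- cj z) ^+ k. Proof. by rewrite /hh evX_ evN evX. Qed.
Lemma hhS m k z : hh m.+1 k z = z * hh m k z + k%:R / pi%:C * hh m k.-1 z.
Proof. by rewrite /hh /= evD !evM evXP evC. Qed.
Lemma Jnp k : cj (k%:R / pi%:C) = k%:R / pi%:C :> C.
Proof. by rewrite JM Jnat -realCV JR. Qed.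
Lemma evHc m k z : ev (Hc m k) z = cj (hh m k z).
Proof.
elim: m k => [|m IH] k; first by rewrite evX_ evN evXP hh0 JX JN JJ.
by rewrite hhS JD (JM z) (JM (_ / _)) Jnp HcS evD !evM evX evC !IH.
Qed.

Lemma hh_k0 m z : hh m 0 z = z ^+ m.
Proof.
elim: m => [|m IH]; first by rewrite hh0.
by rewrite hhS IH mul0r mul0r addr0 exprS.
Qed.

(** The defining recursion raises [m]; this one raises [k]. Their compatibility is the identity
    [alg_swap]. *)
Lemma hhSk m k z : hh m k.+1 z = - cj z * hh m k z + m%:R / pi%:C * hh m.-1 k z.
Proof.
elim: m k => [|m IH] k; first by rewrite !hh0 mul0r mul0r addr0 exprS.
rewrite [LHS]hhS IH [X in _ = _ * X + _]hhS -[k.+1%:R]natr1 -[m.+1%:R]natr1 /=.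
apply: (@alg_swap C _ _ _ _ _ _ _ (hh m.-1 k.-1 z)).
  by case: m {IH} => [|m]; [rewrite !mul0r|rewrite [in LHS]hhS].
by case: k => [|k]; [rewrite !mul0r|rewrite [in LHS]IH].
Qed.

(** Reflection exchanges the two indices up to conjugation, which gives the Moyal identity its
    second symmetry ([Moy_sym2]). *)
Lemma hh_sym m k z : hh m k (- z) = cj (hh k m z).
Proof.
elim: m k => [|m IH] k; first by rewrite hh0 hh_k0 JX JN opprK.
rewrite hhS hhSk !IH JD !JM JN JJ Jnat -realCV JR //.
Qed.

Definition chi1 (v z : C) : C := cexp (pi%:C * (cj v * z - v * cj z)).
Definition be1 (v : C) m (z : C) : C := cexp (pi%:C * cj v * z - (pi / 2 * cabs2 v)%:C) * (z - v) ^+ m.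
(** [L1] and [Q1] are the one-variable ingredients of the Moyal identity: inner products of
    modulated Hermite polynomials, and of translated monomials. *)
Definition L1 v v' m k m' k' := cI g1 (fun p => (chi1 v (emb2 p) * hh m k (emb2 p)) * cj (chi1 v' (emb2 p) * hh m' k' (emb2 p))).
Definition Q1 v v' m m' := cI g1 (fun p => be1 v m (emb2 p) * cj (be1 v' m' (emb2 p))).

Lemma chi1_mul v v' z : chi1 v z * cj (chi1 v' z) = cexp (pi%:C * (cj v - cj v') * z) * cexp (pi%:C * (v' - v) * cj z).
Proof. by rewrite /chi1 cexpJ -!cexpD; congr cexp; rewrite JM JB !JM !JJ JR; ring. Qed.

Lemma L1_Tev v v' m k m' k' : L1 v v' m k m' k' = Tev (pi%:C * (cj v - cj v')) (v' - v) (H m k * Hc m' k').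
Proof.
apply: eq_cI => p; rewrite JM mulrACA chi1_mul evM evHc -/(hh m k _).
by rewrite mulrAC.
Qed.

Lemma Tev_D A a P Q : Tev A a (P + Q) = Tev A a P + Tev A a Q.
Proof.
rewrite /Tev -cID; [|exact: (E1_ci (E1_Tev A a P))|exact: (E1_ci (E1_Tev A a Q))].
by apply: eq_cI => p; rewrite evD mulrDr mulrDl.
Qed.
Lemma Tev_Z A a c P : Tev A a (c%:P%:P * P) = c * Tev A a P.
Proof.
rewrite /Tev -cIZ; last exact: (E1_ci (E1_Tev A a P)).
apply: eq_cI => p; rewrite evM evC; move: (cexp (A * _)) (ev P _) (cexp (_ * cj _)) => x y z; ring.
Qed.

Lemma L1_rec v v' m k m' k' : L1 v v' m.+1 k m' k' =
  (v' - v) * L1 v v' m k m' k' + m'%:R / pi%:C * L1 v v' m k m'.-1 k'.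
Proof.
rewrite !L1_Tev HS mulrDl -!mulrA Tev_D Tev_Z ibp deriv_HHc Tev_D.
rewrite !Tev_Z; exact: alg_L.
Qed.

Definition Qp v v' m m' : {poly {poly C}} := Qpp v (cj v') m m'.
Lemma Q1_Tev v v' m m' : Q1 v v' m m' = (cexp (- (pi / 2 * cabs2 v)%:C) * cexp (- (pi / 2 * cabs2 v')%:C)) *
  Tev (pi%:C * cj v) v' (Qp v v' m m').
Proof.
rewrite /Tev -cIZ; last exact: (E1_ci (E1_Tev _ _ _)).
apply: eq_cI => p; rewrite /be1 /Qp /Qpp JM cexpJ JB JR !JM JJ JR evM !evX_ evD evN evX evC.
rewrite (_ : ev ('X - v%:P)%:P (emb2 p) = emb2 p - v); last by rewrite /ev hornerC hornerXsubC.
rewrite JX JB !cexpD; move: (cexp _) (cexp _) (cexp _) (cexp _) (_ ^+ m) (_ ^+ m') => a b c e x y; ring.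
Qed.
Lemma Q1_rec v v' m m' : Q1 v v' m.+1 m' = (v' - v) * Q1 v v' m m' + m'%:R / pi%:C * Q1 v v' m m'.-1.
Proof.
rewrite !Q1_Tev; set K := cexp _ * cexp _.
have -> : Qp v v' m.+1 m' = 'X%:P * Qp v v' m m' + (- v)%:P%:P * Qp v v' m m' := QppS _ _ _ _.
have dQ : deriv (Qp v v' m m') = m'%:R%:P%:P * Qp v v' m m'.-1 := deriv_Qpp _ _ _ _.
rewrite Tev_D ibp dQ !Tev_Z; move: (Tev _ _ _) (Tev _ _ _) (pi%:C^-1) (m'%:R) => x y p n; ring.
Qed.

Lemma E1_be1 v m : E1 (be1 v m).
Proof.
apply: E1M; last by apply: E1X; apply: E1D; [exact: E1_id|exact: E1_cst].
have := E1M (E1_exp (pi%:C * cj v)) (E1_cst (cexp (- (pi / 2 * cabs2 v)%:C))).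
by congr E1; apply/funext => z; rewrite cexpD.
Qed.
Lemma E1_chi1 v : E1 (chi1 v).
Proof.
have := E1M (E1_exp (pi%:C * cj v)) (E1_expJ (- (pi%:C * v))).
by congr E1; apply/funext => z; rewrite -cexpD /chi1; congr cexp; ring.
Qed.
Lemma E1_hh m k : E1 (hh m k). Proof. exact: E1_ev. Qed.

Lemma Q1_sym v v' m m' : cj (Q1 v' v m' m) = Q1 v v' m m'.
Proof.
rewrite /Q1 -cIJ; last by apply: (E1_ci (f := fun z => be1 v' m' z * cj (be1 v m z))); apply: E1M; [exact: E1_be1|apply: E1J; exact: E1_be1].
by apply: eq_cI => p; rewrite JM JJ mulrC.
Qed.

Definition Moy v v' m k m' k' := L1 v v' m k m' k' = Q1 v v' m m' * cj (Q1 v v' k k').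

Lemma Moy_symJ v v' m k m' k' : Moy v' v m' k' m k -> Moy v v' m k m' k'.
Proof.
rewrite /Moy -(Q1_sym v v' m m') -(Q1_sym v v' k k') -JM => <-.
rewrite /L1 -cIJ; first by apply: eq_cI => p; rewrite [RHS]JM JJ [RHS]mulrC.
apply: (E1_ci (f := fun z => (chi1 v' z * hh m' k' z) * cj (chi1 v z * hh m k z))).
by apply: E1M; [|apply: E1J]; apply: E1M; [exact: E1_chi1|exact: E1_hh|exact: E1_chi1|exact: E1_hh].
Qed.

Lemma Moy_sym2 v v' m k m' k' : Moy v' v k' m' k m -> Moy v v' m k m' k'.
Proof.
rewrite /Moy Q1_sym -{1}(Q1_sym v v' k k') JJ => h.
rewrite [RHS]mulrC -h /L1.
pose F z := (chi1 v z * hh m k z) * cj (chi1 v' z * hh m' k' z).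
have eF : E1 F by apply: E1M; [|apply: E1J]; apply: E1M; [exact: E1_chi1|exact: E1_hh|exact: E1_chi1|exact: E1_hh].
have u1 : cabs2 (-1 : C) = 1 by rewrite cabs2N (cabs2R 1) expr1n.
rewrite -(@cI_g1_rot R (-1) F u1 (proj1 eF) (E1_ci eF)).
apply: eq_cI => p; rewrite mulN1r /F; set z := emb2 p.
have c1 u : chi1 u (- z) = cj (chi1 u z).
  by rewrite /chi1 cexpJ; congr cexp; rewrite JM JB !JM !JJ JR JN; ring.
rewrite !hh_sym !c1 !JM !JJ.
exact: mulrC.
Qed.

(** With no polynomial factor both sides are exponentials, evaluated by the reproducing property. *)
Lemma Moy_0 v v' : Moy v v' 0 0 0 0.
Proof.
rewrite /Moy.
have hexp (A : C) : hol (fun z => cexp (A * z)).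
  by apply: (hol_comp (@hol_exp R)); apply: holM; [exact: hol_cst|exact: hol_id].
have T0 A a : Tev A a 1 = cexp (A * a).
  rewrite -(reproducing a (hexp A) (E1_exp A)); apply: eq_cI => p.
  by rewrite /ev !hornerC mulr1.
have q0 : Q1 v v' 0 0 = cexp (- (pi / 2 * cabs2 v)%:C + - (pi / 2 * cabs2 v')%:C + pi%:C * cj v * v').
  by rewrite Q1_Tev /Qp /Qpp !expr0 mulr1 T0 -!cexpD.
rewrite q0 cexpJ -cexpD L1_Tev /= !expr0 mulr1 T0; congr cexp.
rewrite !(JB, JD, JN, JM, JR, JJ).
rewrite !realCM -!mulJ realCV.
rewrite (_ : (2%:C : C) = 2); last by rewrite -(realCnat R 2).
have h2 : (2 : C) != 0 by rewrite pnatr_eq0.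
move: (cj v) (cj v') (pi%:C) h2 => a b p h2; by field.
Qed.

(** [L1_rec] and [Q1_rec] are the same recursion: [m] is raised while [m'] is kept or lowered.
    Conjugation exchanges primed and unprimed indices and reflection exchanges the pairs [(m, k)]
    and [(k', m')], so that all four indices can be raised from 0. *)
Lemma moyal1 v v' m k m' k' : L1 v v' m k m' k' = Q1 v v' m m' * cj (Q1 v v' k k').
Proof.
have S0 u u' j j' : Moy u u' 0 j 0 j' -> forall i, Moy u u' i j 0 j'.
  by move=> h; elim=> // i IH; rewrite /Moy L1_rec Q1_rec IH !mul0r !addr0 mulrA.
have S1 u u' j j' : (forall i', Moy u u' 0 j i' j') -> forall i i', Moy u u' i j i' j'.
  move=> h; elim=> // i IH i'; rewrite /Moy L1_rec Q1_rec !IH.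
  by move: (Q1 _ _ _ _) (Q1 _ _ _ _) (cj (Q1 _ _ _ _)) (_ / _) => x y z t; ring.
have A0 u u' i' : Moy u u' 0 0 i' 0 := Moy_symJ (S0 u' u 0 0 (Moy_0 u' u) i').
have A1 u u' i i' : Moy u u' i 0 i' 0 := S1 u u' 0 0 (A0 u u') i i'.
have B u u' j j' : Moy u u' 0 j 0 j' := Moy_sym2 (A1 u' u j' j).
have B2 u u' j i' j' : Moy u u' 0 j i' j' := Moy_symJ (S0 u' u j' j (B u' u j' j) i').
exact: (S1 v v' k k' (fun i' => B2 v v' k i' k') m m').
Qed.
End Hermite.

(** * Product functions on C^d and the Moyal identity in several variables *)

Section Prod.
Variables (R : realType) (d : nat).
Local Notation C := (CC R).
Local Notation V := (cvec R d).
Local Notation g1 := (@g1 R).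
Local Notation gm := (gm R d).
Local Notation R2 := (measurableTypeR R * measurableTypeR R)%type.
Local Notation emb2 := (@emb2 R).
Local Open Scope complex_scope.

Lemma gam_prod (f : C -> R) (c : R) s : (s <= d)%N -> measurable_fun setT (fun p : R2 => f (emb2 p)) ->
  (forall w, 0 <= f w) -> (\int[g1]_p (f (emb2 p))%:E = c%:E)%E ->
  (\int[@gam R d s]_z (\prod_(j < d | (j < s)%N) f (z ord0 j))%:E = (c ^+ s)%:E)%E.
Proof.
move=> sd mf f0 fc.
have mfj (j : 'I_d) : measurable_fun setT (fun z : V => f (z ord0 j)).
  have [a b] := mv_coord R j; have := measurableT_comp mf (m_pair a b).
  by apply: eq_measurable_fun => z _ /=; rewrite emb2K.
have mP t : measurable_fun setT (fun z : V => (\prod_(j < d | (j < t)%N) f (z ord0 j))%:E).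
  apply/measurable_EFinP; under eq_fun do rewrite big_mkcond /=.
  by apply: measurable_prod => j _; case: (j < t)%N; [exact: mfj|exact: measurable_cst].
have P0 t (z : V) : (0 <= (\prod_(j < d | (j < t)%N) f (z ord0 j))%:E)%E by rewrite lee_fin prodr_ge0.
have c0 : 0 <= c by rewrite -lee_fin -fc; apply: integral_ge0 => p _; rewrite lee_fin.
elim: s sd => [_|s IH sd].
  by rewrite int_gam0 //; rewrite expr0 big1 // => j; rewrite ltn0.
rewrite int_gamS //.
transitivity (\int[@gam R d s]_z (c%:E * (\prod_(j < d | (j < s)%N) f (z ord0 j))%:E))%E.
  apply: eq_integral => z _.
  transitivity (\int[g1]_p ((\prod_(j < d | (j < s)%N) f (z ord0 j))%:E * (f (emb2 p))%:E))%E.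
    apply: eq_integral => p _; rewrite -EFinM (bigD1 (Ordinal sd)) //= mxE eqxx mulrC; congr (_ * _)%:E.
    apply: eq_big => [j|j /andP[_ ne]].
      by rewrite ltnS leq_eqVlt -val_eqE /=; case: (ltngtP j s).
    by rewrite mxE -[_ == s :> nat]/(j == Ordinal sd) (negPf ne).
  rewrite ge0_integralZl_EFin //; last 3 first.
  - by move=> p _; rewrite lee_fin.
  - exact/measurable_EFinP.
  - by rewrite prodr_ge0.
  by rewrite fc muleC.
by rewrite ge0_integralZl_EFin // IH ?exprS ?EFinM // ltnW.
Qed.

(** The sum of the moduli, rather than the Euclidean norm, makes the majorant a product of functions
    of one variable. *)
Definition Ed (F : V -> C) := mC F /\ exists A B, [/\ 0 <= A, 0 <= B &
  forall z, cn (F z) <= A * expR (B * \sum_j cn (z ord0 j))].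

Lemma Ed_ci F : Ed F -> ci gm F.
Proof.
move=> [mF [A [B [A0 B0 hF]]]]; split => //.
pose f w := expR (B * cn w) : R.
have mf : measurable_fun setT (fun p : R2 => f (emb2 p)).
  by apply: measurableT_comp => //; apply: measurable_funM => //; apply: mcn; exact: (@m_emb2 R).
have If : (\int[g1]_p (f (emb2 p))%:E)%E \is a fin_num.
  by rewrite ge0_fin_numE ?expB_ci //; apply: integral_ge0 => p _; rewrite lee_fin expR_ge0.
have pE (z : V) : \prod_(j < d) f (z ord0 j) = expR (B * \sum_j cn (z ord0 j)).
  rewrite mulr_sumr; elim/big_rec2: _ => [|j x y _ ->]; first by rewrite expR0.
  by rewrite expRD.
have mB : measurable_fun setT (fun z : V => (\prod_(j < d) f (z ord0 j))%:E).
  apply/measurable_EFinP; apply: measurable_prod => j _; have [a b] := mv_coord R j.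
  by have := measurableT_comp mf (m_pair a b); apply: eq_measurable_fun => z _ /=; rewrite emb2K.
apply: (@le_lt_trans _ _ (\int[gm]_z (A%:E * (\prod_(j < d) f (z ord0 j))%:E))%E).
  apply: ge0_le_int.
  - by apply/measurable_EFinP; exact: mcn.
  - by apply: emeasurable_funM; [exact: measurable_cst|exact: mB].
  - by move=> z; rewrite lee_fin cn_ge0.
  - by move=> z; rewrite -EFinM lee_fin pE.
rewrite ge0_integralZl_EFin //; last by move=> z _; rewrite pE lee_fin expR_ge0.
rewrite (eq_integral (fun x : V => (\prod_(j < d | (j < d)%N) f (x ord0 j))%:E)); last first.
  by move=> z _; congr EFin; apply: eq_bigl => j; rewrite ltn_ord.
by rewrite (gam_prod (leqnn d) mf (fun w => expR_ge0 _) (esym (fineK If))) -EFinM ltry.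
Qed.

Lemma Ed_sq F : Ed F -> sq gm F.
Proof.
move=> [mF [A [B [A0 B0 hF]]]]; split => //.
have : Ed (fun z => (cabs2 (F z))%:C).
  split; first by apply: mC_real; exact: mabs2.
  exists (A ^+ 2), (B + B); split => [||z]; rewrite ?sqr_ge0 ?addr_ge0 //.
  rewrite cn_real ?cabs2_ge0 // -cn_sqr mulrDl expRD expr2 expr2 mulrACA.
  by apply: ler_pM; rewrite ?cn_ge0.
move/Ed_ci => [_]; congr (_ < _)%E; apply: eq_integral => z _.
by rewrite cn_real ?cabs2_ge0.
Qed.

Lemma Ed_prod (f : 'I_d -> C -> C) : (forall j, E1 (f j)) -> Ed (fun z => \prod_j f j (z ord0 j)).
Proof.
move=> ef; split.
  apply: mC_prod => j; have [mf _] := ef j; have [a b] := mv_coord R j.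
  by have := mC_comp mf (m_pair a b); congr mC; apply/funext => z /=; rewrite emb2K.
have /choice[A hA] : forall j, exists A, exists B, [/\ 0 <= A, 0 <= B & forall w, cn (f j w) <= A * expR (B * cn w)].
  by move=> j; case: (ef j).
have /choice[B hB] := hA.
exists (\prod_j A j), (\sum_j B j); split => [||z].
- by apply: prodr_ge0 => j _; case: (hB j).
- by apply: sumr_ge0 => j _; case: (hB j).
rewrite cn_prod; apply: (@le_trans _ _ (\prod_j (A j * expR (B j * cn (z ord0 j))))).
  by apply: ler_prod => j _; rewrite cn_ge0; case: (hB j) => _ _ ->.
rewrite big_split ler_wpM2l //=; first by apply: prodr_ge0 => j _; case: (hB j).
have -> : \prod_j expR (B j * cn (z ord0 j)) = expR (\sum_j B j * cn (z ord0 j)).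
  by elim/big_rec2: _ => [|j x y _ ->]; rewrite ?expR0 ?expRD.
rewrite ler_expR mulr_suml; apply: ler_sum => j _; rewrite ler_wpM2l //; first by case: (hB j).
by rewrite (bigD1 j) //= lerDl; apply: sumr_ge0 => i _; exact: cn_ge0.
Qed.

Lemma cI_resample j (F : V -> C) : ci gm F -> (forall z, ci g1 (fun p => F (upd z j (emb2 p)))) ->
  cI gm F = cI gm (fun z => cI g1 (fun p => F (upd z j (emb2 p)))).
Proof.
move=> cF sl.
have mU : measurable_fun setT (fun q : V * R2 => upd q.1 j (emb2 q.2)).
  by apply: m_upd; [exact: measurable_fst|exact: (mC_comp (@m_emb2 R) measurable_snd)].
have tr (f : V -> \bar R) : measurable_fun setT f -> (forall z, (0 <= f z)%E) ->
   (\int[gm]_z f z = \int[(gm \x g1)%E]_q f (upd q.1 j (emb2 q.2)))%E.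
  move=> mf f0; rewrite (gm_resample j mf f0) fubini_tonelli1 //.
  exact: (measurableT_comp mf mU).
case: (cF) => mF fin.
have mFU : mC (fun q : V * R2 => F (upd q.1 j (emb2 q.2))) by exact: (mC_comp mF mU).
have cU : ci (gm \x g1)%E (fun q : V * R2 => F (upd q.1 j (emb2 q.2))).
  by split=> //; rewrite -(tr (fun z => (cn (F z))%:E)) // => [|z]; [apply/measurable_EFinP; exact: mcn|rewrite lee_fin cn_ge0].
have [_ e] := @cI_transfer R _ _ _ V V _ gm (gm \x g1)%E (fun=> 1) id (fun q => upd q.1 j (emb2 q.2))
  (measurable_cst _) (fun _ => ler01) (@measurable_id _ V setT)
  (fun f mf f0 => etrans (eq_integral _ _ (fun x _ => mule1 (f x))) (tr f mf f0)) F mF cU.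
transitivity (cI (gm \x g1)%E (fun q : V * R2 => F (upd q.1 j (emb2 q.2)))).
  by rewrite -e; apply: eq_cI => z; rewrite mul1r.
have key (h : C -> R) : (gm \x g1)%E.-integrable setT (EFin \o (fun q : V * R2 => h (F (upd q.1 j (emb2 q.2))))) ->
    (forall z, g1.-integrable setT (EFin \o (fun p => h (F (upd z j (emb2 p)))))) ->
    \int[(gm \x g1)%E]_q h (F (upd q.1 j (emb2 q.2))) = \int[gm]_z \int[g1]_p h (F (upd z j (emb2 p))).
  move=> hi h1; rewrite /Rintegral; congr fine; rewrite -integral12_prod_meas1 //.
  by apply: eq_integral => z _; rewrite fineK //; apply: integrable_fin_num => //; exact: h1.
rewrite /cI; congr (_ +i* _); apply: (key (fun w => _ w)) => [|z].
- exact: ciRe cU.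
- exact: ciRe (sl z).
- exact: ciIm cU.
- exact: ciIm (sl z).
Qed.

Lemma cI_prod (f : 'I_d -> C -> C) : (forall j, E1 (f j)) ->
  cI gm (fun z => \prod_j f j (z ord0 j)) = \prod_j cI g1 (fun p => f j (emb2 p)).
Proof.
move=> ef; pose I j := cI g1 (fun p => f j (emb2 p)).
(* [S] lists the factors already replaced by their means; the integral is unchanged at each
   replacement, and at the end the integrand is constant. *)
pose g (S : seq 'I_d) j w := if j \in S then I j else f j w.
have eg S j : E1 (g S j).
  by have [jS|jS] := boolP (j \in S); [have := E1_cst (I j)|have := ef j]; congr E1; apply/funext => w; rewrite /g ?jS // (negPf jS).
suff h S : uniq S -> cI gm (fun z => \prod_j f j (z ord0 j)) = cI gm (fun z => \prod_j g S j (z ord0 j)).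
  rewrite (h _ (enum_uniq 'I_d)) -[RHS](cI_cst gm); apply: eq_cI => z.
  by apply: eq_bigr => j _; rewrite /g mem_enum.
elim: S => [_|j S IH /= /andP[jS uS]].
  by apply: eq_cI => z; apply: eq_bigr => j _.
rewrite (IH uS).
have sp (z : V) w : \prod_i g S i (upd z j w ord0 i) = (\prod_(i < d | i != j) g S i (z ord0 i)) * g S j w.
  rewrite (bigD1 j) //= upd_at mulrC; congr (_ * _); apply: eq_bigr => i ij; by rewrite upd_ne.
have cj1 : ci g1 (fun p => g S j (emb2 p)) := E1_ci (eg S j).
rewrite (@cI_resample j) => [||z]; last 2 first.
- by apply: Ed_ci; exact: Ed_prod.
- have := ciZ (\prod_(i < d | i != j) g S i (z ord0 i)) cj1.
  by congr ci; apply/funext => p; rewrite sp.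
apply: eq_cI => z.
transitivity (cI g1 (fun p => (\prod_(i < d | i != j) g S i (z ord0 i)) * g S j (emb2 p))).
  by apply: eq_cI => p; exact: sp.
rewrite cIZ // [RHS](bigD1 j) //= mulrC; congr (_ * _).
  by rewrite /g in_cons eqxx /I; apply: eq_cI => p; rewrite (negPf jS).
by apply: eq_bigr => i ij; rewrite /g in_cons (negPf ij).
Qed.

Lemma ip_prod (f g : 'I_d -> C -> C) : (forall j, E1 (f j)) -> (forall j, E1 (g j)) ->
  ip gm (fun z => \prod_j f j (z ord0 j)) (fun z => \prod_j g j (z ord0 j)) =
  \prod_j cI g1 (fun p => f j (emb2 p) * cj (g j (emb2 p))).
Proof.
move=> ef eg; rewrite -(cI_prod (f := fun j w => f j w * cj (g j w))) => [|j].
  by apply: eq_cI => z; rewrite J_prod -big_split.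
by apply: E1M; [exact: ef|apply: E1J; exact: eg].
Qed.

Definition chi (v z : V) : C := \prod_j chi1 (v ord0 j) (z ord0 j).
Definition kap2 (k : 'I_d -> nat) : R := Num.sqrt (pi ^+ (\sum_(j < d) k j) / (\prod_(j < d) (k j)`!)%:R).
(** Normalised in [k] only: on the [k] side the Moyal identity must produce the orthonormal [ek] of
    the statement, while the [m] side may keep plain monomials. *)
Definition HH (m k : 'I_d -> nat) (z : V) : C := (kap2 k)%:C * \prod_j hh (m j) (k j) (z ord0 j).
Definition bm (v : V) (m : 'I_d -> nat) (z : V) : C := \prod_j be1 (v ord0 j) (m j) (z ord0 j).

Lemma bmE v m z : bm v m z = beta v (fun z => cpow z m) z.
Proof.
rewrite /bm /beta /cpow -/(cpow _ m) /be1 big_split /=; congr (_ * _); last first.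
  by apply: eq_bigr => j _; rewrite !mxE.
rewrite -cexp_sum; congr cexp; rewrite sumrB cdotE mulr_sumr; congr (_ - _).
  by apply: eq_bigr => j _; rewrite mulrA.
by rewrite -realC_sum /vnorm2 mulr_sumr.
Qed.
Lemma be_ek v k z : beta v (ek k) z = (kap2 k)%:C * bm v k z.
Proof. by rewrite bmE /beta /ek mulrCA. Qed.

Lemma Ed_bm v m : Ed (bm v m). Proof. by apply: (Ed_prod (f := fun j => be1 (v ord0 j) (m j))) => j; exact: E1_be1. Qed.
Lemma EdZ c F : Ed F -> Ed (fun z => c * F z).
Proof.
move=> [mF [A [B [A0 B0 hF]]]]; split; first by apply: mCM => //; exact: mC_cst.
by exists (cn c * A), B; split => [||z] //; rewrite ?mulr_ge0 ?cn_ge0 // cnM -mulrA ler_wpM2l ?cn_ge0.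
Qed.
Lemma Ed_be v k : Ed (beta v (ek k)).
Proof. by have := EdZ (kap2 k)%:C (Ed_bm v k); congr Ed; apply/funext => z; rewrite be_ek. Qed.
Lemma Ed_chiHH v m k : Ed (fun z => chi v z * HH m k z).
Proof.
have := EdZ (kap2 k)%:C (Ed_prod (f := fun j w => chi1 (v ord0 j) w * hh (m j) (k j) w) (fun j => E1M (E1_chi1 _) (E1_hh R (m j) (k j)))).
by congr Ed; apply/funext => z; rewrite /HH /chi mulrCA big_split.
Qed.

Lemma moyal v v' m k m' k' : ip gm (fun z => chi v z * HH m k z) (fun z => chi v' z * HH m' k' z) =
  ip gm (bm v m) (bm v' m') * cj (ip gm (beta v (ek k)) (beta v' (ek k'))).
Proof.
have e1 : ip gm (beta v (ek k)) (beta v' (ek k')) = ((kap2 k * kap2 k')%:C) * ip gm (bm v k) (bm v' k').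
  rewrite realCM -mulrA -[X in _ * (X * _)]JR -ipZr; [|exact: Ed_sq (Ed_bm _ _)|exact: Ed_sq (Ed_bm _ _)].
  rewrite -ipZl; [|exact: Ed_sq (Ed_bm _ _)|exact: Ed_sq (EdZ _ (Ed_bm _ _))].
  by apply: eq_cI => z; rewrite !be_ek.
have eL (u : C) a b : E1 (fun w => chi1 u w * hh a b w) by apply: E1M; [exact: E1_chi1|exact: E1_hh].
rewrite e1 JM JR mulrCA.
transitivity ((kap2 k * kap2 k')%:C * ip gm (fun z => \prod_j (chi1 (v ord0 j) (z ord0 j) * hh (m j) (k j) (z ord0 j)))
   (fun z => \prod_j (chi1 (v' ord0 j) (z ord0 j) * hh (m' j) (k' j) (z ord0 j)))).
  have ep (u : V) (a b : 'I_d -> nat) : Ed (fun z => \prod_j (chi1 (u ord0 j) (z ord0 j) * hh (a j) (b j) (z ord0 j))).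
    exact: (Ed_prod (f := fun j w => chi1 (u ord0 j) w * hh (a j) (b j) w) (fun j => eL _ _ _)).
  rewrite realCM -mulrA -[X in _ * (X * _)]JR -ipZr; [|exact: Ed_sq (ep _ _ _)|exact: Ed_sq (ep _ _ _)].
  rewrite -ipZl; [|exact: Ed_sq (ep _ _ _)|exact: Ed_sq (EdZ _ (ep _ _ _))].
  by apply: eq_cI => z; rewrite /HH /chi !big_split /= !(mulrCA (\prod_j chi1 _ _)).
congr (_ * _).
rewrite (ip_prod (f := fun j w => chi1 (v ord0 j) w * hh (m j) (k j) w) (g := fun j w => chi1 (v' ord0 j) w * hh (m' j) (k' j) w)) //.
rewrite /bm (ip_prod (f := fun j => be1 (v ord0 j) (m j)) (g := fun j => be1 (v' ord0 j) (m' j))); [|by move=> j; exact: E1_be1|by move=> j; exact: E1_be1].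
rewrite (ip_prod (f := fun j => be1 (v ord0 j) (k j)) (g := fun j => be1 (v' ord0 j) (k' j))); [|by move=> j; exact: E1_be1|by move=> j; exact: E1_be1].
by rewrite J_prod -big_split; apply: eq_bigr => j _; exact: moyal1.
Qed.

Lemma coefk_X a b : coefk (fun z : C => z ^+ a) b = (a == b)%:R.
Proof.
elim: a b => [|a IH] [|b].
- by rewrite (_ : (fun z : C => z ^+ 0) = (fun=> 1)) ?coefk_1.
- by rewrite (_ : (fun z : C => z ^+ 0) = (fun=> 1)) ?coefk_1.
- by rewrite coefk0 ?exprS ?mul0r //; apply: holX; exact: hol_id.
- rewrite (_ : (fun z : C => z ^+ a.+1) = (fun z => z * z ^+ a)) ?coefk_mulX ?IH //.
  by apply/funext => z; rewrite exprS.
Qed.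

Lemma kap2_gt0 k : 0 < kap2 k.
Proof.
rewrite sqrtr_gt0 divr_gt0 ?exprn_gt0 ?pi_gt0 // ltr0n.
by apply: prodn_gt0 => j; exact: fact_gt0.
Qed.

(** The inner product factors over coordinates, and [int_hol_bar] leaves the moments [mq], which
    [kap2] is designed to cancel. *)
Lemma ip_ek (k k' : 'I_d -> nat) : ip gm (ek k) (ek k') = [forall j, k j == k' j]%:R.
Proof.
have eX a : E1 (fun w : C => w ^+ a) by apply: E1X; exact: E1_id.
have eP (a : 'I_d -> nat) : Ed (fun z => cpow z a) := Ed_prod (fun j => eX (a j)).
have e : ip gm (fun z => cpow z k) (fun z => cpow z k') = \prod_j ((k j == k' j)%:R * mq R (k' j)).
  rewrite (ip_prod (f := fun j w => w ^+ k j) (g := fun j w => w ^+ k' j)) //.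
  apply: eq_bigr => j _; rewrite -coefk_X -int_hol_bar //; last by apply: holX; exact: hol_id.
  by apply: eq_cI => p; rewrite JX.
transitivity ((kap2 k * kap2 k')%:C * ip gm (fun z => cpow z k) (fun z => cpow z k')).
  rewrite realCM -mulrA -[X in _ * (X * _)]JR -ipZr; [|exact: Ed_sq|exact: Ed_sq].
  by rewrite -ipZl; [|exact: Ed_sq|exact: Ed_sq (EdZ _ (eP _))].
rewrite e; case: forallP => [h|h].
  have -> : k = k' by apply/funext => j; exact/eqP.
  rewrite (eq_bigr (fun j => ((k' j)`!%:R / pi ^+ k' j)%:C)) => [|j _]; last by rewrite eqxx mul1r mqE.
  rewrite -realC_prod -realCM -expr2 sqr_sqrtr; last by rewrite divr_ge0 ?exprn_ge0 ?pi_ge0 // ler0n.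
  rewrite (_ : _ * _ = 1 :> R) // big_split /= natr_prod prodfV prodrXr.
  have x0 : pi ^+ (\sum_(j < d) k' j) != 0 :> R by rewrite expf_neq0 // gt_eqF // pi_gt0.
  have y0 : \prod_j ((k' j)`!%:R : R) != 0.
    by apply/prodf_neq0 => j _; rewrite pnatr_eq0 -lt0n fact_gt0.
  by rewrite mulrA divfK // divff.
have [j hj] : exists j, k j != k' j by apply/existsP; rewrite -negb_forall; apply/forallP.
by rewrite (bigD1 j) //= (negPf hj) !mul0r mulr0.
Qed.
End Prod.

Lemma alg_T (K : comNzRingType) (a b x y : K) : a * b * (x * y) = a * b * y * x.
Proof. by ring. Qed.

Section Tensor.
Context (R : realType) d (T : measurableType d) (P : probability T R).
Local Notation C := (CC R).
Local Notation Re := (@complex.Re R).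
Local Open Scope complex_scope.

Lemma int_Re (f : T -> C) : ci P f -> (\int[P]_x (Re (f x))%:E = (Re (cI P f))%:E)%E.
Proof.
move=> cf; have := integrable_fin_num measurableT (ciRe cf); rewrite /comp => h.
by rewrite -(fineK h).
Qed.

(* Both sides only depend on Gram matrices; the product of two Gram matrices is realised as an iterated
   integral, so no tensor product of Hilbert spaces is needed. *)
Lemma tensor_gram (I : Type) (s : seq I) (t : I -> C) (X M E : I -> T -> C) :
  (forall i, sq P (X i)) -> (forall i, sq P (M i)) -> (forall i, sq P (E i)) ->
  (forall i j, ip P (X i) (X j) = ip P (M i) (M j) * cj (ip P (E i) (E j))) ->
  n2 P (fun z => \sum_(i <- s) t i * X i z) =
  (\int[P]_w n2 P (fun y => (\sum_(i <- s) cj (t i * M i w) * E i y)%R))%E.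
Proof.
move=> sX sM sE h; rewrite (gram _ _ sX).
under eq_integral do rewrite (gram _ _ sE).
have cM i j : ci P (fun w => (cj (t i) * t j * ip P (E i) (E j)) * cj (M i w * cj (M j w))).
  by apply: ciZ; apply: ciJ; exact: sq_ci.
have c1 i : ci P (fun w => \sum_(j <- s) (cj (t i) * t j * ip P (E i) (E j)) * cj (M i w * cj (M j w))).
  exact: ci_sum.
transitivity (\int[P]_w (Re (\sum_(i <- s) \sum_(j <- s) (cj (t i) * t j * ip P (E i) (E j)) * cj (M i w * cj (M j w))))%:E)%E.
  rewrite int_Re; last exact: ci_sum.
  congr EFin; rewrite cI_sum // -[LHS]ReJ; congr Re.
  rewrite J_sum; apply: eq_bigr => i _; rewrite cI_sum // J_sum; apply: eq_bigr => j _.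
  rewrite cIZ; last by apply: ciJ; exact: sq_ci.
  rewrite cIJ; last exact: sq_ci.
  rewrite h -/(ip P (M i) (M j)) !JM !JJ.
  exact: alg_T.
apply: eq_integral => w _; congr (Re _)%:E; apply: eq_bigr => i _; apply: eq_bigr => j _.
rewrite !JM !JJ; move: (cj (t i)) (t j) (cj (M i w)) (M j w) (ip _ _ _) => a b x y u; ring.
Qed.
End Tensor.

(** * From Riesz bounds to multiplication by trigonometric polynomials *)
Section Psi.
Variables (R : realType) (d : nat).
Local Notation C := (CC R).
Local Notation V := (cvec R d).
Local Notation gm := (gm R d).
Local Open Scope complex_scope.
Variable n : 'I_d -> nat.
Local Notation kn k := (fun j => k j : nat).

Definition comb (S : seq V) (c : V -> Kn n -> C) (z : V) : C :=
  \sum_(v <- S) \sum_(k : Kn n) c v k * beta v (ek (fun j => k j)) z.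

Definition Riesz (G : set V) (A : R) := 0 < A /\ forall (S : seq V) (c : V -> Kn n -> C),
  uniq S -> (forall v, v \in S -> G v) ->
  ((A * \sum_(v <- S) \sum_(k : Kn n) cabs2 (c v k))%:E <= n2 gm (comb S c))%E.

Lemma beta0 (F : V -> C) z : beta 0 F z = F z.
Proof.
rewrite /beta subr0 cdotE big1 => [|j _]; last by rewrite mxE J0 mul0r.
rewrite /vnorm2 big1 => [|j _]; last by rewrite mxE cabs20.
by rewrite mulr0 mulr0 subr0 cexp0 mul1r.
Qed.
Lemma chi0 (z : V) : chi 0 z = 1.
Proof.
by rewrite /chi big1 // => j _; rewrite mxE /chi1 J0 !mul0r subr0 mulr0 cexp0.
Qed.

Lemma n2_beta v (F : V -> C) : mC F -> n2 gm (beta v F) = n2 gm F.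
Proof.
move=> mF; rewrite /n2 -(gm_shift v (mn2 mF)) => [|z]; last by rewrite lee_fin cabs2_ge0.
by apply: eq_integral => z _; rewrite cabs2_beta EFinM.
Qed.

Lemma beta_sum v (I : Type) (s : seq I) (Q : pred I) (a : I -> C) (f : I -> V -> C) z :
  beta v (fun z => \sum_(i <- s | Q i) a i * f i z) z = \sum_(i <- s | Q i) a i * beta v (f i) z.
Proof. by rewrite /beta mulr_sumr; apply: eq_bigr => i _; rewrite mulrCA. Qed.

Section Fix.
Variables (I : Type) (s : seq I) (a : I -> C) (m : I -> 'I_d -> nat) (kk : I -> Kn n).
Let F z := \sum_(i <- s) a i * HH (m i) (fun j => kk i j) z.
(** The Moyal counterpart of [F]: a function [HH m k] becomes the monomial of exponent [m] in the
    slot [k], so that [F] is encoded by one analytic polynomial for each [k] in K_n. *)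
Let phi k (z : V) := \sum_(i <- s | kk i == k) a i * cpow z (m i).

Lemma big_pair (S : seq V) (f : V -> I -> C) :
  \sum_(p <- allpairs pair S s) f p.1 p.2 = \sum_(v <- S) \sum_(i <- s) f v i.
Proof. by rewrite big_allpairs. Qed.

(** By [moyal] and [tensor_gram], the norm of the product is an average over [w] of norms of finite
    combinations of the atoms [beta v (ek k)]. These are exactly the combinations to which a Riesz
    bound applies. *)
Lemma n2_chiF (S : seq V) (b : V -> C) :
  n2 gm (fun z => (\sum_(v <- S) b v * chi v z) * F z) =
  (\int[gm]_w n2 gm (fun y => (\sum_(v <- S) \sum_(k : Kn n) cj (b v * beta v (phi k) w) * beta v (ek (fun j => k j)) y)%R))%E.
Proof.
pose X (p : V * I) z := chi p.1 z * HH (m p.2) (fun j => kk p.2 j) z.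
pose M (p : V * I) := bm p.1 (m p.2).
pose E (p : V * I) := beta p.1 (@ek R d (fun j => kk p.2 j)).
have -> : n2 gm (fun z => (\sum_(v <- S) b v * chi v z) * F z) =
   n2 gm (fun z => \sum_(p <- allpairs pair S s) (b p.1 * a p.2) * X p z).
  apply: eq_n2 => z; congr cabs2; rewrite (big_pair S (fun v i => b v * a i * X (v, i) z)) mulr_suml.
  apply: eq_bigr => v _; rewrite mulr_sumr; apply: eq_bigr => i _.
  by rewrite /X /=; move: (chi _ _) (HH _ _ _) => x y; rewrite mulrACA.
rewrite (@tensor_gram _ _ _ gm _ _ (fun p => b p.1 * a p.2) X M E).
- apply: eq_integral => w _; apply: eq_n2 => y; congr cabs2.
  rewrite (big_pair S (fun v i => cj (b v * a i * M (v, i) w) * E (v, i) y)).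
  apply: eq_bigr => v _.
  rewrite (partition_big kk predT) //=; apply: eq_bigr => k _.
  rewrite /phi beta_sum mulr_sumr (big_morph (@cj R) (@JD R) (J0 R)) mulr_suml; apply: eq_bigr => i /eqP <-.
  by rewrite /M /E /= bmE mulrA.
- by move=> p; exact: Ed_sq (Ed_chiHH _ _ _).
- by move=> p; exact: Ed_sq (Ed_bm _ _).
- by move=> p; exact: Ed_sq (Ed_be _ _).
- by move=> p q; exact: moyal.
Qed.

Lemma Ed_phi k : sq gm (phi k).
Proof.
have : sq gm (fun z => \sum_(i <- s) (if kk i == k then a i else 0) * bm 0 (m i) z).
  by apply: sq_sum => i; apply: sqZ; exact: Ed_sq (Ed_bm _ _).
congr sq; apply/funext => z; rewrite /phi [RHS]big_mkcond; apply: eq_bigr => i _.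
by case: (kk i == k); rewrite ?mul0r // bmE beta0.
Qed.

(** The case of the trivial character alone: the atoms are then the orthonormal functions [ek k]. *)
Lemma n2_F : n2 gm F = (\sum_(k : Kn n) n2 gm (phi k))%E.
Proof.
transitivity (n2 gm (fun z => (\sum_(v <- [:: (0 : V)]) 1 * chi v z) * F z)).
  by apply: eq_n2 => z; rewrite big_seq1 chi0 mulr1 mul1r.
rewrite n2_chiF -ge0_integral_sum //; last 2 first.
- by move=> k; apply: mn2; case: (Ed_phi k).
- by move=> k y _; rewrite lee_fin cabs2_ge0.
apply: eq_integral => w _.
have -> : n2 gm (fun y => \sum_(v <- [:: (0 : V)]) \sum_(k : Kn n) cj (1 * beta v (phi k) w) * beta v (ek (fun j => k j)) y) =
  n2 gm (fun y => \sum_(k <- index_enum (Kn n)) cj (phi k w) * ek (fun j => k j) y).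
  apply: eq_n2 => y; rewrite big_seq1; congr cabs2; apply: eq_bigr => k _.
  by rewrite mul1r !beta0.
have se (k : Kn n) : sq gm (@ek R d (fun j => k j)).
  have := Ed_sq (Ed_be (0 : V) (fun j => k j)); congr sq; apply/funext => z; exact: beta0.
rewrite (gram _ _ se) sumEFin; congr EFin; rewrite Re_sum; apply: eq_bigr => k _.
rewrite (bigD1 k) //= big1 ?addr0 => [|k' ne].
  rewrite ip_ek; case: forallP => [_|[]]; last by move=> j; exact: eqxx.
  by rewrite mulr1 mulJ cabs2J.
rewrite ip_ek; case: forallP => [h|_]; last by rewrite mulr0.
by case/eqP: ne; apply/ffunP => j; apply/val_inj/eqP; rewrite eq_sym; exact: h.
Qed.

(** The Riesz bound is applied for each [w] to the inner norm in [n2_chiF] and integrated.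
    Translations preserve the norm, so the average of [cabs2 (beta v (phi k) w)] does not depend on
    [v], and the sum factors. *)
Lemma psi_HH (G : set V) (A : R) (S : seq V) (b : V -> C) : Riesz G A -> uniq S -> (forall v, v \in S -> G v) ->
  ((A * \sum_(v <- S) cabs2 (b v))%:E * n2 gm F <= n2 gm (fun z => ((\sum_(v <- S) b v * chi v z) * F z)%R))%E.
Proof.
move=> [A0 rz] uS SG; rewrite n2_chiF.
have mb v k : mC (beta v (phi k)).
  have : sq gm (fun z => \sum_(i <- s) (if kk i == k then a i else 0) * bm v (m i) z).
    by apply: sq_sum => i; apply: sqZ; exact: Ed_sq (Ed_bm _ _).
  case=> h _; move: h; congr mC; apply/funext => z; rewrite /phi beta_sum [RHS]big_mkcond; apply: eq_bigr => i _.
  by case: (kk i == k); rewrite ?mul0r // bmE.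
have mph k : mC (phi k) by case: (Ed_phi k).
apply: (@le_trans _ _ (\int[gm]_w (A * \sum_(v <- S) \sum_(k : Kn n) cabs2 (cj (b v * beta v (phi k) w)))%R%:E)%E).
  rewrite le_eqVlt; apply/orP; left; apply/eqP.
  transitivity (A%:E * \sum_(v <- S) \sum_(k : Kn n) ((cabs2 (b v))%:E * n2 gm (phi k)))%E.
    rewrite EFinM -muleA; congr (_ * _)%E.
    rewrite n2_F -sumEFin ge0_sume_distrl => [|v _]; last by rewrite lee_fin cabs2_ge0.
    apply: eq_bigr => v _; rewrite ge0_sume_distrr // => k _; exact: n2_ge0.
  have mt v k : measurable_fun setT (fun w => (cabs2 (cj (b v * beta v (phi k) w)%R))%:E).
    by apply: mn2; apply: mCJ; apply: mCM; [exact: mC_cst|].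
  have mt2 v : measurable_fun setT (fun w => (\sum_(k : Kn n) (cabs2 (cj (b v * beta v (phi k) w)%R))%:E)%E).
    by apply: emeasurable_sum.
  have t0 v k w : (0 <= (cabs2 (cj (b v * beta v (phi k) w)%R))%:E)%E by rewrite lee_fin cabs2_ge0.
  transitivity (\int[gm]_w (A%:E * \sum_(v <- S) \sum_(k : Kn n) (cabs2 (cj (b v * beta v (phi k) w)%R))%:E))%E; last first.
    apply: eq_integral => w _; rewrite EFinM -sumEFin; congr (_ * _)%E; apply: eq_bigr => v _; by rewrite sumEFin.
  rewrite ge0_integralZl_EFin //; last 3 first.
  - by move=> w _; apply: sume_ge0 => v _; apply: sume_ge0.
  - by apply: emeasurable_sum.
  - exact: ltW.
  congr (_ * _)%E; rewrite ge0_integral_sum //; last by move=> v w _; apply: sume_ge0.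
  apply: eq_bigr => v _; rewrite ge0_integral_sum //; apply: eq_bigr => k _.
  rewrite -(n2_beta v (mph k)) -n2Z //; apply: eq_integral => w _; by rewrite cabs2J.
apply: ge0_le_int.
- apply/measurable_EFinP; apply: measurable_funM => //; apply: measurable_sum => v; apply: measurable_sum => k.
  by apply: mabs2; apply: mCJ; apply: mCM; [exact: mC_cst|].
- apply: (@mI2 _ _ _ _ R gm (fun q : V * V => (cabs2 (\sum_(v <- S) \sum_(k : Kn n) cj (b v * beta v (phi k) q.1) * beta v (ek (fun j => k j)) q.2))%:E)) => [|q].
    apply/measurable_EFinP; apply: mabs2; apply: mC_sum => v; apply: mC_sum => k; apply: mCM.
      by apply: mCJ; apply: mCM; [exact: mC_cst|exact: (mC_comp (mb v k) measurable_fst)].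
    by have [mbe _] := Ed_be v (fun j => k j); exact: (mC_comp mbe measurable_snd).
  by rewrite lee_fin cabs2_ge0.
- by move=> w; rewrite lee_fin mulr_ge0 ?(ltW A0) // sumr_ge0 // => v _; rewrite sumr_ge0 // => k _; exact: cabs2_ge0.
- by move=> w; exact: (rz S (fun v k => cj (b v * beta v (phi k) w)) uS SG).
Qed.
End Fix.
End Psi.

(* A finite-dimensional space of functions is determined by finitely many values. *)
Lemma unisolvent (K : fieldType) (f : nat -> K -> K) (Q : (K -> K) -> Prop) r :
  Q (fun=> 0) -> (forall i, Q (f i)) -> (forall g h c, Q g -> Q h -> Q (fun x => g x + c * h x)) ->
  exists (r' : nat) (p : nat -> K) (q : nat -> K -> K), (forall l, Q (q l)) /\
   forall i, (i < r)%N -> forall z, f i z = \sum_(l < r') q l z * f i (p l).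
Proof.
move=> Q0 Qf Ql; elim: r => [|r [r' [p [q [hQ hf]]]]]; first by exists 0%N, (fun=> 0), (fun _ => f 0%N).
pose g z := f r z - \sum_(l < r') q l z * f r (p l).
have Qg : Q g.
  rewrite /g; elim: (r') => [|l IH].
    by have := Qf r; congr Q; apply/funext => z; rewrite big_ord0 subr0.
  have := Ql _ _ (- f r (p l)) IH (hQ l); congr Q; apply/funext => z.
  by rewrite big_ord_recr /= opprD addrA mulNr [f r (p l) * _]mulrC.
have [[p0 gp]|g0] := pselect (exists p, g p != 0); last first.
  exists r', p, q; split => // i; rewrite ltnS leq_eqVlt => /orP[/eqP ->|/hf //] z.
  by apply/eqP; rewrite -subr_eq0; apply: contrapT => /negP h; apply: g0; exists z.
pose q0 z := 0 + (g p0)^-1 * g z.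
have Qq0 : Q q0 by exact: Ql.
exists r'.+1, (fun l => if l == r' then p0 else p l), (fun l z => if l == r' then q0 z else q l z + (- q l p0) * q0 z); split.
  by move=> l; case: (l == r'); [exact: Qq0|exact: Ql].
move=> i ir z; rewrite big_ord_recr /= eqxx.
have -> : \sum_(l < r') (if l == r' :> nat then q0 z else q l z + (- q l p0) * q0 z) * f i (if l == r' :> nat then p0 else p l) =
  \sum_(l < r') q l z * f i (p l) - q0 z * \sum_(l < r') q l p0 * f i (p l).
  rewrite mulr_sumr -sumrB; apply: eq_bigr => l _; rewrite ltn_eqF //.
  by move: (q l z) (q l p0) (q0 z) (f i _) => a b c e; ring.
move: ir; rewrite ltnS leq_eqVlt => /orP[/eqP ->|/hf h]; last by rewrite -!h subrK.
have e w : \sum_(l < r') q l w * f r (p l) = f r w - g w by rewrite /g subKr.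
rewrite !e /q0; move: gp; move: (f r z) (f r p0) (g z) (g p0) => a b c e1 e0; by field.
Qed.

(** * Density of the complex Hermite functions *)
Section FejOp.
Variables (R : realType) (d : nat).
Local Notation C := (CC R).
Local Notation V := (cvec R d).
Local Notation U := (@U R).
Local Notation ei := (@ei R).
Local Notation gm := (gm R d).
Local Open Scope complex_scope.

Lemma mC_cI d1 d2 (T1 : measurableType d1) (T2 : measurableType d2) (P : probability T2 R) (f : T1 * T2 -> C) :
  mC f -> (forall x, ci P (fun y => f (x, y))) -> mC (fun x => cI P (fun y => f (x, y))).
Proof.
move=> [m1 m2] cf.
have key (h : T1 * T2 -> R) : measurable_fun setT h -> (forall x, P.-integrable setT (EFin \o (fun y => h (x, y)))) ->
    measurable_fun setT (fun x => \int[P]_y h (x, y)).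
  move=> mh ih; rewrite (_ : (fun x => _) = (fun x => fine (\int[P]_y maxe (h (x, y))%:E 0)%E - fine (\int[P]_y maxe (- (h (x, y))%:E) 0)%E)); last first.
    by apply/funext => x; have [-> _ _] := Rintegral_pn (ih x).
  apply: measurable_funB; apply: (measurableT_comp (fine_measurable measurableT)).
    apply: (@mI2 _ _ _ _ R P (fun q => maxe (h q)%:E 0%E)) => [|q]; last by rewrite le_max lexx orbT.
    by apply: measurable_maxe; [exact/measurable_EFinP|exact: measurable_cst].
  apply: (@mI2 _ _ _ _ R P (fun q => maxe (- (h q)%:E)%E 0%E)) => [|q]; last by rewrite le_max lexx orbT.
  by apply: measurable_maxe; [apply/measurable_EFinP; exact: measurable_funN|exact: measurable_cst].
by split; [exact: key m1 (fun x => ciRe (cf x))|exact: key m2 (fun x => ciIm (cf x))].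
Qed.

Lemma fk_le N t : fk N t <= N.+1%:R :> R.
Proof.
have h : cabs2 (1 + ei t) <= 4.
  have := cabs2_para (1 : C) (ei t); rewrite cabs2_ei (cabs2R 1) expr1n => e.
  have := cabs2_ge0 (1 - ei t); lra.
rewrite /fk ler_pdivrMr ?cbin_gt0 //; have := cbin_ge R N; rewrite ler_pdivrMr ?ltr0n // mulrC => /(le_trans _); apply.
by rewrite lerXn2r ?nnegrE ?cabs2_ge0.
Qed.

Lemma fk_bnd_ci N (f : R -> C) M : mC (T := measurableTypeR R) f -> (forall t, cn (f t) <= M) ->
  ci U (fun t => (fk N t)%:C * f t).
Proof.
move=> mf hf; apply: (@ci_bnd _ _ _ _ _ (N.+1%:R * M)).
  by apply: mCM mf; apply: mC_real; exact: mfk.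
by move=> t; rewrite cnM cn_real ?fk_ge0 //; apply: ler_pM; rewrite ?fk_ge0 ?cn_ge0 ?fk_le.
Qed.

Lemma fk_intM N (c : R) : 0 <= c -> (\int[U]_t (fk N t * c)%:E = c%:E)%E.
Proof.
move=> c0; transitivity (c%:E * \int[U]_t (fk N t)%:E)%E; last by rewrite fk_int mule1.
rewrite -ge0_integralZl_EFin //; last 2 first.
- by move=> t _; rewrite lee_fin fk_ge0.
- by apply/measurable_EFinP; exact: mfk.
by apply: eq_integral => t _; rewrite -EFinM mulrC.
Qed.

(** Jensen's inequality for the probability density [fk N], from [2 * cn c * cn (f t) <= cabs2 (f t)
    + cabs2 c] integrated in [t]. *)
Lemma fk_jensen N (f : R -> C) M : mC (T := measurableTypeR R) f -> (forall t, cn (f t) <= M) ->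
  ((cabs2 (cI U (fun t => (fk N t)%:C * f t)))%:E <= \int[U]_t (fk N t * cabs2 (f t))%:E)%E.
Proof.
move=> mf hf; have cf := fk_bnd_ci N mf hf.
set c := cI _ _; set I := (X in (_ <= X)%E).
have mk : measurable_fun setT (fun t : measurableTypeR R => fk N t) by exact: mfk.
have m1 : measurable_fun setT (fun t : measurableTypeR R => (fk N t * cabs2 (f t))%:E).
  by apply/measurable_EFinP; apply: measurable_funM => //; exact: mabs2.
have m2 : measurable_fun setT (fun t : measurableTypeR R => (fk N t * cabs2 c)%:E).
  by apply/measurable_EFinP; apply: measurable_funM.
have p1 (t : R) : (0 <= (fk N t * cabs2 (f t))%:E)%E by rewrite lee_fin mulr_ge0 ?fk_ge0 ?cabs2_ge0.
have p2 (t : R) : (0 <= (fk N t * cabs2 c)%:E)%E by rewrite lee_fin mulr_ge0 ?fk_ge0 ?cabs2_ge0.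
have h : ((2 * cn c * cn c)%:E <= I + (cabs2 c)%:E)%E.
  have c20 : 0 <= 2 * cn c by rewrite mulr_ge0 ?cn_ge0.
  rewrite EFinM; apply: (le_trans (lee_wpmul2l _ (cn_cI cf))); first by rewrite lee_fin.
  rewrite -ge0_integralZl_EFin //; last 2 first.
  - by move=> t _; rewrite lee_fin cn_ge0.
  - by apply/measurable_EFinP; apply: mcn; case: cf.
  rewrite -(fk_intM N (cabs2_ge0 c)) -ge0_integralD //.
  apply: ge0_le_int.
  - by apply: emeasurable_funM; [exact: measurable_cst|apply/measurable_EFinP; apply: mcn; case: cf].
  - exact: emeasurable_funD.
  - by move=> t; rewrite mule_ge0 // lee_fin ?cn_ge0.
  move=> t; rewrite -EFinM -EFinD lee_fin cnM cn_real ?fk_ge0 // -!cn_sqr -mulrDr mulrCA ler_wpM2l ?fk_ge0 //.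
  by have := sqr_ge0 (cn (f t) - cn c); rewrite sqrrB; move: (cn _) (cn c) => x y; rewrite !expr2; lra.
have I0 : (0 <= I)%E by apply: integral_ge0.
have [If|] := boolP (I \is a fin_num); last first.
  by rewrite ge0_fin_numE // -leNgt leye_eq => /eqP ->; rewrite leey.
move: h; rewrite -(fineK If) -EFinD !lee_fin -cn_sqr expr2; lra.
Qed.

Definition W (z : V) : R := expR (pi * vnorm2 z).
(* Growth bound that makes all circle averages absolutely convergent and is invariant under rotations. *)
Definition BG (F : V -> C) := mC F /\ exists2 K, 0 <= K & forall z, cn (F z) <= K * W z.
Definition rot (z : V) j t : V := upd z j (z ord0 j * ei t).
Definition Rop N j (F : V -> C) (z : V) : C := cI U (fun t => (fk N t)%:C * F (rot z j t)).

Lemma rotE z j t i : rot z j t ord0 i = (if i == j then z ord0 j * ei t else z ord0 i).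
Proof. by rewrite mxE. Qed.
Lemma W_rot z j t : W (rot z j t) = W z.
Proof.
rewrite /W; congr (expR (_ * _)); apply: eq_bigr => i _; rewrite rotE.
by case: eqP => [->|//]; rewrite cabs2M cabs2_ei mulr1.
Qed.
Lemma W_ge0 z : 0 <= W z. Proof. exact: expR_ge0. Qed.

Lemma m_rot d1 (T : measurableType d1) (a : T -> V) (b : T -> measurableTypeR R) j :
  measurable_fun setT a -> measurable_fun setT b -> measurable_fun setT (fun x => rot (a x) j (b x)).
Proof.
move=> ma mb; apply: m_upd => //; apply: mCM; first exact: (mC_comp (mv_coord R j) ma).
exact: (mC_comp (@mC_ei R) mb).
Qed.
Lemma m_rot1 z j : measurable_fun setT (fun t : measurableTypeR R => rot z j t).
Proof. exact: (m_rot _ (measurable_cst _) (@measurable_id _ (measurableTypeR R) setT)). Qed.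

Lemma BG_slice F z j : BG F -> mC (T := measurableTypeR R) (fun t => F (rot z j t)) /\
  exists M, forall t, cn (F (rot z j t)) <= M.
Proof.
move=> [mF [K K0 hF]]; split; first exact: (mC_comp mF (m_rot1 z j)).
by exists (K * W z) => t; have := hF (rot z j t); rewrite W_rot.
Qed.
Lemma BG_ci N F z j : BG F -> ci U (fun t => (fk N t)%:C * F (rot z j t)).
Proof. by move=> /(BG_slice z j)[m [M hM]]; exact: fk_bnd_ci m hM. Qed.

Lemma BG_Rop N j F : BG F -> BG (Rop N j F).
Proof.
move=> bF; have [mF [K K0 hF]] := bF; split.
  apply: (@mC_cI _ _ V _ U (fun q => (fk N q.2)%:C * F (rot q.1 j q.2))) => [|z]; last exact: BG_ci.
  apply: mCM; first by apply: mC_real; exact: (measurableT_comp (mfk N) measurable_snd).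
  exact: (mC_comp mF (m_rot j measurable_fst measurable_snd)).
exists K => // z; rewrite -lee_fin; apply: le_trans (cn_cI (BG_ci N z j bF)) _.
rewrite -(fk_intM N (_ : 0 <= K * W z)); last by rewrite mulr_ge0 ?W_ge0.
apply: ge0_le_int.
- by apply/measurable_EFinP; apply: mcn; case: (BG_ci N z j bF).
- by apply/measurable_EFinP; apply: measurable_funM => //; exact: mfk.
- by move=> t; rewrite lee_fin cn_ge0.
by move=> t; rewrite lee_fin cnM cn_real ?fk_ge0 // ler_wpM2l ?fk_ge0 // -(W_rot z j t).
Qed.

Lemma BG_B F G : BG F -> BG G -> BG (fun z => F z - G z).
Proof.
move=> [mF [K K0 hF]] [mG [L L0 hG]]; split; first exact: mCB.
exists (K + L) => [|z]; first exact: addr_ge0.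
by apply: le_trans (cnD _ _) _; rewrite cnN mulrDl lerD.
Qed.
Lemma Rop_B N j F G : BG F -> BG G -> (fun z => Rop N j F z - Rop N j G z) = Rop N j (fun z => F z - G z).
Proof.
move=> bF bG; apply/funext => z; rewrite /Rop -cIB; [|exact: BG_ci|exact: BG_ci].
by apply: eq_cI => t; rewrite mulrBr.
Qed.

(** Jensen's inequality for each [z], then rotation invariance of [gm] for each angle. *)
Lemma Rop_n2 N j F : BG F -> (n2 gm (Rop N j F) <= n2 gm F)%E.
Proof.
move=> bF; have [mF _] := bF; have [mR _] := BG_Rop N j bF.
have mj : measurable_fun setT (fun q : V * measurableTypeR R => (fk N q.2 * cabs2 (F (rot q.1 j q.2)))%:E).
  apply/measurable_EFinP; apply: measurable_funM; first exact: (measurableT_comp (mfk N) measurable_snd).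
  by apply: mabs2; exact: (mC_comp mF (m_rot j measurable_fst measurable_snd)).
have p0 (z : V) (t : R) : (0 <= (fk N t * cabs2 (F (rot z j t)))%:E)%E by rewrite lee_fin mulr_ge0 ?fk_ge0 ?cabs2_ge0.
apply: (@le_trans _ _ (\int[gm]_z \int[U]_t (fk N t * cabs2 (F (rot z j t)))%:E)%E).
  apply: ge0_le_int; first exact: mn2.
  - exact: (@mI2 _ _ _ _ R U _ mj (fun q => p0 q.1 q.2)).
  - by move=> z; rewrite lee_fin cabs2_ge0.
  - by move=> z; have [m [M hM]] := BG_slice z j bF; exact: fk_jensen m hM.
rewrite (@tonelli _ _ V _ _ gm U (fun z t => (fk N t * cabs2 (F (rot z j t)))%:E) mj p0).
have e t : (\int[gm]_z (fk N t * cabs2 (F (rot z j t)))%:E = n2 gm F * (fk N t)%:E)%E.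
  transitivity ((fk N t)%:E * \int[gm]_z (cabs2 (F (rot z j t)))%:E)%E.
    rewrite -ge0_integralZl_EFin ?fk_ge0 // => [z _|]; first by rewrite lee_fin cabs2_ge0.
    by apply: mn2; exact: (mC_comp mF (m_rot j (@measurable_id _ V setT) (measurable_cst t))).
  rewrite muleC; congr (_ * _)%E; rewrite /n2 -(gm_rot j (cabs2_ei t) (mn2 mF)) => [|z]; last by rewrite lee_fin cabs2_ge0.
  by apply: eq_integral => z _; rewrite /rot mulrC.
rewrite (_ : (\int[U]_t _ = \int[U]_t (n2 gm F * (fk N t)%:E))%E); last by apply: eq_integral => t _; exact: e.
have nn := n2_ge0 gm F.
have [nf|] := boolP (n2 gm F \is a fin_num); last first.
  by rewrite ge0_fin_numE // -leNgt leye_eq => /eqP ->; exact: leey.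
rewrite -(fineK nf) ge0_integralZl_EFin ?fk_int ?mule1 //.
- by move=> t _; rewrite lee_fin fk_ge0.
- by apply/measurable_EFinP; exact: mfk.
- by rewrite fine_ge0.
Qed.

Lemma Rop_comm N M i j F : i != j -> BG F -> Rop N i (Rop M j F) = Rop M j (Rop N i F).
Proof.
move=> ij bF; have [mF [K K0 hF]] := bF; apply/funext => z.
have rr s t : rot (rot z i s) j t = rot (rot z j t) i s.
  rewrite /rot upd_ne 1?eq_sym // upd_ne // upd_comm //.
pose f (q : measurableTypeR R * measurableTypeR R) := (fk N q.1)%:C * ((fk M q.2)%:C * F (rot (rot z i q.1) j q.2)).
have mrr d1 (T : measurableType d1) (a b : T -> measurableTypeR R) : measurable_fun setT a -> measurable_fun setT b ->
   mC (fun x => (fk N (a x))%:C * ((fk M (b x))%:C * F (rot (rot z i (a x)) j (b x)))).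
  move=> ma mb; apply: mCM; first by apply: mC_real; exact: (measurableT_comp (mfk N) ma).
  apply: mCM; first by apply: mC_real; exact: (measurableT_comp (mfk M) mb).
  apply: (mC_comp (g := fun x => rot (rot z i (a x)) j (b x)) mF); apply: m_rot => //.
  exact: (measurableT_comp (m_rot1 z i) ma).
have fb s t : cn (f (s, t)) <= N.+1%:R * (M.+1%:R * (K * W z)).
  rewrite /f !cnM !cn_real ?fk_ge0 //; apply: ler_pM; [exact: fk_ge0|by rewrite mulr_ge0 ?fk_ge0 ?cn_ge0|exact: fk_le|].
  apply: ler_pM; [exact: fk_ge0|exact: cn_ge0|exact: fk_le|].
  by have := hF (rot (rot z i s) j t); rewrite !W_rot.
have mid := @measurable_id _ (measurableTypeR R) setT.
have mc (t : R) : measurable_fun setT (fun _ : measurableTypeR R => t : measurableTypeR R) by exact: measurable_cst.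
transitivity (cI U (fun s => cI U (fun t => f (s, t)))).
  apply: eq_cI => s; rewrite /Rop -cIZ //; exact: BG_ci.
rewrite (@cI_fub _ _ _ _ _ U U f).
- apply: eq_cI => t; rewrite /Rop -cIZ; last exact: BG_ci.
  by apply: eq_cI => s; rewrite /f rr mulrCA.
- exact: (mrr _ _ _ _ measurable_fst measurable_snd).
- by move=> s; apply: (@ci_bnd _ _ _ _ _ (N.+1%:R * (M.+1%:R * (K * W z)))) => [|t]; [exact: (mrr _ _ _ _ (mc s) mid)|exact: fb].
- by move=> t; apply: (@ci_bnd _ _ _ _ _ (N.+1%:R * (M.+1%:R * (K * W z)))) => [|s]; [exact: (mrr _ _ _ _ mid (mc t))|exact: fb].
apply: (@le_lt_trans _ _ (N.+1%:R * (M.+1%:R * (K * W z)))%:E); last exact: ltry.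
have b1 s : (\int[U]_t (cn (f (s, t)))%:E <= (N.+1%:R * (M.+1%:R * (K * W z)))%:E)%E.
  by apply: int_bnd => [|t]; [apply: mcn; exact: (mrr _ _ _ _ (mc s) mid)|rewrite cn_ge0 fb].
apply: (@le_trans _ _ (\int[U]_s (N.+1%:R * (M.+1%:R * (K * W z)))%:E)%E); last first.
  rewrite (_ : \int[U]_s _ = (N.+1%:R * (M.+1%:R * (K * W z)))%:E)%E // -[RHS]mule1 -(@probability_setT _ _ _ U); exact: integral_cst.
apply: ge0_le_int; [| exact: measurable_cst | | exact: b1].
  apply: (@mI2 _ _ _ _ R U (fun q => (cn (f q))%:E)) => [|q]; last by rewrite lee_fin cn_ge0.
  by apply/measurable_EFinP; apply: mcn; exact: (mrr _ _ _ _ measurable_fst measurable_snd).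
by move=> t; apply: integral_ge0 => p _; rewrite lee_fin cn_ge0.
Qed.

(** Pointwise convergence and contractivity give norm convergence. By [n2_lim] the norms of
    [Rop N j F + F] cannot all stay at or below [4 * v - e], and where this value is exceeded the
    parallelogram law bounds the difference by [e]. *)
Lemma Rop_cvg j F (e : R) : BG F -> sq gm F -> (forall z, ccont (fun w => F (upd z j w))) -> 0 < e ->
  exists N, (n2 gm (fun z => (Rop N j F z - F z)%R) <= e%:E)%E.
Proof.
move=> bF sF cF e0; have [mF _] := bF.
have fejE N z : Rop N j F z = fejer N (fun w => F (upd z j w)) (z ord0 j) by [].
have pw z : cn ((Rop N j F z + F z) - 2 * F z) @[N --> \oo] --> (0 : R).
  apply/cvgrPdist_le => ep ep0; have [N0 hN] := fejer_cvg (z ord0 j) (cF z) ep0.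
  exists N0 => // N /= /hN; rewrite sub0r normrN ger0_norm ?cn_ge0 // -fejE upd_id.
  by congr (cn _ <= _); ring.
have mR N : mC (Rop N j F) by case: (BG_Rop N j bF).
set v := fine (n2 gm F).
have nF : n2 gm F = v%:E by rewrite /v n2_fine.
have [N hN] : exists N, ((4 * v - e)%:E < n2 gm (fun z => (Rop N j F z + F z)%R))%E.
  apply: contrapT => /forallNP h.
  have := @n2_lim _ _ _ gm (fun N z => Rop N j F z + F z) (fun z => 2 * F z) (4 * v - e).
  have -> : (n2 gm (fun z => (2 * F z)%R) = (4 * v)%:E)%E.
    by rewrite n2Z // nF -EFinM -(realCnat R 2) cabs2R; congr ((_ * _)%:E); ring.
  have m2 : mC (fun z : V => 2 * F z) by apply: mCM mF; exact: mC_cst.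
  move=> /(_ (fun N => mCD (mR N) mF) m2 pw) k.
  have : ((4 * v)%:E <= (4 * v - e)%:E)%E by apply: k => N; rewrite leNgt; apply/negP; exact: h.
  by rewrite lee_fin; lra.
exists N; have := n2_para gm (mR N) mF; rewrite nF.
have sR : sq gm (Rop N j F) by split => //; apply: le_lt_trans (Rop_n2 N j bF) _; case: sF.
have hR : fine (n2 gm (Rop N j F)) <= v.
  by rewrite -lee_fin n2_fine // -nF; exact: Rop_n2.
rewrite -(n2_fine sR) -(n2_fine (sqD sR sF)) -(n2_fine (sqB sR sF)) -!EFinM -!EFinD => -[].
move: hN; rewrite -{1}(n2_fine (sqD sR sF)) lte_fin lee_fin; lra.
Qed.
End FejOp.

(** * Finite spans; approximation by combinations of Hermite functions *)

Section Span.
Variables (K : fieldType) (T : Type).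
Definition Sp (I : Type) (B : I -> T -> K) (f : T -> K) := exists s : seq (K * I), forall z, f z = \sum_(i <- s) i.1 * B i.2 z.
Lemma Sp0 I (B : I -> T -> K) : Sp B (fun=> 0).
Proof. by exists [::] => z; rewrite big_nil. Qed.
Lemma Sp_lin I (B : I -> T -> K) f g c : Sp B f -> Sp B g -> Sp B (fun z => f z + c * g z).
Proof.
move=> [s hs] [t ht]; exists (s ++ [seq (c * i.1, i.2) | i <- t]) => z.
rewrite hs ht big_cat big_map mulr_sumr; congr (_ + _); apply: eq_bigr => i _; exact: mulrA.
Qed.
Lemma Sp_gen I (B : I -> T -> K) i : Sp B (B i).
Proof. by exists [:: (1, i)] => z; rewrite big_seq1 mul1r. Qed.
Lemma Sp_ext I (B : I -> T -> K) f g : Sp B f -> (forall z, f z = g z) -> Sp B g.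
Proof. by move=> h e; have <- : f = g by apply/funext. Qed.
Lemma Sp_sum I (B : I -> T -> K) (J : Type) (s : seq J) (c : J -> K) (f : J -> T -> K) :
  (forall j, Sp B (f j)) -> Sp B (fun z => \sum_(j <- s) c j * f j z).
Proof.
move=> h; elim: s => [|j s IH]; first by apply: Sp_ext (Sp0 B) _ => z; rewrite big_nil.
by apply: Sp_ext (Sp_lin (c j) IH (h j)) _ => z; rewrite big_cons addrC.
Qed.
Lemma Sp_mono I J (B : I -> T -> K) (B' : J -> T -> K) f : (forall i, Sp B' (B i)) -> Sp B f -> Sp B' f.
Proof.
move=> h [s hs]; apply: Sp_ext (Sp_sum s (fun i => i.1) (fun i : K * I => h i.2)) _ => z; exact/esym/hs.
Qed.
End Span.

Section Density.
Variables (R : realType) (d : nat).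
Local Notation C := (CC R).
Local Notation V := (cvec R d).
Local Notation U := (@U R).
Local Notation gm := (gm R d).
Local Open Scope complex_scope.

Definition S1 n : (C -> C) -> Prop := Sp (fun (i : nat * 'I_n) z => hh i.1 i.2 z).

(** The recursion [hhS] solved for [z * hh m k z]; it lowers [k], so the bound by [n] is
    respected. *)
Lemma S1_mul n f : S1 n f -> S1 n (fun z => z * f z).
Proof.
move=> [s hs]; have h (i : C * (nat * 'I_n)) : S1 n (fun z => z * hh i.2.1 i.2.2 z).
  case: i => c [m k]; have kn : (k.-1 < n)%N by apply: leq_ltn_trans (leq_pred _) (ltn_ord k).
  apply: Sp_ext (Sp_lin (- (k%:R / pi%:C)) (Sp_gen _ (m.+1, k)) (Sp_gen _ (m, Ordinal kn))) _ => z /=.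
  by rewrite hhS mulNr addrK.
apply: Sp_ext (Sp_sum s (fun i => i.1) h) _ => z; rewrite hs mulr_sumr; apply: eq_bigr => i _; exact: mulrCA.
Qed.

Lemma S1_mon n k m : (k < n)%N -> S1 n (fun z => cj z ^+ k * z ^+ m).
Proof.
move=> kn; elim: m => [|m IH].
  apply: Sp_ext (Sp_lin ((-1) ^+ k) (Sp0 _) (Sp_gen _ (0%N, Ordinal kn))) _ => z /=.
  by rewrite add0r hh0 -exprMn mulN1r opprK expr0 mulr1.
by apply: Sp_ext (S1_mul IH) _ => z; rewrite exprS mulrCA.
Qed.

(** By [fejer_PA] the means of order [N] of all such functions lie in a single finite-dimensional
    space, on which [unisolvent] provides nodes and an interpolation basis. *)
Lemma fejer_interp N n : exists r (p : nat -> C) (q : nat -> C -> C), (forall l, S1 n (q l)) /\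
  forall f, PA n f -> forall z, fejer N f z = \sum_(l < r) q l z * fejer N f (p l).
Proof.
pose M := (N + n)%N.
(* The pair of exponents [(k, m)] is coded as [k * M + m]; out-of-range codes give the zero
   function. *)
pose f i (z : C) : C := if (i %/ M < n)%N then cj z ^+ (i %/ M) * z ^+ (i %% M) else 0.
have Sf i : S1 n (f i).
  by rewrite /f; case: (boolP (i %/ M < n)%N) => h; [exact: S1_mon|exact: Sp0].
have [r [p [q [hq hf]]]] := unisolvent (n * M) (Sp0 _) Sf (fun g h c => @Sp_lin _ _ _ _ g h c).
exists r, p, q; split => // g /(fejer_PA N)[a ha] z.
have key k m : (k < n)%N -> (m < M)%N -> cj z ^+ k * z ^+ m = \sum_(l < r) q l z * (cj (p l) ^+ k * p l ^+ m).
  move=> kn mM; have M0 : (0 < M)%N by exact: leq_ltn_trans mM.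
  have := hf (k * M + m)%N _ z; rewrite /f divnMDl // divn_small // addn0 kn modnMDl modn_small //; apply.
  by rewrite -ltn_divLR // divnMDl // divn_small // addn0.
rewrite ha (eq_bigr (fun k : 'I_n => \sum_(l < r) q l z * \sum_(m < M) a k m * (cj (p l) ^+ k * p l ^+ m))) => [|k _].
  rewrite exchange_big; apply: eq_bigr => l _ /=; by rewrite ha mulr_sumr.
rewrite (eq_bigr (fun m : 'I_M => \sum_(l < r) q l z * (a k m * (cj (p l) ^+ k * p l ^+ m)))) => [|m _].
  by rewrite exchange_big; apply: eq_bigr => l _ /=; rewrite mulr_sumr.
by rewrite key // mulr_sumr; apply: eq_bigr => l _; exact: mulrCA.
Qed.

Variable n : 'I_d -> nat.
Hypothesis n0 : forall j, (0 < n j)%N.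

Lemma lD_le (F : V -> C) : mC F -> (lD F <= n2 gm F)%E.
Proof.
move=> mF; apply: ge0_le_int.
- by apply/measurable_EFinP; apply: measurable_funM; [exact: mDall|exact: mabs2].
- exact: mn2.
- by move=> y; rewrite lee_fin mulr_ge0 ?cabs2_ge0 // DallE ler0n.
move=> y; rewrite lee_fin -[leRHS]mul1r ler_wpM2r ?cabs2_ge0 // DallE; by case: [forall _, _].
Qed.

Lemma pt_bound : exists2 B, 0 <= B & forall F (a : V), SP n F -> ((cabs2 (F a) * gweight a)%:E <= B%:E * n2 gm F)%E.
Proof.
have [B B0 hB] := local_bound R n0; exists B => // F a sF.
have sb : SP n (beta (- a) F) by exact: SP_beta.
have := hB _ 0 sb; rewrite beta_at0 => /(_ _)/le_trans; apply.
  by move=> j; rewrite mxE cn0 ler01.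
rewrite -(n2_beta (- a) (SP_mC sF)) lee_wpmul2l ?lee_fin //; apply: lD_le; exact: SP_mC sb.
Qed.

Lemma W_gw (z : V) : gweight z * W z = 1.
Proof. by rewrite /gweight /W -expRD mulNr addrC subrr expR0. Qed.

Lemma SP_BG F : SP n F -> sq gm F -> BG F.
Proof.
move=> sF qF; split; first exact: SP_mC sF.
have [B B0 hB] := pt_bound; pose K := B * fine (n2 gm F).
have K0 : 0 <= K by rewrite mulr_ge0 // fine_ge0 // n2_ge0.
exists (1 + K) => [|z]; first by rewrite addr_ge0.
have W1 : 1 <= W z by rewrite /W -expR0 ler_expR mulr_ge0 ?pi_ge0 // vnorm2_ge0.
have := hB F z sF; rewrite -(n2_fine qF) -EFinM lee_fin -/K => h.
have h2 : cabs2 (F z) <= K * W z.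
  have -> : cabs2 (F z) = cabs2 (F z) * gweight z * W z by rewrite -mulrA W_gw mulr1.
  by rewrite ler_wpM2r ?W_ge0.
(* The pointwise bound is quadratic in [cn (F z)]; it is made linear by
   [cn (F z) <= 1 + cabs2 (F z)]. *)
have := sqr_ge0 (cn (F z) - 1); have := cn_ge0 (F z); move: h2; rewrite -cn_sqr mulrDl mul1r !expr2; lra.
Qed.

(* Finite rank in the variable [j], expressed by interpolation at finitely many nodes so that it is
   visibly preserved by operators acting on the other variables. *)
Definition Int j (G : V -> C) := exists r (p : nat -> C) (q : nat -> C -> C), (forall l, S1 (n j) (q l)) /\
  forall z, G z = \sum_(l < r) q l (z ord0 j) * G (upd z j (p l)).

Lemma Int_Rop N j F : SP n F -> Int j (Rop N j F).
Proof.
move=> sF; have [r [p [q [hq hf]]]] := fejer_interp N (n j); exists r, p, q; split => // z.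
rewrite [LHS](hf _ (sF z j)); apply: eq_bigr => l _; congr (_ * _); apply: eq_cI => t.
by rewrite /rot mxE eqxx upd_upd.
Qed.

Lemma Int_Rop_ne N i j G : i != j -> BG G -> Int j G -> Int j (Rop N i G).
Proof.
move=> ij bG [r [p [q [hq hf]]]]; exists r, p, q; split => // z.
transitivity (cI U (fun t => \sum_(l < r) q l (z ord0 j) * ((fk N t)%:C * G (rot (upd z j (p l)) i t)))).
  apply: eq_cI => t; rewrite hf mulr_sumr; apply: eq_bigr => l _.
  by rewrite mulrCA /rot upd_ne 1?eq_sym // [in RHS]upd_ne // upd_comm.
rewrite cI_sum => [|l]; last by apply: ciZ; exact: BG_ci.
by apply: eq_bigr => l _; rewrite cIZ //; exact: BG_ci.
Qed.

Section Iter.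
Variable N : 'I_d -> nat.
Definition Rs (S : seq 'I_d) (F : V -> C) : V -> C := foldr (fun j G => Rop (N j) j G) F S.
Lemma BG_Rs S F : BG F -> BG (Rs S F).
Proof. by move=> bF; elim: S => //= j S IH; exact: BG_Rop. Qed.
Lemma Rop_Rs M j S F : j \notin S -> BG F -> Rop M j (Rs S F) = Rs S (Rop M j F).
Proof.
move=> jS bF; elim: S jS => //= i S IH; rewrite inE negb_or => /andP[ji /IH <-].
by rewrite Rop_comm //; exact: BG_Rs.
Qed.
Lemma Int_Rs j S G : j \notin S -> BG G -> Int j G -> Int j (Rs S G).
Proof.
move=> jS bG iG; elim: S jS => //= i S IH; rewrite inE negb_or => /andP[ji /IH h].
by apply: Int_Rop_ne h; [rewrite eq_sym|exact: BG_Rs].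
Qed.
Lemma Rs_Int j S F : uniq S -> j \in S -> SP n F -> sq gm F -> Int j (Rs S F).
Proof.
move=> uS jS sF qF; have bF := SP_BG sF qF; elim: S uS jS => //= i S IH /andP[iS uS].
rewrite inE; have [->|ji] := eqVneq j i => /= h.
  by rewrite Rop_Rs //; apply: Int_Rs => //; [exact: BG_Rop|exact: Int_Rop].
by apply: Int_Rop_ne; [rewrite eq_sym|exact: BG_Rs|exact: IH].
Qed.
(** Each further operator costs [2 * x + 2 * e]: twice the previous error, transported by a
    contraction, plus twice its own. This is at most 4 times the previous bound. *)
Lemma Rs_n2 S F (e : R) : BG F -> (forall j, (n2 gm (fun z => (Rop (N j) j F z - F z)%R) <= e%:E)%E) -> 0 <= e ->
  (n2 gm (fun z => (Rs S F z - F z)%R) <= (4 ^+ size S * e)%:E)%E.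
Proof.
move=> bF he e0; have [mF _] := bF; elim: S => [|j S IH] /=.
  rewrite (_ : n2 _ _ = 0%E) ?lee_fin ?mulr_ge0 //.
  rewrite -(mul0e (n2 gm F)) -[X in (X%:E * _)%E](cabs20 R) -n2Z //; apply: eq_n2 => z; by rewrite subrr mul0r.
have bS := BG_Rs S bF; set G := Rs S F in bS IH *.
have [mR _] := BG_Rop (N j) j bF; have [mRG _] := BG_Rop (N j) j bS.
have := n2D_le gm (mCB mRG mR) (mCB mR mF).
rewrite (eq_n2 _ (g := fun z => Rop (N j) j G z - F z)) => [|z]; last by congr cabs2; rewrite addrA subrK.
move=> /le_trans; apply; rewrite Rop_B //.
have p4 : 1 <= 4 ^+ size S :> R by apply: exprn_ege1; lra.
apply: (@le_trans _ _ (2%:E * (4 ^+ size S * e)%:E + 2%:E * e%:E)%E).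
  apply: leeD; apply: lee_wpmul2l; rewrite ?lee_fin //.
  by apply: le_trans IH; apply: Rop_n2; exact: BG_B.
rewrite -!EFinM -EFinD lee_fin exprS.
have : e <= 4 ^+ size S * e by rewrite -[leLHS]mul1r ler_wpM2r.
rewrite -mulrA; lra.
Qed.
End Iter.

Definition updK (k : Kn n) j (b : 'I_(n j)) : Kn n := [ffun i => insubd (k i) (if i == j then b : nat else k i)].
Lemma updKE (k : Kn n) j (b : 'I_(n j)) i : updK k b i = (if i == j then b : nat else k i) :> nat.
Proof.
rewrite ffunE val_insubd; case: eqP => [->|_]; first by rewrite ltn_ord.
by rewrite ltn_ord.
Qed.

(** One coordinate after another is expanded by its interpolation formula. In [B S] the coordinates
    of [S] have been expanded and [G] is evaluated there at frozen nodes; when all are frozen, [G]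
    is a constant factor. *)
Lemma Int_span G : (forall j, Int j G) -> Sp (fun (i : ('I_d -> nat) * Kn n) => HH i.1 (fun j => i.2 j)) G.
Proof.
move=> hG.
pose B (S : seq 'I_d) (i : ('I_d -> nat) * Kn n * V) (z : V) : C :=
  (\prod_(j <- S) hh (i.1.1 j) (i.1.2 j) (z ord0 j)) * G (mixs S i.2 z).
have key (S : seq 'I_d) : uniq S -> Sp (B S) G.
  elim: S => [_|j S IH /= /andP[jS /IH]].
    pose k0 : Kn n := [ffun j => Ordinal (n0 j)].
    apply: Sp_ext (Sp_gen _ (fun=> 0%N, k0, 0)) _ => z; rewrite /B big_nil mul1r.
    by congr G; apply/rowP => i; rewrite mxE.
  apply: Sp_mono => -[[m k] y]; have [r [p [q [hq hf]]]] := hG j.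
  have hl (l : 'I_r) : Sp (B (j :: S)) (fun z => q l (z ord0 j) * (\prod_(j <- S) hh (m j) (k j) (z ord0 j) * G (mixs (j :: S) (upd y j (p l)) z))).
    have [s hs] := hq l.
    have ht (i : C * (nat * 'I_(n j))) := Sp_gen (B (j :: S)) ((fun i' => if i' == j then i.2.1 else m i'), updK k i.2.2, upd y j (p l)).
    apply: Sp_ext (Sp_sum s (fun i => i.1) ht) _ => z; rewrite hs mulr_suml; apply: eq_bigr => i _.
    rewrite /B /= big_cons eqxx updKE eqxx -!mulrA; congr (_ * (_ * (_ * _))).
    rewrite big_seq [RHS]big_seq; apply: eq_bigr => i' i'S; rewrite updKE.
    by have [e|//] := eqVneq i' j; case/negP: jS; move: e i'S => ->.
  apply: Sp_ext (Sp_sum (index_enum 'I_r) (fun=> 1) hl) _ => z.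
  rewrite /B /= (hf (mixs S y z)) mulr_sumr; apply: eq_bigr => l _; rewrite mul1r mulrCA.
  congr (_ * (_ * G _)); first by rewrite mxE (negPf jS).
  by apply/rowP => i; rewrite !mxE inE; case: (i == j).
apply: Sp_mono (key _ (enum_uniq 'I_d)) => -[[m k] y].
have k1 : (kap2 R (fun j => k j))%:C != 0 :> C by rewrite (inj_eq (@complexI R)) gt_eqF ?kap2_gt0.
apply: Sp_ext (Sp_lin (G y / (kap2 R (fun j => k j))%:C) (Sp0 _) (Sp_gen _ (m, k))) _ => z.
rewrite /B /HH add0r mulrA divfK //= mulrC; congr (_ * G _); first by rewrite big_enum.
by apply/rowP => i; rewrite mxE mem_enum.
Qed.

Lemma density F (e : R) : SP n F -> sq gm F -> 0 < e -> exists2 G, Sp (fun (i : ('I_d -> nat) * Kn n) => HH i.1 (fun j => i.2 j)) G &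
  BG G /\ (n2 gm (fun z => (G z - F z)%R) <= e%:E)%E.
Proof.
move=> sF qF e0; have bF := SP_BG sF qF; pose e' := e / 4 ^+ size (enum 'I_d).
have e'0 : 0 < e' by rewrite divr_gt0 // exprn_gt0.
have cF j z : ccont (fun w => F (upd z j w)) by exact: (PA_ccont (sF z j)).
have /choice[N hN] : forall j, exists N, (n2 gm (fun z => (Rop N j F z - F z)%R) <= e'%:E)%E.
  by move=> j; exact: Rop_cvg (cF j) e'0.
exists (Rs N (enum 'I_d) F).
  by apply: Int_span => j; apply: Rs_Int => //; rewrite ?enum_uniq ?mem_enum.
split; first exact: BG_Rs.
apply: le_trans (Rs_n2 (enum 'I_d) bF hN (ltW e'0)) _.
by rewrite /e' mulrC divfK // gt_eqF // exprn_gt0.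
Qed.

Lemma chi1_cn v z : cn (chi1 v z : C) = 1.
Proof. by rewrite /chi1 cn_cexp ReM ReR ImR mul0r subr0 ReB !ReM !ReJ !ImJ; apply/eqP; rewrite -expR0 (inj_eq (@expR_inj R)); apply/eqP; ring. Qed.
Lemma chi_cn (v z : V) : cn (chi v z) = 1.
Proof. by rewrite cn_prod big1 // => j _; exact: chi1_cn. Qed.
Lemma mC_chi (v : V) : mC (chi v).
Proof. by have [] : Ed (chi v) by apply: (Ed_prod (f := fun j => chi1 (v ord0 j))) => j; exact: E1_chi1. Qed.

(** [psi_HH] holds for the approximants of [density]. The loss of the factor 4 comes from passing
    from [F] to an approximant and back, each time with [n2D_le]. *)
Lemma mult_lower F (G : set V) A (S : seq V) (b : V -> C) : SP n F -> sq gm F -> Riesz n G A -> uniq S -> (forall v, v \in S -> G v) ->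
  ((A / 4 * \sum_(v <- S) cabs2 (b v))%:E * n2 gm F <= n2 gm (fun z => ((\sum_(v <- S) b v * chi v z) * F z)%R))%E.
Proof.
move=> sF qF rz uS SG; set be := fun z => \sum_(v <- S) b v * chi v z.
pose M := \sum_(v <- S) cn (b v).
have mb : mC be by apply: mC_sum => v; apply: mCM; [exact: mC_cst|exact: mC_chi].
have bM z : cn (be z) <= M.
  by apply: le_trans (cn_sum _ _) _; apply: ler_sum => v _; rewrite cnM chi_cn mulr1.
have qb : sq gm (fun z => be z * F z) by exact: sqM_bnd qF mb bM.
have [mF _] := qF; have [A0 _] := rz.
set a := A / 4 * _; have a0 : 0 <= a by rewrite mulr_ge0 ?divr_ge0 ?(ltW A0) // sumr_ge0 // => v _; exact: cabs2_ge0.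
rewrite -(n2_fine qF) -(n2_fine qb) -EFinM lee_fin; apply/ler_addgt0Pr => e e0.
(* The two approximation errors enter as [2 * a * e'] and [M ^+ 2 * e']; the summand 1 keeps the
   denominator positive. *)
pose e' := e / (2 * a + M ^+ 2 + 1).
have D0 : 0 < 2 * a + M ^+ 2 + 1 by have := sqr_ge0 M; lra.
have e'0 : 0 < e' by rewrite divr_gt0.
have [H [s hs] [bH hH]] := density sF qF e'0; have [mH _] := bH.
have [qH hF] : sq gm H /\ fine (n2 gm F) <= 2 * fine (n2 gm H) + 2 * e'.
  have qd : sq gm (fun z => H z - F z) by split; [exact: mCB|apply: le_lt_trans hH (ltry _)].
  have qH : sq gm H.
    have -> : H = (fun z => (H z - F z) + F z) by apply/funext => z; rewrite subrK.
    exact: sqD.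
  split => //; have := n2D_le gm mH (mCN (mCB mH mF)).
  rewrite (eq_n2 _ (g := F)) => [|z]; last by congr cabs2; rewrite opprB addrCA subrr addr0.
  rewrite (eq_n2 _ (f := fun z => - (H z - F z)) (g := fun z => H z - F z)) => [|z]; last exact: cabs2N.
  rewrite -(n2_fine qF) -(n2_fine qH) => /le_trans h.
  by rewrite -lee_fin EFinD !EFinM; apply: h; rewrite leeD2l // lee_wpmul2l.
have qbH : sq gm (fun z => be z * H z) by exact: sqM_bnd qH mb bM.
have psiH : 4 * a * fine (n2 gm H) <= fine (n2 gm (fun z => be z * H z)).
  rewrite -lee_fin EFinM (n2_fine qH) (n2_fine qbH).
  have -> : 4 * a = A * \sum_(v <- S) cabs2 (b v) by rewrite /a mulrA mulrCA mulfV ?mulr1.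
  have -> : H = (fun z => \sum_(i <- s) i.1 * HH i.2.1 (fun j => i.2.2 j) z) by apply/funext.
  exact: (psi_HH s (fun i => i.1) (fun i => i.2.1) (fun i => i.2.2) b rz uS SG).
have hb : fine (n2 gm (fun z => be z * H z)) <= 2 * fine (n2 gm (fun z => be z * F z)) + 2 * (M ^+ 2 * e').
  have mbd : mC (fun z => be z * (H z - F z)) by apply: mCM mb _; exact: mCB.
  have := n2D_le gm (mCM mb mF) mbd.
  rewrite (eq_n2 _ (g := fun z => be z * H z)) => [|z]; last by congr cabs2; rewrite -mulrDr addrCA subrr addr0.
  move=> /le_trans h; rewrite -lee_fin EFinD [(2 * fine _)%:E]EFinM [(2 * (_ * _))%:E]EFinM (n2_fine qb) (n2_fine qbH); apply: h.
  rewrite leeD2l // lee_wpmul2l //; apply: (@le_trans _ _ ((M ^+ 2)%:E * n2 gm (fun z => (H z - F z)%R))%E); last first.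
    by rewrite [leRHS]EFinM lee_wpmul2l // lee_fin sqr_ge0.
  have mHF := mCB mH mF.
  have <- : cabs2 (M%:C : C) = M ^+ 2 by exact: cabs2R.
  rewrite -n2Z //; apply: ge0_le_int; [exact: mn2|apply: mn2; apply: mCM mHF; exact: mC_cst|by move=> z; rewrite lee_fin cabs2_ge0|].
  move=> z; rewrite lee_fin !cabs2M ler_wpM2r ?cabs2_ge0 // cabs2R -cn_sqr lerXn2r ?nnegrE ?cn_ge0 //.
  exact: le_trans (cn_ge0 _) (bM z).
have ee : (2 * a + M ^+ 2 + 1) * e' = e by rewrite /e' mulrC divfK // gt_eqF.
have := ler_wpM2l a0 hF; rewrite -ee; move: psiH hb.
move: (fine _) (fine _) (fine _) (fine _) e'0 => x y u t e'0.
rewrite mulrDr mulrCA [a * (2 * e')]mulrCA !mulrDl mul1r -!mulrA => h1 h2 h3.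
have h4 : a * e' >= 0 by rewrite mulr_ge0 // ltW.
lra.
Qed.
End Density.

Lemma alg_gauss (K : comNzRingType) (p a b c e : K) : p * (a - b) * (e - c) = - (p * ((c - e) * (a - b))).
Proof. ring. Qed.

(** * Characters and the adjoint lattice *)
Section Lattice.
Variables (R : realType) (d : nat).
Local Notation C := (CC R).
Local Notation V := (cvec R d).
Local Notation Re := (@complex.Re R).
Local Notation Im := (@complex.Im R).
Local Notation ei := (@ei R).
Local Open Scope complex_scope.

Lemma eiD (a b : R) : ei (a + b) = ei a * ei b.
Proof. by rewrite !ei_cexp realCD mulrDl cexpD. Qed.
Lemma ei0 : ei 0 = 1. Proof. by rewrite !ei_cexp mul0r cexp0. Qed.
Lemma ei_nat (k : nat) : ei k%:R = 1.
Proof. by rewrite !ei_cexp realCnat cexp_nat_tau. Qed.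
Lemma eiN (a : R) : ei (- a) = cj (ei a).
Proof. by rewrite !ei_cexp realCN mulNr cexpJ JM JR cj_tau mulrN. Qed.
Lemma ei_int (m : int) : ei m%:~R = 1.
Proof. by case: m => k; rewrite ?NegzE ?mulrNz ?eiN ei_nat ?J1. Qed.
Lemma eiE (x : R) : cexp (0 +i* (2 * pi * x)) = ei x.
Proof. by congr cexp; apply: Ceq; rewrite /tau /=; ring. Qed.
Lemma Re_ei (x : R) : Re (ei x) = 1 - 2 * sin (pi * x) ^+ 2.
Proof.
rewrite -eiE /= expR0 mul1r.
have -> : 2 * pi * x = (pi * x) *+ 2 by rewrite mulr2n; ring.
by rewrite cos_mulr2n -mulr_natl; have := cos2Dsin2 (pi * x); lra.
Qed.
(** This is the squared cosine of [pi * x]; in terms of the sine it measures the distance of [x] to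
    the integers. *)
Lemma cabs2_half_ei (x : R) : cabs2 ((1 + ei x) / 2) = 1 - sin (pi * x) ^+ 2.
Proof.
have e : cabs2 (2^-1 : C) = 4^-1 by rewrite -(realCnat R 2) -realCV cabs2R exprVn; congr (_^-1); ring.
have e2 : 1 * cj (ei x) = cj (ei x) by rewrite mul1r.
rewrite cabs2M e cabs2D cabs2_ei e2 ReJ Re_ei (_ : cabs2 1 = 1); first by lra.
by rewrite (cabs2R 1) expr1n.
Qed.
Lemma round (x : R) : exists m : int, `|x - m%:~R| <= 2^-1.
Proof.
exists (Num.floor (x + 2^-1)); rewrite ler_norml.
have := floor_le_tmp (x + 2^-1); have := floorD1_gt (x + 2^-1); rewrite intrD1; lra.
Qed.
Lemma sin_small (dl x : R) : 0 < dl <= 2^-1 -> `|x| <= 2^-1 -> sin (pi * x) ^+ 2 < sin (pi * dl) ^+ 2 -> `|x| < dl.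
Proof.
move=> /andP[d0 d1] x1 h; rewrite ltNge; apply/negP => dx; move: h; apply/negP; rewrite -leNgt.
have e : sin (pi * x) ^+ 2 = sin (pi * `|x|) ^+ 2.
  by have [|] := ger0P x => // _; rewrite mulrN sinN sqrrN.
have p0 := pi_gt0 R.
have i0 (y : R) : 0 <= y <= 2^-1 -> pi * y \in `[- (pi / 2), pi / 2]%R.
  move=> /andP[y0 y1]; rewrite in_itv /=; apply/andP; split.
    by have := mulr_ge0 (ltW p0) y0; lra.
  by rewrite ler_pM2l.
have m1 : sin (pi * dl) <= sin (pi * `|x|).
  rewrite leNgt ltr_sin -?leNgt ?ler_pM2l //; apply: i0; first by rewrite normr_ge0 x1.
  by rewrite (ltW d0) d1.
have s0 (y : R) : 0 <= y <= 2^-1 -> 0 <= sin (pi * y).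
  move=> /andP[y0 y1]; apply: sin_ge0_pi; rewrite mulr_ge0 ?(ltW p0) //= ger_pMr //; lra.
by rewrite e lerXn2r ?nnegrE ?s0 ?normr_ge0 ?x1 ?(ltW d0).
Qed.
Lemma ei_eq1 (x : R) : ei x = 1 -> exists m : int, x = m%:~R.
Proof.
move=> e; have [m hm] := round x; exists m; apply/eqP; rewrite -subr_eq0 -normr_eq0; apply: contraT => ne.
set r := `|_| in ne hm.
have r0 : 0 < r by rewrite lt_neqAle eq_sym ne normr_ge0.
have : ei (x - m%:~R) = 1 by rewrite eiD e eiN ei_int J1 mulr1.
move=> /(congr1 Re); rewrite Re_ei Re1 => h.
have p0 := pi_gt0 R.
have h0 : sin (pi * (x - m%:~R)) ^+ 2 < sin (pi * r) ^+ 2.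
  have -> : sin (pi * (x - m%:~R)) ^+ 2 = 0 by lra.
  by rewrite exprn_gt0 // sin_gt0_pi // mulr_gt0 //= gtr_pMr //; lra.
by have := @sin_small r _ _ hm h0; rewrite r0 hm ltxx => /(_ isT).
Qed.

(* The symplectic form; [chi v z] is its exponential. *)
Definition sg (v z : V) : R := \sum_j (Re (v ord0 j) * Im (z ord0 j) - Im (v ord0 j) * Re (z ord0 j)).
Lemma chiE v z : chi v z = ei (sg v z).
Proof.
rewrite /sg !ei_cexp realC_sum mulr_suml cexp_sum; apply: eq_bigr => j _; congr cexp.
have t1 : Re (tau R) = 0 by [].
have t2 : Im (tau R) = 2 * pi by [].
by move: (v ord0 j) (z ord0 j) => a b; apply: Ceq; rewrite !(ReM, ImM, ReB, ImB, ReJ, ImJ) t1 t2 !(ReR, ImR); ring.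
Qed.
Lemma sgDr v z z' : sg v (z + z') = sg v z + sg v z'.
Proof. by rewrite /sg -big_split; apply: eq_bigr => j _ /=; rewrite !mxE ReD ImD; ring. Qed.

Definition fromC (z : V) : rvec R d := col_mx (\col_j Re (z ord0 j)) (\col_j Im (z ord0 j)).
Lemma fromCK z : toC (fromC z) = z.
Proof. by apply/rowP => j; rewrite !mxE /xpart /wpart col_mxEu col_mxEd !mxE -CE. Qed.
Definition Jm : 'M[R]_(d + d) := block_mx 0 1%:M (- 1%:M) 0.
Lemma Jm_unit : Jm \in unitmx.
Proof.
apply: (proj1 (mulmx1_unit (B := - Jm) _)).
rewrite mulmxN /Jm mulmx_block !(mul0mx, mulmx0, mul1mx, mulmxN, mulmx1) !(add0r, addr0).
by rewrite opp_block_mx !oppr0 !opprK -scalar_mx_block.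
Qed.
Lemma sg_toC (mu l : rvec R d) : sg (toC mu) (toC l) = (mu^T *m Jm *m l) 0 0.
Proof.
rewrite -{2}[mu]vsubmxK -{2}[l]vsubmxK tr_col_mx /Jm mul_row_block mul_row_col.
rewrite !(mulmx0, mulmx1, mulmxN, add0r, addr0) mulNmx addrC !mxE /sg -sumrB.
by apply: eq_bigr => j _; rewrite !mxE.
Qed.
(** Its columns are the basis dual to the columns of [A] for the symplectic form ([sg_dual]), hence
    generate the adjoint lattice ([adjoint_dual]). *)
Definition dual (A : 'M[R]_(d + d)) : 'M[R]_(d + d) := invmx ((Jm *m A)^T).
Lemma dual_unit A : A \in unitmx -> dual A \in unitmx.
Proof. by move=> uA; rewrite unitmx_inv unitmx_tr unitmx_mul Jm_unit. Qed.
Lemma sg_B A (mu y : rvec R d) : sg (toC mu) (toC (A *m y)) = \sum_i ((Jm *m A)^T *m mu) i ord0 * y i ord0.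
Proof.
rewrite sg_toC -mulmxA [Jm *m (A *m y)]mulmxA mulmxA mxE; apply: eq_bigr => i _; congr (_ * _).
by rewrite -[mu^T *m _]trmxK trmx_mul trmxK mxE.
Qed.
Lemma sg_dual A (u y : rvec R d) : A \in unitmx -> sg (toC (dual A *m u)) (toC (A *m y)) = \sum_i u i ord0 * y i ord0.
Proof. by move=> uA; rewrite sg_B mulKVmx // unitmx_tr unitmx_mul Jm_unit. Qed.

(** Both compositions perform the same translation, and their phases differ by the constant [ei] of
    the symplectic form. *)
Lemma tfshift_comm (mu l : rvec R d) : tfshift l \o tfshift mu = tfshift mu \o tfshift l <-> ei (sg (toC mu) (toC l)) = 1.
Proof.
have e1 : sg (toC mu) (toC l) = \sum_j (wpart l j * xpart mu j) - \sum_j (wpart mu j * xpart l j).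
  by rewrite /sg -sumrB; apply: eq_bigr => j _; rewrite !mxE /= [xpart mu j * _]mulrC.
have e2 (m l' : rvec R d) (t : 'I_d -> R) : \sum_j wpart m j * (t j - xpart l' j) = \sum_j wpart m j * t j - \sum_j wpart m j * xpart l' j.
  by rewrite -sumrB; apply: eq_bigr => j _; rewrite mulrBr.
have z0 (m : rvec R d) : \sum_j wpart m j * 0 = 0 by apply: big1 => j _; exact: mulr0.
have e3 (m l' : rvec R d) : \sum_j wpart m j * (0 - xpart l' j) = - \sum_j wpart m j * xpart l' j.
  by rewrite -sumrN; apply: eq_bigr => j _; rewrite sub0r mulrN.
split=> h.
  (* The constant function 1 evaluated at the origin isolates the two phases. *)
  have := congr1 (fun P => P (fun=> 1) (fun=> 0)) h; rewrite /= /tfshift !eiE !mulr1.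
  rewrite !e3 !z0 ei0 !mul1r => h2; rewrite e1 eiD h2 -eiD subrr ei0 //.
apply/funext => f; apply/funext => t; rewrite /= /tfshift !eiE !mulrA -!eiD !e2.
congr (_ * f _); last by apply/funext => j; ring.
have -> : \sum_j wpart l j * t j + (\sum_j wpart mu j * t j - \sum_j wpart mu j * xpart l j) =
  \sum_j wpart mu j * t j + (\sum_j wpart l j * t j - \sum_j wpart l j * xpart mu j) + sg (toC mu) (toC l).
  by rewrite e1; ring.
by rewrite [LHS]eiD h mulr1.
Qed.

Lemma mapZ_delta i : mapZ R (delta_mx i ord0 : 'cV[int]_(d + d)) = delta_mx i ord0.
Proof. by apply/matrixP => a b; rewrite !mxE; case: (_ && _). Qed.
Lemma sum_delta (f : 'I_(d + d) -> R) i : \sum_k f k * (delta_mx i ord0 : rvec R d) k ord0 = f i.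
Proof.
rewrite (bigD1 i) //= mxE !eqxx mulr1 big1 ?addr0 // => k /negPf ki; by rewrite mxE ki mulr0.
Qed.

(** Testing commutation on the columns of [A] says that the coordinates of [mu] in the dual basis
    are integers. Conversely, a pairing of integer coordinate vectors is an integer. *)
Lemma adjoint_dual A : A \in unitmx -> GammaOf (adjoint (lattice A)) = Gam (dual A).
Proof.
move=> uA; apply/seteqP; split => v.
  move=> [mu hmu <-]; apply/GamP.
  have hi i : exists m : int, ((Jm *m A)^T *m mu) i ord0 = m%:~R.
    apply: ei_eq1; rewrite -(sum_delta (fun k => ((Jm *m A)^T *m mu) k ord0)) -sg_B -tfshift_comm.
    by apply: hmu; exists (delta_mx i ord0); rewrite -/(mapZ R _) mapZ_delta.
  have [m hm] := choice hi; exists (\col_i m i).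
  have uJ : (Jm *m A)^T \in unitmx by rewrite unitmx_tr unitmx_mul Jm_unit.
  rewrite (_ : dual A *m _ = mu) // -[RHS](mulKmx uJ).
  by congr (_ *m _); apply/colP => i; rewrite hm !mxE.
move=> /GamP[m ->]; exists (dual A *m mapZ R m) => // l [m' ->]; rewrite tfshift_comm -/(mapZ R m') sg_dual //.
rewrite (eq_bigr (fun i => (m i ord0 * m' i ord0)%:~R)) => [|i _]; last by rewrite !mxE intrM.
by rewrite -rmorph_sum ei_int.
Qed.

Lemma GamB (A : 'M[R]_(d + d)) (v w : V) : Gam A v -> Gam A w -> Gam A (v - w).
Proof.
move=> /GamP[m ->] /GamP[m' ->]; apply/GamP; exists (m - m'); rewrite -toC_B -mulmxBr; congr (toC (_ *m _)).
by apply/matrixP => i j; rewrite !mxE rmorphB.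
Qed.

Lemma chi_dual A v l : A \in unitmx -> Gam (dual A) v -> Gam A l -> chi v l = 1.
Proof.
move=> uA /GamP[m ->] /GamP[m' ->]; rewrite chiE sg_dual //.
rewrite (eq_bigr (fun i => (m i ord0 * m' i ord0)%:~R)) => [|i _]; last by rewrite !mxE intrM.
by rewrite -rmorph_sum ei_int.
Qed.
Lemma chiDr v (z w : V) : chi v (z + w) = chi v z * chi v w.
Proof. by rewrite !chiE sgDr eiD. Qed.

(* In the coordinates of the lattice the i-th hypothesis says that [cos^2] of [pi * y_i] is close to 1. *)
Lemma near_lattice A (e : R) : A \in unitmx -> 0 < e -> exists2 eta, 0 < eta <= 1 & forall z : V,
  (forall i, 1 - eta < cabs2 ((1 + chi (toC (dual A *m delta_mx i ord0)) z) / 2)) ->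
  exists2 l, Gam A l & forall j, cn (z ord0 j - l ord0 j) <= e.
Proof.
move=> uA e0.
pose M : R := \sum_i \sum_k `|A i k| + 1.
have M0 : 0 < M by rewrite ltr_pwDr // sumr_ge0 // => i _; rewrite sumr_ge0.
(* An error [dl] in each lattice coordinate moves every real coordinate by at most [e / 2]; real and
   imaginary part together give [e]. *)
pose dl := Num.min 2^-1 (e / (2 * M)).
have dl0 : 0 < dl by rewrite lt_min invr_gt0 ltr0n /= divr_gt0 // mulr_gt0.
have dl1 : dl <= 2^-1 by rewrite ge_min lexx.
have dl2 : dl * M <= e / 2.
  have : dl <= e / (2 * M) by rewrite ge_min lexx orbT.
  by rewrite ler_pdivlMr ?mulr_gt0 // => h; rewrite ler_pdivlMr // -mulrA [M * 2]mulrC.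
have p0 := pi_gt0 R.
exists (sin (pi * dl) ^+ 2).
  have s0 : 0 < sin (pi * dl) by apply: sin_gt0_pi; rewrite mulr_gt0 //= gtr_pMr //; lra.
  by rewrite exprn_gt0 //=; have := cos2Dsin2 (pi * dl); have := sqr_ge0 (cos (pi * dl)); lra.
move=> z hz; pose y := invmx A *m fromC z.
have zE : z = toC (A *m y) by rewrite mulKVmx // fromCK.
have [m hm] := choice (fun i => round (y i ord0)).
have r i : `|y i ord0 - (m i)%:~R| < dl.
  apply: sin_small; [by rewrite dl0 dl1|exact: hm|].
  have := hz i; rewrite chiE {1}zE sg_dual //; rewrite (eq_bigr (fun k => y k ord0 * (delta_mx i ord0 : rvec R d) k ord0)) => [|k _]; last exact: mulrC.
  have -> : ei (\sum_k y k ord0 * (delta_mx i ord0 : rvec R d) k ord0) = ei (y i ord0 - (m i)%:~R).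
    by rewrite (sum_delta (fun k => y k ord0)) eiD eiN ei_int J1 mulr1.
  by rewrite cabs2_half_ei; lra.
exists (toC (A *m mapZ R (\col_i m i))); first by apply/GamP; exists (\col_i m i).
have qE (u : rvec R d) i : (u - mapZ R (\col_i m i)) i ord0 = u i ord0 - (m i)%:~R by rewrite !mxE.
have b k : `|(A *m y - A *m mapZ R (\col_i m i)) k ord0| <= e / 2.
  rewrite -mulmxBr mxE; apply: le_trans (ler_norm_sum _ _ _) _; apply: le_trans dl2; rewrite mulrC.
  apply: (@le_trans _ _ (\sum_i `|A k i| * dl)).
    by apply: ler_sum => i _; rewrite normrM ler_wpM2l // qE; exact: ltW (r i).
  rewrite -mulr_suml ler_wpM2r ?(ltW dl0) // /M [X in _ <= X + 1](bigD1 k) //= -addrA lerDl addr_ge0 // sumr_ge0 // => i _.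
  by rewrite sumr_ge0.
move=> j; have -> : z ord0 j - toC (A *m mapZ R (\col_i m i)) ord0 j = toC (A *m y - A *m mapZ R (\col_i m i)) ord0 j.
  by rewrite toC_B zE !mxE.
apply: le_trans (cn_ReIm _) _; rewrite !mxE /= /xpart /wpart.
by have := b (lshift d j); have := b (rshift d j); rewrite !mxE; lra.
Qed.

Lemma ip_chi (v v' : V) : ip (gm R d) (chi v) (chi v') = (gweight (v - v'))%:C.
Proof.
apply: (etrans (ip_prod (fun j => E1_chi1 (v ord0 j)) (fun j => E1_chi1 (v' ord0 j)))).
rewrite /gweight /vnorm2 mulr_sumr expR_sum realC_prod; apply: eq_bigr => j _.
have := L1_Tev (v ord0 j) (v' ord0 j) 0 0 0 0.
have -> : L1 (v ord0 j) (v' ord0 j) 0 0 0 0 = cI (@g1 R) (fun p => chi1 (v ord0 j) (emb2 p) * cj (chi1 (v' ord0 j) (emb2 p))).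
  by apply: eq_cI => p; rewrite !hh0 !expr0 !mulr1.
move=> ->; set A := pi%:C * _; set a := v' ord0 j - _.
have hA : hol (fun z => cexp (A * z)) by apply: (hol_comp (@hol_exp R)); apply: holM; [exact: hol_cst|exact: hol_id].
transitivity (cexp (A * a)).
  rewrite -(reproducing a hA (E1_exp A)); apply: eq_cI => p.
  by rewrite /ev /= !expr0 mulr1 !hornerC mulr1.
rewrite -cexp_real !mxE; congr cexp; rewrite realCM realCN mulNr -mulJ JB; exact: alg_gauss.
Qed.
End Lattice.

(** * The lower sampling inequality *)
Section Lower.
Variables (R : realType) (d : nat).
Local Notation C := (CC R).
Local Notation V := (cvec R d).
Local Notation gm := (gm R d).
Local Notation ei := (@ei R).
Local Open Scope complex_scope.

Lemma bern (y : R) k : 0 <= y <= 1 -> 1 - k%:R * y <= (1 - y) ^+ k.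
Proof.
move=> /andP[y0 y1]; elim: k => [|k IH]; first by rewrite mul0r subr0 expr0.
rewrite exprS; apply: le_trans (ler_wpM2l (_ : 0 <= 1 - y) IH); last by rewrite subr_ge0.
rewrite -natr1; have : 0 <= k%:R * y * y by rewrite !mulr_ge0.
by move: (k%:R : R) => x; nra.
Qed.
(** By Bernoulli [q] is at most the power of exponent [k + 1] of [p = 1 - (1 - q) / (k + 1)], so the
    claim follows from [geo_small] for [p], raised to that power. *)
Lemma pow_small (q e : R) k : 0 <= q < 1 -> 0 < e -> exists N, q ^+ N * N.+1%:R ^+ k <= e.
Proof.
move=> /andP[q0 q1] e0; pose y := (1 - q) / k.+1%:R; pose p := 1 - y.
have y0 : 0 < y by rewrite divr_gt0 ?subr_gt0.
have k1 : (1 : R) <= k.+1%:R by rewrite ler1n.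
have y1 : y <= 1 by rewrite ler_pdivrMr // mul1r; lra.
have p01 : 0 <= p < 1 by rewrite subr_ge0 y1 /= ltrBlDr ltrDl.
have [p0 _] := andP p01.
have e'0 : 0 < Num.min 1 e by rewrite lt_min ltr01.
have [N hN] := geo_small p01 e'0; exists N.
have qp : q <= p ^+ k.+1.
  apply: le_trans (bern k.+1 (_ : 0 <= y <= 1)); last by rewrite ltW.
  by rewrite /y mulrC divfK ?pnatr_eq0 //; lra.
have N1 : 1 <= N.+1%:R :> R by rewrite ler1n.
apply: (@le_trans _ _ ((N.+1%:R * p ^+ N) ^+ k.+1)).
  rewrite exprMn mulrC; apply: ler_pM; rewrite ?exprn_ge0 //.
    by rewrite exprS ler_peMl // exprn_ge0.
  by rewrite -exprM mulnC exprM lerXn2r ?nnegrE ?exprn_ge0.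
have h0 : 0 <= N.+1%:R * p ^+ N by rewrite mulr_ge0 ?exprn_ge0.
have := hN N (leqnn _); rewrite le_min => /andP[h1 h2].
by apply: le_trans h2; rewrite exprS ler_piMr // exprn_ile1.
Qed.

Lemma gweight_ge0 (z : V) : 0 <= gweight z. Proof. exact: expR_ge0. Qed.
Lemma vnorm2N (z : V) : vnorm2 (- z) = vnorm2 z.
Proof. by apply: eq_bigr => j _; rewrite mxE cabs2N. Qed.
Lemma gweightN (z : V) : gweight (- z) = gweight z.
Proof. by rewrite /gweight vnorm2N. Qed.

Lemma SP_cst (n : 'I_d -> nat) (c : C) : (forall j, (0 < n j)%N) -> SP n (fun=> c).
Proof. by move=> n0 z j; exact: PA_cst. Qed.
Lemma n2_1 : n2 gm (fun=> 1) = 1%E.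
Proof.
rewrite /n2 (cabs2R 1 : cabs2 (1 : C) = _) expr1n -[RHS]mul1e -(@probability_setT _ _ _ gm); exact: integral_cst.
Qed.

(** Schur's test: by [ip_chi] the Gram matrix of the characters has Gaussian entries. Its row sums
    are bounded by [bessel], applied to the constant 1 on the translated index set. *)
Lemma schur_gauss A : A \in unitmx -> exists2 B : R, 0 <= B & forall (T : seq V) (b : V -> C), uniq T ->
  (forall v, v \in T -> Gam A v) -> (n2 gm (fun z => (\sum_(v <- T) b v * chi v z)%R) <= (B * \sum_(v <- T) cabs2 (b v))%:E)%E.
Proof.
move=> uA; have [B B0 hB] := bessel (n := fun=> 1%N) (fun j => isT) uA; exists B => // T b uT TG.
have row v : v \in T -> \sum_(w <- T) gweight (w - v) <= B.
  move=> vT; have := hB [seq w - v | w <- T] (fun=> 1) _ _ (SP_cst 1 _); rewrite n2_1 mule1 lee_fin big_map.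
  rewrite (eq_bigr (fun w => gweight (w - v))) => [|w _]; last by rewrite (cabs2R 1 : cabs2 (1 : C) = _) expr1n mul1r.
  apply=> //; first by rewrite map_inj_uniq // => x y; exact: addIr.
  by move=> _ /mapP[w wT ->]; apply: GamB; exact: TG.
have sqc v : sq gm (chi v) by apply: Ed_sq; apply: (Ed_prod (f := fun j => chi1 (v ord0 j))) => j; exact: E1_chi1.
rewrite (gram T b sqc) lee_fin.
have term v w : complex.Re (b v * cj (b w) * ip gm (chi v) (chi w)) <= 2^-1 * (cabs2 (b v) * gweight (w - v)) + 2^-1 * (cabs2 (b w) * gweight (v - w)).
  have -> : gweight (w - v) = gweight (v - w) by rewrite -opprB gweightN.
  rewrite ip_chi; apply: le_trans (ler_norm _) _; apply: le_trans (Re_cn _) _.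
  rewrite !cnM cnJ cnR ger0_norm ?gweight_ge0 // -!cn_sqr.
  have := mulr_ge0 (gweight_ge0 (v - w)) (sqr_ge0 (cn (b v) - cn (b w))).
  by move: (gweight _) (cn (b v)) (cn (b w)) => g x y; rewrite sqrrB !expr2; lra.
rewrite Re_sum; apply: (@le_trans _ _ (\sum_(v <- T) \sum_(w <- T) (2^-1 * (cabs2 (b v) * gweight (w - v)) + 2^-1 * (cabs2 (b w) * gweight (v - w))))).
  by apply: ler_sum => v _; rewrite Re_sum; apply: ler_sum => w _; exact: term.
have half : \sum_(v <- T) \sum_(w <- T) 2^-1 * (cabs2 (b v) * gweight (w - v)) <= 2^-1 * (B * \sum_(v <- T) cabs2 (b v)).
  rewrite !mulr_sumr big_seq [leRHS]big_seq; apply: ler_sum => v vT.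
  by rewrite -mulr_sumr -mulr_sumr ler_wpM2l // mulrC ler_wpM2r ?cabs2_ge0 ?row.
under eq_bigr do rewrite big_split.
rewrite big_split /= [X in _ + X]exchange_big /=; move: half; lra.
Qed.

Section Trig.
Variable A : 'M[R]_(d + d).
Hypothesis uA : A \in unitmx.
Definition chb i (z : V) : C := chi (toC (dual A *m delta_mx i ord0)) z.

Lemma chi_at0 (v : V) : chi v 0 = 1.
Proof. by rewrite chiE /sg big1 ?ei0 // => j _; rewrite mxE Re0 Im0 !mulr0 subrr. Qed.

(** The expansion of the product has nonnegative coefficients on [N.+1 ^ (d + d)] distinct points of
    the dual lattice. Their sum is the value 1 at the origin, so Cauchy-Schwarz bounds the sum of
    squares from below by the inverse of their number. *)
Lemma trig_poly N : exists (T : seq V) (b : V -> C), [/\ uniq T, forall v, v \in T -> Gam (dual A) v,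
  (N.+1%:R ^+ (d + d))^-1 <= \sum_(v <- T) cabs2 (b v) &
  forall z, \sum_(v <- T) b v * chi v z = \prod_i ((1 + chb i z) / 2) ^+ N].
Proof.
pose mm (m : {ffun 'I_(d + d) -> 'I_N.+1}) : 'cV[int]_(d + d) := \col_i (m i : nat)%:Z.
pose v m := toC (dual A *m mapZ R (mm m)).
have sgv m y : sg (v m) (toC (A *m y)) = \sum_i (m i)%:R * y i ord0.
  by rewrite sg_dual //; apply: eq_bigr => i _; rewrite !mxE.
have vi : injective v.
  move=> m m' e; apply/ffunP => i; apply/val_inj/eqP; rewrite -(eqr_nat R); apply/eqP.
  have := congr1 (fun w => sg w (toC (A *m delta_mx i ord0))) e; rewrite !sgv.
  by rewrite (sum_delta (fun k => (m k)%:R)) (sum_delta (fun k => (m' k)%:R)).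
pose cc (m : {ffun 'I_(d + d) -> 'I_N.+1}) : R := \prod_i ('C(N, m i)%:R / 2 ^+ N).
pose b w : C := \sum_(m | v m == w) (cc m)%:C.
have bv m : b (v m) = (cc m)%:C.
  rewrite /b (bigD1 m) //= big1 ?addr0 // => m' /andP[/eqP/vi -> ]; by rewrite eqxx.
have chiv m z : chi (v m) z = \prod_i chb i z ^+ m i.
  have -> : z = toC (A *m (invmx A *m fromC z)) by rewrite mulKVmx // fromCK.
  set y := invmx A *m _; rewrite chiE sgv.
  rewrite (big_morph ei (@eiD R) (ei0 R)); apply: eq_bigr => i _.
  rewrite /chb chiE sg_dual // (eq_bigr (fun k => y k ord0 * (delta_mx i ord0 : rvec R d) k ord0)) => [|k _]; last exact: mulrC.
  rewrite (sum_delta (fun k => y k ord0)); elim: (m i : nat) => [|k IH]; first by rewrite mul0r ei0 expr0.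
  by rewrite -natr1 mulrDl mul1r eiD IH exprSr.
have big_T z : \sum_(m : {ffun 'I_(d + d) -> 'I_N.+1}) (cc m)%:C * chi (v m) z = \prod_i ((1 + chb i z) / 2) ^+ N.
  transitivity (\sum_(m : {ffun 'I_(d + d) -> 'I_N.+1}) \prod_i ('C(N, m i)%:R / 2 ^+ N * chb i z ^+ m i)).
    apply: eq_bigr => m _; rewrite chiv realC_prod -big_split; apply: eq_bigr => i _ /=.
    by rewrite realCM realCV realCX !realCnat.
  rewrite -(bigA_distr_bigA (fun i (j : 'I_N.+1) => 'C(N, j)%:R / 2 ^+ N * chb i z ^+ j)).
  apply: eq_bigr => i _; rewrite expr_div_n [(1 + chb i z) ^+ N]exprDn mulr_suml; apply: eq_bigr => j _.
  rewrite [LHS]mulrAC; congr (_ / _); rewrite mulr_natl; congr (_ *+ _); rewrite expr1n; exact/esym/mul1r.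
exists [seq v m | m <- enum {ffun 'I_(d + d) -> 'I_N.+1}], b; split.
- by rewrite map_inj_uniq ?enum_uniq.
- by move=> _ /mapP[m _ ->]; apply/GamP; exists (mm m).
- rewrite big_map big_enum /=; set K := _^-1.
  have cd : (#|{ffun 'I_(d + d) -> 'I_N.+1}|)%:R = K^-1 :> R by rewrite card_ffun !card_ord natrX invrK.
  have K0 : 0 < K by rewrite invr_gt0 exprn_gt0.
  have s1 : \sum_m cc m = 1.
    apply: (@complexI R); rewrite realC_sum; transitivity (\sum_m (cc m)%:C * chi (v m) 0).
      by apply: eq_bigr => m _; rewrite chi_at0 mulr1.
    by rewrite big_T big1 // => i _; rewrite /chb chi_at0 divff ?expr1n ?pnatr_eq0.
  have sK : \sum_(m : {ffun 'I_(d + d) -> 'I_N.+1}) K ^+ 2 = K.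
    transitivity (K ^+ 2 *+ #|{ffun 'I_(d + d) -> 'I_N.+1}|); first by rewrite -sumr_const.
    by rewrite -mulr_natl cd expr2 mulrA mulVf ?gt_eqF // mul1r.
  have : 0 <= \sum_m (cc m - K) ^+ 2 by apply: sumr_ge0 => m _; exact: sqr_ge0.
  rewrite (eq_bigr (fun m => cabs2 (b (v m)) - 2 * K * cc m + K ^+ 2)) => [|m _]; last by rewrite bv cabs2R sqrrB; ring.
  rewrite !big_split /= sumrN -mulr_sumr s1 sK; lra.
move=> z; rewrite big_map big_enum /= -big_T; by apply: eq_bigr => m _; rewrite bv.
Qed.

Lemma enum_lattice : exists S : nat -> seq V, [/\ forall k, uniq (S k), forall k v, v \in S k -> Gam A v &
  forall v, Gam A v -> exists k0, forall k, (k0 <= k)%N -> v \in S k].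
Proof.
pose T := 'cV[int]_(d + d).
exists (fun k => undup [seq toC (A *m mapZ R m) | m <- pmap (@unpickle T) (iota 0 k)]); split.
- by move=> k; exact: undup_uniq.
- by move=> k v; rewrite mem_undup => /mapP[m _ ->]; apply/GamP; exists m.
move=> v /GamP[m ->]; exists (pickle m).+1 => k hk; rewrite mem_undup; apply: map_f.
by rewrite mem_pmap; apply/mapP; exists (pickle m); rewrite ?mem_iota ?pickleK.
Qed.

Definition Dr (r : R) (z : V) : R := \prod_(j < d) disc r (z ord0 j).
Lemma Dr_ge0 r z : 0 <= Dr r z.
Proof. by apply: prodr_ge0 => j _; exact: disc_ge0. Qed.
Lemma mDr r : measurable_fun setT (Dr r).
Proof.
apply: measurable_prod => j _; apply: (measurableT_comp (@mind01 R)); apply: measurable_funM => //.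
by apply: mabs2; exact: mv_coord.
Qed.
Lemma Dr_val r z : 0 < r -> Dr r z = [forall j, cabs2 (z ord0 j) < r]%:R.
Proof.
move=> r0; case: (boolP [forall j, cabs2 (z ord0 j) < r]) => [/forallP h|].
  by rewrite /Dr big1 // => j _; rewrite discP // h.
rewrite negb_forall => /existsP[j hj]; by rewrite /Dr (bigD1 j) //= discP // (negPf hj) mul0r.
Qed.

Lemma near_part (F be : V -> C) (l : V) r : mC F -> mC be -> (forall z, be (z + l) = be z) ->
  (\int[gm]_z (Dr r (z - l) * cabs2 (be z * F z))%:E = \int[gm]_z (Dr r z * cabs2 (be z) * cabs2 (beta (- l) F z))%:E)%E.
Proof.
move=> mF mb per.
rewrite -(gm_shift (- l) (f := fun z => (Dr r (z - l) * cabs2 (be z * F z))%:E)).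
- apply: eq_integral => z _; rewrite -EFinM opprK addrK per cabs2_beta opprK cabs2M; congr (_%:E); by rewrite !mulrA.
- apply/measurable_EFinP; apply: measurable_funM; first exact: (measurableT_comp (mDr r) (m_vshift l (@measurable_id _ V setT))).
  by apply: mabs2; exact: mCM.
- by move=> z; rewrite lee_fin mulr_ge0 ?Dr_ge0 ?cabs2_ge0.
Qed.
End Trig.
End Lower.

(** * Splitting into the parts near and far from the lattice; choice of constants *)

Section LowerBound.
Variables (R : realType) (d : nat).
Local Notation C := (CC R).
Local Notation V := (cvec R d).
Local Notation gm := (gm R d).
Local Open Scope complex_scope.

Lemma min1_sq (x : R) : 0 <= x -> (Num.min 1 x) ^+ 2 <= x.
Proof. by move=> x0; case: (leP 1 x) => h; rewrite expr2; nra. Qed.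

Lemma mC_beta (a : V) (F : V -> C) : mC F -> mC (beta a F).
Proof.
move=> mF; apply: mCM; last exact: (mC_comp mF (m_vshift a (@measurable_id _ V setT))).
apply: mC_exp; apply: mCB; last exact: mC_cst.
by apply: mCM; [exact: mC_cst|exact: (mcdot (measurable_cst a) (@measurable_id _ V setT))].
Qed.

(* [X] bounds the multiplier far from the lattice; near it, the lattice translates of the region are
   moved to the origin, where [be] does not change by periodicity. *)
Lemma split_bound (F be : V -> C) (p : V -> R) (q X Y r : R) (S : nat -> seq V) : sq gm F -> sq gm be -> sq gm (fun z => be z * F z) ->
  measurable_fun setT p -> (forall z, 0 <= p z) -> 0 < q -> 0 <= X -> 0 <= Y ->
  (forall k, uniq (S k)) -> (forall z, p z < q -> cabs2 (be z) <= X) ->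
  (forall z, q <= p z -> exists k0, forall k, (k0 <= k)%N -> exists2 l, l \in S k & Dr r (z - l) = 1) ->
  (forall k v z, v \in S k -> be (z + v) = be z) ->
  (forall k z, Dr r z != 0 -> \sum_(v <- S k) cabs2 (beta (- v) F z) <= Y) ->
  (n2 gm (fun z => (be z * F z)%R) <= X%:E * n2 gm F + Y%:E * n2 gm be)%E.
Proof.
move=> qF qb qbF mp p0 q0 X0 Y0 uS hX hnear per hY; have [mF _] := qF; have [mb _] := qb.
pose u z : R := ind01 (p z / q).
have uE z : u z = (p z < q)%R%:R by rewrite /u /ind01 divr_ge0 ?(ltW q0) //= ltr_pdivrMr // mul1r.
have mu : measurable_fun setT u by apply: (measurableT_comp (@mind01 R)); exact: measurable_funM.
have u0 z : 0 <= u z by exact: ind01_ge0.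
have mDl l : measurable_fun setT (fun z : V => Dr r (z - l)) by exact: (measurableT_comp (mDr r) (m_vshift l (@measurable_id _ V setT))).
pose s k z := u z + \sum_(l <- S k) Dr r (z - l).
have D0 k z : 0 <= \sum_(l <- S k) Dr r (z - l) by apply: sumr_ge0 => l _; exact: Dr_ge0.
have s0 k z : 0 <= s k z by rewrite addr_ge0.
have ms k : measurable_fun setT (s k).
  by apply: measurable_funD => //; apply: measurable_sum => l; exact: mDl.
(* The weight is eventually 1 at every point, so [n2_lim] recovers the full norm. Its square is at
   most [s k] ([min1_sq]), whose pieces are estimated separately. *)
pose f k z : C := (Num.min 1 (s k z))%:C * (be z * F z).
have mbF := mCM mb mF.
have mf k : mC (f k).
  by apply: mCM mbF; apply: mC_real; apply: measurable_minr => //; exact: measurable_cst.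
have m2 (g h : V -> R) : measurable_fun setT g -> measurable_fun setT h -> measurable_fun setT (fun z => (g z * h z)%:E).
  by move=> mg mh; apply/measurable_EFinP; exact: measurable_funM.
have far : (\int[gm]_z (u z * cabs2 (be z * F z))%:E <= X%:E * n2 gm F)%E.
  rewrite -ge0_integralZl_EFin //; last 2 first.
  - by move=> z _; rewrite lee_fin cabs2_ge0.
  - exact: mn2.
  apply: ge0_le_int; [exact: m2 mu (mabs2 mbF)| |by move=> z; rewrite lee_fin mulr_ge0 ?cabs2_ge0|].
    by apply: emeasurable_funM; [exact: measurable_cst|exact: mn2].
  move=> z; rewrite -EFinM lee_fin uE cabs2M mulrA; apply: ler_wpM2r; first exact: cabs2_ge0.
  by case: ltP => h; rewrite ?mul0r ?mul1r // hX.
have Dpos z : 0 <= Dr r z by exact: Dr_ge0.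
have near k : (\sum_(l <- S k) \int[gm]_z (Dr r (z - l) * cabs2 (be z * F z))%:E <= Y%:E * n2 gm be)%E.
  rewrite big_seq (eq_bigr (fun l => \int[gm]_z (Dr r z * cabs2 (be z) * cabs2 (beta (- l) F z))%:E)%E) => [|l lS]; last first.
    by apply: near_part => // z; exact: per lS.
  rewrite -big_seq.
  have mt l : measurable_fun setT (fun z => (Dr r z * cabs2 (be z) * cabs2 (beta (- l) F z))%:E).
    apply: m2; first by apply: measurable_funM; [exact: mDr|exact: mabs2].
    by apply: mabs2; exact: mC_beta.
  rewrite -ge0_integral_sum //; last by move=> l z _; rewrite lee_fin !mulr_ge0 ?Dpos ?cabs2_ge0.
  rewrite -ge0_integralZl_EFin //; last 2 first.
  - by move=> z _; rewrite lee_fin cabs2_ge0.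
  - exact: mn2.
  apply: ge0_le_int.
  - by apply: emeasurable_sum => l; exact: mt.
  - by apply: emeasurable_funM; [exact: measurable_cst|exact: mn2].
  - by move=> z; apply: sume_ge0 => l _; rewrite lee_fin !mulr_ge0 ?Dpos ?cabs2_ge0.
  move=> z; rewrite sumEFin -EFinM lee_fin -mulr_sumr.
  have [->|Dz] := eqVneq (Dr r z) 0; first by rewrite !mul0r mulr_ge0 ?cabs2_ge0.
  rewrite mulrAC ler_wpM2r ?cabs2_ge0 //.
  apply: le_trans (hY k z Dz); rewrite ler_piMl ?sumr_ge0 // => [l _|]; first exact: cabs2_ge0.
  by apply: prodr_ile1 => j; rewrite disc_ge0 /= /disc /ind01; case: (_ <= _ < _).
have hk k : (n2 gm (f k) <= X%:E * n2 gm F + Y%:E * n2 gm be)%E.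
  apply: le_trans (leeD far (near k)).
  rewrite -ge0_integral_sum //; last 2 first.
  - by move=> l; exact: m2 (mDl l) (mabs2 mbF).
  - by move=> l z _; rewrite lee_fin mulr_ge0 ?Dpos ?cabs2_ge0.
  rewrite -ge0_integralD //; last 4 first.
  - by move=> z _; rewrite lee_fin mulr_ge0 ?cabs2_ge0.
  - exact: m2 mu (mabs2 mbF).
  - by move=> z _; apply: sume_ge0 => l _; rewrite lee_fin mulr_ge0 ?Dpos ?cabs2_ge0.
  - by apply: emeasurable_sum => l; exact: m2 (mDl l) (mabs2 mbF).
  apply: ge0_le_int.
  - exact: mn2.
  - apply: emeasurable_funD; first exact: m2 mu (mabs2 mbF).
    by apply: emeasurable_sum => l; exact: m2 (mDl l) (mabs2 mbF).
  - by move=> z; rewrite lee_fin cabs2_ge0.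
  move=> z; rewrite sumEFin -EFinD lee_fin -mulr_suml -mulrDl /f [cabs2 (_%:C * _)]cabs2M cabs2R ler_wpM2r ?cabs2_ge0 //.
  exact: min1_sq.
have cvg z : cn (f k z - be z * F z) @[k --> \oo] --> (0 : R).
  have [k0 hk0] : exists k0, forall k, (k0 <= k)%N -> 1 <= s k z.
    case: (ltP (p z) q) => h.
      by exists 0%N => k _; rewrite /s uE h lerDl.
    have [k0 hk0] := hnear z h; exists k0 => k /hk0[l lS Dl]; rewrite /s (bigD1_seq l lS (uS k)) /= Dl addrCA lerDl addr_ge0 // sumr_ge0 // => i _; exact: Dr_ge0.
  apply/cvgrPdist_le => e e0; exists k0 => // k /= /hk0 h.
  by rewrite /f (min_idPl h) mul1r subrr cn0 subrr normr0 ltW.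
have lE : (X%:E * n2 gm F + Y%:E * n2 gm be)%E = (X * fine (n2 gm F) + Y * fine (n2 gm be))%:E.
  by rewrite EFinD !EFinM !n2_fine.
by rewrite lE; apply: (n2_lim mf mbF cvg) => k; rewrite -lE.
Qed.

(** With [sg] the sum of squares of the coefficients of [be], [mult_lower] bounds the norm of
    [be * F] below by [a / 4 * sg * v]. The far part is at most [q ^+ N * v], and the near part at
    most the local samples times [S * sg] by [schur_gauss]. Dividing by [sg] leaves constants that
    do not involve [F]. *)
Lemma lower_bound (n : 'I_d -> nat) A a : (forall j, (0 < n j)%N) -> A \in unitmx -> Riesz n (Gam (dual A)) a ->
  exists2 c : R, 0 < c & forall (F : V -> C) (P : R), SP n F -> sq gm F ->
  (forall T : seq V, uniq T -> (forall v, v \in T -> Gam A v) -> \sum_(v <- T) cabs2 (F v) * gweight v <= P) ->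
  c * fine (n2 gm F) <= P.
Proof.
move=> n0 uA rz; have [a0 _] := rz.
have [B B0 hB] := bessel_diff n0 uA.
have [S S0 hS] := schur_gauss (dual_unit uA).
(* The neighbourhoods are so small that the variation of [F] over them, measured by [bessel_diff],
   costs at most [a / 16] (see [rS]). *)
pose r := Num.min 1 (a / (32 * (B * d%:R * S + 1))).
have D0 : 0 <= B * d%:R * S by rewrite !mulr_ge0.
have r0 : 0 < r by rewrite lt_min ltr01 /= divr_gt0 // mulr_gt0 // ltr_wpDl.
have r1 : r <= 1 by rewrite ge_min lexx.
have rS : 2 * (B * (d%:R * r)) * S <= a / 16.
  have : r <= a / (32 * (B * d%:R * S + 1)) by rewrite ge_min lexx orbT.
  rewrite ler_pdivlMr; last by rewrite mulr_gt0 // ltr_wpDl.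
  have : 0 <= r := ltW r0; move: D0; rewrite (_ : 2 * (B * (d%:R * r)) * S = 2 * r * (B * d%:R * S)); last by ring.
  by move: (B * _ * S) => t t0 r00; nra.
have r20 : 0 < r / 2 by rewrite divr_gt0.
have [eta /andP[eta0 eta1] hnear] := near_lattice uA r20.
(* Half of [eta], because [near_lattice] asks for a strict inequality while the near region is given
   by [q <= p z]. *)
pose q := 1 - eta / 2.
have q01 : 0 <= q < 1 by rewrite /q; lra.
have q0 : 0 < q by rewrite /q; lra.
have a16 : 0 < a / 16 by rewrite divr_gt0.
(* Outside the near region [cabs2 (be z)] is at most [q ^+ N], while [sg] is at least a fixed
   negative power of [N + 1]; so for some [N] the far part is at most [a / 16 * sg]. *)
have [N hN] := pow_small (d + d) q01 a16.
have [T [b [uT TG sb bE]]] := trig_poly uA N.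
have [L [uL LG Lex]] := enum_lattice A.
set sg := \sum_(v <- T) _ in sb.
have sg0 : 0 < sg by apply: lt_le_trans sb; rewrite invr_gt0 exprn_gt0.
have qN : q ^+ N <= a / 16 * sg.
  apply: (@le_trans _ _ (a / 16 * (N.+1%:R ^+ (d + d))^-1)); first by rewrite ler_pdivlMr // exprn_gt0.
  by rewrite ler_wpM2l // divr_ge0 // ltW.
exists (a / (32 * (S + 1))); first by rewrite divr_gt0 // mulr_gt0 // ltr_wpDl.
move=> F P sF qF hP.
have P0 : 0 <= P by have := hP [::] isT; rewrite big_nil; apply.
pose be z := \sum_(v <- T) b v * chi v z.
pose p (z : V) : R := \prod_i cabs2 ((1 + chb A i z) / 2).
have mb : mC be by apply: mC_sum => v; apply: mCM; [exact: mC_cst|exact: mC_chi].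
have bM z : cn (be z) <= \sum_(v <- T) cn (b v).
  by apply: le_trans (cn_sum _ _) _; apply: ler_sum => v _; rewrite cnM chi_cn mulr1.
have hb1 : (n2 gm be <= (S * sg)%:E)%E by exact: hS.
have qb : sq gm be by split => //; apply: le_lt_trans hb1 (ltry _).
have qbF : sq gm (fun z => be z * F z) by exact: (sqM_bnd qF mb bM).
have f1 i z : cabs2 ((1 + chb A i z) / 2) <= 1.
  by rewrite /chb chiE cabs2_half_ei lerBlDr lerDl sqr_ge0.
have f0 i z : 0 <= cabs2 ((1 + chb A i z) / 2) by exact: cabs2_ge0.
have beE z : cabs2 (be z) = p z ^+ N.
  rewrite /be bE -cn_sqr cn_prod /p -prodrXl -prodrXl; apply: eq_bigr => i _.
  by rewrite cnX -exprM mulnC exprM cn_sqr.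
have p0 z : 0 <= p z by exact: prodr_ge0.
set v := fine (n2 gm F).
have v0 : 0 <= v by rewrite fine_ge0 // n2_ge0.
have := @split_bound F be p q (q ^+ N) (2 * P + 2 * (B * (d%:R * r) * v)) r L qF qb qbF.
move=> /(_ _ p0 q0 _ _ uL).
have mp : measurable_fun setT p.
  apply: measurable_prod => i _; apply: mabs2; apply: mCM; last exact: mC_cst.
  by apply: mCD; [exact: mC_cst|exact: mC_chi].
have Y0 : 0 <= 2 * P + 2 * (B * (d%:R * r) * v) by rewrite addr_ge0 // !mulr_ge0 ?(ltW r0).
move=> /(_ mp (exprn_ge0 _ (ltW q0)) Y0) h.
have main : (n2 gm (fun z => (be z * F z)%R) <= (q ^+ N)%:E * n2 gm F + (2 * P + 2 * (B * (d%:R * r) * v))%:E * n2 gm be)%E.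
  apply: h.
  - by move=> z pq; rewrite beE lerXn2r ?nnegrE ?(ltW q0) // ltW.
  - move=> z qp.
    have hi i : 1 - eta < cabs2 ((1 + chb A i z) / 2).
      have : p z <= cabs2 ((1 + chb A i z) / 2).
        rewrite /p (bigD1 i) //= ler_piMr //; apply: prodr_ile1 => j; by rewrite f0 f1.
      by move=> /(le_trans qp); apply: lt_le_trans; rewrite /q; lra.
    have [l lG hl] := hnear z hi; have [k0 hk] := Lex l lG; exists k0 => k /hk lL; exists l => //.
    rewrite Dr_val //; case: forallP => // -[] j; rewrite !mxE -cn_sqr.
    have := hl j; have := cn_ge0 (z ord0 j - l ord0 j); move: (cn _) => x x0 xr.
    by apply: (@le_lt_trans _ _ ((r / 2) ^+ 2)); [rewrite lerXn2r ?nnegrE ?divr_ge0 ?(ltW r0)|rewrite expr2; nra].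
  - move=> k l z lL; apply: eq_big_seq => w wT; congr (_ * _).
    by rewrite chiDr (chi_dual uA (TG _ wT) (LG _ _ lL)) mulr1.
  move=> k z; rewrite Dr_val //; case: forallP => [hz _|_]; last by rewrite eqxx.
  have z1 j : cn (z ord0 j) <= 1.
    rewrite -(@ler_pXn2r _ 2) ?nnegrE ?cn_ge0 // cn_sqr expr1n; exact: le_trans (ltW (hz j)) r1.
  have vz : vnorm2 z <= d%:R * r.
    rewrite /vnorm2; apply: le_trans (ler_sum _ (fun j _ => ltW (hz j))) _.
    by rewrite sumr_const card_ord mulr_natl.
  have := hB (L k) F z (uL k) (LG k) sF z1; rewrite -(n2_fine qF) -/v -EFinM lee_fin => hd.
  apply: (@le_trans _ _ (\sum_(w <- L k) (2 * cabs2 (beta (- w) F 0) + 2 * cabs2 (beta (- w) F z - beta (- w) F 0)))).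
    apply: ler_sum => w _; have := cabs2D_le (beta (- w) F 0) (beta (- w) F z - beta (- w) F 0).
    by rewrite addrCA subrr addr0.
  rewrite big_split /= -!mulr_sumr; apply: lerD; rewrite ler_wpM2l //.
    by have := hP (L k) (uL k) (LG k); under eq_bigr do rewrite -beta_at0.
  by apply: le_trans hd _; rewrite ler_wpM2r // ler_wpM2l.
have := mult_lower n0 b sF qF rz uT TG; rewrite -/sg => /le_trans/(_ main).
rewrite -(n2_fine qF) -(n2_fine qb) -/v -!EFinM -EFinD lee_fin.
move: hb1; rewrite -(n2_fine qb) lee_fin; move: (fine (n2 gm be)) => x xS hm.
have e1 : a / 4 * sg * v <= a / 16 * sg * v + (2 * P + 2 * (B * (d%:R * r) * v)) * (S * sg).
  apply: le_trans hm _; apply: lerD; first by rewrite ler_wpM2r.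
  by rewrite ler_wpM2l.
have e2 : 2 * (B * (d%:R * r) * v) * (S * sg) <= a / 16 * (sg * v).
  rewrite (_ : 2 * _ * _ = 2 * (B * (d%:R * r)) * S * (sg * v)); last by ring.
  by rewrite ler_wpM2r // mulr_ge0 // ltW.
have e3 : a / 8 * v <= 2 * P * S.
  rewrite -(ler_pM2r sg0); move: e1 e2.
  move: (B * (d%:R * r) * v) => y; rewrite mulrDl -!mulrA.
  by rewrite [v * sg]mulrC; move: (sg * v) (S * sg) => t w; lra.
rewrite mulrAC ler_pdivrMr; last by rewrite mulr_gt0 // ltr_wpDl.
have : 0 <= P * S by rewrite mulr_ge0.
by move: e3; clear -P0; move: v => w; lra.
Qed.
End LowerBound.

Lemma alg_slice (K : comNzRingType) (p y b x q w : K) :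
  p * (y * (w - b) + x) - q = p * (x - y * b) - q + p * y * w.
Proof. ring. Qed.
Lemma alg_Ex (K : comNzRingType) (p x y q : K) : p * y - q = p * x - q + p * (y - x).
Proof. ring. Qed.

Lemma alg_Fa (K : comNzRingType) (x e ch b k m p : K) :
  x * (ch * (e * (b * (k * (m * p))))) = p * (ch * b * k * m * (x * e)).
Proof. ring. Qed.

Lemma avg_diag (K : comNzRingType) (T U : eqType) (S : seq T) (pts : seq U) (X Y : T -> U -> K) (P : T -> T -> K) (M : nat) :
  uniq S -> (forall v w, v \in S -> w \in S -> \sum_(a <- pts) X v a * Y w a = ((v == w) * M)%:R) ->
  \sum_(a <- pts) \sum_(v <- S) \sum_(w <- S) X v a * Y w a * P v w = M%:R * \sum_(v <- S) P v v.
Proof.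
move=> uS h; rewrite exchange_big mulr_sumr big_seq [RHS]big_seq; apply: eq_bigr => v vS; rewrite exchange_big /=.
rewrite (bigD1_seq v) //= -mulr_suml h // eqxx mul1n big_seq_cond big1 ?addr0 // => w /andP[wS /negPf wv].
by rewrite -mulr_suml h // eq_sym wv mul0n mul0r.
Qed.

(** * From sampling to the Riesz bound *)
Section SamplingRiesz.
Variables (R : realType) (d : nat).
Local Notation C := (CC R).
Local Notation V := (cvec R d).
Local Notation gm := (gm R d).
Local Notation ei := (@ei R).
Local Open Scope complex_scope.
Variable n : 'I_d -> nat.

Lemma Sp_coef (T : Type) (I : finType) (B : I -> T -> C) f : Sp B f -> exists e : I -> C, forall z, f z = \sum_(i : I) e i * B i z.
Proof.
move=> [s hs]; exists (fun i => \sum_(x <- s | x.2 == i) x.1) => z; rewrite hs (partition_big (fun x : C * I => x.2) predT) //=.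
by apply: eq_bigr => i _; rewrite mulr_suml; apply: eq_bigr => x /eqP ->.
Qed.

(** The binomial expansion in each coordinate does not raise the degree, so the exponents stay in
    K_n. *)
Lemma cpowbar_shift (b : V) (k : Kn n) : exists e : Kn n -> C, forall z : V,
  \prod_j (cj (z ord0 j) - cj (b ord0 j)) ^+ k j = \sum_(m : Kn n) e m * cpowbar z (fun j => m j).
Proof.
apply: (@Sp_coef V _ (fun (m : Kn n) (z : V) => cpowbar z (fun j => m j))).
pose B (S : seq 'I_d) (m : Kn n) (z : V) : C := \prod_(j <- S) cj (z ord0 j) ^+ m j.
have key (S : seq 'I_d) : uniq S -> Sp (B S) (fun z => \prod_(j <- S) (cj (z ord0 j) - cj (b ord0 j)) ^+ k j).
  elim: S => [_|j S IH /= /andP[jS /IH h]].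
    by apply: Sp_ext (Sp_gen (B [::]) k) _ => z; rewrite /B !big_nil.
  have [s hs] := h.
  have hij (x : C * Kn n) (i : 'I_(k j).+1) : Sp (B (j :: S)) (fun z => cj (z ord0 j) ^+ i * B S x.2 z).
    have ij : (i < n j)%N by apply: leq_trans (ltn_ord i) (ltn_ord (k j)).
    apply: Sp_ext (Sp_gen (B (j :: S)) (updK x.2 (Ordinal ij))) _ => z.
    rewrite /B big_cons updKE eqxx; congr (_ * _); apply: eq_big_seq => i' i'S; rewrite updKE.
    by have [e|//] := eqVneq i' j; case/negP: jS; move: e i'S => ->.
  have h2 (x : C * Kn n) : Sp (B (j :: S)) (fun z => (cj (z ord0 j) - cj (b ord0 j)) ^+ k j * B S x.2 z).
    apply: Sp_ext (Sp_sum (index_enum 'I_(k j).+1) (fun i : 'I_(k j).+1 => (- cj (b ord0 j)) ^+ (k j - i) *+ 'C(k j, i)) (hij x)) _ => z.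
    rewrite [cj (z ord0 j) - _]addrC exprDn mulr_suml; apply: eq_bigr => i _.
    by rewrite mulrA mulrnAl.
  apply: Sp_ext (Sp_sum s (fun x => x.1) h2) _ => z; rewrite big_cons hs mulr_sumr; apply: eq_bigr => x _.
  exact: mulrCA.
apply: Sp_ext (Sp_mono _ (key _ (enum_uniq 'I_d))) _ => [m|z]; last by rewrite big_enum.
by apply: Sp_ext (Sp_gen _ m) _ => z; rewrite /B big_enum.
Qed.

Definition qq (c : Kn n -> C) (z : V) : C := \sum_(k : Kn n) c k * ek (fun j => k j) z.
Lemma sq_ek (k : 'I_d -> nat) : sq gm (@ek R d k).
Proof. have e : beta (0 : V) (@ek R d k) = @ek R d k :> (V -> C) by apply/funext => z; exact: beta0.
by have := Ed_sq (Ed_be (0 : V) k); rewrite e. Qed.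
Lemma sq_qq c : sq gm (qq c).
Proof. by apply: sq_sum => k; apply: sqZ; exact: sq_ek. Qed.
Lemma n2_qq c : n2 gm (qq c) = (\sum_(k : Kn n) cabs2 (c k))%:E.
Proof.
rewrite (gram _ c (fun k : Kn n => sq_ek (fun j => k j))) Re_sum; congr (_%:E); apply: eq_bigr => k _.
rewrite (bigD1 k) //= ip_ek big1 ?addr0.
  by rewrite (_ : [forall j, _] = true) ?mulr1 ?mulJ ?ReR //; apply/forallP.
move=> k' kk'; rewrite ip_ek; case: forallP => [h|]; last by rewrite mulr0.
by exfalso; move/eqP: kk'; apply; apply/ffunP => j; apply: val_inj; apply/esym/eqP; exact: h.
Qed.
Lemma comb_qq S c z : comb S c z = \sum_(v <- S) beta v (qq (c v)) z.
Proof. by apply: eq_bigr => v _; rewrite /qq beta_sum. Qed.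

Definition Ex (v : V) (z : V) : C := cexp (pi%:C * cdot v z - (pi / 2 * vnorm2 v)%:C).
Lemma betaE v F z : beta v F z = Ex v z * F (z - v). Proof. by []. Qed.
Lemma chi_cdot (v z : V) : chi v z = cexp (pi%:C * (cdot v z - cj (cdot v z))).
Proof.
rewrite !cdotE J_sum -sumrB mulr_sumr cexp_sum; apply: eq_bigr => j _.
by rewrite /chi1 JM JJ.
Qed.
(** Consequently [Ex v] is real wherever [chi v] is 1. This is why conjugating only the polynomial
    factor preserves moduli on the lattice. *)
Lemma Ex_chi (v z : V) : cj (Ex v z) = Ex v z * cj (chi v z).
Proof.
rewrite /Ex chi_cdot !cexpJ -cexpD; congr cexp; rewrite JB !JM !JR JB JJ.
exact: alg_Ex.
Qed.
Lemma hol_Ex (v a z : V) j : hol (fun w => Ex v (upd z j w - a)).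
Proof.
have e w : pi%:C * cdot v (upd z j w - a) - (pi / 2 * vnorm2 v)%:C =
   (pi%:C * (\sum_(i | i != j) cj (v ord0 i) * (z - a) ord0 i - cj (v ord0 j) * a ord0 j) - (pi / 2 * vnorm2 v)%:C) + pi%:C * cj (v ord0 j) * w.
  rewrite cdotE (bigD1 j) //= !mxE eqxx (eq_bigr (fun i => cj (v ord0 i) * (z - a) ord0 i)) => [|i /negPf ij]; last by rewrite !mxE ij.
  exact: alg_slice.
have := hol_comp (@hol_exp R) (holD (hol_cst (pi%:C * (\sum_(i | i != j) cj (v ord0 i) * (z - a) ord0 i - cj (v ord0 j) * a ord0 j) - (pi / 2 * vnorm2 v)%:C)) (holM (hol_cst (pi%:C * cj (v ord0 j))) (@hol_id R))).
by congr hol; apply/funext => w; rewrite /Ex e.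
Qed.

Lemma eiX (x : R) k : ei (k%:R * x) = ei x ^+ k.
Proof. by elim: k => [|k IH]; [rewrite mul0r ei0|rewrite -natr1 mulrDl mul1r eiD IH exprSr]. Qed.

(** A geometric sum over a full period; the bound [|x| < q] ensures that the ratio is 1 only for
    [x = 0]. *)
Lemma geom_ei (x : int) (q : nat) : (`|x| < q)%N -> \sum_(t < q) ei (t%:R * (x%:~R / q%:R)) = ((x == 0) * q)%:R.
Proof.
move=> xq; have q0 : (0 < q)%N by exact: leq_ltn_trans xq.
have qR : q%:R != 0 :> R by rewrite pnatr_eq0 -lt0n.
have [->|x0] := eqVneq x 0.
  rewrite mul1n (eq_bigr (fun=> 1)) => [|t _]; last by rewrite mul0r mulr0 ei0.
  by rewrite sumr_const card_ord.
rewrite mul0n; set z := ei (x%:~R / q%:R).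
have zq : z ^+ q = 1 by rewrite -eiX mulrC divfK // ei_int.
have z1 : z - 1 != 0.
  rewrite subr_eq0; apply/eqP => /ei_eq1[m]; move/(congr1 (fun y => y * q%:R)); rewrite divfK // => e.
  have {}e : x = m * q%:Z by apply/eqP; rewrite -(eqr_int R) intrM -e.
  move: xq; rewrite e abszM -[X in (_ < X)%N]mul1n ltn_mul2r q0 /= ltnS leqn0 absz_eq0 => /eqP m0.
  by move: x0; rewrite e m0 mul0r eqxx.
rewrite (eq_bigr (fun t : 'I_q => z ^+ t)) => [|t _]; last exact: eiX.
by apply: (mulfI z1); rewrite -subrX1 zq subrr mulr0.
Qed.

(** Evaluated on the grid of mesh [1 / q] in the coordinates of [A], the characters become products
    of powers of roots of unity, and orthogonality reduces to [geom_ei] in each coordinate. *)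
Lemma char_avg A (S : seq V) : A \in unitmx -> uniq S -> (forall v, v \in S -> Gam (dual A) v) ->
  exists (pts : seq V) (M : nat), (0 < M)%N /\ size pts = M /\
  forall v w, v \in S -> w \in S -> \sum_(a <- pts) chi v a * cj (chi w a) = ((v == w) * M)%:R.
Proof.
move=> uA uS SG.
have /choice[m hm] : forall v, exists m, Gam (dual A) v -> v = toC (dual A *m mapZ R m).
  by move=> v; have [/GamP[m e]|h] := pselect (Gam (dual A) v); [exists m|exists 0].
(* [Q] bounds all integer coordinates of points of [S], so that differences of coordinates stay
   below [q]. *)
pose Q := (\sum_(v <- S) \sum_i `|m v i ord0|)%N; pose q := (Q + Q).+1.
have hQ v i : v \in S -> (`|m v i ord0| <= Q)%N.
  by move=> vS; rewrite /Q (bigD1_seq v) //= (bigD1 i) //= -addnA leq_addr.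
pose pt (s : {ffun 'I_(d + d) -> 'I_q}) : V := toC (A *m \col_i ((s i)%:R / q%:R)).
exists [seq pt s | s <- enum {ffun 'I_(d + d) -> 'I_q}], (q ^ (d + d))%N; split; first by rewrite expn_gt0.
split; first by rewrite size_map -cardE card_ffun !card_ord.
move=> v w vS wS; rewrite big_map big_enum /=.
transitivity (\sum_(s : {ffun 'I_(d + d) -> 'I_q}) \prod_i ei ((s i)%:R * ((m v i ord0 - m w i ord0)%:~R / q%:R))).
  apply: eq_bigr => s _; rewrite !chiE -eiN -eiD -(big_morph ei (@eiD R) (ei0 R)); congr ei.
  rewrite {1}(hm v (SG v vS)) {1}(hm w (SG w wS)) !sg_dual // -sumrB; apply: eq_bigr => i _.
  by rewrite !mxE intrB; move: (_%:~R) (_%:~R) (_^-1) => x y t; ring.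
rewrite -(bigA_distr_bigA (fun i (t : 'I_q) => ei (t%:R * ((m v i ord0 - m w i ord0)%:~R / q%:R)))).
have lt i : (`|m v i ord0 - m w i ord0| < q)%N.
  rewrite ltnS; apply: leq_trans (leq_add (hQ v i vS) (hQ w i wS)).
  by have := leqD_dist (m v i ord0) 0 (m w i ord0); rewrite subr0 sub0r abszN.
rewrite (eq_bigr (fun i => ((m v i ord0 - m w i ord0 == 0)%R * q)%:R)) => [|i _]; last exact: geom_ei.
have [e|vw] := eqVneq v w.
  rewrite (eq_bigr (fun=> q%:R)) => [|i _]; last by rewrite e subrr eqxx mul1n.
  by rewrite prodr_const card_ord mul1n natrX.
have /existsP[i hi] : [exists i, m v i ord0 != m w i ord0].
  apply: contraNT vw; rewrite negb_exists => /forallP h; rewrite (hm v (SG v vS)) (hm w (SG w wS)).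
  by apply/eqP; congr (toC (_ *m mapZ R _)); apply/colP => i; apply/eqP; rewrite -[_ == _]negbK h.
by rewrite (bigD1 i) //= subr_eq0 (negPf hi) mul0n mul0r.
Qed.

(* On the lattice, where the characters are trivial, this has the same modulus as the translate of
   [comb S c] (see [Fa_at]), but it is polyanalytic instead of analytic. *)
Definition Fa (a : V) (S : seq V) (c : V -> Kn n -> C) : V -> C :=
  beta a (fun z => \sum_(v <- S) chi v a * beta v (fun w => cj (qq (c v) w)) z).

Lemma sq_g v (c : Kn n -> C) : sq gm (beta v (fun w => cj (qq c w))).
Proof.
have [mq _] := sq_qq c; split; first by apply: mC_beta; exact: mCJ.
rewrite n2_beta; last exact: mCJ.
by rewrite (eq_n2 _ (g := qq c)) ?n2_qq ?ltry // => z; rewrite cabs2J.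
Qed.
Lemma n2_g v (c : Kn n -> C) : n2 gm (beta v (fun w => cj (qq c w))) = (\sum_(k : Kn n) cabs2 (c k))%:E.
Proof.
have [mq _] := sq_qq c; rewrite n2_beta; last exact: mCJ.
by rewrite -n2_qq; apply: eq_n2 => z; rewrite cabs2J.
Qed.
Lemma sq_beta v F : sq gm F -> sq gm (beta v F).
Proof. by move=> [mF lF]; split; [exact: mC_beta|rewrite n2_beta]. Qed.
Lemma sq_Fa a S c : sq gm (Fa a S c).
Proof. by apply: sq_beta; apply: sq_sum => v; apply: sqZ; exact: sq_g. Qed.

Lemma Fa_polyFock a S c : polyFock n (Fa a S c).
Proof.
split; last by have [mF lF] := sq_Fa a S c; rewrite fnorm2_gm.
have /choice[e he] : forall v, exists e : Kn n -> Kn n -> C, forall (k : Kn n) (z : V), \prod_j (cj (z ord0 j) - cj ((a + v : V) ord0 j)) ^+ k j = \sum_(m : Kn n) e k m * cpowbar z (fun j => m j).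
  by move=> v; have [e he] := choice (cpowbar_shift (a + v)); exists e.
pose K v (k m : Kn n) : C := chi v a * cj (c v k) * (kap2 R (fun j => k j))%:C * e v k m.
exists (fun m z => \sum_(v <- S) \sum_(k : Kn n) K v k m * (Ex a (z - 0) * Ex v (z - a))); split.
  move=> m; apply/entire_hol => z j; apply: hol_sum => v; apply: hol_sum => k.
  by apply: holM; [exact: hol_cst|apply: holM; exact: hol_Ex].
move=> z; rewrite /Fa betaE mulr_sumr.
transitivity (\sum_(v <- S) \sum_(k : Kn n) \sum_(m : Kn n) cpowbar z (fun j => m j) * (K v k m * (Ex a (z - 0) * Ex v (z - a)))).
  apply: eq_bigr => v _; rewrite betaE J_sum !mulr_sumr; apply: eq_bigr => k _.
  rewrite /ek JM JM JR -/(kap2 R _) J_prod (eq_bigr (fun j => (cj (z ord0 j) - cj ((a + v : V) ord0 j)) ^+ k j)) => [|j _]; last first.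
    by rewrite JX !mxE -addrA -opprD JB.
  rewrite he !mulr_sumr; apply: eq_bigr => m _; rewrite /K subr0.
  exact: alg_Fa.
rewrite [LHS](eq_bigr (fun v => \sum_(m : Kn n) \sum_(k : Kn n) cpowbar z (fun j => m j) * (K v k m * (Ex a (z - 0) * Ex v (z - a))))) => [|v _]; last exact: exchange_big.
rewrite exchange_big; apply: eq_bigr => m _; rewrite mulr_sumr; apply: eq_bigr => v _; by rewrite mulr_sumr.
Qed.

Lemma sgNr (v z : V) : sg v (- z) = - sg v z.
Proof. by rewrite /sg -sumrN; apply: eq_bigr => j _; rewrite !mxE ReN ImN; ring. Qed.

(** At [l - a] the conjugate of [Ex v] differs from [Ex v] by the factor [chi v a], since
    [chi v l = 1]. The coefficients [chi v a] in [Fa] supply exactly this factor. *)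
Lemma Fa_at a S (c : V -> Kn n -> C) l : (forall v, v \in S -> chi v l = 1) ->
  cabs2 (Fa a S c l) = cabs2 (beta a (comb S c) l).
Proof.
move=> h; rewrite /Fa !betaE !cabs2M; congr (_ * _); rewrite -[RHS]cabs2J comb_qq J_sum; congr cabs2.
apply: eq_big_seq => v vS; rewrite !betaE JM Ex_chi chiDr h // mul1r mulrA; congr (_ * _); rewrite mulrC; congr (_ * _).
by rewrite !chiE sgNr eiN JJ.
Qed.

Lemma hol_be (v : V) (k : 'I_d -> nat) (z : V) j : hol (fun w => beta v (ek k) (upd z j w)).
Proof.
have hb i : hol (fun w => be1 (v ord0 i) (k i) (upd z j w ord0 i)).
  have [->|ij] := eqVneq i j; last first.
    by have := hol_cst (be1 (v ord0 i) (k i) (z ord0 i)); congr hol; apply/funext => w; rewrite upd_ne.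
  have := holM (hol_comp (@hol_exp R) (holD (holM (hol_cst (pi%:C * cj (v ord0 j))) (@hol_id R)) (hol_cst (- (pi / 2 * cabs2 (v ord0 j))%:C))))
    (holX (k j) (holD (@hol_id R) (hol_cst (- v ord0 j)))).
  by congr hol; apply/funext => w; rewrite upd_at.
have := holM (hol_cst ((kap2 R k)%:C)) (hol_prod (index_enum 'I_d) hb).
by congr hol; apply/funext => w; rewrite be_ek.
Qed.

Lemma comb_SP (n0 : forall j, (0 < n j)%N) S c : SP n (@comb R d n S c).
Proof.
move=> z j; rewrite /comb; apply: PA_sum => v; apply: PA_sum => k.
have := PA_mono (n0 j) (f := fun w => c v k * beta v (ek (fun j => k j)) (upd z j w)).
by move=> h; have := h (holM (hol_cst _) (hol_be v _ z j)); congr PA; apply/funext => w; rewrite expr0 mul1r.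
Qed.

(** For each translate [x], the norm of the twisted combination [g x] is bounded through sampling by
    the samples of a translate of [comb S c], hence by its norm ([bessel]). Averaging over [pts]
    removes the cross terms and leaves the sum of squares of the coefficients. *)
Theorem sampling_Riesz A a : (forall j, (0 < n j)%N) -> A \in unitmx -> 0 < a ->
  (forall F : V -> C, polyFock n F -> (a%:E * fnorm2 F <= \esum_(z in Gam A) (cabs2 (F z) * gweight z)%:E)%E) ->
  exists b : R, Riesz n (Gam (dual A)) b.
Proof.
move=> n0 uA a0 hA; have [B B0 hB] := bessel n0 uA.
exists (a / (B + 1)); split; first by rewrite divr_gt0 // ltr_wpDl.
move=> S c uS SG; have [pts [M [M0 [sM ptsE]]]] := char_avg uA uS SG.
have sh : sq gm (comb S c).
  have -> : comb S c = (fun z => \sum_(v <- S) beta v (qq (c v)) z) by apply/funext => z; exact: comb_qq.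
  by apply: sq_sum => v; apply: sq_beta; exact: sq_qq.
have [mh _] := sh; set Q := fine (n2 gm (comb S c)).
pose g x (z : V) : C := \sum_(v <- S) chi v x * beta v (fun w => cj (qq (c v) w)) z.
have sg_ x : sq gm (g x) by apply: sq_sum => v; apply: sqZ; exact: sq_g.
have each x : a * fine (n2 gm (g x)) <= B * Q.
  rewrite -lee_fin !EFinM (n2_fine (sg_ x)) (n2_fine sh).
  have [mF _] := sq_Fa x S c; have [mg _] := sg_ x.
  have -> : n2 gm (g x) = fnorm2 (Fa x S c) by rewrite fnorm2_gm // n2_beta.
  apply: le_trans (hA _ (Fa_polyFock x S c)) _; apply: esum_le_seq => [z _|T uT TG].
    by rewrite lee_fin mulr_ge0 ?cabs2_ge0 ?gweight_ge0.
  rewrite -(n2_beta x mh); apply: le_trans (hB T _ uT TG (SP_beta x (comb_SP n0 S c))).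
  rewrite sumEFin lee_fin big_seq [leRHS]big_seq; apply: ler_sum => l lT.
  by rewrite Fa_at // => v vS; apply: (chi_dual uA); [exact: SG|exact: TG].
have avg : \sum_(x <- pts) fine (n2 gm (g x)) = M%:R * \sum_(v <- S) \sum_(k : Kn n) cabs2 (c v k).
  pose gg v := beta v (fun w => cj (qq (c v) w)).
  have e x : fine (n2 gm (g x)) = complex.Re (\sum_(v <- S) \sum_(w <- S) chi v x * cj (chi w x) * ip gm (gg v) (gg w)).
    by rewrite /g (gram S (fun v => chi v x) (k := gg)) // => v; exact: sq_g.
  rewrite (eq_bigr _ (fun x _ => e x)) -Re_sum (avg_diag (fun v w => ip gm (gg v) (gg w)) uS ptsE).
  rewrite -(realCnat R) -[RHS]ReR realCM realC_sum; congr (complex.Re (_ * _)).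
  by apply: eq_bigr => v _; rewrite ip_n2C ?n2_g //; exact: sq_g.
have tot : a * (M%:R * \sum_(v <- S) \sum_(k : Kn n) cabs2 (c v k)) <= M%:R * (B * Q).
  rewrite -avg mulr_sumr; apply: le_trans (ler_sum _ (fun x _ => each x)) _.
  by rewrite big_const_seq count_predT sM iter_addr_0 mulr_natl.
rewrite -(n2_fine sh) lee_fin -/Q mulrAC ler_pdivrMr; last by rewrite ltr_wpDl.
have Q0 : 0 <= Q by rewrite fine_ge0 // n2_ge0.
have : a * (\sum_(v <- S) \sum_(k : Kn n) cabs2 (c v k)) <= B * Q.
  by rewrite -(ler_pM2l (_ : 0 < M%:R)) ?ltr0n // mulrCA.
move=> /le_trans; apply; rewrite mulrC ler_wpM2l // lerDl //.
Qed.
End SamplingRiesz.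

(** * From the Riesz bound to interpolation *)
Section RieszInterp.
Variables (R : realType) (d : nat).
Local Notation C := (CC R).
Local Notation V := (cvec R d).
Local Notation gm := (gm R d).
Local Notation Re := (@complex.Re R).
Local Open Scope complex_scope.

Lemma n2D (f g : V -> C) : sq gm f -> sq gm g ->
  fine (n2 gm (fun z => (f z + g z)%R)) = fine (n2 gm f) + fine (n2 gm g) + 2 * Re (ip gm f g).
Proof.
move=> qf qg; have qs := sqD qf qg.
have e h : sq gm h -> fine (n2 gm h) = Re (ip gm h h) by move=> qh; rewrite ip_n2.
rewrite (e _ qs) (e _ qf) (e _ qg) ipDl // (ipC qs qf) (ipC qs qg) !ipDl // (ipC qf qg).
by rewrite !(ReD, JD, ReJ, JJ); lra.
Qed.

Definition rr (j : nat) : R := j.+1%:R^-1.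
Lemma rr_gt0 j : 0 < rr j. Proof. by rewrite invr_gt0. Qed.
Lemma rr_anti i j : (i <= j)%N -> rr j <= rr i.
Proof. by move=> ij; rewrite lef_pV2 ?posrE // ler_nat ltnS. Qed.
Lemma rr_le1 j : rr j <= 1. Proof. by rewrite invf_le1 // ler1n. Qed.
Lemma rr_small (e : R) : 0 < e -> exists N, rr N <= e.
Proof.
move=> e0; exists (Num.truncn e^-1).
by rewrite -[leRHS]invrK lef_pV2 ?posrE ?invr_gt0 //; apply: ltW (truncnS_gt _).
Qed.

Variable n : 'I_d -> nat.
Hypothesis n0 : forall j, (0 < n j)%N.
Definition atom (i : V * Kn n) : V -> C := beta i.1 (ek (fun j => i.2 j)).
Definition lc (s : seq (C * (V * Kn n))) z := \sum_(i <- s) i.1 * atom i.2 z.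

Lemma sq_atom i : sq gm (atom i).
Proof. by apply: sq_beta; exact: sq_ek. Qed.
Lemma sq_lc s : sq gm (lc s).
Proof. by apply: sq_sum => i; apply: sqZ; exact: sq_atom. Qed.
Lemma n2_atom i : n2 gm (atom i) = 1%E.
Proof.
have qe := sq_ek R (fun j => i.2 j); have [me _] := qe; rewrite n2_beta // (ip_n2 qe) ip_ek.
by rewrite (_ : [forall j, _] = true) //; apply/forallP.
Qed.
Lemma lc_cat s t z : lc (s ++ t) z = lc s z + lc t z.
Proof. by rewrite /lc big_cat. Qed.
Definition scal (c : C) (s : seq (C * (V * Kn n))) := [seq (c * i.1, i.2) | i <- s].
Lemma lc_scal c s z : lc (scal c s) z = c * lc s z.
Proof. by rewrite /lc big_map mulr_sumr; apply: eq_bigr => i _; exact/esym/mulrA. Qed.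
Lemma hol_lc s z j : hol (fun w => lc s (upd z j w)).
Proof. by apply: hol_sum => i; apply: holM; [exact: hol_cst|exact: hol_be]. Qed.
Lemma hol_SP (F : V -> C) : (forall z j, hol (fun w => F (upd z j w))) -> SP n F.
Proof.
move=> h z j; have := PA_mono (n0 j) (h z j); congr PA; apply/funext => w; by rewrite expr0 mul1r.
Qed.
Lemma lc_SP s : SP n (lc s).
Proof. by apply: hol_SP => z j; exact: hol_lc. Qed.

(** Lists of weighted atoms are convenient for concatenation and scaling but may repeat an atom;
    collecting repetitions gives the form in which the Riesz bound is stated. *)
Lemma lc_merge (s : seq (C * (V * Kn n))) : exists (S : seq V) (c : V -> Kn n -> C), [/\ uniq S,
  forall v, v \in S -> exists2 i, i \in s & i.2.1 = v &
  forall f : V -> Kn n -> C, \sum_(i <- s) i.1 * f i.2.1 i.2.2 = \sum_(v <- S) \sum_(k : Kn n) c v k * f v k].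
Proof.
pose S := undup [seq i.2.1 | i <- s].
exists S, (fun v k => \sum_(i <- s | i.2 == (v, k)) i.1); split; first exact: undup_uniq.
  by move=> v; rewrite mem_undup => /mapP[i si ->]; exists i.
move=> f.
transitivity (\sum_(v <- S) \sum_(k : Kn n) \sum_(i <- s) (if i.2 == (v, k) then i.1 * f v k else 0)); last first.
  by apply: eq_bigr => v _; apply: eq_bigr => k _; rewrite mulr_suml -big_mkcond.
transitivity (\sum_(i <- s) \sum_(v <- S) \sum_(k : Kn n) (if i.2 == (v, k) then i.1 * f v k else 0)); last first.
  by rewrite exchange_big; apply: eq_bigr => v _; rewrite exchange_big.
rewrite big_seq [RHS]big_seq; apply: eq_bigr => i si.
have iS : i.2.1 \in S by rewrite mem_undup; apply/mapP; exists i.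
rewrite (bigD1_seq i.2.1 iS) ?undup_uniq //= (bigD1 i.2.2) //= -surjective_pairing eqxx.
rewrite [X in _ + X + _]big1 ?addr0 => [|k /negPf ki]; last first.
  by case: eqP => // /(congr1 snd) /= e; move: ki; rewrite e eqxx.
by rewrite big1 ?addr0 // => v /negPf vi; apply: big1 => k _; case: eqP => // e; move: vi; rewrite e eqxx.
Qed.

Variables (G : set V) (a : R).
Hypothesis rz : Riesz n G a.
Variables (al : V -> Kn n -> C) (M : R).
Hypothesis alM : forall S : seq V, uniq S -> (forall v, v \in S -> G v) -> \sum_(v <- S) \sum_(k : Kn n) cabs2 (al v k) <= M.

Definition la s := \sum_(i <- s) Re (i.1 * cj (al i.2.1 i.2.2)).
Definition ok (s : seq (C * (V * Kn n))) := forall i, i \in s -> G i.2.1.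
(** Its minimiser over the closed span would be the interpolating function of least norm: the first
    variation is precisely the interpolation condition. *)
Definition JJs s := fine (n2 gm (lc s)) - 2 * la s.

(** Young's inequality with weight [a] absorbs the linear term into the Riesz lower bound for the
    quadratic one. *)
Lemma J_bound s : ok s -> - (a^-1 * M) <= JJs s.
Proof.
move=> os; have [S [c [uS SG hs]]] := lc_merge s; have [a0 hR] := rz.
have GS v : v \in S -> G v by move=> /SG[i /os h <-].
have e1 : lc s = comb S c by apply/funext => z; exact: hs (fun v k => beta v (ek (fun j => k j)) z).
have e2 : la s = \sum_(v <- S) \sum_(k : Kn n) Re (c v k * cj (al v k)).
  by rewrite /la -Re_sum (hs (fun v k => cj (al v k))) Re_sum; apply: eq_bigr => v _; rewrite Re_sum.
have := hR S c uS GS; rewrite -e1 -(n2_fine (sq_lc s)) lee_fin => h1.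
have h2 : 2 * la s <= a * \sum_(v <- S) \sum_(k : Kn n) cabs2 (c v k) + a^-1 * \sum_(v <- S) \sum_(k : Kn n) cabs2 (al v k).
  rewrite e2 !mulr_sumr -big_split; apply: ler_sum => v _ /=; rewrite !mulr_sumr -big_split; apply: ler_sum => k _ /=.
  apply: le_trans (cnM_le (c v k) (al v k) a0); rewrite ler_wpM2l //.
  by apply: le_trans (ler_norm _) _; apply: le_trans (Re_cn _) _; rewrite cnM cnJ.
have := ler_wpM2l (_ : 0 <= a^-1) (alM uS GS); rewrite invr_ge0 => /(_ (ltW a0)).
by rewrite /JJs; lra.
Qed.

Let m := inf [set x | exists2 s, ok s & x = JJs s].
Let hasE : has_inf [set x | exists2 s, ok s & x = JJs s].
Proof.
split; first by exists (JJs [::]), [::].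
by exists (- (a^-1 * M)) => x [s os ->]; exact: J_bound.
Qed.
Let m_le s : ok s -> m <= JJs s.
Proof. by move=> os; apply: ge_inf; [case: hasE|exists s]. Qed.
Let m_adh e : 0 < e -> exists2 s, ok s & JJs s < m + e.
Proof. by move=> e0; have [x [s os ->] h] := inf_adherent e0 hasE; exists s. Qed.

Lemma la_cat s t : la (s ++ t) = la s + la t.
Proof. by rewrite /la big_cat. Qed.
Lemma la_half s : la (scal (2^-1)%:C s) = 2^-1 * la s.
Proof. by rewrite /la big_map mulr_sumr; apply: eq_bigr => i _; rewrite -mulrA ReM ReR ImR mul0r subr0. Qed.

(** The midpoint of two combinations is admissible, so its value is at least the infimum; the
    parallelogram law then bounds the distance by the two excesses. *)
Lemma J_para s t : ok s -> ok t -> (n2 gm (fun z => (lc s z - lc t z)%R) <= (2 * (JJs s - m) + 2 * (JJs t - m))%:E)%E.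
Proof.
move=> os ot.
have omid : ok (scal (2^-1)%:C (s ++ t)).
  by move=> i /mapP[i0]; rewrite mem_cat => /orP[/os|/ot] h -> /=.
have [ms _] := sq_lc s; have [mt _] := sq_lc t.
have qd := sqB (sq_lc s) (sq_lc t); have qa := sqD (sq_lc s) (sq_lc t).
have := m_le omid; rewrite /JJs la_half la_cat.
have -> : fine (n2 gm (lc (scal (2^-1)%:C (s ++ t)))) = 4^-1 * fine (n2 gm (fun z => lc s z + lc t z)).
  apply: EFin_inj; rewrite EFinM n2_fine ?n2_fine //; last exact: sq_lc.
  have <- : cabs2 ((2^-1)%:C : C) = 4^-1 by rewrite cabs2R exprVn; congr (_^-1); ring.
  by rewrite -n2Z; [apply: eq_n2 => z; rewrite lc_scal lc_cat|case: qa].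
rewrite -(n2_fine qd) lee_fin => h.
have : fine (n2 gm (fun z => lc s z + lc t z)) + fine (n2 gm (fun z => lc s z - lc t z)) = 2 * fine (n2 gm (lc s)) + 2 * fine (n2 gm (lc t)).
  by apply: EFin_inj; rewrite !EFinD !EFinM (n2_fine qd) (n2_fine qa) !(n2_fine (sq_lc _)) n2_para.
lra.
Qed.

(* First variation of the quadratic functional [JJs] in the direction of an atom. *)
Lemma J_atom s i : ok s -> G i.1 -> cabs2 (ip gm (lc s) (atom i) - al i.1 i.2) <= JJs s - m.
Proof.
move=> os Gi; set x := _ - _.
have ot : ok (s ++ [:: (- x, i)]).
  by move=> i0; rewrite mem_cat inE => /orP[/os //|/eqP ->].
have := m_le ot; rewrite {1}/JJs la_cat {2}/la big_seq1 /=.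
have e z : lc (s ++ [:: (- x, i)]) z = lc s z + - x * atom i z by rewrite lc_cat /lc big_seq1.
have -> : fine (n2 gm (lc (s ++ [:: (- x, i)]))) = fine (n2 gm (lc s)) + cabs2 x + 2 * Re (cj (- x) * ip gm (lc s) (atom i)).
  rewrite (_ : lc _ = fun z => lc s z + - x * atom i z); last exact/funext.
  rewrite n2D; [|exact: sq_lc|by apply: sqZ; exact: sq_atom].
  have [ma _] := sq_atom i.
  have -> : fine (n2 gm (fun z => - x * atom i z)) = cabs2 x by rewrite n2Z // n2_atom mule1 /= cabs2N.
  by rewrite ipZr //; [exact: sq_atom|exact: sq_lc].
have ex : ip gm (lc s) (atom i) = x + al i.1 i.2 by rewrite /x subrK.
rewrite ex mulrDr ReD JN !mulNr !ReN [cj x * x]mulrC mulJ ReR.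
have -> : Re (cj x * al i.1 i.2) = Re (x * cj (al i.1 i.2)) by rewrite -ReJ JM JJ.
by rewrite /JJs; lra.
Qed.

Theorem Riesz_interp : exists F : V -> C, Fock F /\ forall i, G i.1 -> ip gm F (atom i) = al i.1 i.2.
Proof.
have /choice[s hs] : forall j : nat, exists s, ok s /\ JJs s < m + rr j.
  by move=> j; have [s os h] := m_adh (rr_gt0 j); exists s.
have os j : ok (s j) by case: (hs j).
have Js j : JJs (s j) - m <= rr j by have [_] := hs j; lra.
have diff i j : (n2 gm (fun z => (lc (s i) z - lc (s j) z)%R) <= (2 * rr i + 2 * rr j)%:E)%E.
  apply: le_trans (J_para (os i) (os j)) _; rewrite lee_fin; have := Js i; have := Js j; lra.
have [B B0 hB] := pt_bound R n0.
have ptW F z : SP n F -> ((cabs2 (F z))%:E <= (W z * B)%:E * n2 gm F)%E.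
  move=> sF; have h := hB F z sF; rewrite EFinM -muleA.
  have -> : cabs2 (F z) = W z * (cabs2 (F z) * gweight z) by rewrite mulrCA [W z * _]mulrC W_gw mulr1.
  by rewrite EFinM lee_wpmul2l // lee_fin W_ge0.
have cau z (e : R) : 0 < e -> exists N, forall k, (N <= k)%N -> cn (lc (s k) z - lc (s N) z) <= e.
  move=> ep; pose D := 4 * (W z * B) + 1.
  have D0 : 0 < D by rewrite ltr_wpDl // !mulr_ge0 ?W_ge0.
  have eD : 0 < e ^+ 2 / D by rewrite divr_gt0 // exprn_gt0.
  have [N hN] := rr_small eD.
  exists N => k Nk; rewrite -(@ler_pXn2r _ 2) ?nnegrE ?cn_ge0 ?(ltW ep) // cn_sqr -lee_fin.
  have := ptW _ z (SP_B (lc_SP (s k)) (lc_SP (s N))) => /le_trans; apply.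
  apply: le_trans (lee_wpmul2l _ (diff k N)) _; first by rewrite lee_fin mulr_ge0 ?W_ge0.
  rewrite -EFinM lee_fin; have := hN; rewrite ler_pdivlMr // => h2.
  apply: le_trans h2; rewrite /D; have w0 : 0 <= W z * B by rewrite mulr_ge0 ?W_ge0.
  have := ler_wpM2l w0 (rr_anti Nk); have := rr_gt0 N; move: (rr N) (rr k) (W z * B) => x y t; lra.
have /choice[F hF] := fun z => C_cauchy (cau z).
have bndQ k : fine (n2 gm (lc (s k))) <= 2 * fine (n2 gm (lc (s 0%N))) + 8.
  have qd := sqB (sq_lc (s k)) (sq_lc (s 0%N)).
  have [m0 _] := sq_lc (s 0%N); have [md _] := qd.
  rewrite -lee_fin EFinD EFinM !(n2_fine (sq_lc _)).
  rewrite (eq_n2 _ (g := fun z => lc (s 0%N) z + (lc (s k) z - lc (s 0%N) z))) => [|z]; last by rewrite addrCA subrr addr0.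
  apply: le_trans (n2D_le gm m0 md) _; rewrite leeD2l //; apply: le_trans (lee_wpmul2l _ (diff k 0%N)) _ => //.
  by rewrite -EFinM lee_fin; have := rr_le1 k; have := rr_le1 0; lra.
(* [hol_lim] asks for a bound on a unit disc uniform in [k]: it comes from [pt_bound], the
   boundedness of the norms ([bndQ]) and the largest weight [W] on the disc. *)
have holF z j : hol (fun w => F (upd z j w)).
  apply: (hol_lim (f_ := fun k w => lc (s k) (upd z j w))) => [k|w e ep|w]; [exact: hol_lc|exact: hF|].
  pose X := expR (pi * (vnorm2 z + (cn w + 1) ^+ 2)) * B * (2 * fine (n2 gm (lc (s 0%N))) + 8).
  exists (1 + X) => k u u1.
  have Wb : W (upd z j (w + u)) <= expR (pi * (vnorm2 z + (cn w + 1) ^+ 2)).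
    rewrite ler_expR ler_wpM2l ?pi_ge0 // /vnorm2 (bigD1 j) //= upd_at [X in _ <= X + _](bigD1 j) //=.
    rewrite (eq_bigr (fun i => cabs2 (z ord0 i))) => [|i ij]; last by rewrite upd_ne.
    have : cabs2 (w + u) <= (cn w + 1) ^+ 2.
      rewrite -cn_sqr lerXn2r ?nnegrE ?cn_ge0 ?addr_ge0 ?cn_ge0 //; apply: le_trans (cnD _ _) _; by rewrite lerD2l.
    have := cabs2_ge0 (z ord0 j); lra.
  have Q0 : 0 <= fine (n2 gm (lc (s k))) by rewrite fine_ge0 // n2_ge0.
  have : cabs2 (lc (s k) (upd z j (w + u))) <= X.
    rewrite -lee_fin; apply: le_trans (ptW _ _ (lc_SP (s k))) _; rewrite -(n2_fine (sq_lc _)) -EFinM lee_fin.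
    by apply: ler_pM => //; [rewrite mulr_ge0 ?W_ge0|rewrite ler_wpM2r].
  have := sqr_ge0 (cn (lc (s k) (upd z j (w + u))) - 1); have := cn_ge0 (lc (s k) (upd z j (w + u))).
  by rewrite -cn_sqr; move: (cn _) X => x y; rewrite !expr2; lra.
have SF : SP n F by exact: hol_SP.
have mF := SP_mC SF.
(* Fatou as [k] grows with [j] fixed; the index [k + j] makes [rr (k + j)] at most [rr j] for every
   [k]. *)
have L2 j : (n2 gm (fun z => (F z - lc (s j) z)%R) <= (4 * rr j)%:E)%E.
  have [mj _] := sq_lc (s j).
  apply: (n2_lim (f_ := fun k z => lc (s (k + j)%N) z - lc (s j) z)) => [k| |z|k].
  - by apply: mCB => //; have [] := sq_lc (s (k + j)%N).
  - exact: mCB.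
  - apply/cvgrPdist_le => e ep; have [N hN] := hF z e ep; exists N => // k /= Nk.
    rewrite sub0r normrN ger0_norm ?cn_ge0 // opprB addrA subrK; apply: hN; exact: leq_trans Nk (leq_addr _ _).
  apply: le_trans (diff _ j) _; rewrite lee_fin.
  have := rr_anti (leq_addl k j); lra.
have qd j : sq gm (fun z => F z - lc (s j) z).
  split; last exact: le_lt_trans (L2 j) (ltry _).
  by apply: mCB => //; have [] := sq_lc (s j).
have qF : sq gm F.
  rewrite (_ : F = fun z => (F z - lc (s 0%N) z) + lc (s 0%N) z); last by apply/funext => z; rewrite subrK.
  by apply: sqD => //; exact: sq_lc.
exists F; split; first by split; [apply/entire_hol|rewrite fnorm2_gm //; case: qF].
move=> i Gi; apply/eqP; rewrite -subr_eq0; apply/eqP/cn0_eq0/eqP; rewrite -sqrf_eq0 cn_sqr.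
rewrite eq_le cabs2_ge0 andbT; apply/ler_addgt0Pr => e ep; rewrite add0r.
(* The two squared errors are [4 * rr N] and [rr N], and [cabs2D_le] doubles each: 10 in all. *)
have e10 : 0 < e / 10 by rewrite divr_gt0.
have [N ha] := rr_small e10.
have -> : ip gm F (atom i) - al i.1 i.2 = ip gm (fun z => F z - lc (s N) z) (atom i) + (ip gm (lc (s N)) (atom i) - al i.1 i.2).
  by rewrite ipBl ?addrA ?subrK //; [exact: sq_lc|exact: sq_atom].
apply: le_trans (cabs2D_le _ _) _.
have h1 := ip_cs (qd N) (sq_atom i); rewrite n2_atom mulr1 in h1.
have h2 : fine (n2 gm (fun z => F z - lc (s N) z)) <= 4 * rr N by rewrite -lee_fin (n2_fine (qd N)).
have h3 := le_trans (J_atom (os N) Gi) (Js N).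
lra.
Qed.
End RieszInterp.

(** * From interpolation to the Riesz bound *)
Section InterpRiesz.
Variables (R : realType) (d : nat).
Local Notation C := (CC R).
Local Notation V := (cvec R d).
Local Notation gm := (gm R d).
Local Notation Re := (@complex.Re R).
Local Notation rr := (@rr R).
Local Open Scope complex_scope.
Variable n : 'I_d -> nat.
Local Notation seqs := (V -> Kn n -> C).

Definition l2 (T : seq V) (x : seqs) : R := \sum_(v <- T) \sum_(k : Kn n) cabs2 (x v k).
Lemma l2_ge0 T x : 0 <= l2 T x.
Proof. by apply: sumr_ge0 => v _; apply: sumr_ge0 => k _; exact: cabs2_ge0. Qed.

Section Hump.
Variables (S : nat -> seq V) (c : nat -> seqs).
Hypothesis uS : forall i, uniq (S i).
Hypothesis c0 : forall i v k, v \notin S i -> c i v k = 0.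
Hypothesis c1 : forall i, l2 (S i) (c i) = 1.

(** With ratio 1/3 the sum of all later terms is half of the current one, so a hump is never undone
    by its successors. *)
Definition th (i : nat) : R := 3^-1 ^+ i.
Lemma th_gt0 i : 0 < th i. Proof. by rewrite exprn_gt0 // invr_gt0. Qed.
Lemma thS i : 3 * th i.+1 = th i.
Proof. by rewrite /th exprS mulrA mulfV ?mul1r. Qed.
Lemma th_rr i : th i <= rr i.
Proof. by rewrite /th exprVn lef_pV2 ?posrE ?exprn_gt0 // -natrX ler_nat ltn_expl. Qed.

Definition pr (i : nat) (x : seqs) : C := \sum_(v <- S i) \sum_(k : Kn n) x v k * cj (c i v k).
(* Partial sums of [sum +-3^-j c_j]; the sign is chosen so that the j-th term does not decrease the
   pairing with [c_j], and the later terms cannot undo more than half of it. *)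
Fixpoint st (i : nat) : seqs :=
  if i is j.+1 then fun v k => st j v k + ((if 0 <= Re (pr j (st j)) then 1 else -1) * th j)%:C * c j v k else fun _ _ => 0.
Definition ep j : R := if 0 <= Re (pr j (st j)) then 1 else -1.
Lemma ep_norm j : `|ep j| = 1.
Proof. by rewrite /ep; case: (0 <= _); rewrite ?normrN1 ?normr1. Qed.

Lemma c_le1 T i : uniq T -> l2 T (c i) <= 1.
Proof.
move=> uT; rewrite -(c1 i) /l2; set f := fun v => \sum_(k : Kn n) cabs2 (c i v k).
have f0 v : 0 <= f v by apply: sumr_ge0 => k _; exact: cabs2_ge0.
rewrite (bigID (fun v => v \in S i)) /= [X in _ + X]big1 ?addr0 => [|v vS]; last first.
  by apply: big1 => k _; rewrite c0 // cabs20.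
rewrite -big_filter (perm_big [seq v <- S i | v \in T]) /=; last first.
  apply: uniq_perm; [exact: filter_uniq|exact: filter_uniq|].
  by move=> v; rewrite !mem_filter andbC.
by rewrite big_filter [leRHS](bigID (fun v => v \in T)) /= lerDl; apply: sumr_ge0 => v _; exact: f0.
Qed.

(** Stated for a general functional because it serves twice: for single entries, to get a limit, and
    for the pairings [pr i]. *)
Lemma st_tail (q : seqs -> C) : (forall x j (r : R), q (fun v k => x v k + r%:C * c j v k) = q x + r%:C * q (c j)) ->
  (forall j, cn (q (c j)) <= 1) -> forall N t, cn (q (st (N + t)) - q (st N)) <= 3 / 2 * th N - 3 / 2 * th (N + t).
Proof.
move=> ql q1 N; elim=> [|t IH]; first by rewrite addn0 !subrr cn0.
rewrite addnS /= ql -addrA [_ - q (st N)]addrC addrA.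
apply: le_trans (cnD _ _) _; rewrite cnM cnR normrM -/(ep _) ep_norm mul1r ger0_norm ?(ltW (th_gt0 _)) //.
have := thS (N + t); have := ler_wpM2l (ltW (th_gt0 (N + t))) (q1 (N + t)%N); move: IH; rewrite mulr1 -/(th _).
by move: (th (N + t)) (th (N + t).+1) (th N) (cn _) (_ * cn _) => x y u w s; lra.
Qed.

Lemma ev_tail v k N t : cn (st (N + t) v k - st N v k) <= 3 / 2 * th N.
Proof.
have := @st_tail (fun x => x v k) _ _ N t => /(_ (fun _ _ _ => erefl)) h.
apply: le_trans (h _) _ => [j|]; last by have := th_gt0 (N + t); lra.
rewrite -(@ler_pXn2r _ 2) ?nnegrE ?cn_ge0 // cn_sqr expr1n.
apply: le_trans (@c_le1 [:: v] j isT); rewrite /l2 big_seq1 (bigD1 k) //= lerDl sumr_ge0 // => k' _.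
exact: cabs2_ge0.
Qed.

Lemma pr_lin i x j (r : R) : pr i (fun v k => x v k + r%:C * c j v k) = pr i x + r%:C * pr i (c j).
Proof.
rewrite /pr mulr_sumr -big_split; apply: eq_bigr => v _ /=; rewrite mulr_sumr -big_split; apply: eq_bigr => k _ /=.
by rewrite mulrDl mulrA.
Qed.
Lemma cn_pr i (x : seqs) : 2 * cn (pr i x) <= l2 (S i) x + 1.
Proof.
rewrite -[X in _ <= _ + X](c1 i) /l2 -big_split; apply: le_trans (ler_wpM2l _ (cn_sum _ _)) _ => //.
rewrite mulr_sumr; apply: ler_sum => v _ /=; rewrite -big_split; apply: le_trans (ler_wpM2l _ (cn_sum _ _)) _ => //.
rewrite mulr_sumr; apply: ler_sum => k _ /=; rewrite cnM cnJ.
by have := cnM_le (x v k) (c i v k) (ltr01 : 0 < 1 :> R); rewrite invr1 !mul1r.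
Qed.
Lemma pr_c i j : cn (pr i (c j)) <= 1.
Proof. by have := cn_pr i (c j); have := c_le1 j (uS i); lra. Qed.
Lemma pr_self i : pr i (c i) = 1.
Proof.
rewrite -[RHS](_ : (1 : R)%:C = 1) // -(c1 i) /l2 realC_sum; apply: eq_bigr => v _; rewrite realC_sum; apply: eq_bigr => k _.
exact: mulJ.
Qed.

(** The choice of sign gives at least [th i] right after the step [i]; the tail from [i.+1] on
    changes the pairing by at most half of that. *)
Lemma hump i t : th i / 2 <= cn (pr i (st (i.+1 + t))).
Proof.
have h := st_tail (@pr_lin i) (pr_c i) i.+1 t.
have : th i <= cn (pr i (st i.+1)).
  rewrite /= pr_lin pr_self mulr1; apply: le_trans (Re_cn _); rewrite ReD ReR.
  have t0 := th_gt0 i; case: (leP 0 (Re (pr i (st i)))) => h0.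
    by rewrite mul1r; apply: le_trans (ler_norm _); rewrite lerDr.
  by rewrite mulN1r -normrN; apply: le_trans (ler_norm _); lra.
have := cn_dist (pr i (st i.+1)) (pr i (st (i.+1 + t))); rewrite cnB.
move: h; have := thS i; have := th_gt0 (i.+1 + t); lra.
Qed.

(** The triangle inequality in l2, carried out on squares: by convexity ([pt]) adding a term of size
    [th M] turns the bound [b M] into [b M + th M]. *)
Lemma st_l2 T M : uniq T -> l2 T (st M) <= (5 / 2) ^+ 2.
Proof.
(* [b M] is 1 plus the sum of the first [M] terms [th]; the initial 1 keeps it positive, as [pt]
   divides by it. *)
move=> uT; pose b M := 5 / 2 - 3 / 2 * th M.
have th1 N : th N <= 1 by rewrite exprn_ile1 // invf_le1 //; lra.
have b0 N : 0 < b N by rewrite /b; have := th1 N; lra.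
suff h : l2 T (st M) <= b M ^+ 2.
  have hb : b M <= 5 / 2 by rewrite /b; have := th_gt0 M; lra.
  by apply: le_trans h _; rewrite !expr2; apply: ler_pM => //; exact: ltW.
elim: M => [|M IH].
  rewrite (_ : l2 _ _ = 0) ?sqr_ge0 // /l2 big1 // => v _; apply: big1 => k _; exact: cabs20.
have bS : b M.+1 = b M + th M by rewrite /b; have := thS M; lra.
have t0 := th_gt0 M; have bM := b0 M.
have pt x y : cabs2 (x + (ep M * th M)%:C * y) <= (b M + th M) * ((b M)^-1 * cabs2 x + th M * cabs2 y).
  apply: (@le_trans _ _ ((cn x + th M * cn y) ^+ 2)).
    rewrite -cn_sqr lerXn2r ?nnegrE ?cn_ge0 ?addr_ge0 ?mulr_ge0 ?cn_ge0 ?(ltW t0) //.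
    by apply: le_trans (cnD _ _) _; rewrite cnM cnR normrM ep_norm mul1r gtr0_norm.
  rewrite -!cn_sqr; have -> : (b M)^-1 * cn x ^+ 2 = b M * ((b M)^-1 * cn x) ^+ 2.
    by move: (b M) (cn x) bM => p u p0; field; rewrite gt_eqF.
  have -> : cn x = b M * ((b M)^-1 * cn x) by rewrite mulrA mulfV ?mul1r // gt_eqF.
  rewrite [(b M)^-1 * (_ * _)]mulrA mulVf ?gt_eqF // mul1r.
  move: (_^-1 * cn x) (cn y) => u w.
  have := mulr_ge0 (mulr_ge0 (ltW bM) (ltW t0)) (sqr_ge0 (u - w)).
  by move: (b M) (th M) => p q; rewrite !expr2; lra.
apply: (@le_trans _ _ ((b M + th M) * ((b M)^-1 * l2 T (st M) + th M * l2 T (c M)))).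
  rewrite /l2 !mulr_sumr -big_split mulr_sumr; apply: ler_sum => v _ /=.
  rewrite !mulr_sumr -big_split mulr_sumr; apply: ler_sum => k _ /=; exact: pt.
rewrite bS expr2; apply: ler_wpM2l; first by rewrite addr_ge0 // ltW.
apply: lerD.
  by rewrite mulrC ler_pdivrMr // -expr2.
by rewrite -[leRHS]mulr1 ler_wpM2l ?(ltW t0) // c_le1.
Qed.

(** Entrywise limits suffice, since both claims involve finitely many entries at a time. The
    constant 13 is twice the [(5 / 2) ^+ 2] of [st_l2] plus 1/2 for the approximation error. *)
Lemma hump_lim : exists al : seqs, (forall T, uniq T -> l2 T al <= 13) /\ forall i, th i / 2 <= cn (pr i al).
Proof.
have cau v k (e : R) : 0 < e -> exists N, forall m, (N <= m)%N -> cn (st m v k - st N v k) <= e.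
  move=> e0; have e2 : 0 < e / 2 by rewrite divr_gt0.
  have [N hN] := rr_small e2; exists N => m Nm; rewrite -(subnKC Nm); apply: le_trans (ev_tail _ _ _ _) _.
  by have := le_trans (th_rr N) hN; lra.
have /choice[al' hal] := fun q : V * Kn n => C_cauchy (cau q.1 q.2).
pose al v k := al' (v, k).
have alE v k N : cn (al v k - st N v k) <= 2 * th N.
  have h : 0 < th N / 2 by rewrite divr_gt0 // th_gt0.
  have [M hM] := hal (v, k) _ h; have := hM (maxn N M) (leq_maxr _ _); have := ev_tail v k N (maxn N M - N).
  rewrite subnKC ?leq_maxl // => h1 h2.
  have := cnD (al v k - st (maxn N M) v k) (st (maxn N M) v k - st N v k); rewrite addrA subrK [cn (al v k - st (maxn _ _) _ _)]cnB.
  move: h1 h2 => /=; rewrite -/(al v k); lra.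
have small (D e : R) : 0 <= D -> 0 < e -> exists N, forall M, (N <= M)%N -> D * th M <= e.
  move=> D0 e0; have h : 0 < e / (D + 1) by rewrite divr_gt0 // ltr_wpDl.
  have [N hN] := rr_small h; exists N => M NM.
  have := le_trans (th_rr M) (le_trans (rr_anti R NM) hN); rewrite ler_pdivlMr ?ltr_wpDl //.
  by have := th_gt0 M; rewrite mulrDr mulr1 [D * _]mulrC; lra.
exists al; split => [T uT|i].
  (* Each entry of [al] differs from that of [st N] by at most [2 * th N]. Twice its square is at
     most [8 * th N] because [th N <= 1]. *)
  pose D : R := \sum_(v <- T) \sum_(k : Kn n) 8.
  have D0 : 0 <= D by apply: sumr_ge0 => v _; apply: sumr_ge0.
  have h2 : 0 < 2^-1 :> R by rewrite invr_gt0.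
  have [N hN] := small D _ D0 h2.
  have hT : D * th N <= 2^-1 by exact: hN.
  have th1 : th N <= 1 by rewrite exprn_ile1 // invf_le1 //; lra.
  apply: (@le_trans _ _ (2 * l2 T (st N) + D * th N)); last by have := st_l2 N uT; rewrite expr2; lra.
  rewrite /l2 /D mulr_sumr mulr_suml -big_split; apply: ler_sum => v _ /=.
  rewrite mulr_sumr mulr_suml -big_split; apply: ler_sum => k _ /=.
  have := cabs2D_le (st N v k) (al v k - st N v k); rewrite addrCA subrr addr0 => /le_trans; apply.
  rewrite lerD2l -cn_sqr; have := alE v k N; have := cn_ge0 (al v k - st N v k); have := th_gt0 N.
  by move: (cn _) (th N) th1 => x y y1 y0 x0 xy; rewrite expr2; nra.
apply/ler_addgt0Pr => e e0.
pose D : R := \sum_(v <- S i) \sum_(k : Kn n) 2 * cn (c i v k).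
have D0 : 0 <= D by apply: sumr_ge0 => v _; apply: sumr_ge0 => k _; rewrite mulr_ge0 ?cn_ge0.
have [N hN] := small D e D0 e0; have h := hump i N; have hM := hN (i.+1 + N)%N (leq_addl _ _).
set M := (i.+1 + N)%N in h hM.
have := cn_dist (pr i (st M)) (pr i al).
have -> : pr i (st M) - pr i al = \sum_(v <- S i) \sum_(k : Kn n) (st M v k - al v k) * cj (c i v k).
  by rewrite -sumrB; apply: eq_bigr => v _; rewrite -sumrB; apply: eq_bigr => k _; rewrite mulrBl.
have : cn (\sum_(v <- S i) \sum_(k : Kn n) (st M v k - al v k) * cj (c i v k)) <= D * th M.
  apply: le_trans (cn_sum _ _) _; rewrite mulr_suml; apply: ler_sum => v _.
  apply: le_trans (cn_sum _ _) _; rewrite mulr_suml; apply: ler_sum => k _.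
  by rewrite cnM cnJ cnB mulrAC ler_wpM2r ?cn_ge0.
lra.
Qed.
End Hump.

(** Without a Riesz bound there are unit sequences whose combinations have tiny norm. An
    interpolating function for the data of [hump_lim] would have pairings of size at least
    [th i / 2] with them, which Cauchy-Schwarz forbids for large [i]. *)
Theorem interp_Riesz (G : set V) : (forall j, (0 < n j)%N) -> mult_interpolating n G -> exists a, Riesz n G a.
Proof.
move=> n0 mi; apply: contrapT => nR.
have ex (i : nat) : exists q : seq V * seqs, [/\ uniq q.1, forall v, v \in q.1 -> G v, forall v k, v \notin q.1 -> q.2 v k = 0,
   l2 q.1 q.2 = 1 & (n2 gm (comb q.1 q.2) <= (th i ^+ 2 * rr i)%:E)%E].
  (* The factor [th i ^+ 2] matches the square of the guaranteed pairing; the additional [rr i]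
     tends to 0 and yields the contradiction. *)
  apply: contrapT => h; apply: nR; exists (th i ^+ 2 * rr i); split; first by rewrite mulr_gt0 ?exprn_gt0 ?th_gt0 ?rr_gt0.
  move=> S c uS SG; rewrite leNgt; apply/negP => hlt; apply: h.
  set a := th i ^+ 2 * rr i in hlt *.
  have sc : sq gm (comb S c) by apply: sq_sum => v; apply: sq_sum => k; apply: sqZ; apply: sq_beta; exact: sq_ek.
  rewrite -/(l2 S c) in hlt; have l0 := l2_ge0 S c.
  have a0 : 0 < a by rewrite mulr_gt0 ?exprn_gt0 ?th_gt0 ?rr_gt0.
  have lp : 0 < l2 S c.
    rewrite lt_neqAle l0 andbT; apply/eqP => e; move: hlt; rewrite -e mulr0 ltNge n2_ge0 //.
  pose t := (Num.sqrt (l2 S c))^-1.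
  have t2 : t ^+ 2 * l2 S c = 1 by rewrite exprVn sqr_sqrtr // mulVf ?gt_eqF.
  exists (S, fun v k => if v \in S then t%:C * c v k else 0); split => //=.
  - by move=> v k /negPf ->.
  - rewrite -t2 /l2 mulr_sumr; apply: eq_big_seq => v vS; rewrite mulr_sumr; apply: eq_bigr => k _.
    by rewrite vS cabs2M cabs2R.
  rewrite (eq_n2 _ (g := fun z => t%:C * comb S c z)) => [|z]; last first.
    congr cabs2; rewrite /comb mulr_sumr; apply: eq_big_seq => v vS; rewrite mulr_sumr; apply: eq_bigr => k _.
    by rewrite vS; exact/esym/mulrA.
  have [ms _] := sc; rewrite n2Z // cabs2R -(n2_fine sc) -EFinM lee_fin.
  move: hlt; rewrite -(n2_fine sc) lte_fin => /ltW hlt.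
  apply: le_trans (ler_wpM2l (sqr_ge0 t) hlt) _; by rewrite mulrCA t2 mulr1.
have /choice[q hq] := ex.
have [al [alT alp]] := @hump_lim (fun i => (q i).1) (fun i => (q i).2) (fun i => let: And5 h _ _ _ _ := hq i in h)
   (fun i => let: And5 _ _ h _ _ := hq i in h) (fun i => let: And5 _ _ _ h _ := hq i in h).
have [|F [[eF fF] hF]] := mi al.
  apply: (@le_lt_trans _ _ (13%:R : R)%:E); last exact: ltry.
  apply: esum_le_seq => [v _|T uT _]; first by rewrite lee_fin sumr_ge0 // => k _; exact: cabs2_ge0.
  by rewrite sumEFin lee_fin; exact: alT.
have mF : mC F by apply: (SP_mC (n := n)); apply: hol_SP => //; exact/entire_hol.
have qF : sq gm F by split => //; rewrite -fnorm2_gm.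
have key i : 4^-1 <= fine (n2 gm F) * rr i.
  have [uq qG _ _ qn] := hq i.
  have sa v k : sq gm (beta v (@ek R d k)) by apply: sq_beta; exact: sq_ek.
  have sc : sq gm (comb (q i).1 (q i).2) by apply: sq_sum => v; apply: sq_sum => k; apply: sqZ.
  have e : pr (fun i => (q i).1) (fun i => (q i).2) i al = ip gm F (comb (q i).1 (q i).2).
    rewrite /pr /comb ip_sumr //; last by move=> v; apply: sq_sum => k; apply: sqZ.
    apply: eq_big_seq => v vS; rewrite ip_sumr //; last by move=> k; apply: sqZ.
    by apply: eq_bigr => k _; rewrite ipZr // mulrC -finner_gm // hF //; exact: qG.
  have := ip_cs qF sc; rewrite -e -cn_sqr => h1.
  have h2 : (th i / 2) ^+ 2 <= cn (pr (fun i => (q i).1) (fun i => (q i).2) i al) ^+ 2.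
    by rewrite lerXn2r ?nnegrE ?cn_ge0 ?divr_ge0 ?(ltW (th_gt0 _)).
  have h3 : fine (n2 gm (comb (q i).1 (q i).2)) <= th i ^+ 2 * rr i by rewrite -lee_fin n2_fine.
  have F0 : 0 <= fine (n2 gm F) by rewrite fine_ge0 // n2_ge0.
  have h4 := le_trans h2 (le_trans h1 (ler_wpM2l F0 h3)).
  have t2 : 0 < th i ^+ 2 by rewrite exprn_gt0 // th_gt0.
  rewrite -(ler_pM2l t2) mulrCA; apply: le_trans h4; rewrite exprMn exprVn -natrX; exact: lexx.
(* With this choice [fine (n2 gm F) * rr N] is at most 1/8, below the 1/4 required by [key]. *)
have F1 : 0 < 8 * (fine (n2 gm F) + 1) by rewrite mulr_gt0 // ltr_wpDl // fine_ge0 // n2_ge0.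
have F2 : 0 < (8 * (fine (n2 gm F) + 1))^-1 by rewrite invr_gt0.
have [N hN] := rr_small F2; have := key N.
have : rr N * (8 * (fine (n2 gm F) + 1)) <= 1 by rewrite -ler_pdivlMr // mul1r.
by have := rr_gt0 R N; move: (rr N) (fine _) => x y; lra.
Qed.
End InterpRiesz.

(** * The two implications assembled *)

Section Duality.
Variables (R : realType) (d : nat) (n : 'I_d -> nat) (A : 'M[R]_(d + d)).
Hypothesis n0 : forall j, (0 < n j)%N.
Hypothesis uA : A \in unitmx.
Local Notation V := (cvec R d).

Lemma sampling_interp : sampling n (Gam A) -> mult_interpolating n (Gam (dual A)).
Proof.
move=> [a [B [a0 [_ h]]]] al al_fin.
have [b rz] := sampling_Riesz n0 uA a0 (fun F hF => proj1 (h F hF)).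
have sum_ge0 (v : V) : 0 <= \sum_(k : Kn n) cabs2 (al v k) by apply: sumr_ge0 => k _; exact: cabs2_ge0.
set E := esum _ _ in al_fin.
have E_fin : E \is a fin_num by rewrite ge0_fin_numE // esum_ge0 // => v _; rewrite lee_fin.
have al_bnd (S : seq V) : uniq S -> (forall v, v \in S -> Gam (dual A) v) ->
    \sum_(v <- S) \sum_(k : Kn n) cabs2 (al v k) <= fine E.
  move=> uS SG; rewrite -lee_fin (fineK E_fin) -sumEFin.
  by apply: seq_le_esum => // v _; rewrite lee_fin.
have [F [FF hF]] := Riesz_interp n0 rz al_bnd.
exists F; split => // z k Gz; have [eF nF] := FF.
have mF : mC F by apply: (SP_mC (n := n)); apply: hol_SP => //; exact/entire_hol.
rewrite finner_gm; first exact: (hF (z, k)).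
  by split; rewrite -?fnorm2_gm.
exact: sq_atom (z, k).
Qed.

Lemma interp_sampling : mult_interpolating n (Gam (dual A)) -> sampling n (Gam A).
Proof.
move=> /(interp_Riesz n0)[a /(lower_bound n0 uA)[c c0 hc]].
have [B B0 hB] := bessel n0 uA.
have w0 (F : V -> CC R) z : (0 <= (cabs2 (F z) * gweight z)%:E)%E by rewrite lee_fin mulr_ge0 ?cabs2_ge0 ?gweight_ge0.
(* The Bessel constant is only known to be nonnegative, whereas sampling asks for a positive upper
   constant. *)
exists c, (B + 1); split => //; split; first by rewrite ltr_wpDl.
move=> F pF; have sF := polyFock_SP pF; have mF := SP_mC sF.
have qF : sq (gm R d) F by split => //; rewrite -fnorm2_gm //; case: pF.
rewrite fnorm2_gm //; split.
  (* An infinite sum makes the lower inequality trivial; a finite one bounds all finite partial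
     sums, as [lower_bound] expects. *)
  set E := esum _ _; have [E_fin|] := boolP (E \is a fin_num); last first.
    by rewrite ge0_fin_numE ?esum_ge0 // -leNgt leye_eq => /eqP ->; exact: leey.
  rewrite -(fineK E_fin) -(n2_fine qF) -EFinM lee_fin; apply: hc => // T uT TG.
  by rewrite -lee_fin (fineK E_fin) -sumEFin; apply: seq_le_esum.
apply: esum_le_seq => // T uT TG; rewrite sumEFin; apply: le_trans (hB T F uT TG sF) _.
by apply: lee_wpmul2r; [exact: n2_ge0|rewrite lee_fin lerDl].
Qed.
End Duality.

End Proofs.
Import Proofs.

Theorem theorem3 (R : realType) (d : nat) (n : 'I_d -> nat)
  (A : 'M[R]_(d + d)) :
  (0 < d)%N -> (forall j, (0 < n j)%N) -> A \in unitmx ->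
  sampling n (GammaOf (lattice A)) <->
  mult_interpolating n (GammaOf (adjoint (lattice A))).
Proof.
move=> _ n0 uA; rewrite (adjoint_dual uA).
by split; [exact: sampling_interp|exact: interp_sampling].
Qed.
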